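(* Let $\Omega \subset \mathbb{C}$ be a connected open set, let $p,q \in \overline{\Omega}$, and let $\gamma$ be a path in $\Omega$ (e.p.e.) joining $p$ and $q$. Then $\overline{[\gamma]}$ contains an efficient path, and this efficient path is unique up to reparameterization.
   Context: A path in $\Omega$ (e.p.e., ''except possibly at endpoints'') joining $p$ and $q$ is a continuous $\gamma:[0,1]\to\mathbb{C}$ with $\gamma(0)=p$, $\gamma(1)=q$ and $\gamma(s)\in\Omega$ for all $s\in(0,1)$. $\overline{[\gamma]}$ is the set of all paths $\lambda:[0,1]\to\mathbb{C}$ for which there is a continuous $h:[0,1]\times[0,1]\to\mathbb{C}$ with $h(\cdot,0)=\gamma$, $h(\cdot,1)=\lambda$, and such that for every $t\in[0,1)$ the path $h_t=h(\cdot,t)$ is a path in $\Omega$ (e.p.e.) joining $p$ and $q$ (so paths in $\overline{[\gamma]}$ may meet $\partial\Omega$ at interior times). A path $\lambda\in\overline{[\gamma]}$ is efficient if: for all $s_1<s_2$ in $[0,1]$, letting $\lambda'$ agree with $\lambda$ off $[s_1,s_2]$ and let $\lambda'|_{[s_1,s_2]}$ parameterize the straight segment from $\lambda(s_1)$ to $\lambda(s_2)$ (constant if these are equal), if $\lambda'\in\overline{[\gamma]}$ then $\lambda=\lambda'$ up to reparameterization. *)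

(* Defs.v *)
From Stdlib Require Import Reals.
Open Scope R_scope.

Definition Cpl : Type := (R * R)%type.

Definition cdist (z w : Cpl) : R :=
  sqrt ((fst z - fst w) ^ 2 + (snd z - snd w) ^ 2).

Definition cadd (z w : Cpl) : Cpl := (fst z + fst w, snd z + snd w).
Definition csub (z w : Cpl) : Cpl := (fst z - fst w, snd z - snd w).
Definition cscale (a : R) (z : Cpl) : Cpl := (a * fst z, a * snd z).

Definition In01 (s : R) : Prop := 0 <= s <= 1.

Definition c_open (U : Cpl -> Prop) : Prop :=
  forall z, U z -> exists r, 0 < r /\ forall w, cdist z w < r -> U w.

Definition c_connected (Om : Cpl -> Prop) : Prop :=
  forall U V : Cpl -> Prop, c_open U -> c_open V ->
    (forall z, Om z -> U z \/ V z) ->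
    (forall z, Om z -> U z -> V z -> False) ->
    (exists z, Om z /\ U z) -> (exists z, Om z /\ V z) -> False.

Definition c_closure (Om : Cpl -> Prop) (p : Cpl) : Prop :=
  forall eps, 0 < eps -> exists z, Om z /\ cdist p z < eps.

Definition cont01 (g : R -> Cpl) : Prop :=
  forall s, In01 s -> forall eps, 0 < eps -> exists delta, 0 < delta /\
    forall s', In01 s' -> Rabs (s - s') < delta -> cdist (g s) (g s') < eps.

Definition cont01x01 (h : R -> R -> Cpl) : Prop :=
  forall s t, In01 s -> In01 t -> forall eps, 0 < eps -> exists delta, 0 < delta /\
    forall s' t', In01 s' -> In01 t' -> Rabs (s - s') < delta -> Rabs (t - t') < delta ->
      cdist (h s t) (h s' t') < eps.

Definition path_epe (Om : Cpl -> Prop) (p q : Cpl) (g : R -> Cpl) : Prop :=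
  cont01 g /\ g 0 = p /\ g 1 = q /\ (forall s, 0 < s < 1 -> Om (g s)).

Definition in_closure_class (Om : Cpl -> Prop) (p q : Cpl) (gam lam : R -> Cpl) : Prop :=
  cont01 lam /\
  exists h : R -> R -> Cpl,
    cont01x01 h /\
    (forall s, In01 s -> h s 0 = gam s) /\
    (forall s, In01 s -> h s 1 = lam s) /\
    (forall t, 0 <= t < 1 -> path_epe Om p q (fun s => h s t)).

Definition straighten (lam : R -> Cpl) (s1 s2 : R) : R -> Cpl :=
  fun s =>
    match Rle_dec s1 s with
    | left _ =>
      match Rle_dec s s2 with
      | left _ => cadd (lam s1) (cscale ((s - s1) / (s2 - s1)) (csub (lam s2) (lam s1)))
      | right _ => lam s
      end
    | right _ => lam s
    end.

Definition reparam01 (phi : R -> R) : Prop :=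
  phi 0 = 0 /\ phi 1 = 1 /\
  (forall a b, In01 a -> In01 b -> a <= b -> phi a <= phi b) /\
  (forall s, In01 s -> forall eps, 0 < eps -> exists delta, 0 < delta /\
     forall s', In01 s' -> Rabs (s - s') < delta -> Rabs (phi s - phi s') < eps).

Definition eq_up_to_reparam (lam mu : R -> Cpl) : Prop :=
  exists phi psi : R -> R, reparam01 phi /\ reparam01 psi /\
    forall s, In01 s -> lam (phi s) = mu (psi s).

Definition efficient (Om : Cpl -> Prop) (p q : Cpl) (gam lam : R -> Cpl) : Prop :=
  in_closure_class Om p q gam lam /\
  forall s1 s2, In01 s1 -> In01 s2 -> s1 < s2 ->
    in_closure_class Om p q gam (straighten lam s1 s2) ->
    eq_up_to_reparam lam (straighten lam s1 s2).

(* Main.v *)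
Require Import Defs.
From Stdlib Require Import Reals Rtopology Lra Lia List Classical ClassicalEpsilon Setoid Morphisms Bool ZArith Cantor.
Import ListNotations.
Open Scope R_scope.

(** A path is measured by its crossing numbers: for an integral linear functional [v] and an
    integer [k], the number of times it alternates between [v < k] and [v > k + 1].  They are lower
    semicontinuous and do not increase when an arc is replaced by its chord; if none of them drops,
    the arc already ran monotonically along its chord.  Paths with bounded crossing numbers form a
    compact set up to reparametrization, so the uniform closure of the homotopy class of [gam]
    contains a path whose crossing numbers are minimal.

    Homotopic paths without shortcuts fellow-travel.  Along a line [x + m y = c], a crossing of one
    path is joined inside the line either to another crossing of the same path, which is a shortcut,
    or to a crossing of the other path.  The joining segments are the rungs of a ladder with small
    null-homotopic boxes; a bigon remaining in the limit is excluded by the same dichotomy for lines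
    parallel to its chord.

    Paths approaching a minimal path have no shortcuts in the limit, hence are joined by small
    homotopies, whose infinite concatenation ends at a reparametrization of the minimal path: this is
    existence.  Paths approaching an efficient path through its homotopy have no shortcuts in the
    limit either, since by existence for the arc of the homotopy along a lens-shaped curve a shortcut
    could be realized in the limit.  Hence two efficient paths fellow-travel in the limit. *)

(** A crossing number is finite for every continuous path. The class of the theorem is not closed
    under uniform limits, so compactness is applied to its uniform closure [wcl], and membership in
    the class has to be recovered from homotopies of controlled size. Their size is the real
    difficulty: a homotopy in [Om] between uniformly close paths may have to retract a long
    excursion, and the absence of shortcuts is what excludes this. Two facts about the plane carry
    the argument: the parity of the crossings of a line inside one homotopy class, which produces
    the rungs, and the fact that chains of a half-plane that are homotopic in [S] are homotopic
    inside the half-plane, which confines the filling of a box to its surroundings. Both are proved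
    for finite chains up to elementary moves. A box narrow in one direction is small only if the
    limit paths never move along the lines of the ladder, hence the choice of a generic
    direction. *)

Ltac rabs := unfold Rabs in *; repeat destruct Rcase_abs; try lra.

Lemma choice {A B : Type} (R : A -> B -> Prop) :
  (forall x, exists y, R x y) -> exists f, forall x, R x (f x).
Proof.
  intros H. exists (fun x => proj1_sig (constructive_indefinite_description _ (H x))).
  intros x. exact (proj2_sig (constructive_indefinite_description _ (H x))).
Qed.

Lemma Rabs_lt_iff x e : Rabs x < e <-> - e < x < e.
Proof. split; intros; rabs. Qed.

Lemma Rabs_le_iff x e : Rabs x <= e <-> - e <= x <= e.
Proof. split; intros; rabs. Qed.

Lemma Rlt_min x a b : x < Rmin a b -> x < a /\ x < b.
Proof. intros H. pose proof (Rmin_l a b). pose proof (Rmin_r a b). lra. Qed.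

Lemma archi_inv (e : R) : 0 < e -> exists n : nat, forall m : nat, (n <= m)%nat -> / (INR m + 1) < e.
Proof.
  intros He. destruct (INR_unbounded (/ e)) as [n Hn]. exists n. intros m Hm.
  apply le_INR in Hm. assert (0 < / e) by (apply Rinv_0_lt_compat; lra).
  rewrite <- (Rinv_inv e). apply Rinv_lt_contravar; [apply Rmult_lt_0_compat|]; lra.
Qed.

Lemma inv_succ_pos (n : nat) : 0 < / (INR n + 1).
Proof. apply Rinv_0_lt_compat. pose proof (pos_INR n). lra. Qed.

(** * Continuity on a set *)

Definition dR (x y : R) : R := Rabs (x - y).
(** The sup metric takes the place of the Euclidean one, to which it is equivalent with factor 2
    ([dm_cdist], [cdist_dm]). Its balls are axis-parallel squares, the shape in which [ceq_rect] can
    confine a homotopy of chains. *)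
Definition dm (z w : Cpl) : R := Rmax (Rabs (fst z - fst w)) (Rabs (snd z - snd w)).

Lemma dm_lt z w e : dm z w < e <-> Rabs (fst z - fst w) < e /\ Rabs (snd z - snd w) < e.
Proof.
  unfold dm; split.
  - intros H. pose proof (Rmax_l (Rabs (fst z - fst w)) (Rabs (snd z - snd w))).
    pose proof (Rmax_r (Rabs (fst z - fst w)) (Rabs (snd z - snd w))). lra.
  - intros [H1 H2]. apply Rmax_lub_lt; auto.
Qed.

Lemma dm_le z w e : dm z w <= e <-> Rabs (fst z - fst w) <= e /\ Rabs (snd z - snd w) <= e.
Proof.
  unfold dm; split.
  - intros H. pose proof (Rmax_l (Rabs (fst z - fst w)) (Rabs (snd z - snd w))).
    pose proof (Rmax_r (Rabs (fst z - fst w)) (Rabs (snd z - snd w))). lra.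
  - intros [H1 H2]. apply Rmax_lub; auto.
Qed.

Lemma dm_pos z w : 0 <= dm z w.
Proof. unfold dm. eapply Rle_trans; [|apply Rmax_l]. apply Rabs_pos. Qed.

Lemma dm_sym z w : dm z w = dm w z.
Proof. unfold dm. now rewrite (Rabs_minus_sym (fst z)), (Rabs_minus_sym (snd z)). Qed.

Lemma dm_refl z : dm z z = 0.
Proof. unfold dm. rewrite !Rminus_diag, Rabs_R0. apply Rmax_left; lra. Qed.

Lemma dm_tri u v w : dm u w <= dm u v + dm v w.
Proof.
  apply dm_le. pose proof (proj1 (dm_le u v _) (Rle_refl _)) as [A B].
  pose proof (proj1 (dm_le v w _) (Rle_refl _)) as [C D].
  revert A B C D. generalize (dm u v) (dm v w). intros a b A B C D.
  apply Rabs_le_iff in A, B, C, D. split; apply Rabs_le_iff; lra.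
Qed.

Lemma dm_0 z w : dm z w <= 0 -> z = w.
Proof.
  intros H. apply dm_le in H as [A B]. apply Rabs_le_iff in A, B.
  destruct z, w; simpl in *. f_equal; lra.
Qed.

Lemma dm_cdist z w : dm z w <= cdist z w.
Proof.
  unfold cdist. apply dm_le. split.
  - rewrite <- sqrt_Rsqr_abs. apply sqrt_le_1_alt. unfold Rsqr. pose proof (pow2_ge_0 (snd z - snd w)). lra.
  - rewrite <- sqrt_Rsqr_abs. apply sqrt_le_1_alt. unfold Rsqr. pose proof (pow2_ge_0 (fst z - fst w)). lra.
Qed.

Lemma cdist_dm z w : cdist z w <= 2 * dm z w.
Proof.
  pose proof (proj1 (dm_le z w _) (Rle_refl _)) as [A B]. pose proof (dm_pos z w).
  unfold cdist. apply Rabs_le_iff in A, B. revert A B H. generalize (dm z w). intros d A B H.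
  rewrite <- (sqrt_Rsqr (2 * d)) by lra. apply sqrt_le_1_alt. unfold Rsqr. nra.
Qed.

(** One notion serves real functions, paths and homotopies. The distances are bare functions; metric
    axioms are supplied only where a lemma uses them. *)
Definition contD {A B : Type} (dA : A -> A -> R) (dB : B -> B -> R) (D : A -> Prop) (f : A -> B) : Prop :=
  forall x, D x -> forall e, 0 < e -> exists d, 0 < d /\ forall y, D y -> dA x y < d -> dB (f x) (f y) < e.

Definition I01 (a b : R) : R -> Prop := fun s => a <= s <= b.
Definition Sq : Cpl -> Prop := fun z => In01 (fst z) /\ In01 (snd z).

Lemma contD_comp {A B C} (dA : A -> A -> R) (dB : B -> B -> R) (dC : C -> C -> R) D E f g :
  contD dA dB D f -> contD dB dC E g -> (forall x, D x -> E (f x)) -> contD dA dC D (fun x => g (f x)).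
Proof.
  intros Hf Hg HE x Hx e He. destruct (Hg (f x) (HE x Hx) e He) as [d [Hd H]].
  destruct (Hf x Hx d Hd) as [d' [Hd' H']]. exists d'. split; auto.
Qed.

Lemma contD_sub {A B} (dA : A -> A -> R) (dB : B -> B -> R) (D E : A -> Prop) f :
  contD dA dB E f -> (forall x, D x -> E x) -> contD dA dB D f.
Proof.
  intros Hf HE x Hx e He. destruct (Hf x (HE x Hx) e He) as [d [Hd H]]. exists d. split; auto.
Qed.

Lemma contD_ext {A B} (dA : A -> A -> R) (dB : B -> B -> R) (D : A -> Prop) f g :
  contD dA dB D f -> (forall x, D x -> f x = g x) -> contD dA dB D g.
Proof.
  intros Hf HE x Hx e He. destruct (Hf x Hx e He) as [d [Hd H]]. exists d. split; auto.
  intros y Hy Hxy. rewrite <- !HE; auto.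
Qed.

Definition relclosed {A} (dA : A -> A -> R) (D P : A -> Prop) : Prop :=
  forall x, D x -> ~ P x -> exists d, 0 < d /\ forall y, D y -> dA x y < d -> ~ P y.

Lemma contD_paste {A B} (dA : A -> A -> R) (dB : B -> B -> R) (D P Q : A -> Prop) f :
  relclosed dA D P -> relclosed dA D Q -> (forall x, D x -> P x \/ Q x) ->
  contD dA dB (fun x => D x /\ P x) f -> contD dA dB (fun x => D x /\ Q x) f -> contD dA dB D f.
Proof.
  intros cP cQ HPQ fP fQ x Hx e He.
  assert (HP : exists d, 0 < d /\ forall y, D y -> dA x y < d -> P y -> dB (f x) (f y) < e).
  { destruct (classic (P x)) as [Px|Px].
    - destruct (fP x (conj Hx Px) e He) as [d [Hd H]]. exists d. split; auto.
    - destruct (cP x Hx Px) as [d [Hd H]]. exists d. split; auto. intros y Hy Hxy Py. now elim (H y Hy Hxy). }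
  assert (HQ : exists d, 0 < d /\ forall y, D y -> dA x y < d -> Q y -> dB (f x) (f y) < e).
  { destruct (classic (Q x)) as [Px|Px].
    - destruct (fQ x (conj Hx Px) e He) as [d [Hd H]]. exists d. split; auto.
    - destruct (cQ x Hx Px) as [d [Hd H]]. exists d. split; auto. intros y Hy Hxy Py. now elim (H y Hy Hxy). }
  destruct HP as [d1 [Hd1 H1]], HQ as [d2 [Hd2 H2]].
  exists (Rmin d1 d2). split. { now apply Rmin_pos. }
  intros y Hy Hxy. apply Rlt_min in Hxy as [Hx1 Hx2].
  destruct (HPQ y Hy); auto.
Qed.

Lemma contD_const {A B} (dA : A -> A -> R) (dB : B -> B -> R) D (c : B) :
  dB c c = 0 -> contD dA dB D (fun _ => c).
Proof. intros H x Hx e He. exists 1. split; [lra|]. intros. now rewrite H. Qed.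

Lemma contD_id {A} (dA : A -> A -> R) D : contD dA dA D (fun x => x).
Proof. intros x Hx e He. exists e. split; auto. Qed.

Lemma dR_refl x : dR x x = 0.
Proof. unfold dR. now rewrite Rminus_diag, Rabs_R0. Qed.

Section RealValued.
Context {A : Type} (dA : A -> A -> R) (D : A -> Prop).

Lemma contD_binop (op : R -> R -> R) (f g : A -> R) :
  (forall x y e, 0 < e -> exists d, 0 < d /\ forall x' y', Rabs (x - x') < d -> Rabs (y - y') < d ->
     Rabs (op x y - op x' y') < e) ->
  contD dA dR D f -> contD dA dR D g -> contD dA dR D (fun x => op (f x) (g x)).
Proof.
  intros Hop Hf Hg x Hx e He. destruct (Hop (f x) (g x) e He) as [d [Hd H]].
  destruct (Hf x Hx d Hd) as [d1 [Hd1 H1]]. destruct (Hg x Hx d Hd) as [d2 [Hd2 H2]].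
  exists (Rmin d1 d2). split. { now apply Rmin_pos. }
  intros y Hy Hxy. apply H; [apply H1|apply H2]; auto; now apply Rlt_min in Hxy.
Qed.

Lemma contD_plus f g : contD dA dR D f -> contD dA dR D g -> contD dA dR D (fun x => f x + g x).
Proof.
  apply contD_binop. intros x y e He. exists (e / 2). split; [lra|]. intros x' y' H1 H2.
  apply Rabs_lt_iff in H1, H2. apply Rabs_lt_iff. lra.
Qed.

Lemma contD_minus f g : contD dA dR D f -> contD dA dR D g -> contD dA dR D (fun x => f x - g x).
Proof.
  apply (contD_binop Rminus). intros x y e He. exists (e / 2). split; [lra|]. intros x' y' H1 H2.
  apply Rabs_lt_iff in H1, H2. apply Rabs_lt_iff. lra.
Qed.

Lemma contD_mult f g : contD dA dR D f -> contD dA dR D g -> contD dA dR D (fun x => f x * g x).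
Proof.
  apply contD_binop. intros x y e He.
  set (M := Rabs x + Rabs y + 1).
  assert (HM : 0 < M) by (unfold M; pose proof (Rabs_pos x); pose proof (Rabs_pos y); lra).
  exists (Rmin 1 (e / M)). split. { apply Rmin_pos; [lra|]. now apply Rdiv_lt_0_compat. }
  intros x' y' H1 H2. replace (x * y - x' * y') with (x * (y - y') + y * (x - x') - (x - x') * (y - y')) by ring.
  pose proof (Rmin_l 1 (e / M)). pose proof (Rmin_r 1 (e / M)).
  set (d := Rmin 1 (e / M)) in *.
  assert (Hd : d * M <= e).
  { apply Rmult_le_reg_r with (/ M). { now apply Rinv_0_lt_compat. } rewrite Rmult_assoc, Rinv_r, Rmult_1_r; [|lra]. exact H0. }
  apply Rle_lt_trans with (Rabs x * Rabs (y - y') + Rabs y * Rabs (x - x') + Rabs (x - x') * Rabs (y - y')).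
  { rewrite <- !Rabs_mult. set (u := x * (y - y')). set (v := y * (x - x')). set (w := (x - x') * (y - y')). rabs. }
  unfold M in Hd. pose proof (Rabs_pos x). pose proof (Rabs_pos y).
  pose proof (Rabs_pos (x - x')). pose proof (Rabs_pos (y - y')). nra.
Qed.

Lemma contD_max f g : contD dA dR D f -> contD dA dR D g -> contD dA dR D (fun x => Rmax (f x) (g x)).
Proof.
  apply (contD_binop Rmax). intros x y e He. exists e. split; [lra|]. intros x' y' H1 H2.
  apply Rabs_lt_iff in H1, H2. apply Rabs_lt_iff.
  unfold Rmax. destruct (Rle_dec x y), (Rle_dec x' y'); lra.
Qed.

Lemma contD_min f g : contD dA dR D f -> contD dA dR D g -> contD dA dR D (fun x => Rmin (f x) (g x)).
Proof.
  apply (contD_binop Rmin). intros x y e He. exists e. split; [lra|]. intros x' y' H1 H2.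
  apply Rabs_lt_iff in H1, H2. apply Rabs_lt_iff.
  unfold Rmin. destruct (Rle_dec x y), (Rle_dec x' y'); lra.
Qed.

Lemma contD_inv f : contD dA dR D f -> (forall x, D x -> f x <> 0) -> contD dA dR D (fun x => / f x).
Proof.
  intros Hf Hn x Hx e He. pose proof (Hn x Hx) as Hx0.
  set (m := Rabs (f x)). assert (Hm : 0 < m) by now apply Rabs_pos_lt.
  destruct (Hf x Hx (Rmin (m / 2) (e * m * m / 2))) as [d [Hd H]].
  { apply Rmin_pos; [lra|]. apply Rdiv_lt_0_compat; [|lra]. apply Rmult_lt_0_compat; [|lra]. now apply Rmult_lt_0_compat. }
  exists d. split; auto. intros y Hy Hxy. specialize (H y Hy Hxy). unfold dR in *.
  pose proof (Rmin_l (m / 2) (e * m * m / 2)). pose proof (Rmin_r (m / 2) (e * m * m / 2)).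
  pose proof (Hn y Hy) as Hy0.
  assert (Hm2 : m / 2 < Rabs (f y)).
  { assert (m <= Rabs (f x - f y) + Rabs (f y)); [|lra]. unfold m.
    replace (f x) with ((f x - f y) + f y) at 1 by ring. apply Rabs_triang. }
  replace (/ f x - / f y) with ((f y - f x) * / (f x * f y)) by (field; auto).
  rewrite Rabs_mult, Rabs_inv, Rabs_mult, (Rabs_minus_sym (f y)). fold m.
  assert (0 < m * Rabs (f y)) by (apply Rmult_lt_0_compat; lra).
  apply Rmult_lt_reg_r with (m * Rabs (f y)); auto.
  rewrite Rmult_assoc, Rinv_l, Rmult_1_r; [|lra].
  assert (m * (m / 2) < m * Rabs (f y)) by (apply Rmult_lt_compat_l; lra). nra.
Qed.

Lemma contD_pair f g : contD dA dR D f -> contD dA dR D g -> contD dA dm D (fun x => (f x, g x)).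
Proof.
  intros Hf Hg x Hx e He. destruct (Hf x Hx e He) as [d1 [Hd1 H1]]. destruct (Hg x Hx e He) as [d2 [Hd2 H2]].
  exists (Rmin d1 d2). split. { now apply Rmin_pos. }
  intros y Hy Hxy. apply dm_lt. simpl. split; [apply H1|apply H2]; auto; now apply Rlt_min in Hxy.
Qed.

Lemma contD_fst f : contD dA dm D f -> contD dA dR D (fun x => fst (f x)).
Proof.
  intros Hf x Hx e He. destruct (Hf x Hx e He) as [d1 [Hd1 H1]]. exists d1. split; auto.
  intros y Hy Hxy. now apply (proj1 (dm_lt _ _ _) (H1 y Hy Hxy)).
Qed.

Lemma contD_snd f : contD dA dm D f -> contD dA dR D (fun x => snd (f x)).
Proof.
  intros Hf x Hx e He. destruct (Hf x Hx e He) as [d1 [Hd1 H1]]. exists d1. split; auto.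
  intros y Hy Hxy. now apply (proj1 (dm_lt _ _ _) (H1 y Hy Hxy)).
Qed.

Lemma contD_cR (c : R) : contD dA dR D (fun _ => c).
Proof. apply contD_const, dR_refl. Qed.

Lemma relclosed_le f g : contD dA dR D f -> contD dA dR D g -> relclosed dA D (fun x => f x <= g x).
Proof.
  intros Hf Hg x Hx Hn. destruct (contD_minus _ _ Hf Hg x Hx (f x - g x)) as [d [Hd H]]; [lra|].
  exists d. split; auto. intros y Hy Hxy. specialize (H y Hy Hxy). unfold dR in H.
  apply Rabs_lt_iff in H. lra.
Qed.

End RealValued.

Lemma contD_dfst D : contD dm dR D fst.
Proof. apply (contD_fst dm D (fun x => x)), contD_id. Qed.

Lemma contD_dsnd D : contD dm dR D snd.
Proof. apply (contD_snd dm D (fun x => x)), contD_id. Qed.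

Ltac ctac := repeat first
  [ apply contD_cR | apply contD_id | apply contD_dfst | apply contD_dsnd | assumption
  | apply contD_minus | apply contD_plus | apply contD_mult | apply contD_max | apply contD_min | apply contD_pair
  | apply contD_fst; assumption | apply contD_snd; assumption ].

(** * Sequential compactness *)

Lemma bw (u : nat -> R) (a b : R) : (forall n, a <= u n <= b) ->
  exists l s, a <= l <= b /\ forall k : nat, (k <= s k)%nat /\ Rabs (u (s k) - l) < / (INR k + 1).
Proof.
  intros H. destruct (Bolzano_Weierstrass u (fun c => a <= c <= b) (compact_P3 a b) H) as [l Hl].
  assert (Hs : forall k : nat, exists p : nat, (k <= p)%nat /\ Rabs (u p - l) < / (INR k + 1)).
  { intros k. apply (Hl (disc l (mkposreal _ (inv_succ_pos k)))). exists (mkposreal _ (inv_succ_pos k)). intros x Hx; exact Hx. }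
  destruct (choice _ Hs) as [s Hs']. exists l, s. split; auto.
  split; apply Rnot_lt_le; intros Hlt.
  - destruct (archi_inv (a - l)) as [n Hn]; [lra|]. destruct (Hs' n) as [_ B].
    specialize (Hn n (le_n n)). specialize (H (s n)). apply Rabs_lt_iff in B. lra.
  - destruct (archi_inv (l - b)) as [n Hn]; [lra|]. destruct (Hs' n) as [_ B].
    specialize (Hn n (le_n n)). specialize (H (s n)). apply Rabs_lt_iff in B. lra.
Qed.

(** The extracted indices only satisfy [k <= s k]. This is weaker than being increasing, but it is
    all that a limit needs and it survives composition of extractions; the explicit rate replaces a
    convergence predicate. *)
Definition seqcpt {A} (dA : A -> A -> R) (D : A -> Prop) : Prop :=
  forall u : nat -> A, (forall n, D (u n)) ->
  exists l s, D l /\ forall k : nat, (k <= s k)%nat /\ dA l (u (s k)) < / (INR k + 1).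

Lemma seqcpt_I a b : seqcpt dR (I01 a b).
Proof.
  intros u Hu. destruct (bw u a b Hu) as [l [s [H1 H2]]]. exists l, s. split; auto.
  intros k. destruct (H2 k). split; auto. unfold dR. now rewrite Rabs_minus_sym.
Qed.

Lemma seqcpt_rect a b c d : seqcpt dm (fun z => a <= fst z <= b /\ c <= snd z <= d).
Proof.
  intros u Hu. destruct (bw (fun n => fst (u n)) a b) as [l [s [H1 H2]]]. { intros; apply Hu. }
  destruct (bw (fun n => snd (u (s n))) c d) as [l' [s' [H1' H2']]]. { intros; apply Hu. }
  exists (l, l'), (fun k => s (s' k)). split; auto. intros k. destruct (H2' k) as [A B]. destruct (H2 (s' k)) as [A' B'].
  split; [lia|]. apply dm_lt. simpl. rewrite (Rabs_minus_sym l), (Rabs_minus_sym l'). split; auto.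
  eapply Rlt_le_trans; [exact B'|]. apply Rinv_le_contravar. { pose proof (pos_INR k). lra. } apply le_INR in A. lra.
Qed.

Lemma seqcpt_Sq : seqcpt dm Sq.
Proof. exact (seqcpt_rect 0 1 0 1). Qed.

Lemma unif_cont {A B} (dA : A -> A -> R) (dB : B -> B -> R) D f :
  (forall x y z, dA x z <= dA x y + dA y z) -> (forall x y z, dB x z <= dB x y + dB y z) ->
  (forall x y, dB x y = dB y x) ->
  seqcpt dA D -> contD dA dB D f ->
  forall e, 0 < e -> exists d, 0 < d /\ forall x y, D x -> D y -> dA x y < d -> dB (f x) (f y) < e.
Proof.
  intros tA tB sB Hc Hf e He. apply NNPP. intros Hn.
  assert (H : forall n : nat, exists p : A * A, D (fst p) /\ D (snd p) /\ dA (fst p) (snd p) < / (INR n + 1) /\ ~ dB (f (fst p)) (f (snd p)) < e).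
  { intros n. apply NNPP. intros Hn'. apply Hn. exists (/ (INR n + 1)). split; [apply inv_succ_pos|].
    intros x y Hx Hy Hxy. apply NNPP. intros Hd. apply Hn'. exists (x, y). simpl. auto. }
  destruct (choice _ H) as [p Hp].
  destruct (Hc (fun n => fst (p n))) as [l [s [Hl Hs]]]. { intros n; apply Hp. }
  destruct (Hf l Hl (e / 2)) as [d [Hd Hfd]]; [lra|].
  destruct (archi_inv (d / 2)) as [n Hn']; [lra|]. specialize (Hn' n (le_n n)).
  destruct (Hs n) as [A1 A2]. destruct (Hp (s n)) as [B1 [B2 [B3 B4]]].
  assert (C : / (INR (s n) + 1) <= / (INR n + 1)).
  { apply Rinv_le_contravar. { pose proof (pos_INR n). lra. } apply le_INR in A1. lra. }
  apply B4. pose proof (Hfd (fst (p (s n))) B1 ltac:(lra)) as E1.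
  pose proof (Hfd (snd (p (s n))) B2) as E2. specialize (tA l (fst (p (s n))) (snd (p (s n)))).
  specialize (E2 ltac:(lra)). specialize (tB (f (fst (p (s n)))) (f l) (f (snd (p (s n))))).
  rewrite (sB _ (f l)) in tB. lra.
Qed.

Lemma dR_tri x y z : dR x z <= dR x y + dR y z.
Proof. unfold dR. rabs. Qed.
Lemma dR_sym x y : dR x y = dR y x.
Proof. unfold dR. apply Rabs_minus_sym. Qed.

Lemma unif_path a b f : contD dR dm (I01 a b) f ->
  forall e, 0 < e -> exists d, 0 < d /\ forall x y, a <= x <= b -> a <= y <= b -> Rabs (x - y) < d -> dm (f x) (f y) < e.
Proof.
  intros Hf e He. destruct (unif_cont dR dm _ f dR_tri dm_tri dm_sym (seqcpt_I a b) Hf e He) as [d [Hd H]].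
  exists d. split; auto.
Qed.

Lemma max_attained {A} (dA : A -> A -> R) D (f : A -> R) :
  seqcpt dA D -> contD dA dR D f -> (exists x, D x) -> exists x, D x /\ forall y, D y -> f y <= f x.
Proof.
  intros Hc Hf [x0 Hx0].
  assert (Hb : exists M, forall x, D x -> f x <= M).
  { apply NNPP. intros Hn.
    assert (H : forall n : nat, exists x, D x /\ INR n < f x).
    { intros n. apply NNPP. intros Hn'. apply Hn. exists (INR n). intros x Hx. apply Rnot_lt_le. intros Hlt. apply Hn'; eauto. }
    destruct (choice _ H) as [u Hu]. destruct (Hc u) as [l [s [Hl Hs]]]. { intros; apply Hu. }
    destruct (Hf l Hl 1) as [d [Hd Hd']]; [lra|]. destruct (archi_inv d Hd) as [n Hn'].
    destruct (INR_unbounded (f l + 1)) as [m Hm]. set (k := Nat.max n m).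
    destruct (Hs k) as [A1 A2]. specialize (Hn' k ltac:(lia)). destruct (Hu (s k)) as [B1 B2].
    specialize (Hd' _ B1 ltac:(lra)). unfold dR in Hd'. apply Rabs_lt_iff in Hd'.
    assert (INR m <= INR (s k)) by (apply le_INR; lia). lra. }
  destruct Hb as [M HM].
  destruct (completeness (fun y => exists x, D x /\ y = f x)) as [m [Hm1 Hm2]].
  { exists M. intros y [x [Hx ->]]. auto. } { eauto. }
  assert (H : forall n : nat, exists x, D x /\ m - / (INR n + 1) < f x).
  { intros n. apply NNPP. intros Hn'. pose proof (inv_succ_pos n).
    assert (m <= m - / (INR n + 1)); [|lra]. apply Hm2. intros y [x [Hx ->]]. apply Rnot_lt_le. intros Hlt. apply Hn'; eauto. }
  destruct (choice _ H) as [u Hu]. destruct (Hc u) as [l [s [Hl Hs]]]. { intros; apply Hu. }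
  exists l. split; auto. intros y Hy. apply Rle_trans with m. { apply Hm1; eauto. }
  apply Rnot_lt_le. intros Hlt. destruct (Hf l Hl ((m - f l) / 2)) as [d [Hd Hd']]; [lra|].
  destruct (archi_inv (Rmin d ((m - f l) / 2))) as [n Hn']. { apply Rmin_pos; lra. }
  destruct (Hs n) as [A1 A2]. destruct (Hu (s n)) as [B1 B2]. specialize (Hn' n (le_n n)).
  pose proof (Rmin_l d ((m - f l) / 2)). pose proof (Rmin_r d ((m - f l) / 2)).
  specialize (Hd' _ B1 ltac:(lra)). unfold dR in Hd'. apply Rabs_lt_iff in Hd'.
  assert (/ (INR (s n) + 1) <= / (INR n + 1)).
  { apply Rinv_le_contravar. { pose proof (pos_INR n). lra. } apply le_INR in A1. lra. } lra.
Qed.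

(** Points outside [Om] arbitrarily close to the image would accumulate at the image of a limit
    parameter, against openness there. *)
Lemma open_clear {A} (dA : A -> A -> R) D (f : A -> Cpl) (Om : Cpl -> Prop) :
  c_open Om -> seqcpt dA D -> contD dA dm D f -> (forall x, D x -> Om (f x)) ->
  exists r, 0 < r /\ forall x w, D x -> dm (f x) w < r -> Om w.
Proof.
  intros HO Hc Hf HD. apply NNPP. intros Hn.
  assert (H : forall n : nat, exists p : A * Cpl, D (fst p) /\ dm (f (fst p)) (snd p) < / (INR n + 1) /\ ~ Om (snd p)).
  { intros n. apply NNPP. intros Hn'. apply Hn. exists (/ (INR n + 1)). split; [apply inv_succ_pos|].
    intros x w Hx Hw. apply NNPP. intros Ho. apply Hn'. exists (x, w). auto. }
  destruct (choice _ H) as [p Hp].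
  destruct (Hc (fun n => fst (p n))) as [l [s [Hl Hs]]]. { intros; apply Hp. }
  destruct (HO _ (HD l Hl)) as [r [Hr Hr']].
  destruct (Hf l Hl (r / 4)) as [d [Hd Hfd]]; [lra|].
  destruct (archi_inv (Rmin d (r / 4))) as [n Hn']. { apply Rmin_pos; lra. } specialize (Hn' n (le_n n)).
  pose proof (Rmin_l d (r / 4)). pose proof (Rmin_r d (r / 4)).
  destruct (Hs n) as [A1 A2]. destruct (Hp (s n)) as [B1 [B2 B3]].
  assert (C : / (INR (s n) + 1) <= / (INR n + 1)).
  { apply Rinv_le_contravar. { pose proof (pos_INR n). lra. } apply le_INR in A1. lra. }
  apply B3. apply Hr'. eapply Rle_lt_trans; [apply cdist_dm|].
  pose proof (dm_tri (f l) (f (fst (p (s n)))) (snd (p (s n)))).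
  specialize (Hfd _ B1 ltac:(lra)). lra.
Qed.

(** * One real variable *)

(** The supremum argument shared by [ivt], [first_hit] and [last_before]. Whether [P] holds at [m]
    itself is left to the caller, who decides it by continuity. *)
Lemma sup_prefix (P : R -> Prop) a b : a <= b -> P a ->
  exists m, a <= m <= b /\ (forall t, a <= t < m -> exists t', t < t' <= m /\ P t') /\
    (forall t, m < t <= b -> ~ P t).
Proof.
  intros Hab Pa. destruct (completeness (fun t => a <= t <= b /\ P t)) as [m [H1 H2]].
  { exists b. intros t [Ht _]. lra. } { exists a. split; [lra|auto]. }
  exists m. split; [|split].
  - split. { apply H1. split; [lra|auto]. } apply H2. intros t [Ht _]; lra.
  - intros t Ht. apply NNPP. intros Hn. assert (m <= t); [|lra]. apply H2. intros t' [Ht' Pt'].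
    apply Rnot_lt_le. intros Hlt. apply Hn. exists t'. split; [|exact Pt']. split; [exact Hlt|]. apply H1. split; [exact Ht'|exact Pt'].
  - intros t Ht Pt. assert (t <= m); [|lra]. apply H1. split; auto. split; [|lra]. apply Rle_trans with m; [|lra].
    apply H1. split; [lra|auto].
Qed.

Lemma ivt a b (f : R -> R) c : a <= b -> contD dR dR (I01 a b) f -> f a < c < f b -> exists s, a < s < b /\ f s = c.
Proof.
  intros Hab Hf [Ha Hb]. destruct (sup_prefix (fun t => f t < c) a b Hab Ha) as [m [Hm [H1 H2]]].
  destruct (Rtotal_order (f m) c) as [Hlt|[Heq|Hgt]].
  - exfalso. destruct (Req_dec m b) as [->|Hmb]; [lra|].
    destruct (Hf m Hm (c - f m)) as [d [Hd H]]; [lra|].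
    set (t := Rmin b (m + d / 2)). assert (m < t <= b).
    { unfold t. split; [apply Rmin_glb_lt; lra|apply Rmin_l]. }
    apply (H2 t H0). assert (t <= m + d / 2) by apply Rmin_r.
    specialize (H t). unfold I01, dR in H. specialize (H ltac:(lra)). rewrite Rabs_minus_sym in H.
    rewrite Rabs_right in H by lra. specialize (H ltac:(lra)). apply Rabs_lt_iff in H. lra.
  - exists m. split; auto. destruct (Req_dec m a) as [->|]; [lra|]. destruct (Req_dec m b) as [->|]; [lra|]. lra.
  - exfalso. destruct (Req_dec m a) as [->|Hma]; [lra|].
    destruct (Hf m Hm (f m - c)) as [d [Hd H]]; [lra|].
    destruct (H1 (Rmax a (m - d / 2))) as [t [Ht Pt]].
    { split; [apply Rmax_l|apply Rmax_lub_lt; lra]. }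
    assert (m - d / 2 <= Rmax a (m - d / 2)) by apply Rmax_r. assert (a <= Rmax a (m - d / 2)) by apply Rmax_l.
    specialize (H t). unfold I01, dR in H. specialize (H ltac:(lra)).
    rewrite Rabs_right in H by lra. specialize (H ltac:(lra)). apply Rabs_lt_iff in H. lra.
Qed.

Lemma first_hit a b (f : R -> R) c : a <= b -> contD dR dR (I01 a b) f -> f a < c ->
  (forall t, a <= t <= b -> f t < c) \/ exists t, a < t <= b /\ f t = c /\ forall r, a <= r < t -> f r < c.
Proof.
  intros Hab Hf Ha. destruct (classic (forall t, a <= t <= b -> f t < c)) as [|Hn]; [now left|right].
  assert (exists u, a <= u <= b /\ c <= f u) as [u [Hu Hu']].
  { apply NNPP. intros H. apply Hn. intros t Ht. apply Rnot_le_lt. intros Hl. apply H. eauto. }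
  destruct (sup_prefix (fun t => forall r, a <= r <= t -> f r < c) a b Hab) as [m [Hm [H1 H2]]].
  { intros r Hr. replace r with a by lra. auto. }
  assert (Hlt : forall r, a <= r < m -> f r < c).
  { intros r Hr. destruct (H1 r Hr) as [t' [Ht' Pt]]. apply Pt. lra. }
  assert (Hum : m <= u).
  { apply Rnot_lt_le. intros Hl. specialize (Hlt u). lra. }
  assert (Hmc : f m = c).
  { destruct (Rtotal_order (f m) c) as [Hl|[Heq|Hgt]]; auto; exfalso.
    - destruct (Hf m Hm (c - f m)) as [d [Hd H]]; [lra|].
      destruct (Req_dec m b) as [->|Hmb]. { assert (u = b) by lra. subst u. lra. }
      set (t := Rmin b (m + d / 2)). assert (m < t <= b).
      { unfold t. split; [apply Rmin_glb_lt; lra|apply Rmin_l]. }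
      apply (H2 t H0). intros r Hr. destruct (Rlt_le_dec r m). { apply Hlt. lra. }
      assert (t <= m + d / 2) by apply Rmin_r. specialize (H r). unfold I01, dR in H. specialize (H ltac:(lra)).
      rewrite Rabs_minus_sym, Rabs_right in H by lra. specialize (H ltac:(lra)). apply Rabs_lt_iff in H. lra.
    - destruct (Req_dec m a) as [->|Hma]; [lra|].
      destruct (Hf m Hm (f m - c)) as [d [Hd H]]; [lra|].
      set (t := Rmax a (m - d / 2)).
      assert (m - d / 2 <= t) by apply Rmax_r. assert (a <= t) by apply Rmax_l. assert (t < m) by (apply Rmax_lub_lt; lra).
      specialize (H t). unfold I01, dR in H. specialize (H ltac:(lra)).
      rewrite Rabs_right in H by lra. specialize (H ltac:(lra)). apply Rabs_lt_iff in H. specialize (Hlt t). lra. }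
  exists m. split; [|split]; auto. split; [|lra]. destruct (Req_dec m a) as [->|]; lra.
Qed.

Lemma incr_inverse (f : R -> R) : contD dR dR In01 f -> f 0 = 0 -> f 1 = 1 ->
  (forall x y, In01 x -> In01 y -> x < y -> f x < f y) ->
  exists g, (forall y, In01 y -> In01 (g y) /\ f (g y) = y) /\ (forall x, In01 x -> g (f x) = x) /\
    contD dR dR In01 g /\ g 0 = 0 /\ g 1 = 1 /\ (forall x y, In01 x -> In01 y -> x < y -> g x < g y).
Proof.
  unfold In01. intros Hf F0 F1 Hi.
  assert (Hle : forall x y, 0 <= x <= 1 -> 0 <= y <= 1 -> f x <= f y -> x <= y).
  { intros x y Hx Hy H. apply Rnot_lt_le. intros Hl. specialize (Hi y x Hy Hx Hl). lra. }
  assert (H : forall y, exists x, 0 <= y <= 1 -> 0 <= x <= 1 /\ f x = y).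
  { intros y. destruct (classic (0 < y < 1)).
    - destruct (ivt 0 1 f y) as [x [Hx Hx']]; [lra|exact Hf|lra|]. exists x. intros _. split; [lra|auto].
    - destruct (classic (y <= 0)). { exists 0. intros. split; lra. } exists 1. intros. split; lra. }
  destruct (choice _ H) as [g Hg]. exists g.
  assert (Hg' : forall x, 0 <= x <= 1 -> g (f x) = x).
  { intros x Hx. assert (0 <= f x <= 1).
    { split. { rewrite <- F0. destruct (Req_dec x 0) as [->|]; [lra|]. left; apply Hi; lra. }
      rewrite <- F1. destruct (Req_dec x 1) as [->|]; [lra|]. left; apply Hi; lra. }
    destruct (Hg _ H0) as [A B]. apply Rle_antisym; apply Hle; auto; lra. }
  assert (Hgi : forall x y, 0 <= x <= 1 -> 0 <= y <= 1 -> x < y -> g x < g y).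
  { intros x y Hx Hy Hxy. destruct (Hg x Hx) as [A B]. destruct (Hg y Hy) as [A' B'].
    apply Rnot_le_lt. intros Hl. destruct (Req_dec (g x) (g y)) as [E|]; [rewrite E in B; lra|].
    specialize (Hi (g y) (g x) A' A). lra. }
  split; [exact Hg|]. split; [exact Hg'|]. split; [|split; [|split; [|exact Hgi]]].
  - intros y Hy e He. destruct (Hg y Hy) as [A B].
    set (xl := Rmax 0 (g y - e / 2)). set (xr := Rmin 1 (g y + e / 2)).
    assert (Hl : 0 <= xl /\ xl <= g y /\ g y - e / 2 <= xl).
    { unfold xl. split; [apply Rmax_l|split; [apply Rmax_lub; lra|apply Rmax_r]]. }
    assert (Hr : xr <= 1 /\ g y <= xr /\ xr <= g y + e / 2).
    { unfold xr. split; [apply Rmin_l|split; [apply Rmin_glb; lra|apply Rmin_r]]. }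
    assert (Dl : exists d, 0 < d /\ forall y', 0 <= y' <= 1 -> y - d < y' -> xl <= g y').
    { destruct (Req_dec xl (g y)) as [E|E].
      - assert (g y = 0). { unfold xl in *. unfold Rmax in *. destruct Rle_dec; lra. }
        exists 1. split; [lra|]. intros y' Hy' _. destruct (Hg y' Hy'). lra.
      - assert (f xl < f (g y)) by (apply Hi; lra). exists (f (g y) - f xl). split; [lra|].
        intros y' Hy' Hl'. destruct (Hg y' Hy'). apply Hle; lra. }
    assert (Dr : exists d, 0 < d /\ forall y', 0 <= y' <= 1 -> y' < y + d -> g y' <= xr).
    { destruct (Req_dec xr (g y)) as [E|E].
      - assert (g y = 1). { unfold xr in *. unfold Rmin in *. destruct Rle_dec; lra. }
        exists 1. split; [lra|]. intros y' Hy' _. destruct (Hg y' Hy'). lra.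
      - assert (f (g y) < f xr) by (apply Hi; lra). exists (f xr - f (g y)). split; [lra|].
        intros y' Hy' Hl'. destruct (Hg y' Hy'). apply Hle; lra. }
    destruct Dl as [d1 [D1 E1]], Dr as [d2 [D2 E2]]. exists (Rmin d1 d2). split; [now apply Rmin_pos|].
    intros y' Hy' Hd. unfold dR in *. apply Rabs_lt_iff in Hd.
    pose proof (Rmin_l d1 d2). pose proof (Rmin_r d1 d2).
    specialize (E1 y' Hy' ltac:(lra)). specialize (E2 y' Hy' ltac:(lra)). apply Rabs_lt_iff. lra.
  - rewrite <- F0. rewrite Hg'; lra.
  - rewrite <- F1 at 1. rewrite Hg'; lra.
Qed.

(** * Diagonal extraction and the Arzela-Ascoli theorem *)

Lemma bw_cv (u : nat -> R) B : (forall n, Rabs (u n) <= B) ->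
  exists s, (forall k, (k <= s k)%nat) /\ exists l, Un_cv (fun k => u (s k)) l.
Proof.
  intros H. destruct (bw u (- B) B) as [l [s [H1 H2]]]. { intros n. apply Rabs_le_iff, H. }
  exists s. split. { intros; apply H2. } exists l. intros e He. destruct (archi_inv e He) as [n Hn].
  exists n. intros k Hk. eapply Rlt_trans; [apply H2|]. apply Hn. lia.
Qed.

Lemma diagonal (u : nat -> nat -> R) B : (forall i n, Rabs (u i n) <= B) ->
  exists s, (forall k, (k <= s k)%nat) /\ forall i, exists l, Un_cv (fun k => u i (s k)) l.
Proof.
  intros H.
  assert (T : forall p : nat * (nat -> nat), exists t : nat -> nat, (forall k, (k <= t k)%nat) /\ exists l, Un_cv (fun k => u (fst p) (snd p (t k))) l).
  { intros [i S]. apply (bw_cv (fun k => u i (S k)) B). intros; apply H. }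
  destruct (choice _ T) as [tau Ht].
  (* [tau] refines the extraction it is given so that one more row converges; along [S i] all rows
     before [i] converge. *)
  set (S := fix S (i : nat) : nat -> nat := match i with O => fun k => k | Datatypes.S i => fun k => S i (tau (i, S i) k) end).
  assert (Sge : forall i k, (k <= S i k)%nat).
  { induction i; intros k; simpl; [lia|]. pose proof (proj1 (Ht (i, S i)) k). specialize (IHi (tau (i, S i) k)). lia. }
  (* Since extractions need not be increasing, the diagonal is compared with [S i] through an
     explicit factor [r] with [k <= r k]. *)
  assert (Scomp : forall i j, exists r : nat -> nat, (forall k, (k <= r k)%nat) /\ forall k, S (j + i)%nat k = S i (r k)).
  { intros i j. induction j.
    - exists (fun k => k). split; auto.
    - destruct IHj as [r [R1 R2]]. exists (fun k => r (tau ((j + i)%nat, S (j + i)%nat) k)). split.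
      + intros k. pose proof (proj1 (Ht ((j + i)%nat, S (j + i)%nat)) k). specialize (R1 (tau ((j + i)%nat, S (j + i)%nat) k)). lia.
      + intros k. simpl. now rewrite R2. }
  exists (fun k => S k k). split. { intros; apply Sge. }
  intros i. destruct (Ht (i, S i)) as [_ [l Hl]]. exists l. intros e He. destruct (Hl e He) as [N HN].
  exists (Nat.max N (Datatypes.S i)). intros k Hk. destruct (Scomp (Datatypes.S i) (k - Datatypes.S i)%nat) as [r [R1 R2]].
  replace (k - Datatypes.S i + Datatypes.S i)%nat with k in R2 by lia. rewrite R2. simpl. apply HN.
  specialize (R1 k). lia.
Qed.

Lemma finite_bound (P : nat -> nat -> Prop) (M : nat) :
  (forall j, exists K, forall k, (K <= k)%nat -> P j k) ->
  exists K, forall j k, (j <= M)%nat -> (K <= k)%nat -> P j k.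
Proof.
  intros H. induction M as [|M [K HK]].
  - destruct (H O) as [K HK]. exists K. intros j k Hj Hk. replace j with O by lia. auto.
  - destruct (H (S M)) as [K' HK']. exists (Nat.max K K'). intros j k Hj Hk.
    destruct (Nat.eq_dec j (S M)) as [->|]; [apply HK'; lia|apply HK; lia].
Qed.

Lemma net_point (M : nat) (s : R) : 0 <= s <= 1 -> exists j, (j <= M)%nat /\ INR j / (INR M + 1) <= s <= (INR j + 1) / (INR M + 1).
Proof.
  intros Hs. pose proof (pos_INR M) as HM.
  assert (H : forall m, (m <= M)%nat -> s <= (INR m + 1) / (INR M + 1) -> exists j, (j <= M)%nat /\ INR j / (INR M + 1) <= s <= (INR j + 1) / (INR M + 1)).
  { induction m; intros Hm Hle.
    - exists O. split; auto. split; auto. simpl. unfold Rdiv. rewrite Rmult_0_l. lra.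
    - destruct (Rle_dec (INR (S m) / (INR M + 1)) s).
      + exists (S m). auto.
      + apply IHm; [lia|]. rewrite S_INR in n. lra. }
  apply (H M); auto. replace ((INR M + 1) / (INR M + 1)) with 1 by (field; lra). lra.
Qed.

(** Equicontinuity is demanded only of a tail that depends on [e]: [equalize] tames just the first
    [k] scales of the [k]-th path. *)
Lemma ascoli (f : nat -> R -> R) B :
  (forall k s, In01 s -> Rabs (f k s) <= B) ->
  (forall e, 0 < e -> exists d K, 0 < d /\ forall k, (K <= k)%nat -> forall s s', In01 s -> In01 s' -> Rabs (s - s') < d -> Rabs (f k s - f k s') < e) ->
  exists (s : nat -> nat) (F : R -> R), (forall k, (k <= s k)%nat) /\
    forall e, 0 < e -> exists K, forall k, (K <= k)%nat -> forall x, In01 x -> Rabs (f (s k) x - F x) < e.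
Proof.
  intros Hb Heq.
  (* The pairing function enumerates all fractions [j / (M + 1)]; capping at 1 makes every index a
     legal sample point. *)
  set (q := fun i : nat => Rmin 1 (INR (fst (of_nat i)) / (INR (snd (of_nat i)) + 1))).
  assert (Hq : forall i, In01 (q i)).
  { intros i. unfold q, In01. split; [|apply Rmin_l]. apply Rmin_glb; [lra|].
    apply Rmult_le_pos; [apply pos_INR|]. left; apply inv_succ_pos. }
  destruct (diagonal (fun i k => f k (q i)) B) as [s [Hs Hcv]]. { intros; apply Hb, Hq. }
  assert (Huc : forall e, 0 < e -> exists K, forall k k', (K <= k)%nat -> (K <= k')%nat -> forall x, In01 x -> Rabs (f (s k) x - f (s k') x) < e).
  { intros e He. destruct (Heq (e / 3)) as [d [K0 [Hd Hd']]]; [lra|].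
    destruct (archi_inv d Hd) as [M HM]. specialize (HM M (le_n M)).
    destruct (finite_bound (fun j k => forall k', (k <= k')%nat -> Rabs (f (s k) (q (to_nat (j, M))) - f (s k') (q (to_nat (j, M)))) < e / 6) M) as [K1 HK1].
    { intros j. destruct (Hcv (to_nat (j, M))) as [l Hl]. destruct (Hl (e / 12)) as [N HN]; [lra|].
      exists N. intros k Hk k' Hk'. pose proof (HN k ltac:(lia)) as A. pose proof (HN k' ltac:(lia)) as A'.
      unfold R_dist in *. apply Rabs_lt_iff in A, A'. apply Rabs_lt_iff. lra. }
    exists (Nat.max K0 K1). intros k k' Hk Hk' x Hx.
    destruct (net_point M x Hx) as [j [Hj Hjx]].
    assert (Eq : q (to_nat (j, M)) = INR j / (INR M + 1)).
    { unfold q. rewrite cancel_of_to. simpl. apply Rmin_right. unfold In01 in Hx. pose proof (pos_INR M).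
      apply Rmult_le_reg_r with (INR M + 1); [lra|]. unfold Rdiv. rewrite Rmult_assoc, Rinv_l, Rmult_1_l, Rmult_1_r; [|lra].
      apply le_INR in Hj. lra. }
    set (y := q (to_nat (j, M))) in *. assert (Hy : In01 y) by apply Hq.
    assert (Dxy : Rabs (x - y) < d).
    { rewrite Eq. assert (x - INR j / (INR M + 1) <= / (INR M + 1)).
      { replace ((INR j + 1) / (INR M + 1)) with (INR j / (INR M + 1) + / (INR M + 1)) in Hjx by (unfold Rdiv; ring). lra. }
      rewrite Rabs_right; lra. }
    pose proof (Hs k). pose proof (Hs k').
    pose proof (Hd' (s k) ltac:(lia) x y Hx Hy Dxy) as A1. pose proof (Hd' (s k') ltac:(lia) x y Hx Hy Dxy) as A2.
    pose proof (HK1 j (Nat.max K0 K1) Hj ltac:(lia) k ltac:(lia)) as A3. pose proof (HK1 j (Nat.max K0 K1) Hj ltac:(lia) k' ltac:(lia)) as A4.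
    fold y in A3, A4. apply Rabs_lt_iff in A1, A2, A3, A4. apply Rabs_lt_iff. lra. }
  assert (HF : forall x, exists l, In01 x -> Un_cv (fun k => f (s k) x) l).
  { intros x. destruct (classic (In01 x)) as [Hx|Hx]; [|exists 0; tauto].
    destruct (R_complete (fun k => f (s k) x)) as [l Hl]; [|exists l; auto].
    intros e He. destruct (Huc e He) as [K HK]. exists K. intros n m Hn Hm. apply HK; auto. }
  destruct (choice _ HF) as [F HF']. exists s, F. split; auto.
  intros e He. destruct (Huc (e / 2)) as [K HK]; [lra|]. exists K. intros k Hk x Hx.
  destruct (HF' x Hx (e / 2)) as [N HN]; [lra|]. specialize (HN (Nat.max N K) ltac:(lia)).
  specialize (HK k (Nat.max N K) Hk ltac:(lia) x Hx). unfold R_dist in HN.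
  apply Rabs_lt_iff in HN, HK. apply Rabs_lt_iff. lra.
Qed.

(** * Polygonal chains up to homotopy *)

Definition lerp (x y : Cpl) (t : R) : Cpl := ((1 - t) * fst x + t * fst y, (1 - t) * snd x + t * snd y).
Definition convex (K : Cpl -> Prop) : Prop := forall x y t, K x -> K y -> 0 <= t <= 1 -> K (lerp x y t).
(** Some convex subset of [S] containing the vertices stands in for their convex hull, so that hulls
    never have to be described. *)
Definition cvx (S : Cpl -> Prop) (l : list Cpl) : Prop :=
  exists K, convex K /\ (forall z, K z -> S z) /\ Forall K l.

(** Homotopy of chains with fixed ends, generated by passing over a triangle that lies in a convex
    part of [S] and by repeating a vertex. An invariant has to be checked on these two moves only.
    The edges need not lie in [S]; that is the separate condition [valid]. *)
Inductive ceq (S : Cpl -> Prop) : list Cpl -> list Cpl -> Prop :=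
| ceq_refl l : ceq S l l
| ceq_sym l l' : ceq S l l' -> ceq S l' l
| ceq_trans l l' l'' : ceq S l l' -> ceq S l' l'' -> ceq S l l''
| ceq_tri l1 a b c l2 : cvx S [a; b; c] -> ceq S (l1 ++ a :: b :: c :: l2) (l1 ++ a :: c :: l2)
| ceq_dup l1 a l2 : ceq S (l1 ++ a :: a :: l2) (l1 ++ a :: l2).

#[export] Instance ceq_equiv S : Equivalence (ceq S).
Proof. split; red; [apply ceq_refl|apply ceq_sym|apply ceq_trans]. Qed.

Lemma ceq_ctx S x y l l' : ceq S l l' -> ceq S (x ++ l ++ y) (x ++ l' ++ y).
Proof.
  induction 1.
  - reflexivity.
  - now symmetry.
  - etransitivity; eassumption.
  - rewrite <- !app_assoc, !(app_assoc x). simpl. now apply ceq_tri.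
  - rewrite <- !app_assoc, !(app_assoc x). simpl. apply ceq_dup.
Qed.

#[export] Instance ceq_app S : Proper (ceq S ==> ceq S ==> ceq S) (@app Cpl).
Proof.
  intros a a' Ha b b' Hb. transitivity (a' ++ b).
  - apply (ceq_ctx S [] b _ _ Ha).
  - pose proof (ceq_ctx S a' [] _ _ Hb) as H. now rewrite !app_nil_r in H.
Qed.

#[export] Instance ceq_cons S a : Proper (ceq S ==> ceq S) (@cons Cpl a).
Proof. intros b b' Hb. change (ceq S ([a] ++ b) ([a] ++ b')). now rewrite Hb. Qed.

Lemma ceq_dup0 S a l : ceq S (a :: a :: l) (a :: l).
Proof. apply (ceq_dup S []). Qed.

Lemma ceq_tri0 S a b c l : cvx S [a; b; c] -> ceq S (a :: b :: c :: l) (a :: c :: l).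
Proof. apply (ceq_tri S []). Qed.

Lemma cvx_sub S l l' : cvx S l -> incl l' l -> cvx S l'.
Proof.
  intros [K [H1 [H2 H3]]] Hi. exists K. repeat split; auto. rewrite Forall_forall in *. auto.
Qed.

Lemma cvx_mono (S S' : Cpl -> Prop) l : (forall z, S z -> S' z) -> cvx S l -> cvx S' l.
Proof. intros H [K [H1 [H2 H3]]]. exists K. auto. Qed.

Lemma ceq_mono (S S' : Cpl -> Prop) l l' : (forall z, S z -> S' z) -> ceq S l l' -> ceq S' l l'.
Proof.
  intros H. induction 1.
  - reflexivity.
  - now symmetry.
  - etransitivity; eassumption.
  - apply ceq_tri. eapply cvx_mono; eauto.
  - apply ceq_dup.
Qed.

Ltac incl_tac := let z := fresh in let H := fresh in
  intros z H; repeat (rewrite ?in_app_iff in *; simpl in * ); intuition (subst; auto).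

Lemma ceq_collapse S a m e l2 : cvx S (a :: e :: m) -> ceq S (a :: m ++ e :: l2) (a :: e :: l2).
Proof.
  induction m as [|b m IH]; intros H; simpl; [reflexivity|].
  destruct m as [|c m].
  - simpl. apply (ceq_tri S []). eapply cvx_sub; [exact H|]. incl_tac.
  - transitivity (a :: (c :: m) ++ e :: l2).
    + apply (ceq_tri S []). eapply cvx_sub; [exact H|]. incl_tac.
    + apply IH. eapply cvx_sub; [exact H|]. incl_tac.
Qed.

Lemma ceq_cvx S l1 l2 a e m m' : cvx S (a :: e :: m ++ m') ->
  ceq S (l1 ++ a :: m ++ e :: l2) (l1 ++ a :: m' ++ e :: l2).
Proof.
  intros H. rewrite (ceq_collapse S a m), (ceq_collapse S a m'); [reflexivity| |]; eapply cvx_sub; try exact H; incl_tac.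
Qed.

Lemma ceq_back S a b l : cvx S [a; b] -> ceq S (a :: b :: a :: l) (a :: l).
Proof.
  intros H. rewrite (ceq_tri S [] a b a l); [simpl|eapply cvx_sub; [exact H|incl_tac]]. apply (ceq_dup S []).
Qed.

Lemma ceq_last S l l' d : ceq S l l' -> last l d = last l' d.
Proof.
  induction 1; auto.
  - congruence.
  - induction l1; [destruct l2; reflexivity|]. simpl. rewrite IHl1. destruct l1; reflexivity.
  - induction l1; [destruct l2; reflexivity|]. simpl. rewrite IHl1. destruct l1; reflexivity.
Qed.

Lemma ceq_hd S l l' d : ceq S l l' -> hd d l = hd d l'.
Proof. induction 1; auto; try congruence; destruct l1; reflexivity. Qed.

Lemma ceq_rev S l l' : ceq S l l' -> ceq S (rev l) (rev l').
Proof.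
  induction 1.
  - reflexivity.
  - now symmetry.
  - etransitivity; eassumption.
  - rewrite !rev_app_distr. simpl. rewrite <- !app_assoc. simpl. apply ceq_tri.
    eapply cvx_sub; [eassumption|incl_tac].
  - rewrite !rev_app_distr. simpl. rewrite <- !app_assoc. simpl. apply ceq_dup.
Qed.

Fixpoint valid (S : Cpl -> Prop) (l : list Cpl) : Prop :=
  match l with
  | a :: l' => match l' with b :: _ => cvx S [a; b] /\ valid S l' | [] => True end
  | [] => True
  end.

Lemma valid_app S l l' : valid S (l ++ l') -> valid S l /\ valid S l'.
Proof.
  induction l as [|a l IH]; simpl; [tauto|]. destruct l as [|b l]; simpl.
  - destruct l'; simpl; tauto.
  - intros [H1 H2]. apply IH in H2. tauto.
Qed.

Lemma valid_edge S l1 a b l2 : valid S (l1 ++ a :: b :: l2) -> cvx S [a; b].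
Proof. intros H. apply valid_app in H as [_ H]. apply H. Qed.

Lemma last_cons_default (x : Cpl) l d d' : last (x :: l) d = last (x :: l) d'.
Proof. revert x. induction l as [|y l IH]; intros x; [reflexivity|]. exact (IH y). Qed.

Lemma ceq_rev_cancel S X x : valid S (x :: X) -> ceq S (rev (x :: X) ++ x :: X) [last (x :: X) x].
Proof.
  revert x. induction X as [|y X IH]; intros x H.
  - simpl. apply (ceq_dup S [] x []).
  - destruct H as [H1 H2]. specialize (IH y H2).
    transitivity (rev (y :: X) ++ y :: X).
    + simpl. rewrite <- !app_assoc. simpl. rewrite (ceq_dup0 S x).
      rewrite ceq_back; [|eapply cvx_sub; [exact H1|incl_tac]].
      symmetry. rewrite (ceq_dup0 S y). reflexivity.
    + rewrite IH. change (last (x :: y :: X) x) with (last (y :: X) x). now rewrite (last_cons_default y X x y).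
Qed.

(** Chains form a groupoid: [rev (x :: X)] is put in front of both sides and cancels. Vertices
    doubled at the junctions are harmless because of [ceq_dup]. *)
Lemma ceq_cancel_l S x X Y Z : valid S (x :: X) -> hd x Y = last (x :: X) x -> hd x Z = last (x :: X) x ->
  Y <> [] -> Z <> [] -> ceq S ((x :: X) ++ Y) ((x :: X) ++ Z) -> ceq S Y Z.
Proof.
  intros Hv HY HZ NY NZ H. destruct Y as [|y Y]; [easy|]. destruct Z as [|z Z]; [easy|]. simpl hd in *.
  assert (E : forall w W, w = last (x :: X) x -> ceq S (w :: W) (rev (x :: X) ++ (x :: X) ++ w :: W)).
  { intros w W ->. rewrite app_assoc, (ceq_rev_cancel S X x Hv). simpl app. symmetry. apply (ceq_dup S []). }
  rewrite (E y Y HY), (E z Z HZ), H. reflexivity.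
Qed.

Lemma rev_last_hd (l : list Cpl) d : last (rev l) d = hd d l.
Proof. destruct l; simpl; auto. apply last_last. Qed.

Lemma hd_rev_last (l : list Cpl) d : hd d (rev l) = last l d.
Proof. rewrite <- (rev_involutive l) at 2. symmetry. apply rev_last_hd. Qed.

Lemma cvx_comm S a b : cvx S [a; b] -> cvx S [b; a].
Proof. intros H. eapply cvx_sub; [exact H|incl_tac]. Qed.

Lemma valid_join S l a l' : valid S (l ++ [a]) -> valid S (a :: l') -> valid S (l ++ a :: l').
Proof.
  induction l as [|x l IH]; [now intros|]. intros H H'. destruct l as [|y l].
  - destruct H as [H _]. split; auto.
  - destruct H as [H1 H2]. split; [exact H1|]. now apply IH.
Qed.

Lemma valid_rev S l : valid S l -> valid S (rev l).
Proof.
  induction l as [|a l IH]; simpl; auto. destruct l as [|b l]; simpl; auto.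
  intros [H1 H2]. specialize (IH H2). rewrite <- app_assoc. simpl. apply valid_join; auto.
  simpl. split; auto. now apply cvx_comm.
Qed.

Lemma app_cons_last (l : list Cpl) (a : Cpl) : l <> [] -> exists l0 x, l = l0 ++ [x].
Proof. intros H. destruct (exists_last H) as [l0 [x E]]. eauto. Qed.

(** * Crossings of a line *)

Section Line.
Variables (al be c : R).
Hypothesis Hnz : al <> 0 \/ be <> 0.
Definition lin (z : Cpl) : R := al * fst z + be * snd z.
Let v := lin.
Let w (z : Cpl) : R := al * snd z - be * fst z.

Lemma lin_lerp x y t : lin (lerp x y t) = (1 - t) * lin x + t * lin y.
Proof. unfold lin, lerp. simpl. ring. Qed.

Lemma convex_le : convex (fun z => lin z <= c).
Proof. intros x y t Hx Hy Ht. rewrite lin_lerp. nra. Qed.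

Lemma line_between z1 z2 z : v z1 = c -> v z2 = c -> v z = c -> w z1 <= w z <= w z2 ->
  exists t, 0 <= t <= 1 /\ z = lerp z1 z2 t.
Proof.
  intros H1 H2 H Hw. unfold v, lin, w in *.
  assert (N : 0 < al * al + be * be) by (destruct Hnz; nra).
  assert (U : forall a b : Cpl, al * fst a + be * snd a = al * fst b + be * snd b -> al * snd a - be * fst a = al * snd b - be * fst b -> a = b).
  { intros [a1 a2] [b1 b2]; simpl. intros E1 E2. f_equal; apply Rmult_eq_reg_l with (al * al + be * be); try lra.
    - transitivity (al * (al * a1 + be * a2) - be * (al * a2 - be * a1)); [ring|]. rewrite E1, E2. ring.
    - transitivity (be * (al * a1 + be * a2) + al * (al * a2 - be * a1)); [ring|]. rewrite E1, E2. ring. }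
  destruct (Req_dec (al * snd z1 - be * fst z1) (al * snd z2 - be * fst z2)) as [E|E].
  - exists 0. split; [lra|]. apply U; unfold lerp; simpl; lra.
  - set (d := (al * snd z2 - be * fst z2) - (al * snd z1 - be * fst z1)). assert (0 < d) by (unfold d; lra).
    set (t := ((al * snd z - be * fst z) - (al * snd z1 - be * fst z1)) / d). exists t.
    assert (Ht : t * d = (al * snd z - be * fst z) - (al * snd z1 - be * fst z1)) by (unfold t; field; lra).
    split.
    + split; [apply Rmult_le_reg_r with d; lra|]. apply Rmult_le_reg_r with d; auto. rewrite Ht. unfold d. lra.
    + apply U; unfold lerp; simpl.
      * transitivity ((1 - t) * (al * fst z1 + be * snd z1) + t * (al * fst z2 + be * snd z2)); [|ring]. rewrite H1, H2, H. ring.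
      * transitivity ((al * snd z1 - be * fst z1) + t * d); [|unfold d; ring]. lra.
Qed.

(** Two segments of one line with a common end cover the whole interval spanned by the three points.
    Thus being joined by a segment of the line inside [S] is transitive, which is what makes sliding
    along the line well behaved. *)
Lemma cvx_line S z1 z2 z3 : v z1 = c -> v z2 = c -> v z3 = c -> cvx S [z1; z2] -> cvx S [z2; z3] -> cvx S [z1; z2; z3].
Proof.
  intros H1 H2 H3 [K [K1 [K2 K3]]] [L [L1 [L2 L3]]].
  rewrite !Forall_cons_iff in K3, L3. destruct K3 as (A1 & A2 & _), L3 as (B1 & B2 & _).
  exists (fun z => v z = c /\ Rmin (w z1) (Rmin (w z2) (w z3)) <= w z <= Rmax (w z1) (Rmax (w z2) (w z3))).
  split; [|split].
  - intros x y t [X1 X2] [Y1 Y2] Ht. split.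
    + unfold v in *. rewrite lin_lerp, X1, Y1. ring.
    + assert (E : w (lerp x y t) = (1 - t) * w x + t * w y) by (unfold w, lerp; simpl; ring). rewrite E.
      revert X2 Y2. generalize (Rmin (w z1) (Rmin (w z2) (w z3))) (Rmax (w z1) (Rmax (w z2) (w z3))).
      intros m M X2 Y2. split; nra.
  - intros z [Z1 Z2].
    assert (Q : (w z1 <= w z <= w z2 \/ w z2 <= w z <= w z1) \/ (w z2 <= w z <= w z3 \/ w z3 <= w z <= w z2)).
    { unfold Rmin, Rmax in Z2. repeat destruct Rle_dec; lra. }
    destruct Q as [[Q|Q]|[Q|Q]].
    + destruct (line_between z1 z2 z) as [t [Ht ->]]; auto.
    + destruct (line_between z2 z1 z) as [t [Ht ->]]; auto.
    + destruct (line_between z2 z3 z) as [t [Ht ->]]; auto.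
    + destruct (line_between z3 z2 z) as [t [Ht ->]]; auto.
  - rewrite !Forall_cons_iff. unfold Rmin, Rmax.
    split; [|split; [|split; [|constructor]]]; (split; [assumption|]); repeat destruct Rle_dec; lra.
Qed.

Lemma cvx_line2 S z1 z2 z3 : v z1 = c -> v z2 = c -> v z3 = c -> cvx S [z1; z2] -> cvx S [z2; z3] -> cvx S [z1; z3].
Proof. intros H1 H2 H3 A B. eapply cvx_sub; [apply (cvx_line S z1 z2 z3); eauto|incl_tac]. Qed.

(** Points of the line count as lying below. With ties broken once and for all, an edge crosses
    exactly when its ends get different values, and no general position has to be arranged. *)
Definition sd (z : Cpl) : bool := if Rle_dec (lin z) c then false else true.
Definition cross (a b : Cpl) : Cpl := lerp a b ((c - lin a) / (lin b - lin a)).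

Lemma sd_false z : sd z = false <-> lin z <= c.
Proof. unfold sd. destruct Rle_dec; split; auto; try easy; lra. Qed.
Lemma sd_true z : sd z = true <-> c < lin z.
Proof. unfold sd. destruct Rle_dec; split; auto; try easy; lra. Qed.

Lemma cross_param a b : sd a <> sd b -> 0 <= (c - lin a) / (lin b - lin a) <= 1 /\ lin a <> lin b.
Proof.
  intros H. destruct (sd a) eqn:Ea, (sd b) eqn:Eb; try easy;
    [apply sd_true in Ea; apply sd_false in Eb|apply sd_false in Ea; apply sd_true in Eb].
  - split; [|intro; lra]. replace ((c - lin a) / (lin b - lin a)) with ((lin a - c) * / (lin a - lin b)) by (field; lra).
    split. { apply Rmult_le_pos; [lra|]. left; apply Rinv_0_lt_compat; lra. }
    apply Rmult_le_reg_r with (lin a - lin b); [lra|]. rewrite Rmult_assoc, Rinv_l; lra.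
  - split; [|intro; lra]. unfold Rdiv.
    split. { apply Rmult_le_pos; [lra|]. left; apply Rinv_0_lt_compat; lra. }
    apply Rmult_le_reg_r with (lin b - lin a); [lra|]. rewrite Rmult_assoc, Rinv_l; lra.
Qed.

Lemma cross_line a b : sd a <> sd b -> lin (cross a b) = c.
Proof. intros H. destruct (cross_param a b H) as [_ H2]. unfold cross. rewrite lin_lerp. field. lra. Qed.

Lemma cross_on_line a b : lin a = c -> cross a b = a.
Proof. intros H. unfold cross. rewrite H. unfold Rdiv. replace (c - c) with 0 by ring. rewrite Rmult_0_l. unfold lerp. destruct a; simpl. f_equal; ring. Qed.

Lemma cross_in K a b : convex K -> K a -> K b -> sd a <> sd b -> K (cross a b).
Proof. intros HK Ha Hb H. apply HK; auto. now apply cross_param. Qed.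

Lemma sd_line z : lin z = c -> sd z = false.
Proof. intros H. apply sd_false. lra. Qed.

(** * Parity of the crossings that belong to an invariant class *)

Section Parity.
Variable S : Cpl -> Prop.
Variable Phi : list Cpl -> Prop.
Hypothesis Phi_ceq : forall l l', ceq S l l' -> Phi l -> Phi l'.
Hypothesis Phi_slide : forall l x y, lin x = c -> lin y = c -> cvx S [x; y] -> Phi (l ++ [x]) -> Phi (l ++ [x; y]).

(** A door: an edge that crosses the line and whose crossing point, reached along the prefix [pre],
    lies in the class [Phi]. The class is invariant under homotopy of the prefix and under sliding
    its end along the line. *)
Definition dr (pre : list Cpl) (a b : Cpl) : Prop := sd a <> sd b /\ Phi (pre ++ [cross a b]).
Definition drb pre a b : bool := if excluded_middle_informative (dr pre a b) then true else false.

Lemma drb_iff pre a b pre' a' b' : (dr pre a b <-> dr pre' a' b') -> drb pre a b = drb pre' a' b'.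
Proof. clear Hnz. intros H. unfold drb. do 2 destruct excluded_middle_informative; tauto. Qed.

Lemma drb_false pre a b : ~ dr pre a b -> drb pre a b = false.
Proof. clear Hnz. unfold drb. destruct excluded_middle_informative; tauto. Qed.
Lemma drb_true pre a b : dr pre a b -> drb pre a b = true.
Proof. clear Hnz. unfold drb. destruct excluded_middle_informative; tauto. Qed.

Fixpoint cnt (pre : list Cpl) (a : Cpl) (l : list Cpl) : bool :=
  match l with
  | [] => false
  | b :: l' => xorb (drb pre a b) (cnt (pre ++ [b]) b l')
  end.

Definition parity (P : list Cpl) : bool := match P with [] => false | z :: l => cnt [z] z l end.

Lemma cnt_ceq l : forall pre pre' a, ceq S pre pre' -> cnt pre a l = cnt pre' a l.
Proof.
  induction l as [|b l IH]; intros pre pre' a H; simpl; auto.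
  f_equal.
  - apply drb_iff. unfold dr. split; intros [H1 H2]; split; auto; eapply Phi_ceq; [|exact H2| |exact H2]; rewrite H; reflexivity.
  - apply IH. now rewrite H.
Qed.

Lemma cnt_app l1 : forall pre a l2, cnt pre a (l1 ++ l2) = xorb (cnt pre a l1) (cnt (pre ++ l1) (last (a :: l1) a) l2).
Proof.
  induction l1 as [|b l1 IH]; intros pre a l2.
  - simpl. now rewrite app_nil_r.
  - simpl app. simpl cnt. rewrite IH, <- app_assoc, xorb_assoc. simpl app. do 3 f_equal.
    change (last (a :: b :: l1) a) with (last (b :: l1) a). apply last_cons_default.
Qed.

(** Inside one convex piece any point of the line can be slid to any other and any route deformed to
    any other, so all crossings there are doors or none is. *)
Lemma Phi_K pre m m' a x y : lin x = c -> lin y = c -> cvx S (a :: x :: y :: m ++ m') ->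
  Phi (pre ++ a :: m ++ [x]) -> Phi (pre ++ a :: m' ++ [y]).
Proof.
  intros Hx Hy Hc H.
  assert (H1 : Phi ((pre ++ a :: m) ++ [x; y])).
  { apply Phi_slide; auto. { eapply cvx_sub; [exact Hc|incl_tac]. } rewrite <- app_assoc. exact H. }
  rewrite <- app_assoc in H1. simpl in H1.
  eapply Phi_ceq; [|exact H1].
  replace (a :: m ++ [x; y]) with (a :: (m ++ [x]) ++ y :: []) by (rewrite <- app_assoc; reflexivity).
  replace (a :: m' ++ [y]) with (a :: m' ++ y :: []) by reflexivity.
  apply ceq_cvx. eapply cvx_sub; [exact Hc|incl_tac].
Qed.

(** A line meets the boundary of a triangle in zero or two edges, and by [Phi_K] the two crossings
    are both doors or both not. Replacing two sides by the third therefore keeps the parity. *)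
Lemma cnt_tri pre a b c' l : cvx S [a; b; c'] -> cnt (pre ++ [a]) a (b :: c' :: l) = cnt (pre ++ [a]) a (c' :: l).
Proof.
  intros H. simpl.
  assert (E : cnt (((pre ++ [a]) ++ [b]) ++ [c']) c' l = cnt ((pre ++ [a]) ++ [c']) c' l).
  { apply cnt_ceq. rewrite <- !app_assoc. simpl. now apply ceq_tri. }
  rewrite E, <- xorb_assoc. f_equal.
  destruct H as [K [K1 [K2 K3]]].
  rewrite !Forall_cons_iff in K3. destruct K3 as (Ka & Kb & Kc & _).
  assert (KS : forall l, Forall K l -> cvx S l) by (intros; exists K; auto).
  assert (Q : forall m m' x y, lin x = c -> lin y = c -> Forall K (x :: y :: m ++ m') ->
    Phi ((pre ++ a :: m) ++ [x]) -> Phi ((pre ++ a :: m') ++ [y])).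
  { intros m m' x y Hx Hy HK HP. rewrite <- app_assoc in *. simpl in *. eapply (Phi_K pre m m' a x y); auto. }
  assert (I : forall p q, sd p <> sd q -> K p -> K q -> K (cross p q)) by (intros; now apply cross_in).
  rewrite <- !app_assoc. simpl app.
  destruct (sd a) eqn:Ea, (sd b) eqn:Eb, (sd c') eqn:Ec.
  all: repeat match goal with |- context [drb ?p ?x ?y] =>
     let H := fresh "N" in assert (H : sd x = sd y) by congruence; rewrite (drb_false p x y) by (intros [? _]; congruence); clear H end.
  all: try reflexivity.
  all: try (assert (Sab : sd a <> sd b) by congruence; pose proof (cross_line a b Sab); pose proof (I a b Sab Ka Kb)).
  all: try (assert (Sbc : sd b <> sd c') by congruence; pose proof (cross_line b c' Sbc); pose proof (I b c' Sbc Kb Kc)).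
  all: try (assert (Sac : sd a <> sd c') by congruence; pose proof (cross_line a c' Sac); pose proof (I a c' Sac Ka Kc)).
  all: rewrite ?xorb_false_l, ?xorb_false_r.
  all: try match goal with |- xorb ?x ?y = false => replace x with y; [apply xorb_nilpotent|] end.
  all: apply drb_iff; unfold dr; split; intros [HH1 HH2]; split; try congruence.
  all: match goal with
    | H : Phi ((?p ++ [?u]) ++ [?x]), Q : forall m, _ |- Phi ((?p ++ [?u]) ++ [?y]) => apply (Q [] [] x y)
    | H : Phi ((?p ++ [?u; ?t]) ++ [?x]), Q : forall m, _ |- Phi ((?p ++ [?u]) ++ [?y]) => apply (Q [t] [] x y)
    | H : Phi ((?p ++ [?u]) ++ [?x]), Q : forall m, _ |- Phi ((?p ++ [?u; ?t]) ++ [?y]) => apply (Q [] [t] x y)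
    end; auto; simpl; auto.
Qed.

Theorem parity_ceq P P' : ceq S P P' -> parity P = parity P'.
Proof.
  induction 1; auto.
  - congruence.
  - destruct l1 as [|z l1]; simpl app; unfold parity.
    + apply (cnt_tri []); auto.
    + rewrite !cnt_app. f_equal. cbn [cnt]. f_equal. apply (cnt_tri ([z] ++ l1)); auto.
  - destruct l1 as [|z l1]; simpl app; unfold parity.
    + cbn [cnt]. rewrite drb_false by (intros [? _]; congruence). rewrite xorb_false_l. apply cnt_ceq. apply (ceq_dup S [] a []).
    + rewrite !cnt_app. f_equal. cbn [cnt]. f_equal.
      rewrite (drb_false _ a a) by (intros [? _]; congruence). rewrite xorb_false_l. apply cnt_ceq. rewrite <- !app_assoc. simpl.
      apply (ceq_dup S (z :: l1) a []).
Qed.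

(** When every crossing is a door, the sum telescopes to a comparison of the sides of the two
    ends. *)
Lemma cnt_all l : forall pre a,
  (forall l1 x y l2, a :: l = l1 ++ x :: y :: l2 -> sd x <> sd y -> dr (pre ++ tl (l1 ++ [x])) x y) ->
  cnt pre a l = xorb (sd a) (sd (last (a :: l) a)).
Proof.
  induction l as [|b l IH]; intros pre a H.
  - simpl. now rewrite xorb_nilpotent.
  - cbn [cnt]. rewrite IH.
    + change (last (a :: b :: l) a) with (last (b :: l) a). rewrite (last_cons_default b l a b).
      assert (E : drb pre a b = xorb (sd a) (sd b)).
      { destruct (bool_dec (sd a) (sd b)) as [E|E].
        - rewrite E, xorb_nilpotent. apply drb_false. intros [? _]; congruence.
        - rewrite drb_true. { destruct (sd a), (sd b); auto; congruence. }
          specialize (H [] a b l eq_refl E). simpl in H. now rewrite app_nil_r in H. }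
      rewrite E. destruct (sd a), (sd b), (sd (last (b :: l) b)); reflexivity.
    + intros l1 x y l2 E D. specialize (H (a :: l1) x y l2). rewrite E in H. specialize (H eq_refl D).
      simpl in H. destruct l1 as [|b' l1]; simpl in *.
      * inversion E. subst. rewrite app_nil_r. exact H.
      * inversion E. subst. rewrite <- app_assoc. simpl. exact H.
Qed.

Lemma cnt_none l : forall pre a,
  (forall l1 x y l2, a :: l = l1 ++ x :: y :: l2 -> ~ dr (pre ++ tl (l1 ++ [x])) x y) ->
  cnt pre a l = false.
Proof.
  induction l as [|b l IH]; intros pre a H; [reflexivity|].
  cbn [cnt]. rewrite IH.
  - rewrite drb_false; auto. specialize (H [] a b l eq_refl). simpl in H. now rewrite app_nil_r in H.
  - intros l1 x y l2 E. specialize (H (a :: l1) x y l2). rewrite E in H. specialize (H eq_refl).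
    simpl in H. destruct l1 as [|b' l1]; simpl in *.
    + inversion E. subst. rewrite app_nil_r. exact H.
    + inversion E. subst. rewrite <- app_assoc. simpl. exact H.
Qed.
End Parity.

(* If no crossing of [R] were homotopic along the line to a crossing of [A], then exactly the
   crossings of [A] would be in the invariant class, and their number is odd. *)
Theorem door_link S z A x R : valid S (z :: A) -> last (z :: A) z = x -> ceq S (z :: A ++ R) [z] ->
  lin z <= c -> c < lin x ->
  exists A1 a b A2 R1 e f R2, z :: A = A1 ++ a :: b :: A2 /\ sd a <> sd b /\ x :: R = R1 ++ e :: f :: R2 /\ sd e <> sd f /\
    cvx S [cross a b; cross e f] /\
    ceq S (A1 ++ [a; cross a b; cross e f]) ((z :: A) ++ tl (R1 ++ [e]) ++ [cross e f]).
Proof.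
  intros Hv Hx Hnull Hz Hx'.
  (* The class of chains that follow [A] up to one of its crossings and then slide along the line
     inside [S]. *)
  set (Phi := fun l : list Cpl => exists A1 a b A2, z :: A = A1 ++ a :: b :: A2 /\ sd a <> sd b /\ lin (last l z) = c /\
     cvx S [cross a b; last l z] /\ ceq S l (A1 ++ [a; cross a b; last l z])).
  assert (P1 : forall l l', ceq S l l' -> Phi l -> Phi l').
  { intros l l' H (A1 & a & b & A2 & H1 & H2 & H3 & H4 & H5). exists A1, a, b, A2.
    rewrite <- (ceq_last S l l' z H). repeat split; auto. now rewrite <- H. }
  assert (P2 : forall l x y, lin x = c -> lin y = c -> cvx S [x; y] -> Phi (l ++ [x]) -> Phi (l ++ [x; y])).
  { intros l p y Hp Hy Hc (A1 & a & b & A2 & H1 & H2 & H3 & H4 & H5). exists A1, a, b, A2.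
    replace (l ++ [p; y]) with ((l ++ [p]) ++ [y]) by (rewrite <- app_assoc; reflexivity).
    rewrite last_last in *. repeat split; auto.
    - apply (cvx_line2 S _ p); auto. now apply cross_line.
    - rewrite H5, <- app_assoc. simpl. replace (A1 ++ [a; cross a b; p; y]) with ((A1 ++ [a]) ++ cross a b :: p :: y :: []) by (rewrite <- app_assoc; reflexivity).
      rewrite ceq_tri. { rewrite <- app_assoc. reflexivity. } apply cvx_line; auto. now apply cross_line. }
  pose proof (parity_ceq S Phi P1 P2 _ _ Hnull) as HP. unfold parity in HP.
  rewrite cnt_app, Hx in HP.
  (* Every crossing of [A] is a door, being linked to itself. *)
  rewrite (cnt_all Phi A) in HP.
  2:{ intros l1 a b l2 E D. split; auto. exists l1, a, b, l2.
      rewrite last_last. repeat split; auto. { now apply cross_line. }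
      - rewrite E in Hv. apply valid_edge in Hv. destruct Hv as [K [K1 [K2 K3]]].
        rewrite !Forall_cons_iff in K3. destruct K3 as (Ka & Kb & _).
        exists K. repeat split; auto. constructor; [|constructor]; auto; now apply cross_in.
      - assert (E2 : [z] ++ tl (l1 ++ [a]) = l1 ++ [a]). { destruct l1; simpl in *; inversion E; subst; reflexivity. }
        rewrite E2, <- app_assoc. simpl.
        replace (l1 ++ [a; cross a b; cross a b]) with ((l1 ++ [a]) ++ cross a b :: cross a b :: []) by (rewrite <- app_assoc; reflexivity).
        rewrite ceq_dup, <- app_assoc. reflexivity. }
  rewrite Hx in HP. replace (sd z) with false in HP by (symmetry; now apply sd_false). replace (sd x) with true in HP by (symmetry; now apply sd_true).
  simpl in HP.
  (* The whole chain is null-homotopic, hence has an even number of doors. [A] contributes an odd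
     number, so [R] must contribute one. *)
  apply NNPP. intros Hn. rewrite cnt_none in HP; [easy|].
  intros l1 e f l2 E [D (A1 & a & b & A2 & H1 & H2 & H3 & H4 & H5)]. apply Hn.
  rewrite last_last in *.
  exists A1, a, b, A2, l1, e, f, l2. repeat split; auto. rewrite <- H5, <- !app_assoc. reflexivity.
Qed.

End Line.

Ltac fall := repeat apply Forall_cons; try apply Forall_nil; auto; try lra.

(** * Null-homotopies inside a half-plane *)

Section Fill.
Variables (al be c : R).
Hypothesis Hnz : al <> 0 \/ be <> 0.
Variable S : Cpl -> Prop.
Notation v := (lin al be).
Notation sd := (sd al be c).
Notation cross := (cross al be c).

Definition halfS (z : Cpl) : Prop := S z /\ v z <= c.

Lemma cvx_half l : cvx S l -> Forall (fun z => v z <= c) l -> cvx halfS l.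
Proof.
  intros [K [K1 [K2 K3]]] H. exists (fun z => K z /\ v z <= c). split; [|split].
  - intros x y t [X1 X2] [Y1 Y2] Ht. split; auto. now apply (convex_le al be c).
  - intros z [Z1 Z2]. split; auto.
  - rewrite Forall_forall in *. auto.
Qed.

(** Equality is a separate alternative because [cvx S [x; x]] would require [x] to lie in [S]. *)
Definition lk (x y : Cpl) : Prop := x = y \/ cvx S [x; y].

Lemma lk_sym x y : lk x y -> lk y x.
Proof. intros [->|H]; [now left|right]. now apply cvx_comm. Qed.

Lemma lk_trans x y z : v x = c -> v y = c -> v z = c -> lk x y -> lk y z -> lk x z.
Proof.
  intros Hx Hy Hz [->|H] [->|H']; unfold lk; auto. right. apply (cvx_line2 al be c Hnz S x y z); auto.
Qed.

Lemma lk3h x y z l : v x = c -> v y = c -> v z = c -> lk x y -> lk y z -> ceq halfS (x :: y :: z :: l) (x :: z :: l).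
Proof.
  intros Hx Hy Hz [->|H] [->|H'].
  - apply ceq_dup0.
  - apply ceq_dup0.
  - now rewrite (ceq_dup0 halfS z).
  - apply ceq_tri0. apply cvx_half; [|fall]. apply (cvx_line al be c Hnz S x y z); auto.
Qed.

Lemma lk3 x y z l : v x = c -> v y = c -> v z = c -> lk x y -> lk y z -> ceq S (x :: y :: z :: l) (x :: z :: l).
Proof. intros. eapply ceq_mono; [|apply lk3h; eassumption]. now intros w []. Qed.

Lemma lk2h x y l : v x = c -> v y = c -> lk x y -> ceq halfS (x :: y :: x :: l) (x :: l).
Proof. intros Hx Hy H. rewrite (lk3h x y x); auto; [apply ceq_dup0|now apply lk_sym]. Qed.

Lemma lk2 x y l : v x = c -> v y = c -> lk x y -> ceq S (x :: y :: x :: l) (x :: l).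
Proof. intros. eapply ceq_mono; [|apply lk2h; eassumption]. now intros w []. Qed.

(* Sheets of the covering of [S] that restricts to the universal covering of [halfS]: either
   the current point is reached by a chain [s] of [halfS], or the half-plane was left for good
   at the point [x] and the rest [p] of the chain is only remembered up to homotopy in [S]. *)
Inductive sheet := Inner (s : list Cpl) | Outer (s : list Cpl) (x : Cpl) (p : list Cpl).

(** The excursion [p] that left at [x], closed up at the point [y] of the line, can be pushed back
    into the line. Then the sheet reached at [y] is an inner one again. *)
Definition triv (x : Cpl) (p : list Cpl) (y : Cpl) : Prop := lk x y /\ ceq S (p ++ [y]) [x; y].
Definition trivb x p y : bool := if excluded_middle_informative (triv x p y) then true else false.

(** Lifting of the edge from [a] to [b] to the covering. The half-plane is left at the first
    crossing and re-entered only by a downward crossing at which the excursion is trivial. *)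
Definition step (st : sheet) (a b : Cpl) : sheet :=
  match st with
  | Inner s => if sd b then Outer (s ++ [cross a b]) (cross a b) [cross a b; b] else Inner (s ++ [b])
  | Outer s x p => if (sd a && negb (sd b) && trivb x p (cross a b))%bool then Inner (s ++ [cross a b; b]) else Outer s x (p ++ [b])
  end.

Definition Phi (x : Cpl) (l : list Cpl) : Prop := lk x (last l x) /\ v (last l x) = c /\ ceq S l [x; last l x].

Definition par (x : Cpl) := parity al be c (Phi x).

Lemma par_ceq x l l' : v x = c -> ceq S l l' -> par x l = par x l'.
Proof.
  intros Hx. apply (parity_ceq al be c Hnz S (Phi x)).
  - intros m m' H (H1 & H2 & H3). unfold Phi. rewrite <- (ceq_last S m m' x H). repeat split; auto. now rewrite <- H.
  - intros m y z Hy Hz Hc (H1 & H2 & H3). unfold Phi.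
    replace (m ++ [y; z]) with ((m ++ [y]) ++ [z]) by (rewrite <- app_assoc; reflexivity).
    rewrite last_last in *. assert (lk y z) by now right. repeat split; auto.
    + apply (lk_trans x y z); auto.
    + rewrite H3. simpl. apply lk3; auto.
Qed.

Lemma par_snoc x l a b : l <> [] -> last l x = a -> ~ dr al be c (Phi x) l a b -> par x (l ++ [b]) = par x l.
Proof.
  intros Hl Ha Hn. destruct l as [|z l]; [easy|].
  change (cnt al be c (Phi x) [z] z (l ++ [b]) = cnt al be c (Phi x) [z] z l). rewrite cnt_app.
  rewrite <- (last_cons_default z l x z) in *. rewrite Ha. simpl cnt. rewrite drb_false; [|exact Hn]. now rewrite !xorb_false_r.
Qed.

(** [par x p = true] says that the excursion has an odd number of crossings homotopic to [x] along
    the line: the lifted point is still beyond the lift of the line through which it left. *)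
Definition wf (st : sheet) (a : Cpl) : Prop :=
  match st with
  | Inner s => sd a = false /\ exists s0, s = s0 ++ [a]
  | Outer s x p => v x = c /\ (exists s0, s = s0 ++ [x]) /\ (exists p0, p = x :: p0) /\ (exists p1, p = p1 ++ [a]) /\ par x p = true
  end.

(** Outer sheets are compared up to sliding the exit point along the line. *)
Definition eqv (st st' : sheet) : Prop :=
  match st, st' with
  | Inner s, Inner s' => ceq halfS s s'
  | Outer s x p, Outer s' x' p' => lk x x' /\ ceq halfS (s ++ [x']) s' /\ ceq S p (x :: p')
  | _, _ => False
  end.

Lemma triv_iff x p y : trivb x p y = true <-> triv x p y.
Proof. unfold trivb. destruct excluded_middle_informative; split; auto; easy. Qed.

Lemma trivb_ext x p y x' p' y' : (triv x p y <-> triv x' p' y') -> trivb x p y = trivb x' p' y'.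
Proof. intros H. unfold trivb. do 2 destruct excluded_middle_informative; tauto. Qed.

Lemma sd_le z : sd z = false -> v z <= c.
Proof. apply sd_false. Qed.

(** If an upward crossing closed the excursion up trivially, the excursion would have the parity of
    a chain inside the line, which is even, against [wf]. *)
Lemma outer_not_back s x p a b : wf (Outer s x p) a -> sd a = false -> sd b = true -> ~ triv x p (cross a b).
Proof.
  intros (H1 & _ & (p0 & ->) & (p1 & E) & Hp) Ha Hb [T1 T2].
  assert (D : sd a <> sd b) by congruence.
  assert (L : last (x :: p0) x = a) by (rewrite E; apply last_last).
  pose proof (cross_line al be c a b D) as Hc.
  assert (Hp' : par x ((x :: p0) ++ [cross a b]) = true).
  { rewrite (par_snoc x (x :: p0) a); auto; [easy|]. intros [D' _]. apply D'. rewrite Ha. symmetry. now apply sd_line. }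
  rewrite (par_ceq x _ _ H1 T2) in Hp'. unfold par, parity in Hp'. simpl in Hp'.
  rewrite drb_false in Hp'; [easy|]. intros [D' _]. apply D'. now rewrite (sd_line al be c x H1), (sd_line al be c _ Hc).
Qed.

Lemma wf_step st a b : wf st a -> wf (step st a b) b.
Proof.
  destruct st as [s|s x p]; intros H.
  - destruct H as [Ha [s0 ->]]. simpl. destruct (sd b) eqn:Eb; simpl.
    + assert (D : sd a <> sd b) by congruence. pose proof (cross_line al be c a b D) as Hc.
      split; auto. split; [eauto|]. split; [eauto|]. split; [exists [cross a b]; reflexivity|].
      (* The excursion starts on the line, which counts as below, so its first edge crosses at its
         own starting point and the parity is odd. *)
      unfold par, parity. simpl. rewrite drb_true; [reflexivity|].
      split. { rewrite (sd_line al be c _ Hc), Eb. easy. }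
      assert (E : cross (cross a b) b = cross a b) by now apply cross_on_line.
      rewrite E. split; [now left|]. split; [exact Hc|]. reflexivity.
    + split; auto. eexists; reflexivity.
  - pose proof H as (H1 & (s0 & ->) & (p0 & ->) & (p1 & E) & Hp).
    assert (L : last (x :: p0) x = a) by (rewrite E; apply last_last).
    unfold step. destruct (sd a && negb (sd b) && trivb x (x :: p0) (cross a b))%bool eqn:T.
    + apply andb_prop in T as [T1 T2]. apply andb_prop in T1 as [T0 T1]. simpl. split.
      * now destruct (sd b).
      * exists ((s0 ++ [x]) ++ [cross a b]). now rewrite <- !app_assoc.
    + simpl. split; auto. split; [eauto|]. split; [eauto|]. split; [exists (x :: p0); reflexivity|].
      (* A change of parity would come from a trivial crossing; downwards it would have led to an
         inner sheet, upwards [outer_not_back] forbids it. *)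
      refine (eq_trans (par_snoc x (x :: p0) a b _ L _) Hp); [easy|].
      intros [D (F1 & F2 & F3)]. rewrite last_last in *.
      assert (TT : triv x (x :: p0) (cross a b)) by (split; auto).
      destruct (sd a) eqn:Ea, (sd b) eqn:Eb; try congruence.
      * apply triv_iff in TT. rewrite TT in T. easy.
      * revert TT. eapply outer_not_back; eauto.
Qed.

Lemma eqv_refl st a : wf st a -> eqv st st.
Proof.
  destruct st as [s|s x p]; intros H; simpl; [reflexivity|].
  destruct H as (H1 & (s0 & ->) & (p0 & ->) & _). split; [now left|]. split.
  - rewrite <- app_assoc. simpl. now rewrite (ceq_dup0 halfS x).
  - symmetry. apply ceq_dup0.
Qed.

Lemma eqv_sym st st' a : wf st a -> wf st' a -> eqv st st' -> eqv st' st.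
Proof.
  destruct st as [s|s x p], st' as [s'|s' x' p']; simpl; try easy.
  intros (H1 & (s0 & ->) & (p0 & ->) & _) (H1' & (s0' & ->) & (p0' & ->) & _) (A & B & C).
  split; [now apply lk_sym|]. split.
  - rewrite <- B, <- !app_assoc. simpl. now rewrite lk2h.
  - rewrite C. symmetry. apply lk2; auto. now apply lk_sym.
Qed.

Lemma eqv_trans st st' st'' a : wf st a -> wf st' a -> wf st'' a -> eqv st st' -> eqv st' st'' -> eqv st st''.
Proof.
  destruct st as [s|s x p], st' as [s'|s' x' p'], st'' as [s''|s'' x'' p'']; simpl; try easy.
  { intros _ _ _ A B. now rewrite A. }
  intros (H1 & (s0 & ->) & (p0 & ->) & _) (H1' & (s0' & ->) & (p0' & ->) & _) (H1'' & (s0'' & ->) & (p0'' & ->) & _) (A & B & C) (A' & B' & C').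
  split; [eapply lk_trans; [exact H1|exact H1'|exact H1''|exact A|exact A']|]. split.
  - rewrite <- B', <- B, <- !app_assoc. simpl. now rewrite (lk3h x x' x'').
  - rewrite C, C'. apply lk3; auto.
Qed.

Lemma eqv_step st st' a b : wf st a -> wf st' a -> eqv st st' -> eqv (step st a b) (step st' a b).
Proof.
  intros W W' E. pose proof (wf_step st a b W) as V. pose proof (wf_step st' a b W') as V'.
  destruct st as [s|s x p], st' as [s'|s' x' p']; simpl in E; try easy.
  - revert V. simpl. destruct (sd b); simpl; intros V.
    + split; [now left|]. split.
      * destruct V as (_ & (t & V) & _). rewrite V, <- !app_assoc. simpl. rewrite (ceq_dup0 halfS (cross a b)), <- V. now rewrite E.
      * symmetry. apply ceq_dup0.
    + now rewrite E.
  - destruct W as (H1 & (s0 & ->) & (p0 & ->) & _), W' as (H1' & (s0' & ->) & (p0' & ->) & _), E as (A & B & C).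
    unfold step.
    destruct (sd a) eqn:Ea; destruct (sd b) eqn:Eb; simpl andb; cbv iota; try (split; [exact A|split; [exact B|]]; rewrite C; reflexivity).
    assert (D : sd a <> sd b) by congruence. pose proof (cross_line al be c a b D) as Hc.
    assert (T : triv x (x :: p0) (cross a b) <-> triv x' (x' :: p0') (cross a b)).
    { split; intros [T1 T2]; split.
      - eapply (lk_trans x' x); eauto. now apply lk_sym.
      - assert (X : ceq S (x' :: p0') (x' :: x :: p0)) by (rewrite C; symmetry; apply lk2; auto; now apply lk_sym).
        rewrite X. simpl in *. rewrite T2. apply lk3; auto. now apply lk_sym.
      - eapply (lk_trans x x'); eauto.
      - rewrite C. simpl in *. rewrite T2. apply lk3; auto. }
    rewrite (trivb_ext _ _ _ _ _ _ T). destruct (trivb x' (x' :: p0') (cross a b)) eqn:Tb; simpl.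
    + apply triv_iff in Tb. destruct Tb as [T1 T2]. rewrite <- B, <- !app_assoc. simpl. rewrite (lk3h x x' (cross a b)); auto. reflexivity.
    + split; [exact A|split; [exact B|]]. exact (ceq_app S _ _ C [b] [b] (ceq_refl _ _)).
Qed.

Lemma eqv_dup st a : wf st a -> eqv (step st a a) st.
Proof.
  destruct st as [s|s x p]; intros W.
  - destruct W as [Ha [s0 ->]]. simpl. rewrite Ha. simpl. rewrite <- app_assoc. simpl. now rewrite (ceq_dup0 halfS a).
  - destruct W as (H1 & (s0 & ->) & (p0 & Ep) & (p1 & ->) & _). unfold step. destruct (sd a); simpl.
    all: split; [now left|split].
    all: try (rewrite <- !app_assoc; simpl; now rewrite (ceq_dup0 halfS x)).
    all: rewrite <- app_assoc; simpl; rewrite (ceq_dup0 S a), Ep, (ceq_dup0 S x); reflexivity.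
Qed.

(** Trivial monodromy around a triangle, by cases on the sides of its vertices. All crossing points
    lie in one convex piece and are linked, so an excursion is trivial at one of them if and only if
    it is at another ([TR]). *)
Lemma eqv_tri st a b d : wf st a -> cvx S [a; b; d] -> eqv (step (step st a b) b d) (step st a d).
Proof.
  intros W [K [K1 [K2 K3]]].
  rewrite !Forall_cons_iff in K3. destruct K3 as (Ka & Kb & Kd & _).
  assert (KS : forall l, Forall K l -> cvx S l) by (intros; exists K; auto).
  assert (I : forall p q, sd p <> sd q -> K p -> K q -> K (cross p q)) by (intros; now apply cross_in).
  assert (KH : forall l, Forall K l -> Forall (fun z => v z <= c) l -> cvx halfS l) by (intros; apply cvx_half; auto).
  assert (Lab : sd a <> sd b -> v (cross a b) = c /\ K (cross a b)) by (split; [now apply cross_line|auto]).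
  assert (Lbd : sd b <> sd d -> v (cross b d) = c /\ K (cross b d)) by (split; [now apply cross_line|auto]).
  assert (Lad : sd a <> sd d -> v (cross a d) = c /\ K (cross a d)) by (split; [now apply cross_line|auto]).
  set (zab := cross a b) in *. set (zbd := cross b d) in *. set (zad := cross a d) in *.
  assert (LK : forall p q, K p -> K q -> lk p q) by (intros; right; auto).
  assert (LE : forall z, sd z = false -> v z <= c) by (intros; now apply sd_le).
  destruct st as [s|s x p].
  - destruct W as [Ha [s0 ->]]. pose proof (LE _ Ha) as La. unfold step. fold zab zbd zad.
    destruct (sd b) eqn:Eb; destruct (sd d) eqn:Ed.
    + destruct Lab as [Hab Kab]; [congruence|]. destruct Lad as [Had Kad]; [congruence|]. clear Lbd. simpl.
      split; [auto|]. split.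
      * rewrite <- !app_assoc. simpl. apply ceq_app; [reflexivity|]. apply ceq_tri0. apply KH; fall.
      * rewrite (ceq_tri0 S zab b d), (ceq_tri0 S zab zad d); [reflexivity| |]; apply KS; auto.
    + destruct Lab as [Hab Kab]; [congruence|]. destruct Lbd as [Hbd Kbd]; [congruence|]. pose proof (LE _ Ed).
      (* The excursion leaves and returns within the triangle, hence is trivial. *)
      replace (trivb zab [zab; b] zbd) with true. 2:{ symmetry. apply triv_iff. split; auto. simpl. apply ceq_tri0, KS; auto. }
      simpl. rewrite <- !app_assoc. simpl. apply ceq_app; [reflexivity|].
      apply (ceq_collapse halfS a [zab; zbd] d []). apply KH; fall.
    + destruct Lbd as [Hbd Kbd]; [congruence|]. destruct Lad as [Had Kad]; [congruence|]. pose proof (LE _ Eb). simpl.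
      split; [auto|]. split.
      * rewrite <- !app_assoc. simpl. apply ceq_app; [reflexivity|].
        apply (ceq_collapse halfS a [b; zbd] zad []). apply KH; fall.
      * rewrite (ceq_tri0 S zbd zad d); [reflexivity|]; apply KS; auto.
    + pose proof (LE _ Eb). pose proof (LE _ Ed). simpl. rewrite <- !app_assoc. simpl. apply ceq_app; [reflexivity|].
      apply ceq_tri0, KH; fall.
  - pose proof W as (H1 & (s0 & ->) & (p0 & Ep) & (p1 & Ep1) & Hp).
    assert (SX : ceq halfS ((s0 ++ [x]) ++ [x]) (s0 ++ [x])) by (rewrite <- app_assoc; simpl; now rewrite (ceq_dup0 halfS x)).
    assert (OO : eqv (Outer (s0 ++ [x]) x ((p ++ [b]) ++ [d])) (Outer (s0 ++ [x]) x (p ++ [d]))).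
    { split; [now left|]. split; [exact SX|].
      transitivity (p ++ [d]).
      - rewrite Ep1, <- !app_assoc. simpl. apply ceq_app; [reflexivity|]. apply ceq_tri0, KS; auto.
      - rewrite Ep. simpl. now rewrite (ceq_dup0 S x). }
    assert (TR : forall m m' y z, Forall K (m ++ m') -> K y -> K z -> v y = c -> v z = c -> triv x (p ++ m) y -> triv x (p ++ m') z).
    { intros m m' y z Fm Ky Kz Hy Hz [T1 T2]. split.
      - apply (lk_trans x y z); auto.
      - transitivity ((p ++ m ++ [y]) ++ [z]).
        + rewrite Ep1, <- !app_assoc. simpl.
          assert (Q := ceq_cvx S p1 [] a z m' (m ++ [y])). rewrite <- !app_assoc in Q. simpl in Q. apply Q.
          apply KS. rewrite Forall_app in Fm. destruct Fm. fall. apply Forall_app; split; auto. apply Forall_app; split; auto.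
        + rewrite <- app_assoc in T2. rewrite T2. simpl. apply lk3; auto. }
    unfold step at 2 3. fold zab zad.
    destruct (sd a) eqn:Ea; destruct (sd b) eqn:Eb; destruct (sd d) eqn:Ed; simpl andb; cbv iota.
    + unfold step. rewrite Eb, Ed. exact OO.
    + destruct Lbd as [Hbd Kbd]; [congruence|]. destruct Lad as [Had Kad]; [congruence|]. clear Lab. pose proof (LE _ Ed).
      unfold step. rewrite Eb, Ed. simpl andb. fold zbd.
      assert (T : triv x (p ++ [b]) zbd <-> triv x p zad).
      { split; intros T.
        - rewrite <- (app_nil_r p). apply (TR [b] [] zbd zad); auto. simpl; auto.
        - apply (TR [] [b] zad zbd); auto. { simpl; auto. } now rewrite app_nil_r. }
      rewrite (trivb_ext _ _ _ _ _ _ T). destruct (trivb x p zad) eqn:Tb; [|exact OO].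
      apply triv_iff in Tb. destruct Tb as [Tl _]. simpl.
      rewrite <- !app_assoc. simpl. apply ceq_app; [reflexivity|].
      transitivity [x; zad; zbd; d].
      * symmetry. apply (lk3h x zad zbd); auto.
      * apply ceq_cons. apply ceq_tri0, KH; fall.
    + destruct Lab as [Hab Kab]; [congruence|]. destruct Lbd as [Hbd Kbd]; [congruence|]. clear Lad. pose proof (LE _ Eb).
      destruct (trivb x p zab) eqn:Tb.
      * apply triv_iff in Tb. destruct Tb as [Tl T2]. unfold step. rewrite Ed. fold zbd. simpl.
        (* Along two sides the chain re-enters at [zab] and leaves again at [zbd]; the new exit
           point is linked to the old one. *)
        assert (Lx : lk zbd x). { apply (lk_trans zbd zab x); auto. now apply lk_sym. }
        split; [exact Lx|]. split.
        -- rewrite <- !app_assoc. simpl. apply ceq_app; [reflexivity|].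
           transitivity [x; zab; zbd; x].
           ++ apply ceq_cons. apply ceq_tri0, KH; fall.
           ++ rewrite (lk3h x zab zbd); auto. apply lk2h; auto. now apply lk_sym.
        -- symmetry. transitivity (zbd :: (p ++ [zab]) ++ [d]).
           ++ apply ceq_cons. rewrite Ep1, <- !app_assoc. simpl. apply ceq_app; [reflexivity|]. symmetry. apply ceq_tri0, KS; auto.
           ++ rewrite T2. simpl. rewrite (lk3 zbd x zab); auto. apply ceq_tri0, KS; auto.
      * unfold step. rewrite Eb, Ed. exact OO.
    + destruct Lab as [Hab Kab]; [congruence|]. destruct Lad as [Had Kad]; [congruence|]. clear Lbd. pose proof (LE _ Ed). pose proof (LE _ Eb).
      assert (T : triv x p zab <-> triv x p zad).
      { split; intros T; rewrite <- (app_nil_r p); [apply (TR [] [] zab zad)|apply (TR [] [] zad zab)]; auto; now rewrite app_nil_r. }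
      rewrite (trivb_ext _ _ _ _ _ _ T). destruct (trivb x p zad) eqn:Tb.
      * apply triv_iff in Tb. destruct Tb as [Tl _]. unfold step. rewrite Ed. simpl.
        rewrite <- !app_assoc. simpl. apply ceq_app; [reflexivity|].
        transitivity [x; zad; zab; b; d].
        -- symmetry. apply (lk3h x zad zab); auto.
        -- apply ceq_cons. apply (ceq_collapse halfS zad [zab; b] d []), KH; fall.
      * unfold step. rewrite Eb, Ed. exact OO.
    + destruct Lab as [Hab Kab]; [congruence|]. unfold step. rewrite Eb, Ed. exact OO.
    + destruct Lab as [Hab Kab]; [congruence|]. destruct Lbd as [Hbd Kbd]; [congruence|].
      unfold step. rewrite Eb, Ed. simpl andb. fold zbd.
      (* A trivial return at [zbd] would make the upward crossing at [zab] trivial as well. *)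
      destruct (trivb x (p ++ [b]) zbd) eqn:Tb; [|exact OO]. exfalso.
      apply triv_iff in Tb. apply (outer_not_back _ _ _ _ b W Ea Eb). rewrite <- (app_nil_r p).
      apply (TR [b] [] zbd zab); auto. simpl; auto.
    + unfold step. rewrite Eb, Ed. exact OO.
    + unfold step. rewrite Eb, Ed. exact OO.
Qed.

(** * Lifting of whole chains *)

Fixpoint run (st : sheet) (a : Cpl) (l : list Cpl) : sheet :=
  match l with [] => st | b :: l' => run (step st a b) b l' end.

Lemma run_app l1 : forall st a l2, run st a (l1 ++ l2) = run (run st a l1) (last (a :: l1) a) l2.
Proof.
  induction l1 as [|b l1 IH]; intros st a l2; [reflexivity|]. simpl app. simpl run. rewrite IH.
  f_equal. apply (last_cons_default b l1).
Qed.

Lemma run_wf l : forall st a, wf st a -> wf (run st a l) (last (a :: l) a).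
Proof.
  induction l as [|b l IH]; intros st a W; [exact W|]. simpl run.
  change (last (a :: b :: l) a) with (last (b :: l) a). rewrite (last_cons_default b l a b). apply IH, wf_step, W.
Qed.

Lemma run_eqv l : forall st st' a, wf st a -> wf st' a -> eqv st st' -> eqv (run st a l) (run st' a l).
Proof.
  induction l as [|b l IH]; intros st st' a W W' E; [exact E|]. simpl. apply IH; try now apply wf_step. now apply eqv_step.
Qed.

Definition start (P : list Cpl) : sheet := match P with [] => Inner [] | z :: l => run (Inner [z]) z l end.

(** The lift of a chain depends only on its class: each move happens after a common prefix ([core]),
    and equality of sheets is carried along the common rest by [run_eqv]. *)
Lemma start_eqv P P' d : ceq S P P' -> P <> [] -> sd (hd d P) = false -> eqv (start P) (start P').
Proof.
  assert (W0 : forall z, sd z = false -> wf (Inner [z]) z). { intros z Hz. split; auto. now exists []. }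
  assert (WS : forall P, P <> [] -> sd (hd d P) = false -> wf (start P) (last P d)).
  { intros [|z l] HP Hs; [easy|]. simpl start. rewrite (last_cons_default z l d z). now apply run_wf, W0. }
  assert (NE : forall P P', ceq S P P' -> P <> [] -> P' <> []).
  { assert (forall P P', ceq S P P' -> P <> [] <-> P' <> []).
    { intros Q Q'. induction 1; try tauto; destruct l1; simpl; split; easy. }
    intros. eapply H; [apply ceq_sym|]; eassumption. }
  assert (core : forall l1 a l2 l2', (forall st, wf st a -> eqv (run st a l2) (run st a l2')) ->
     sd (hd d (l1 ++ a :: l2)) = false -> eqv (start (l1 ++ a :: l2)) (start (l1 ++ a :: l2'))).
  { intros [|z l1] a l2 l2' H Hs; simpl in Hs |- *.
    - apply H. now apply W0.
    - change (a :: l2) with ([a] ++ l2). change (a :: l2') with ([a] ++ l2'). rewrite !app_assoc, !run_app.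
      replace (last (z :: l1 ++ [a]) z) with a by (symmetry; apply (last_last (z :: l1))).
      apply H. rewrite <- run_app. pose proof (run_wf (l1 ++ [a]) _ _ (W0 z Hs)) as Q.
      replace (last (z :: l1 ++ [a]) z) with a in Q by (symmetry; apply (last_last (z :: l1))). exact Q. }
  induction 1 as [l|l l' H IH|l l' l'' H IH H' IH'|l1 a b c' l2 H|l1 a l2]; intros HP Hs.
  - eapply eqv_refl, WS; eauto.
  - pose proof (NE _ _ (ceq_sym _ _ _ H) HP) as HQ. pose proof (ceq_hd S _ _ d H) as Eh. pose proof (ceq_last S _ _ d H) as El.
    apply (eqv_sym _ _ (last l d)).
    + apply WS; auto. congruence.
    + rewrite El. apply WS; auto.
    + apply IH; auto. congruence.
  - pose proof (NE _ _ H HP) as HQ. pose proof (NE _ _ H' HQ) as HQ'.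
    pose proof (ceq_hd S _ _ d H) as Eh. pose proof (ceq_last S _ _ d H) as El.
    pose proof (ceq_hd S _ _ d H') as Eh'. pose proof (ceq_last S _ _ d H') as El'.
    apply (eqv_trans _ (start l') _ (last l d)).
    + apply WS; auto.
    + rewrite El. apply WS; auto. congruence.
    + rewrite El, El'. apply WS; auto. congruence.
    + auto.
    + apply IH'; auto. congruence.
  - apply core; auto. intros st W. simpl. apply run_eqv.
    + now apply wf_step, wf_step.
    + now apply wf_step.
    + now apply eqv_tri.
  - apply core; auto. intros st W. simpl. apply run_eqv; auto.
    + now apply wf_step.
    + now apply eqv_dup.
Qed.

Lemma run_inside l : forall s a, Forall (fun z => v z <= c) l -> run (Inner s) a l = Inner (s ++ l).
Proof.
  induction l as [|b l IH]; intros s a H; simpl; [now rewrite app_nil_r|].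
  apply Forall_cons_iff in H as [Hb H]. rewrite (proj2 (sd_false al be c b) Hb). rewrite IH; auto. now rewrite <- app_assoc.
Qed.

(** Chains that stay in the half-plane lift to the inner sheets that record the chains themselves,
    and equality of inner sheets is homotopy inside the half-plane. *)
Theorem ceq_half P P' : ceq S P P' -> Forall (fun z => v z <= c) P -> Forall (fun z => v z <= c) P' -> ceq halfS P P'.
Proof.
  intros H F F'. destruct P as [|z P].
  (* [hd] with two different defaults shows that the empty chain is equivalent to no other. *)
  - destruct P' as [|z' P']; [reflexivity|]. pose proof (ceq_hd S _ _ (0, 0) H). pose proof (ceq_hd S _ _ (1, 1) H). simpl in *.
    assert (Q : (0, 0) = (1, 1) :> Cpl) by congruence. injection Q; intros; lra.
  - destruct P' as [|z' P'].
    { pose proof (ceq_hd S _ _ (0, 0) H). pose proof (ceq_hd S _ _ (1, 1) H). simpl in *.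
    assert (Q : (0, 0) = (1, 1) :> Cpl) by congruence. injection Q; intros; lra. }
    pose proof (Forall_inv F). pose proof (Forall_inv_tail F). pose proof (Forall_inv_tail F').
    pose proof (start_eqv _ _ z H) as E. specialize (E ltac:(easy)). simpl in E. specialize (E (proj2 (sd_false al be c z) H0)).
    rewrite !run_inside in E; auto.
Qed.
End Fill.

Definition rect (a b c d : R) (z : Cpl) : Prop := a <= fst z <= b /\ c <= snd z <= d.

Lemma convex_rect a b c d : convex (rect a b c d).
Proof. intros x y t [X1 X2] [Y1 Y2] Ht. unfold rect, lerp; simpl. split; split; nra. Qed.

Theorem ceq_rect S a b c d P P' : ceq S P P' -> Forall (rect a b c d) P -> Forall (rect a b c d) P' ->
  ceq (fun z => S z /\ rect a b c d z) P P'.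
Proof.
  intros H F F'.
  assert (G : forall al be e, (forall z, rect a b c d z -> lin al be z <= e) -> Forall (fun z => lin al be z <= e) P /\ Forall (fun z => lin al be z <= e) P').
  { intros al be e Q. split; eapply Forall_impl; [|exact F| |exact F']; auto. }
  assert (N1 : 1 <> 0 \/ 0 <> 0) by (left; lra). assert (N2 : -1 <> 0 \/ 0 <> 0) by (left; lra).
  assert (N3 : 0 <> 0 \/ 1 <> 0) by (right; lra). assert (N4 : 0 <> 0 \/ -1 <> 0) by (right; lra).
  destruct (G 1 0 b) as [A1 A1']. { intros z [Z1 Z2]. unfold lin. lra. }
  destruct (G (-1) 0 (- a)) as [A2 A2']. { intros z [Z1 Z2]. unfold lin. lra. }
  destruct (G 0 1 d) as [A3 A3']. { intros z [Z1 Z2]. unfold lin. lra. }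
  destruct (G 0 (-1) (- c)) as [A4 A4']. { intros z [Z1 Z2]. unfold lin. lra. }
  pose proof (ceq_half 1 0 b N1 S P P' H A1 A1') as H1.
  pose proof (ceq_half (-1) 0 (- a) N2 _ P P' H1 A2 A2') as H2.
  pose proof (ceq_half 0 1 d N3 _ P P' H2 A3 A3') as H3.
  pose proof (ceq_half 0 (-1) (- c) N4 _ P P' H3 A4 A4') as H4.
  eapply ceq_mono; [|exact H4]. unfold halfS, lin, rect. intros z. intuition lra.
Qed.

(** * Chains inscribed in continuous paths *)

(** Subdivisions of mesh at most [d]. Times may repeat, so that concatenation needs no care at the
    junction. *)
Inductive FL (d : R) : R -> R -> list R -> Prop :=
| FL_one a : FL d a a [a]
| FL_cons a u b tau : a <= u <= a + d -> FL d u b tau -> FL d a b (a :: tau).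

Lemma FL_le d a b tau : FL d a b tau -> a <= b.
Proof. induction 1; lra. Qed.

Lemma FL_range d a b tau : FL d a b tau -> Forall (fun t => a <= t <= b) tau.
Proof.
  induction 1.
  - constructor; [lra|constructor].
  - pose proof (FL_le _ _ _ _ H0). constructor; [lra|]. eapply Forall_impl; [|exact IHFL]. simpl; intros; lra.
Qed.

Lemma FL_shape d a b tau : FL d a b tau -> exists tau', tau = a :: tau'.
Proof. induction 1; eauto. Qed.

Lemma FL_app d a b e tau tau' : 0 <= d -> FL d a b tau -> FL d b e tau' -> FL d a e (tau ++ tau').
Proof.
  intros Hd. induction 1; intros H'; simpl.
  - econstructor; [|exact H']. lra.
  - econstructor; [eassumption|]. auto.
Qed.

Lemma FL_exists d a b : 0 < d -> a <= b -> exists tau, FL d a b tau.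
Proof.
  intros Hd Hab.
  assert (H : forall n a, a <= b -> b - a <= INR n * d -> exists tau, FL d a b tau).
  { induction n; intros x Hx Hn.
    - exists [x]. simpl in Hn. replace b with x by lra. constructor.
    - rewrite S_INR in Hn. destruct (Rle_dec b (x + d)).
      + exists [x; b]. econstructor; [|constructor]. lra.
      + destruct (IHn (x + d)) as [tau Ht]; [lra|lra|]. exists (x :: tau). econstructor; [|exact Ht]. lra. }
  destruct (INR_unbounded ((b - a) / d)) as [n Hn]. apply (H n); auto.
  apply Rmult_le_reg_r with (/ d). { now apply Rinv_0_lt_compat. } rewrite Rmult_assoc, Rinv_r; lra.
Qed.

(** The hypotheses stand below the existential so that the choice is a total function of [d], [a]
    and [b]. *)
Lemma fl_ex d a b : exists tau, 0 < d -> a <= b -> FL d a b tau.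
Proof.
  destruct (classic (0 < d /\ a <= b)) as [[H1 H2]|H].
  - destruct (FL_exists d a b H1 H2) as [tau Ht]. eauto.
  - exists []. tauto.
Qed.

Definition fl (d a b : R) : list R := proj1_sig (constructive_indefinite_description _ (fl_ex d a b)).

Lemma fl_spec d a b : 0 < d -> a <= b -> FL d a b (fl d a b).
Proof. exact (proj2_sig (constructive_indefinite_description _ (fl_ex d a b))). Qed.

Definition ch (d : R) (f : R -> Cpl) (a b : R) : list Cpl := map f (fl d a b).

(** Every time window of radius [d] is mapped into one convex part of [S], so triangles between
    neighbouring vertices of inscribed chains are legal moves. *)
Definition fine (S : Cpl -> Prop) (f : R -> Cpl) (l r d : R) : Prop :=
  0 < d /\ forall t, l <= t <= r -> exists K, convex K /\ (forall z, K z -> S z) /\ forall t', l <= t' <= r -> Rabs (t' - t) <= d -> K (f t').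

Lemma fine_cvx S f l r d t ts : fine S f l r d -> l <= t <= r -> Forall (fun t' => l <= t' <= r /\ Rabs (t' - t) <= d) ts -> cvx S (map f ts).
Proof.
  intros [Hd H] Ht Hts. destruct (H t Ht) as [K [K1 [K2 K3]]]. exists K. repeat split; auto.
  apply Forall_map. eapply Forall_impl; [|exact Hts]. simpl. intros a [A B]. auto.
Qed.

Section Fine.
Variables (S : Cpl -> Prop) (f : R -> Cpl) (l r d : R).
Hypothesis Hfine : fine S f l r d.

Let cv t ts := fine_cvx S f l r d t ts Hfine.
Let Hd : 0 < d := proj1 Hfine.

Ltac rng := unfold Rabs; repeat destruct Rcase_abs; lra.

(** Two subdivisions are walked through together. The one that lags behind advances by a step, which
    keeps the current times within [d] of each other and costs one triangle. *)
Lemma fine_eq_gen n : forall a a' b tau tau', (length tau + length tau' <= n)%nat -> FL d a b tau -> FL d a' b tau' ->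
  Rabs (a - a') <= d -> l <= a -> l <= a' -> b <= r -> ceq S (f a' :: map f tau) (map f tau').
Proof.
  induction n; intros a a' b tau tau' Hn F F' Haa Ha Ha' Hb.
  { destruct (FL_shape _ _ _ _ F) as [? ->]. simpl in Hn. lia. }
  apply Rabs_le_iff in Haa.
  destruct (Rle_dec a a') as [Hle|Hle].
  - inversion F as [x|x u y tau1 Hu F1]; subst.
    + pose proof (FL_le _ _ _ _ F'). assert (a' = b) by lra. subst a'.
      inversion F' as [|x' u' y' tau1' Hu' F1']; subst; simpl; [apply ceq_dup0|].
      pose proof (FL_le _ _ _ _ F1'). assert (u' = b) by lra. subst u'.
      destruct (FL_shape _ _ _ _ F1') as [t' Et]. rewrite Et. simpl.
      rewrite !ceq_dup0. transitivity (f b :: map f [b]); [simpl; now rewrite ceq_dup0|].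
      change (f b :: map f t') with (map f (b :: t')). rewrite <- Et.
      apply (IHn b b b [b] tau1'); [simpl in *; lia|constructor|exact F1'|rng|lra|lra|lra].
    + destruct (FL_shape _ _ _ _ F1) as [t1 Et]. pose proof (FL_le _ _ _ _ F1). pose proof (FL_le _ _ _ _ F').
      transitivity (f a' :: map f tau1).
      * rewrite Et. simpl. apply ceq_tri0. apply (cv a [a'; a; u]); [lra|]. fall; split; try lra; rng.
      * apply (IHn u a' b); auto; try lra. { simpl in Hn. lia. } rng.
  - inversion F' as [x|x u y tau1 Hu F1]; subst.
    + pose proof (FL_le _ _ _ _ F). lra.
    + destruct (FL_shape _ _ _ _ F1) as [t1 Et]. pose proof (FL_le _ _ _ _ F1). pose proof (FL_le _ _ _ _ F).
      simpl. transitivity (f a' :: f u :: map f tau).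
      * destruct (FL_shape _ _ _ _ F) as [t0 Et0]. rewrite Et0. simpl. symmetry. apply ceq_tri0.
        apply (cv a' [a'; u; a]); [lra|]. fall; split; try lra; rng.
      * apply ceq_cons. apply (IHn a u b); auto; try lra. { simpl in Hn. lia. } rng.
Qed.

Lemma fine_eq a b tau tau' : l <= a -> b <= r -> FL d a b tau -> FL d a b tau' -> ceq S (map f tau) (map f tau').
Proof.
  intros Ha Hb F F'. transitivity (f a :: map f tau).
  - destruct (FL_shape _ _ _ _ F) as [t ->]. simpl. symmetry. apply ceq_dup0.
  - eapply fine_eq_gen; eauto. rewrite Rminus_diag, Rabs_R0. lra.
Qed.

Lemma ch_fl a b tau : l <= a -> b <= r -> FL d a b tau -> ceq S (map f tau) (ch d f a b).
Proof. intros Ha Hb F. eapply fine_eq; eauto. apply fl_spec; auto. now apply FL_le in F. Qed.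

Lemma ch_app a b e : l <= a -> a <= b -> b <= e -> e <= r -> ceq S (ch d f a b ++ ch d f b e) (ch d f a e).
Proof.
  intros. unfold ch. rewrite <- map_app. apply ch_fl; auto. apply (FL_app d a b e); try lra; apply fl_spec; auto.
Qed.

Lemma FL_valid a b tau : l <= a -> b <= r -> FL d a b tau -> valid S (map f tau).
Proof.
  intros Ha Hb F. induction F as [|x u y tau Hu F IH]; simpl; auto.
  pose proof (FL_le _ _ _ _ F).
  destruct (FL_shape _ _ _ _ F) as [t ->]. simpl. split; [|apply IH; lra].
  apply (cv x [x; u]); [lra|]. fall; split; try lra; rng.
Qed.

Lemma ch_valid a b : l <= a -> a <= b -> b <= r -> valid S (ch d f a b).
Proof. intros. eapply FL_valid; eauto. now apply fl_spec. Qed.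

Lemma ch_shape a b : a <= b -> exists t, ch d f a b = f a :: t.
Proof. intros H. destruct (FL_shape _ _ _ _ (fl_spec d a b Hd H)) as [t E]. exists (map f t). unfold ch. now rewrite E. Qed.

Lemma ch_last a b x : a <= b -> last (ch d f a b) x = f b.
Proof.
  intros H. unfold ch. pose proof (fl_spec d a b Hd H) as F. induction F as [|y u z tau Hu F IH]; [reflexivity|].
  destruct (FL_shape _ _ _ _ F) as [t E]. rewrite E in *. simpl in *. apply IH. now apply FL_le in F.
Qed.

Lemma ch_in a b z : a <= b -> In z (ch d f a b) -> exists t, a <= t <= b /\ z = f t.
Proof.
  intros H Hin. unfold ch in Hin. apply in_map_iff in Hin as [t [<- Ht]]. exists t. split; auto.
  pose proof (FL_range _ _ _ _ (fl_spec d a b Hd H)) as F. rewrite Forall_forall in F. auto.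
Qed.
End Fine.

Lemma ceq_inv_r S X x : valid S X -> hd x X = x -> X <> [] -> ceq S (X ++ rev X) [x].
Proof.
  intros Hv Hh Hn. rewrite <- (rev_involutive X) at 1. assert (Hv' := valid_rev S X Hv).
  destruct (rev X) as [|y Y] eqn:E. { apply (f_equal (@rev Cpl)) in E. rewrite rev_involutive in E. easy. }
  rewrite (ceq_rev_cancel S Y y Hv'). rewrite <- E.
  destruct X as [|z X]; [easy|]. simpl in Hh. subst z. simpl. now rewrite last_last.
Qed.

(** * Doors of a chain *)

Definition Dpos (al be c : R) (L pre : list Cpl) (x : Cpl) : Prop :=
  exists R1 e f R2, L = R1 ++ e :: f :: R2 /\ sd al be c e <> sd al be c f /\ pre = R1 ++ [e] /\ x = cross al be c e f.

(** The two pieces share the junction vertex, so the edge joining them is degenerate and cannot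
    cross. *)
Lemma Dpos_app al be c P Q pre x d : Dpos al be c (P ++ Q) pre x -> last P d = hd d Q ->
  Dpos al be c P pre x \/ exists pre', Dpos al be c Q pre' x /\ pre = P ++ pre'.
Proof.
  intros (R1 & e & f & R2 & E & D & -> & ->) J.
  revert R1 E. induction P as [|y P IH]; intros R1 E.
  - right. exists (R1 ++ [e]). split; auto. exists R1, e, f, R2. auto.
  - destruct R1 as [|y' R1]; simpl in E; inversion E; subst.
    + destruct P as [|z P]; simpl in *.
      * exfalso. subst Q. simpl in J. congruence.
      * inversion H1. subst. left. exists [], e, f, P. auto.
    + destruct P as [|z P].
      * right. simpl in *. exists (R1 ++ [e]). split; auto. exists R1, e, f, R2. auto.
      * destruct (IH J R1 H1) as [(R1' & e' & f' & R2' & A1 & A2 & A3 & A4)|(pre' & (R1' & e' & f' & R2' & A1 & A2 & A3 & A4) & A5)].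
        -- left. exists (y' :: R1'), e', f', R2'. simpl. rewrite A1. repeat split; auto. simpl in *. congruence.
        -- right. exists pre'. split; [exists R1', e', f', R2'; auto|]. simpl in *. congruence.
Qed.

Lemma Dpos_none al be c L pre x b : Forall (fun z => sd al be c z = b) L -> ~ Dpos al be c L pre x.
Proof.
  intros F (R1 & e & f & R2 & -> & D & _). apply Forall_app in F as [_ F]. rewrite !Forall_cons_iff in F. destruct F as (A & B & _). congruence.
Qed.

Section DoorTimes.
Variables (al be c : R) (S : Cpl -> Prop) (f : R -> Cpl) (l r d : R).
Hypothesis Hfine : fine S f l r d.
Hypothesis Hcont : contD dR dm (I01 l r) f.
Notation v := (lin al be).
Notation sd := (sd al be c).
Notation cross := (cross al be c).

Lemma lin_cont a b : l <= a -> b <= r -> contD dR dR (I01 a b) (fun t => v (f t)).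
Proof.
  intros Ha Hb. assert (H : contD dR dm (I01 a b) f) by (eapply contD_sub; [exact Hcont|unfold I01; intros; lra]).
  unfold lin. ctac.
Qed.

Lemma hit_time t1 t2 : l <= t1 -> t1 <= t2 -> t2 <= r -> sd (f t1) <> sd (f t2) -> exists t, t1 <= t <= t2 /\ v (f t) = c.
Proof.
  intros H1 H12 H2 D.
  destruct (sd (f t1)) eqn:E1, (sd (f t2)) eqn:E2; try congruence.
  - apply sd_true in E1. apply sd_false in E2.
    destruct (Req_dec (v (f t2)) c) as [E|E]; [exists t2; split; [lra|auto]|].
    destruct (ivt t1 t2 (fun t => - v (f t)) (- c)) as [t [Ht Et]]; auto.
    + assert (Q := lin_cont t1 t2 H1 H2). eapply contD_ext; [apply (contD_minus dR (I01 t1 t2) (fun _ => 0) _ (contD_cR _ _ _) Q)|]. intros; simpl; lra.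
    + lra.
    + exists t. split; [lra|]. lra.
  - apply sd_true in E2. apply sd_false in E1.
    destruct (Req_dec (v (f t1)) c) as [E|E]; [exists t1; split; [lra|auto]|].
    destruct (ivt t1 t2 (fun t => v (f t)) c) as [t [Ht Et]]; auto.
    + now apply lin_cont.
    + lra.
    + exists t. split; [lra|]. lra.
Qed.

Lemma FL_split a b tau R1 e h R2 : FL d a b tau -> map f tau = R1 ++ e :: h :: R2 ->
  exists t1 t2 tau1 tau2, e = f t1 /\ h = f t2 /\ t1 <= t2 <= t1 + d /\ FL d a t1 (tau1 ++ [t1]) /\ R1 = map f tau1 /\
    FL d t2 b (t2 :: tau2) /\ R2 = map f tau2 /\ a <= t1.
Proof.
  intros F. revert R1. induction F as [x|x u y tau Hu F IH]; intros R1 E.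
  - destruct R1 as [|? [|]]; simpl in E; inversion E.
  - destruct R1 as [|y1 R1]; simpl in E.
    + destruct (FL_shape _ _ _ _ F) as [t Et]. rewrite Et in *. simpl in E. inversion E. subst.
      exists x, u, [], t. repeat split; auto; try lra. constructor.
    + inversion E. subst. destruct (IH R1 H1) as (t1 & t2 & tau1 & tau2 & A1 & A2 & A3 & A4 & A5 & A6 & A7 & A8).
      exists t1, t2, (x :: tau1), tau2. repeat split; auto; try lra.
      * simpl. econstructor; eauto.
      * simpl. congruence.
Qed.

(** A crossing of the inscribed polygon need not lie on the path, but within the same mesh interval
    the path meets the line too, and both points lie in one convex piece. *)
Lemma Dpos_ch a b pre x : l <= a -> a <= b -> b <= r -> Dpos al be c (ch d f a b) pre x ->
  exists s, a <= s <= b /\ v (f s) = c /\ v x = c /\ cvx S [x; f s] /\ ceq S (pre ++ [x]) (ch d f a s ++ [x]).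
Proof.
  intros Ha Hab Hb (R1 & e & h & R2 & E & D & -> & ->).
  pose proof (proj1 Hfine) as Hd.
  destruct (FL_split a b _ R1 e h R2 (fl_spec d a b Hd Hab) E) as (t1 & t2 & tau1 & tau2 & -> & -> & H12 & F1 & -> & F2 & -> & H1).
  pose proof (FL_le _ _ _ _ F2). destruct (hit_time t1 t2) as [s [Hs Es]]; try lra; auto.
  destruct (proj2 Hfine t1) as [K [K1 [K2 K3]]]; [lra|].
  assert (B1 : K (f t1)) by (apply K3; [lra|rabs]). assert (B2 : K (f t2)) by (apply K3; [lra|rabs]).
  assert (B3 : K (f s)) by (apply K3; [lra|rabs]).
  assert (Bx : K (cross (f t1) (f t2))) by now apply cross_in.
  assert (KS : forall m, Forall K m -> cvx S m) by (intros; exists K; auto).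
  exists s. split; [lra|]. split; [auto|]. split; [now apply cross_line|]. split; [apply KS; auto|].
  rewrite <- (ch_fl S f l r d Hfine a s (tau1 ++ [t1] ++ [s])).
  - rewrite map_app. simpl. rewrite <- !app_assoc. simpl. apply ceq_app; [reflexivity|]. symmetry. apply ceq_tri0, KS; auto.
  - lra.
  - lra.
  - rewrite app_assoc. replace [s] with (tl [t1; s]) by reflexivity.
    assert (G : forall p q w, FL d p q w -> q <= s <= q + d -> FL d p s (w ++ [s])).
    { intros p q w Fw. induction Fw as [|? ? ? ? ? ? IH]; intros Q; simpl.
      - econstructor; [|constructor]. lra.
      - econstructor; [eassumption|]. auto. }
    simpl. apply (G a t1); auto. lra.
Qed.

Lemma Dpos_rev_ch a b pre x : l <= a -> a <= b -> b <= r -> Dpos al be c (rev (ch d f a b)) pre x ->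
  exists s, a <= s <= b /\ v (f s) = c /\ v x = c /\ cvx S [x; f s] /\ ceq S (pre ++ [x]) (rev (ch d f s b) ++ [x]).
Proof.
  intros Ha Hab Hb (R1 & e & h & R2 & E & D & -> & ->).
  pose proof (proj1 Hfine) as Hd.
  assert (E' : ch d f a b = rev R2 ++ h :: e :: rev R1).
  { rewrite <- (rev_involutive (ch d f a b)), E, rev_app_distr. simpl. now rewrite <- !app_assoc. }
  destruct (FL_split a b _ _ _ _ _ (fl_spec d a b Hd Hab) E') as (t1 & t2 & tau1 & tau2 & -> & -> & H12 & F1 & _ & F2 & E2 & H1).
  pose proof (FL_le _ _ _ _ F2). destruct (hit_time t1 t2) as [s [Hs Es]]; try lra; auto.
  destruct (proj2 Hfine t1) as [K [K1 [K2 K3]]]; [lra|].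
  assert (B1 : K (f t1)) by (apply K3; [lra|rabs]). assert (B2 : K (f t2)) by (apply K3; [lra|rabs]).
  assert (B3 : K (f s)) by (apply K3; [lra|rabs]).
  assert (Bx : K (cross (f t2) (f t1))) by now apply cross_in.
  assert (KS : forall m, Forall K m -> cvx S m) by (intros; exists K; auto).
  exists s. split; [lra|]. split; [auto|]. split; [now apply cross_line|]. split; [apply KS; auto|].
  transitivity (rev (map f (s :: t2 :: tau2)) ++ [cross (f t2) (f t1)]).
  - simpl. rewrite <- E2, rev_involutive, <- !app_assoc. simpl. apply ceq_app; [reflexivity|]. symmetry. apply ceq_tri0, KS; auto.
  - apply ceq_app; [|reflexivity]. apply ceq_rev. apply (ch_fl S f l r d Hfine); try lra. econstructor; [|exact F2]. lra.
Qed.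
End DoorTimes.

(** * Two homotopic paths and the tracks between them *)

Section TwoPaths.
Variables (S : Cpl -> Prop) (l r d : R).

Definition isTrack (f g : R -> Cpl) (T : list Cpl) (a a' : R) : Prop :=
  valid S T /\ (exists T0, T = f a :: T0) /\ last T (f a) = g a'.

(* [Adm f g T a a' T' b b']: the tracks [T] from [f a] to [g a'] and [T'] from [f b] to [g b']
   bound with the two paths a null-homotopic box. *)
Definition Adm (f g : R -> Cpl) (T : list Cpl) (a a' : R) (T' : list Cpl) (b b' : R) : Prop :=
  ceq S (ch d f a b ++ T') (T ++ ch d g a' b').

Definition Short (f : R -> Cpl) (s s' : R) : Prop := cvx S [f s; f s'] /\ ceq S (ch d f s s') [f s; f s'].

Definition good (f : R -> Cpl) : Prop := fine S f l r d /\ contD dR dm (I01 l r) f.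

Variables (f g : R -> Cpl).
Hypothesis Hf : good f.
Hypothesis Hg : good g.

Lemma track_rev T a a' : isTrack f g T a a' -> isTrack g f (rev T) a' a.
Proof.
  intros (V & (T0 & ->) & E). repeat split.
  - now apply valid_rev.
  - assert (H := hd_rev_last (f a :: T0) (f a)). rewrite E in H. destruct (rev (f a :: T0)) eqn:Q.
    + apply (f_equal (@rev Cpl)) in Q. rewrite rev_involutive in Q. easy.
    + simpl in H. subst c. eauto.
  - rewrite rev_last_hd. reflexivity.
Qed.

Lemma Adm_sym T a a' T' b b' : l <= a -> a <= b -> b <= r -> l <= a' -> a' <= b' -> b' <= r ->
  isTrack f g T a a' -> isTrack f g T' b b' -> Adm f g T a a' T' b b' -> Adm g f (rev T) a' a (rev T') b' b.
Proof.
  intros Ha Hab Hb Ha' Hab' Hb' HT HT' H. unfold Adm in *.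
  destruct HT as (V & (T0 & ->) & E). destruct HT' as (V' & (T0' & ->) & E').
  destruct (ch_shape S g l r d (proj1 Hg) a' b' Hab') as [w Ew].
  destruct (ch_shape S f l r d (proj1 Hf) a b Hab) as [u Eu].
  transitivity (rev (f a :: T0) ++ (f a :: T0) ++ ch d g a' b' ++ rev (f b :: T0')).
  - rewrite (app_assoc (rev _)), (ceq_rev_cancel S T0 (f a) V), E, Ew. simpl app. now rewrite ceq_dup0.
  - rewrite (app_assoc (f a :: T0)), <- H. apply ceq_app; [reflexivity|]. rewrite <- app_assoc.
    rewrite (ceq_inv_r S (f b :: T0') (f b)); auto; [|easy].
    assert (L := ch_last S f l r d (proj1 Hf) a b (f a) Hab).
    destruct (app_cons_last (ch d f a b) (f a)) as [u0 [x Ex]]; [rewrite Eu; easy|].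
    rewrite Ex in *. rewrite last_last in L. subst x. rewrite <- app_assoc. simpl. now rewrite ceq_dup0.
Qed.

Lemma Adm_trans T a a' T' b b' T'' e e' : l <= a -> a <= b -> b <= e -> e <= r -> l <= a' -> a' <= b' -> b' <= e' -> e' <= r ->
  Adm f g T a a' T' b b' -> Adm f g T' b b' T'' e e' -> Adm f g T a a' T'' e e'.
Proof.
  unfold Adm. intros. rewrite <- (ch_app S f l r d (proj1 Hf) a b e), <- (ch_app S g l r d (proj1 Hg) a' b' e'); auto.
  rewrite <- app_assoc, H8, app_assoc, H7, <- app_assoc. reflexivity.
Qed.

Lemma Adm_cancel T a a' T' b b' T'' e e' : l <= a -> a <= b -> b <= e -> e <= r -> l <= a' -> a' <= b' -> b' <= e' -> e' <= r ->
  isTrack f g T' b b' ->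
  Adm f g T a a' T' b b' -> Adm f g T a a' T'' e e' -> Adm f g T' b b' T'' e e'.
Proof.
  unfold Adm. intros Ha Hab Hbe He Ha' Hab' Hbe' He' (V & (T0 & ->) & E) H H'.
  rewrite <- (ch_app S f l r d (proj1 Hf) a b e), <- (ch_app S g l r d (proj1 Hg) a' b' e') in H'; auto.
  rewrite (app_assoc T), <- H, <- !app_assoc in H'.
  destruct (ch_shape S f l r d (proj1 Hf) a b Hab) as [u Eu].
  destruct (ch_shape S f l r d (proj1 Hf) b e Hbe) as [w Ew].
  pose proof (ch_valid S f l r d (proj1 Hf) a b Ha Hab ltac:(lra)) as V1.
  pose proof (ch_last S f l r d (proj1 Hf) a b (f a) Hab) as L. rewrite Eu in *. rewrite Ew in *.
  apply (ceq_cancel_l S (f a) u) in H'; auto; easy.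
Qed.

(* The dichotomy behind everything: a crossing of the line [lin = c] by [f] either can be
   shortcut along the line, or continues along the line to a crossing by [g]. *)
Theorem cross_or_short al be c T a a' T' b b' t beta : al <> 0 \/ be <> 0 ->
  l <= a -> a <= t -> t <= b -> b <= r -> l <= a' -> a' <= b' -> b' <= r ->
  isTrack f g T a a' -> isTrack f g T' b b' -> Adm f g T a a' T' b b' ->
  Forall (fun z => lin al be z <= c) T -> Forall (fun z => sd al be c z = beta) T' -> c < lin al be (f t) ->
  exists s, a <= s <= t /\ lin al be (f s) = c /\
    ((exists s', t <= s' <= b /\ lin al be (f s') = c /\ Short f s s') \/
     (exists q, a' <= q <= b' /\ lin al be (g q) = c /\ cvx S [f s; g q] /\ Adm f g T a a' [f s; g q] s q)).
Proof.
  intros Hnz Ha Hat Htb Hb Ha' Hab' Hb' HT HT' HA FT FT' Hct. unfold Adm in HA.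
  pose proof (proj1 Hf) as Ff. pose proof (proj1 Hg) as Fg. pose proof (proj1 Ff) as Hd.
  set (v := lin al be) in *.
  pose proof (ch_valid S f l r d Ff a t Ha Hat ltac:(lra)) as VA.
  pose proof (ch_last S f l r d Ff a t (f a) Hat) as LA.
  destruct (ch_shape S f l r d Ff a t Hat) as [A EA].
  destruct (ch_shape S f l r d Ff t b Htb) as [B EB].
  pose proof HT as (VT & (T0 & ET) & LT). pose proof HT' as (VT' & (T0' & ET') & LT').
  pose proof (ch_valid S g l r d Fg a' b' Ha' Hab' Hb') as VG.
  destruct (ch_shape S g l r d Fg a' b' Hab') as [Gt EG].
  assert (Va : v (f a) <= c). { rewrite ET in FT. now apply Forall_inv in FT. }
  (* Together with [f a :: A] this is the boundary of the box: onwards along [f], along [T'],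
     backwards along [g] and back along [T]. It is null-homotopic by [HA]. *)
  set (R := B ++ T' ++ rev (ch d g a' b') ++ rev T).
  assert (Null : ceq S (f a :: A ++ R) [f a]).
  { transitivity ((ch d f a t ++ ch d f t b) ++ T' ++ rev (ch d g a' b') ++ rev T).
    - rewrite EA, EB. unfold R. destruct (app_cons_last (f a :: A) (f a)) as [A0 [y Ey]]; [easy|].
      assert (y = f t). { rewrite EA, Ey, last_last in LA. auto. } subst y.
      change (f a :: A ++ B ++ T' ++ rev (ch d g a' b') ++ rev T) with ((f a :: A) ++ B ++ T' ++ rev (ch d g a' b') ++ rev T).
      rewrite Ey, <- !app_assoc. simpl. now rewrite ceq_dup0.
    - rewrite (ch_app S f l r d Ff a t b); auto; try lra. rewrite app_assoc, HA, <- app_assoc, (app_assoc (ch d g a' b')).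
      rewrite (ceq_inv_r S _ (g a')); auto; [|rewrite EG; reflexivity|rewrite EG; easy].
      transitivity (T ++ rev T).
      + destruct (app_cons_last T (f a)) as [t0 [y Ey]]; [rewrite ET; easy|].
        assert (y = g a') by (rewrite Ey, last_last in LT; auto). subst y. rewrite Ey, rev_app_distr, <- !app_assoc. simpl. now rewrite ceq_dup0.
      + apply ceq_inv_r; auto. { now rewrite ET. } rewrite ET; easy. }
  destruct (door_link al be c Hnz S (f a) A (f t) R) as (A1 & x & y & A2 & R1 & e & h & R2 & E1 & D1 & E2 & D2 & CV & CE); auto.
  { now rewrite <- EA. } { now rewrite <- EA. }
  assert (DA : Dpos al be c (ch d f a t) (A1 ++ [x]) (cross al be c x y)). { exists A1, x, y, A2. rewrite EA. auto. }
  destruct (Dpos_ch al be c S f l r d Ff (proj2 Hf) a t _ _ Ha Hat ltac:(lra) DA) as (s & Hs & Vs & Vz & Cs & Es).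
  set (z := cross al be c x y) in *. set (z' := cross al be c e h) in *.
  exists s. split; [lra|]. split; [exact Vs|].
  assert (DR : Dpos al be c (ch d f t b ++ T' ++ rev (ch d g a' b') ++ rev T) (R1 ++ [e]) z').
  { exists R1, e, h, R2. repeat split; auto. rewrite EB. exact E2. }
  assert (Pre : ceq S (ch d f a s ++ [z; z']) (ch d f a t ++ (R1 ++ [e]) ++ [z'])).
  { transitivity ((f a :: A) ++ tl (R1 ++ [e]) ++ [z']).
    - rewrite <- CE. replace (A1 ++ [x; z; z']) with (((A1 ++ [x]) ++ [z]) ++ [z']) by now rewrite <- !app_assoc.
      rewrite Es, <- app_assoc. reflexivity.
    - rewrite <- EA. destruct (R1 ++ [e]) as [|k Rr] eqn:Ek; [now destruct R1|].
      assert (k = f t). { destruct R1; simpl in *; inversion E2; inversion Ek; subst; reflexivity. } subst k. simpl.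
      destruct (app_cons_last (ch d f a t) (f a)) as [A0 [y' Ey]]; [rewrite EA; easy|].
      assert (y' = f t) by (rewrite Ey, last_last in LA; auto). subst y'. rewrite Ey, <- !app_assoc. simpl. now rewrite ceq_dup0. }
  assert (Vz' : v z' = c) by now apply cross_line.
  pose proof (ch_last S f l r d Ff a s (f a) (proj1 Hs)) as Las.
  destruct (ch_shape S f l r d Ff a s (proj1 Hs)) as [As EAs].
  assert (Sas : exists W, ch d f a s = W ++ [f s]).
  { destruct (app_cons_last (ch d f a s) (f a)) as [A0 [y' Ey]]; [rewrite EAs; easy|].
    rewrite Ey, last_last in Las. subst y'. eauto. }
  destruct Sas as [W EW].
  (* The partner crossing lies on the rest of [f], giving a shortcut, or on [g], giving a rung; [T]
     and [T'] each stay on one side of the line and have no crossing. *)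
  apply (Dpos_app al be c _ _ _ _ (f a)) in DR.
  2:{ rewrite (ch_last S f l r d Ff t b _ Htb), ET'. reflexivity. }
  destruct DR as [DR|(pre1 & DR & Epre1)].
  - left. destruct (Dpos_ch al be c S f l r d Ff (proj2 Hf) t b _ _ ltac:(lra) Htb Hb DR) as (s' & Hs' & Vs' & _ & Cs' & Es').
    exists s'. split; [lra|]. split; [exact Vs'|].
    assert (C1 : cvx S [f s; z'; f s'] /\ cvx S [f s; z; z']).
    { apply cvx_comm in Cs. split.
      - apply (cvx_line al be c Hnz); auto. apply (cvx_line2 al be c Hnz S (f s) z z'); auto.
      - apply (cvx_line al be c Hnz); auto. }
    destruct C1 as [C1 C2].
    split. { eapply cvx_sub; [exact C1|incl_tac]. }
    pose proof (ch_valid S f l r d Ff a s Ha ltac:(lra) ltac:(lra)) as Vas.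
    destruct (ch_shape S f l r d Ff s s' ltac:(lra)) as [Q EQ].
    symmetry.
    (* Chord and arc agree after the common initial arc up to [f s], which is then cancelled. *)
    assert (X : ceq S (ch d f a s ++ [f s; f s']) (ch d f a s ++ ch d f s s')).
    { transitivity (ch d f a s ++ [z; z'; f s']).
      - rewrite EW, <- !app_assoc. simpl. apply ceq_app; [reflexivity|]. rewrite ceq_dup0.
        rewrite (ceq_tri0 S (f s) z z'); auto. rewrite (ceq_tri0 S (f s) z' (f s')); auto. reflexivity.
      - replace (ch d f a s ++ [z; z'; f s']) with ((ch d f a s ++ [z; z']) ++ [f s']) by now rewrite <- app_assoc.
        rewrite Pre, Es', (app_assoc (ch d f a t)), (ch_app S f l r d Ff a t s'); try lra.
        rewrite (ch_app S f l r d Ff a s s'); try lra.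
        pose proof (ch_last S f l r d Ff a s' (f a) ltac:(lra)) as L'.
        destruct (app_cons_last (ch d f a s') (f a)) as [W' [y' Ey']]. { destruct (ch_shape S f l r d Ff a s' ltac:(lra)) as [? ->]. easy. }
        rewrite Ey', last_last in L'. subst y'. rewrite Ey', <- !app_assoc. simpl. rewrite (ceq_back S (f s') z'); [reflexivity|]. now apply cvx_comm. }
    rewrite EAs in *. rewrite EQ in *. apply (ceq_cancel_l S (f a) As) in X; auto; easy.
  - right.
    apply (Dpos_app al be c _ _ _ _ (f b)) in DR.
    2:{ rewrite ET' in *. rewrite LT'.
        destruct (rev (ch d g a' b') ++ rev T) eqn:Q.
        - apply app_eq_nil in Q as [Q _]. apply (f_equal (@rev Cpl)) in Q. rewrite rev_involutive, EG in Q. easy.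
        - assert (H := hd_rev_last (ch d g a' b') (f b)). rewrite (ch_last S g l r d Fg a' b' _ Hab') in H.
          destruct (rev (ch d g a' b')) eqn:Q'; [apply (f_equal (@rev Cpl)) in Q'; rewrite rev_involutive, EG in Q'; easy|].
          simpl in *. inversion Q. subst. reflexivity. }
    destruct DR as [DR|(pre2 & DR & Epre2)]. { exfalso. eapply Dpos_none; [exact FT'|exact DR]. }
    apply (Dpos_app al be c _ _ _ _ (f b)) in DR.
    2:{ rewrite rev_last_hd, EG, hd_rev_last. simpl. rewrite <- LT, ET. apply last_cons_default. }
    destruct DR as [DR|(pre3 & DR & Epre3)].
    2:{ exfalso. eapply (Dpos_none al be c (rev T) _ _ false); [|exact DR]. apply Forall_rev. eapply Forall_impl; [|exact FT]. intros ?. apply sd_false. }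
    destruct (Dpos_rev_ch al be c S g l r d Fg (proj2 Hg) a' b' _ _ Ha' Hab' Hb' DR) as (q & Hq & Vq & _ & Cq & Eq).
    exists q. split; [lra|]. split; [exact Vq|].
    assert (C1 : cvx S [f s; z'; g q] /\ cvx S [f s; z; z']).
    { apply cvx_comm in Cs. split.
      - apply (cvx_line al be c Hnz); auto. apply (cvx_line2 al be c Hnz S (f s) z z'); auto.
      - apply (cvx_line al be c Hnz); auto. }
    destruct C1 as [C1 C2].
    split. { eapply cvx_sub; [exact C1|incl_tac]. }
    unfold Adm. transitivity ((ch d f a s ++ [z; z']) ++ [g q]).
    { rewrite EW, <- !app_assoc. simpl. apply ceq_app; [reflexivity|]. rewrite ceq_dup0.
      rewrite (ceq_tri0 S (f s) z z'); auto. rewrite (ceq_tri0 S (f s) z' (g q)); auto. reflexivity. }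
    rewrite Pre, Epre1, Epre2, <- !app_assoc, (app_assoc pre2), Eq.
    rewrite (app_assoc (ch d f a t)), (ch_app S f l r d Ff a t b); try lra.
    rewrite (app_assoc (ch d f a b)), HA, <- !app_assoc.
    apply ceq_app; [reflexivity|].
    pose proof (ch_valid S g l r d Fg q b' ltac:(lra) ltac:(lra) Hb') as Vqb.
    destruct (ch_shape S g l r d Fg q b' ltac:(lra)) as [Gq EGq].
    rewrite <- (ch_app S g l r d Fg a' q b'); try lra. rewrite <- app_assoc, (app_assoc (ch d g q b')).
    rewrite (ceq_inv_r S _ (g q) Vqb); [|rewrite EGq; reflexivity|rewrite EGq; easy].
    pose proof (ch_last S g l r d Fg a' q (f a) ltac:(lra)) as L'.
    destruct (app_cons_last (ch d g a' q) (f a)) as [W' [y' Ey']]. { destruct (ch_shape S g l r d Fg a' q ltac:(lra)) as [? ->]. easy. }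
    rewrite Ey', last_last in L'. subst y'. rewrite Ey', <- !app_assoc. simpl. rewrite ceq_dup0, (ceq_back S (g q) z'); [reflexivity|]. now apply cvx_comm.
Qed.
End TwoPaths.

Lemma convex_ball z r : convex (fun w => dm z w < r).
Proof.
  intros x y t Hx Hy Ht. apply dm_lt in Hx as [X1 X2]. apply dm_lt in Hy as [Y1 Y2].
  apply Rabs_lt_iff in X1, X2, Y1, Y2. apply dm_lt. unfold lerp; simpl.
  destruct (Req_dec t 0) as [->|]; [split; apply Rabs_lt_iff; lra|].
  split; apply Rabs_lt_iff; split; nra.
Qed.

Lemma fine_exists Om f l r : c_open Om -> contD dR dm (I01 l r) f -> (forall t, l <= t <= r -> Om (f t)) ->
  exists d0, 0 < d0 /\ forall d, 0 < d <= d0 -> fine Om f l r d.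
Proof.
  intros HO Hf HD. destruct (open_clear dR (I01 l r) f Om HO (seqcpt_I l r) Hf HD) as [e [He H]].
  destruct (unif_path l r f Hf e He) as [d [Hd H']]. exists (d / 2). split; [lra|].
  intros d' Hd'. split; [lra|]. intros t Ht. exists (fun w => dm (f t) w < e). split; [apply convex_ball|]. split.
  - intros z Hz. now apply (H t).
  - intros t' Ht' Htt. apply H'; auto. rewrite Rabs_minus_sym. lra.
Qed.

(** * From a homotopy to chains *)

Section Ladder.
Variables (S : Cpl -> Prop) (G : Cpl -> Cpl) (l r d : R).
Hypothesis Hd : 0 < d.
Hypothesis HG : forall z, (l <= fst z <= r /\ 0 <= snd z <= 1) -> exists K, convex K /\ (forall w, K w -> S w) /\
  forall z', (l <= fst z' <= r /\ 0 <= snd z' <= 1) -> dm z z' <= d -> K (G z').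

(** Two neighbouring rows of a fine grid are exchanged one cell at a time; the corners of a cell lie
    in one convex part of [S]. *)
Lemma ladder a b tau t t' : FL d a b tau -> l <= a -> b <= r -> 0 <= t <= 1 -> 0 <= t' <= 1 -> Rabs (t - t') <= d ->
  ceq S (map (fun s => G (s, t)) tau ++ [G (b, t')]) (G (a, t) :: map (fun s => G (s, t')) tau).
Proof.
  intros F. induction F as [x|x u y tau Hu F IH]; intros Ha Hb Ht Ht' Htt; simpl.
  - reflexivity.
  - pose proof (FL_le _ _ _ _ F). rewrite IH; auto; try lra.
    destruct (HG (x, t)) as [K [K1 [K2 K3]]]; [simpl; lra|].
    assert (KS : forall m, Forall K m -> cvx S m) by (intros; exists K; auto).
    assert (B : forall p q, l <= p <= r -> 0 <= q <= 1 -> Rabs (x - p) <= d -> Rabs (t - q) <= d -> K (G (p, q))).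
    { intros. apply K3; simpl; [lra|]. apply dm_le; auto. }
    assert (Q : Rabs (t - t) <= d /\ Rabs (x - x) <= d /\ Rabs (x - u) <= d) by rabs.
    destruct (FL_shape _ _ _ _ F) as [tt ->]. simpl.
    transitivity (G (x, t) :: G (u, t') :: map (fun s => G (s, t')) tt).
    + apply ceq_tri0, KS. fall; apply B; lra.
    + symmetry. apply ceq_tri0, KS. fall; apply B; lra.
Qed.

Lemma ladders tau t1 t2 sig : l <= r -> FL d l r tau -> FL d t1 t2 sig -> 0 <= t1 -> t2 <= 1 ->
  ceq S (map (fun s => G (s, t1)) tau ++ map (fun t => G (r, t)) sig) (map (fun t => G (l, t)) sig ++ map (fun s => G (s, t2)) tau).
Proof.
  intros Hlr F F'. induction F' as [x|x u y sig Hu F' IH]; intros H1 H2; simpl.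
  - rewrite <- (ladder l r tau x x); auto; try lra; [reflexivity|rabs].
  - pose proof (FL_le _ _ _ _ F'). rewrite <- IH; try lra.
    transitivity ((map (fun s => G (s, x)) tau ++ [G (r, u)]) ++ map (fun t => G (r, t)) sig).
    + destruct (FL_shape _ _ _ _ F') as [tt ->]. simpl.
      assert (exists W, map (fun s => G (s, x)) tau = W ++ [G (r, x)]) as [W ->].
      { clear -F. induction F as [|? ? ? ? ? ? [W E]]; simpl; [now exists []|]. rewrite E. now eexists (_ :: W). }
      rewrite <- !app_assoc. simpl. apply ceq_app; [reflexivity|]. now rewrite !ceq_dup0.
    + rewrite (ladder l r tau x u); auto; try lra; [reflexivity|rabs].
Qed.
End Ladder.

Lemma homotopy_chains Om G l r : c_open Om -> l <= r ->
  contD dm dm (fun z => l <= fst z <= r /\ 0 <= snd z <= 1) G -> (forall z, (l <= fst z <= r /\ 0 <= snd z <= 1) -> Om (G z)) ->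
  exists d0, 0 < d0 /\ forall d, 0 < d <= d0 ->
    ceq Om (ch d (fun s => G (s, 0)) l r ++ ch d (fun t => G (r, t)) 0 1) (ch d (fun t => G (l, t)) 0 1 ++ ch d (fun s => G (s, 1)) l r).
Proof.
  intros HO Hlr Hc HD. destruct (open_clear dm _ G Om HO (seqcpt_rect l r 0 1) Hc HD) as [e [He H]].
  destruct (unif_cont dm dm _ G dm_tri dm_tri dm_sym (seqcpt_rect l r 0 1) Hc e He) as [d [Hd H']].
  exists (d / 2). split; [lra|]. intros d' Hd'. unfold ch. apply (ladders Om G l r d').
  - lra.
  - intros z Hz. exists (fun w => dm (G z) w < e). split; [apply convex_ball|]. split.
    + intros w Hw. now apply (H z).
    + intros z' Hz' Hzz. apply H'; auto. lra.
  - exact Hlr.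
  - apply fl_spec; lra.
  - apply fl_spec; lra.
  - lra.
  - lra.
Qed.

(** * Homotopy of continuous paths relative to the endpoints *)

Notation pathC f := (contD dR dm In01 f).

(** The constraint may depend on the path parameter, so that one set of lemmas covers both
    homotopies inside a set ([hp]) and homotopies unconstrained at the two ends ([hequiv]). *)
Definition hq (P : R -> Cpl -> Prop) (f g : R -> Cpl) : Prop :=
  exists K, contD dm dm Sq K /\ (forall z, Sq z -> P (fst z) (K z)) /\
    forall s, In01 s -> K (s, 0) = f s /\ K (s, 1) = g s /\ K (0, s) = f 0 /\ K (1, s) = f 1.

Notation hp S := (hq (fun _ => S)).

Lemma in01_0 : In01 0. Proof. unfold In01; lra. Qed.
Lemma in01_1 : In01 1. Proof. unfold In01; lra. Qed.

Lemma hp_ends P f g : hq P f g -> g 0 = f 0 /\ g 1 = f 1.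
Proof.
  intros (K & _ & _ & H). destruct (H 0 in01_0) as (A1 & A2 & A3 & A4). destruct (H 1 in01_1) as (B1 & B2 & B3 & B4). split; congruence.
Qed.

Lemma hp_ext P f g f' g' : hq P f g -> (forall s, In01 s -> f s = f' s) -> (forall s, In01 s -> g s = g' s) -> hq P f' g'.
Proof.
  intros (K & H1 & H2 & H3) Ef Eg. exists K. split; auto. split; auto. intros s Hs.
  destruct (H3 s Hs) as (A & B & C & D). rewrite <- (Ef s Hs), <- (Eg s Hs), <- (Ef 0 in01_0), <- (Ef 1 in01_1). auto.
Qed.

Lemma hp_in P f g : hq P f g -> (forall s, In01 s -> P s (f s)) /\ (forall s, In01 s -> P s (g s)).
Proof.
  intros (K & H1 & H2 & H3). split; intros s Hs; destruct (H3 s Hs) as (A & B & C & D).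
  - rewrite <- A. apply (H2 (s, 0)). split; [exact Hs|exact in01_0].
  - rewrite <- B. apply (H2 (s, 1)). split; [exact Hs|exact in01_1].
Qed.

Lemma sq_row (K : Cpl -> Cpl) t : In01 t -> contD dm dm Sq K -> pathC (fun s => K (s, t)).
Proof.
  intros Ht HK. apply (contD_comp dR dm dm In01 Sq (fun s => (s, t)) K); auto.
  - ctac.
  - intros s Hs. split; auto.
Qed.

Lemma sq_col (K : Cpl -> Cpl) s : In01 s -> contD dm dm Sq K -> pathC (fun t => K (s, t)).
Proof.
  intros Ht HK. apply (contD_comp dR dm dm In01 Sq (fun t => (s, t)) K); auto.
  - ctac.
  - intros t Ht'. split; auto.
Qed.

Lemma hp_cont P f g : hq P f g -> pathC f /\ pathC g.
Proof.
  intros (K & H1 & H2 & H3). split.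
  - eapply contD_ext; [apply (sq_row K 0 in01_0 H1)|]. intros s Hs. apply H3; auto.
  - eapply contD_ext; [apply (sq_row K 1 in01_1 H1)|]. intros s Hs. apply H3; auto.
Qed.

Lemma hp_sym P f g : hq P f g -> hq P g f.
Proof.
  intros H. destruct (hp_ends _ _ _ H) as [E0 E1]. destruct H as (K & H1 & H2 & H3).
  exists (fun z => K (fst z, 1 - snd z)). split; [|split].
  - apply (contD_comp dm dm dm Sq Sq (fun z => (fst z, 1 - snd z)) K); auto.
    + ctac.
    + intros [s t] [Hs Ht]; unfold Sq, In01 in *; simpl in *; lra.
  - intros [s t] [Hs Ht]. apply (H2 (s, 1 - t)). unfold Sq, In01 in *; simpl in *; lra.
  - intros s Hs. simpl. rewrite Rminus_0_r, Rminus_diag. assert (Hs' : In01 (1 - s)) by (unfold In01 in *; lra).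
    destruct (H3 s Hs) as (A & B & _ & _). destruct (H3 (1 - s) Hs') as (_ & _ & C & D). rewrite E0, E1. auto.
Qed.

Lemma hp_trans P f g h : hq P f g -> hq P g h -> hq P f h.
Proof.
  intros H H'. destruct (hp_ends _ _ _ H) as [E0 E1].
  destruct H as (K & H1 & H2 & H3), H' as (L & L1 & L2 & L3).
  exists (fun z => if Rle_dec (snd z) (1/2) then K (fst z, 2 * snd z) else L (fst z, 2 * snd z - 1)).
  split; [|split].
  - apply (contD_paste dm dm Sq (fun z => snd z <= 1/2) (fun z => 1/2 <= snd z)).
    + apply relclosed_le; ctac.
    + apply relclosed_le; ctac.
    + intros z _. lra.
    + apply contD_ext with (f := fun z => K (fst z, 2 * snd z)).
      * apply (contD_comp dm dm dm _ Sq (fun z => (fst z, 2 * snd z)) K); auto; [ctac|].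
        intros [s t] [[Hs Ht] Hl]; unfold Sq, In01 in *; simpl in *; lra.
      * intros z [_ Hz]. destruct Rle_dec; [reflexivity|lra].
    + apply contD_ext with (f := fun z => L (fst z, 2 * snd z - 1)).
      * apply (contD_comp dm dm dm _ Sq (fun z => (fst z, 2 * snd z - 1)) L); auto; [ctac|].
        intros [s t] [[Hs Ht] Hl]; unfold Sq, In01 in *; simpl in *; lra.
      * intros z [[Hz0 _] Hz]. destruct Rle_dec; [|reflexivity]. assert (E : snd z = 1/2) by lra. rewrite E.
        replace (2 * (1 / 2) - 1) with 0 by lra. replace (2 * (1 / 2)) with 1 by lra.
        destruct (H3 _ Hz0) as (_ & B & _ & _). destruct (L3 _ Hz0) as (A & _ & _ & _). congruence.
  - intros [s t] [Hs Ht]. simpl in *. unfold In01 in *. destruct Rle_dec; [apply (H2 (s, 2 * t))|apply (L2 (s, 2 * t - 1))]; unfold Sq, In01; simpl; lra.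
  - intros s Hs. simpl. destruct (H3 s Hs) as (A & B & _ & _). destruct (L3 s Hs) as (A' & B' & _ & _).
    split; [|split; [|split]].
    + destruct Rle_dec; [|lra]. now rewrite Rmult_0_r.
    + destruct Rle_dec; [lra|]. replace (2 * 1 - 1) with 1 by lra. auto.
    + unfold In01 in *. destruct Rle_dec.
      * apply (H3 (2 * s)). unfold In01; lra.
      * destruct (L3 (2 * s - 1)) as (_ & _ & C & _); [unfold In01; lra|]. congruence.
    + unfold In01 in *. destruct Rle_dec.
      * apply (H3 (2 * s)). unfold In01; lra.
      * destruct (L3 (2 * s - 1)) as (_ & _ & _ & C); [unfold In01; lra|]. congruence.
Qed.

Lemma lerp_same z t : lerp z z t = z.
Proof. unfold lerp. destruct z; simpl. f_equal; ring. Qed.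
Lemma lerp_0 x y : lerp x y 0 = x.
Proof. unfold lerp. destruct x; simpl. f_equal; ring. Qed.
Lemma lerp_1 x y : lerp x y 1 = y.
Proof. unfold lerp. destruct y; simpl. f_equal; ring. Qed.

Lemma contD_lerp {A} (dA : A -> A -> R) D f g h : contD dA dm D f -> contD dA dm D g -> contD dA dR D h ->
  contD dA dm D (fun x => lerp (f x) (g x) (h x)).
Proof. intros. unfold lerp. ctac. Qed.

Lemma contD_on_fst (f : R -> Cpl) : pathC f -> contD dm dm Sq (fun z => f (fst z)).
Proof. intros. apply (contD_comp dm dR dm Sq In01 fst f); auto; [ctac|now intros z []]. Qed.

Lemma hp_lin P f g : pathC f -> pathC g -> f 0 = g 0 -> f 1 = g 1 -> (forall s t, In01 s -> In01 t -> P s (lerp (f s) (g s) t)) -> hq P f g.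
Proof.
  intros Hf Hg E0 E1 H. exists (fun z => lerp (f (fst z)) (g (fst z)) (snd z)). split; [|split].
  - apply contD_lerp; [now apply contD_on_fst|now apply contD_on_fst|ctac].
  - intros z [Hs Ht]. now apply H.
  - intros s Hs. simpl. rewrite lerp_0, lerp_1, <- E0, <- E1, !lerp_same. auto.
Qed.

Lemma hp_refl P f : pathC f -> (forall s, In01 s -> P s (f s)) -> hq P f f.
Proof. intros Hf H. apply hp_lin; auto. intros. rewrite lerp_same. auto. Qed.

Lemma in01_mix s s' t : In01 s -> In01 s' -> In01 t -> In01 ((1 - t) * s + t * s').
Proof. unfold In01. intros. split; nra. Qed.

Lemma hp_reparam S f rho : pathC f -> (forall s, In01 s -> S (f s)) ->
  contD dR dR In01 rho -> (forall s, In01 s -> In01 (rho s)) -> rho 0 = 0 -> rho 1 = 1 -> hp S f (fun s => f (rho s)).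
Proof.
  intros Hf HS Hr Hin R0 R1.
  assert (Hc : contD dm dR Sq (fun z => (1 - snd z) * fst z + snd z * rho (fst z))).
  { assert (contD dm dR Sq (fun z => rho (fst z))) by (apply (contD_comp dm dR dR Sq In01 fst rho); auto; [ctac|now intros z []]). ctac. }
  exists (fun z => f ((1 - snd z) * fst z + snd z * rho (fst z))). split; [|split].
  - apply (contD_comp dm dR dm Sq In01 _ f); auto. intros z [Hs Ht]. apply in01_mix; auto.
  - intros z [Hs Ht]. apply HS. apply in01_mix; auto.
  - intros s Hs. simpl. rewrite R0, R1. repeat split; f_equal; ring.
Qed.

Definition cat (f g : R -> Cpl) (s : R) : Cpl := if Rle_dec s (1/2) then f (2 * s) else g (2 * s - 1).

Lemma cat_cont f g : pathC f -> pathC g -> f 1 = g 0 -> pathC (cat f g).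
Proof.
  intros Hf Hg E. apply (contD_paste dR dm In01 (fun s => s <= 1/2) (fun s => 1/2 <= s)).
  - apply relclosed_le; ctac.
  - apply relclosed_le; ctac.
  - intros; lra.
  - apply contD_ext with (f := fun s => f (2 * s)).
    + apply (contD_comp dR dR dm _ In01 (fun s => 2 * s) f); auto; [ctac|]. unfold In01; intros; lra.
    + intros s [_ Hs]. unfold cat. destruct Rle_dec; [reflexivity|lra].
  - apply contD_ext with (f := fun s => g (2 * s - 1)).
    + apply (contD_comp dR dR dm _ In01 (fun s => 2 * s - 1) g); auto; [ctac|]. unfold In01; intros; lra.
    + intros s [_ Hs]. unfold cat. destruct Rle_dec; [|reflexivity]. replace s with (1/2) by lra.
      replace (2 * (1 / 2) - 1) with 0 by lra. replace (2 * (1 / 2)) with 1 by lra. auto.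
Qed.

Lemma cat_in S f g : (forall s, In01 s -> S (f s)) -> (forall s, In01 s -> S (g s)) -> forall s, In01 s -> S (cat f g s).
Proof. unfold In01, cat. intros Hf Hg s Hs. destruct Rle_dec; [apply Hf|apply Hg]; lra. Qed.

Lemma cat_0 f g : cat f g 0 = f 0.
Proof. unfold cat. destruct Rle_dec; [now rewrite Rmult_0_r|lra]. Qed.
Lemma cat_1 f g : cat f g 1 = g 1.
Proof. unfold cat. destruct Rle_dec; [lra|]. f_equal; lra. Qed.

Lemma hp_cat S f f' g g' : hp S f f' -> hp S g g' -> f 1 = g 0 -> hp S (cat f g) (cat f' g').
Proof.
  intros H H' E. destruct H as (K & H1 & H2 & H3), H' as (L & L1 & L2 & L3).
  exists (fun z => if Rle_dec (fst z) (1/2) then K (2 * fst z, snd z) else L (2 * fst z - 1, snd z)).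
  split; [|split].
  - apply (contD_paste dm dm Sq (fun z => fst z <= 1/2) (fun z => 1/2 <= fst z)).
    + apply relclosed_le; ctac.
    + apply relclosed_le; ctac.
    + intros z _. lra.
    + apply contD_ext with (f := fun z => K (2 * fst z, snd z)).
      * apply (contD_comp dm dm dm _ Sq (fun z => (2 * fst z, snd z)) K); auto; [ctac|].
        intros [s t] [[Hs Ht] Hl]; unfold Sq, In01 in *; simpl in *; lra.
      * intros z [_ Hz]. destruct Rle_dec; [reflexivity|lra].
    + apply contD_ext with (f := fun z => L (2 * fst z - 1, snd z)).
      * apply (contD_comp dm dm dm _ Sq (fun z => (2 * fst z - 1, snd z)) L); auto; [ctac|].
        intros [s t] [[Hs Ht] Hl]; unfold Sq, In01 in *; simpl in *; lra.
      * intros z [[_ Hz0] Hz]. destruct Rle_dec; [|reflexivity]. assert (E' : fst z = 1/2) by lra. rewrite E'.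
        replace (2 * (1 / 2) - 1) with 0 by lra. replace (2 * (1 / 2)) with 1 by lra.
        destruct (H3 _ Hz0) as (_ & _ & _ & B). destruct (L3 _ Hz0) as (_ & _ & A & _). congruence.
  - intros [s t] [Hs Ht]. simpl in *. unfold In01 in *. destruct Rle_dec; [apply H2|apply L2]; unfold Sq, In01; simpl; lra.
  - intros s Hs. simpl. rewrite cat_0, cat_1. unfold cat, In01 in *.
    split; [|split; [|split]].
    + destruct Rle_dec; [apply H3|apply L3]; unfold In01; lra.
    + destruct Rle_dec; [apply H3|apply L3]; unfold In01; lra.
    + destruct Rle_dec; [|lra]. rewrite Rmult_0_r. now apply H3.
    + destruct Rle_dec; [lra|]. replace (2 * 1 - 1) with 1 by lra. now apply L3.
Qed.

Ltac rmm := unfold Rmin, Rmax; repeat destruct Rle_dec; try lra.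

Lemma hp_assoc S f g h : pathC f -> pathC g -> pathC h -> f 1 = g 0 -> g 1 = h 0 ->
  (forall s, In01 s -> S (f s)) -> (forall s, In01 s -> S (g s)) -> (forall s, In01 s -> S (h s)) ->
  hp S (cat (cat f g) h) (cat f (cat g h)).
Proof.
  intros Hf Hg Hh E1 E2 Sf Sg Sh.
  (* The piecewise linear function sends the breakpoints 1/2 and 3/4 of the right bracketing to the
     breakpoints 1/4 and 1/2 of the left one. *)
  eapply hp_ext; [apply (hp_reparam S (cat (cat f g) h) (fun s => Rmax (s / 2) (Rmax (s - 1/4) (2 * s - 1))))| |].
  - repeat apply cat_cont; auto. now rewrite cat_1.
  - repeat apply cat_in; auto.
  - unfold Rdiv. ctac.
  - unfold In01. intros s Hs. rmm.
  - rmm.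
  - rmm.
  - auto.
  - intros s Hs. unfold In01 in Hs.
    destruct (Rle_dec s (1/2)) as [A|A]; [|destruct (Rle_dec s (3/4)) as [B|B]].
    + replace (Rmax (s / 2) (Rmax (s - 1/4) (2 * s - 1))) with (s / 2) by rmm. unfold cat.
      destruct (Rle_dec (s / 2) (1/2)); [|lra]. destruct (Rle_dec (2 * (s / 2)) (1/2)); [|lra]. destruct (Rle_dec s (1/2)); [|lra]. f_equal; lra.
    + replace (Rmax (s / 2) (Rmax (s - 1/4) (2 * s - 1))) with (s - 1/4) by rmm. unfold cat.
      destruct (Rle_dec (s - 1/4) (1/2)); [|lra]. destruct (Rle_dec (2 * (s - 1/4)) (1/2)); [lra|]. destruct (Rle_dec s (1/2)); [lra|].
      destruct (Rle_dec (2 * s - 1) (1/2)); [|lra]. f_equal; lra.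
    + replace (Rmax (s / 2) (Rmax (s - 1/4) (2 * s - 1))) with (2 * s - 1) by rmm. unfold cat.
      destruct (Rle_dec (2 * s - 1) (1/2)); [lra|]. destruct (Rle_dec s (1/2)); [lra|]. f_equal; lra.
Qed.

Lemma hp_unit_l S f z : pathC f -> (forall s, In01 s -> S (f s)) -> f 0 = z -> hp S f (cat (fun _ => z) f).
Proof.
  intros Hf Sf E. eapply hp_ext; [apply (hp_reparam S f (fun s => Rmax 0 (2 * s - 1)))| |]; auto.
  - ctac.
  - unfold In01; intros; rmm.
  - rmm.
  - rmm.
  - intros s Hs. unfold cat, In01 in *. destruct Rle_dec.
    + rewrite <- E. f_equal; rmm.
    + f_equal; rmm.
Qed.

Lemma hp_unit_r S f z : pathC f -> (forall s, In01 s -> S (f s)) -> f 1 = z -> hp S f (cat f (fun _ => z)).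
Proof.
  intros Hf Sf E. eapply hp_ext; [apply (hp_reparam S f (fun s => Rmin 1 (2 * s)))| |]; auto.
  - ctac.
  - unfold In01; intros; rmm.
  - rmm.
  - rmm.
  - intros s Hs. unfold cat, In01 in *. destruct Rle_dec.
    + f_equal; rmm.
    + rewrite <- E. f_equal; rmm.
Qed.

(** * From chains to continuous homotopies *)

(** The first edge takes half of the time and the remaining chain the other half. The speed is
    uneven, but induction on the chain becomes immediate and only homotopy classes matter. *)
Fixpoint pl (l : list Cpl) : R -> Cpl :=
  match l with
  | [] => fun _ => (0, 0)
  | z :: l' => match l' with [] => fun _ => z | w :: _ => cat (lerp z w) (pl l') end
  end.

(** A chain with one vertex is [valid] without lying in [S], so membership of the vertices is
    demanded separately. *)
Definition vS (S : Cpl -> Prop) (l : list Cpl) : Prop := valid S l /\ Forall S l.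

Lemma pl_0 l z : pl (z :: l) 0 = z.
Proof. destruct l; simpl; auto. rewrite cat_0. apply lerp_0. Qed.

Lemma pl_1 l : forall z d, pl (z :: l) 1 = last (z :: l) d.
Proof.
  induction l as [|w l IH]; intros z d; [reflexivity|].
  change (pl (z :: w :: l)) with (cat (lerp z w) (pl (w :: l))). rewrite cat_1. apply IH.
Qed.

Lemma lerp_path z w : pathC (lerp z w).
Proof. apply (contD_lerp dR In01 (fun _ => z) (fun _ => w) (fun t => t)); ctac; apply contD_const, dm_refl. Qed.

Lemma pl_cont l : pathC (pl l).
Proof.
  induction l as [|z l IH]; [apply contD_const, dm_refl|]. destruct l as [|w l]; [apply contD_const, dm_refl|].
  apply cat_cont; auto. { apply lerp_path. } rewrite lerp_1. symmetry. apply (pl_0 l w).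
Qed.

Lemma cvx_lerp S a b : cvx S [a; b] -> forall t, In01 t -> S (lerp a b t).
Proof.
  intros (K & K1 & K2 & K3) t Ht. rewrite !Forall_cons_iff in K3. apply K2, K1; tauto.
Qed.

Lemma pl_in S l : vS S l -> l <> [] -> forall s, In01 s -> S (pl l s).
Proof.
  intros [H1 H2] Hn. induction l as [|z l IH]; [easy|]. destruct l as [|w l].
  - intros s _. now apply Forall_inv in H2.
  - apply cat_in; [apply cvx_lerp, H1|]. apply IH; [apply H1|now apply Forall_inv_tail in H2|easy].
Qed.

Lemma valid_cons2 S a b l : valid S (a :: b :: l) <-> cvx S [a; b] /\ valid S (b :: l).
Proof. reflexivity. Qed.

Lemma vS_ctx S l1 a m m' : (vS S (a :: m) <-> vS S (a :: m')) -> (vS S (l1 ++ a :: m) <-> vS S (l1 ++ a :: m')).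
Proof.
  intros H. unfold vS in *. rewrite !Forall_app in *.
  split; intros (V & F1 & F2).
  - assert (V1 := valid_app S l1 (a :: m) V). destruct (proj1 H) as [V' F']; [tauto|]. split; [|tauto]. apply valid_join; auto.
    change (l1 ++ a :: m) with (l1 ++ [a] ++ m) in V. rewrite app_assoc in V. now apply valid_app in V.
  - assert (V1 := valid_app S l1 (a :: m') V). destruct (proj2 H) as [V' F']; [tauto|]. split; [|tauto]. apply valid_join; auto.
    change (l1 ++ a :: m') with (l1 ++ [a] ++ m') in V. rewrite app_assoc in V. now apply valid_app in V.
Qed.

Lemma vS_tri S a b c l : cvx S [a; b; c] -> (vS S (a :: b :: c :: l) <-> vS S (a :: c :: l)).
Proof.
  intros H. unfold vS. rewrite !valid_cons2, !Forall_cons_iff.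
  assert (cvx S [a; b]) by (eapply cvx_sub; [exact H|incl_tac]). assert (cvx S [b; c]) by (eapply cvx_sub; [exact H|incl_tac]).
  assert (cvx S [a; c]) by (eapply cvx_sub; [exact H|incl_tac]).
  assert (S b). { destruct H as (K & K1 & K2 & K3). rewrite !Forall_cons_iff in K3. apply K2; tauto. } tauto.
Qed.

Lemma vS_dup S a l : vS S (a :: a :: l) <-> vS S (a :: l).
Proof.
  unfold vS. rewrite !valid_cons2, !Forall_cons_iff. split; [tauto|]. intros (V & Sa & F). repeat split; auto.
  exists (fun z => z = a). split; [|split].
  - intros x y t -> -> _. apply lerp_same.
  - now intros z ->.
  - fall.
Qed.

Lemma vS_ceq S l l' : ceq S l l' -> (vS S l <-> vS S l').
Proof.
  induction 1; try tauto.
  - apply vS_ctx. now apply vS_tri.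
  - apply vS_ctx. apply vS_dup.
Qed.

Lemma pl_ctx S l1 : forall a m m', vS S (l1 ++ a :: m) -> vS S (l1 ++ a :: m') -> hp S (pl (a :: m)) (pl (a :: m')) ->
  hp S (pl (l1 ++ a :: m)) (pl (l1 ++ a :: m')).
Proof.
  induction l1 as [|x l1 IH]; intros a m m' V V' H; [exact H|].
  assert (Hh : forall k, vS S (x :: l1 ++ k) -> vS S (l1 ++ k)).
  { intros k [A B]. split; [|now apply Forall_inv_tail in B]. now apply (valid_app S [x]) in A. }
  specialize (IH a m m' (Hh _ V) (Hh _ V') H).
  assert (exists y k k', l1 ++ a :: m = y :: k /\ l1 ++ a :: m' = y :: k') as (y & k & k' & Ek & Ek').
  { destruct l1; simpl; eauto. }
  simpl app. rewrite Ek, Ek' in *. change (pl (x :: y :: k)) with (cat (lerp x y) (pl (y :: k))). change (pl (x :: y :: k')) with (cat (lerp x y) (pl (y :: k'))).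
  apply hp_cat; auto.
  - apply hp_refl; [apply lerp_path|]. apply cvx_lerp. simpl in V. rewrite Ek in V. apply V.
  - now rewrite pl_0, lerp_1.
Qed.

(** [vS] is preserved by the moves, so all intermediate chains are paths in [S]. A triangle is
    filled by linear interpolation in its convex piece, a repeated vertex by the unit law. *)
Theorem ceq_hp S l l' : ceq S l l' -> vS S l -> l <> [] -> hp S (pl l) (pl l').
Proof.
  assert (NE : forall P P', ceq S P P' -> P <> [] <-> P' <> []).
  { intros Q Q'. induction 1; try tauto; destruct l1; simpl; split; easy. }
  induction 1 as [l|l l' H IH|l l' l'' H IH H' IH'|l1 a b c l2 H|l1 a l2]; intros V N.
  - apply hp_refl; [apply pl_cont|now apply pl_in].
  - apply hp_sym, IH; [now apply (vS_ceq S l l' H)|now apply (NE l l' H)].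
  - eapply hp_trans; [now apply IH|]. apply IH'; [now apply (vS_ceq S l l' H)|now apply (NE l l' H)].
  - assert (V' : vS S (l1 ++ a :: c :: l2)) by (eapply vS_ceq; [apply ceq_sym, ceq_tri; eauto|exact V]).
    apply pl_ctx; auto.
    assert (W : vS S (c :: l2)). { destruct V' as [A B]. apply valid_app in A as [_ A]. apply Forall_app in B as [_ B]. split; [apply A|now apply Forall_inv_tail in B]. }
    assert (cvx S [a; b]) by (eapply cvx_sub; [exact H|incl_tac]). assert (cvx S [b; c]) by (eapply cvx_sub; [exact H|incl_tac]).
    change (pl (a :: b :: c :: l2)) with (cat (lerp a b) (cat (lerp b c) (pl (c :: l2)))). change (pl (a :: c :: l2)) with (cat (lerp a c) (pl (c :: l2))).
    eapply hp_trans; [apply hp_sym, hp_assoc|].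
    + apply lerp_path.
    + apply lerp_path.
    + apply pl_cont.
    + now rewrite lerp_0, lerp_1.
    + now rewrite pl_0, lerp_1.
    + now apply cvx_lerp.
    + now apply cvx_lerp.
    + now apply pl_in.
    + apply hp_cat.
      * apply hp_lin; [apply cat_cont; try apply lerp_path; now rewrite lerp_0, lerp_1|apply lerp_path|now rewrite cat_0, !lerp_0|now rewrite cat_1, !lerp_1|].
        destruct H as (K & K1 & K2 & K3). rewrite !Forall_cons_iff in K3. intros s t Hs Ht. apply K2, K1; auto.
        -- apply cat_in; auto; intros; apply K1; tauto.
        -- apply K1; tauto.
      * apply hp_refl; [apply pl_cont|now apply pl_in].
      * now rewrite cat_1, pl_0, lerp_1.
  - assert (V' : vS S (l1 ++ a :: l2)) by (eapply vS_ceq; [apply ceq_sym, ceq_dup|exact V]).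
    apply pl_ctx; auto.
    assert (W : vS S (a :: l2)). { destruct V' as [A B]. apply valid_app in A as [_ A]. apply Forall_app in B as [_ B]. split; auto. }
    change (pl (a :: a :: l2)) with (cat (lerp a a) (pl (a :: l2))). apply hp_sym.
    eapply hp_ext; [apply (hp_unit_l S (pl (a :: l2)) a)| |].
    + apply pl_cont.
    + now apply pl_in.
    + apply pl_0.
    + auto.
    + intros s _. unfold cat. now rewrite lerp_same.
Qed.

Lemma pl_app S l1 : forall l2 d, vS S (l1 ++ l2) -> l1 <> [] -> l2 <> [] -> last l1 d = hd d l2 -> hp S (pl (l1 ++ l2)) (cat (pl l1) (pl l2)).
Proof.
  induction l1 as [|x l1 IH]; intros l2 d V N1 N2 E; [easy|].
  assert (V2 : vS S l2). { destruct V as [A B]. apply valid_app in A as [_ A]. apply Forall_app in B as [_ B]. split; auto. }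
  destruct l1 as [|y l1].
  - destruct l2 as [|z l2]; [easy|]. simpl in E. subst z. change (pl ([x] ++ x :: l2)) with (cat (lerp x x) (pl (x :: l2))).
    eapply hp_ext; [apply (hp_refl (fun _ => S) (cat (fun _ => x) (pl (x :: l2))))| |].
    + apply cat_cont; [apply contD_const, dm_refl|apply pl_cont|]. now rewrite pl_0.
    + apply cat_in; [|now apply pl_in]. intros _ _. destruct V2 as [_ B]. now apply Forall_inv in B.
    + intros s _. unfold cat. now rewrite lerp_same.
    + intros s _. reflexivity.
  - assert (V' : vS S ((y :: l1) ++ l2)). { destruct V as [A B]. split; [now apply (valid_app S [x]) in A|now apply Forall_inv_tail in B]. }
    assert (V1 : vS S (y :: l1)). { destruct V' as [A B]. apply valid_app in A as [A _]. apply Forall_app in B as [B _]. split; auto. }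
    assert (Cxy : cvx S [x; y]) by apply V.
    specialize (IH l2 d V' ltac:(easy) N2 E).
    change (pl ((x :: y :: l1) ++ l2)) with (cat (lerp x y) (pl ((y :: l1) ++ l2))). change (pl (x :: y :: l1)) with (cat (lerp x y) (pl (y :: l1))).
    eapply hp_trans.
    + apply hp_cat; [apply hp_refl; [apply lerp_path|now apply cvx_lerp]|exact IH|]. simpl app. now rewrite pl_0, lerp_1.
    + apply hp_sym, hp_assoc; try apply lerp_path; try apply pl_cont; try (now apply pl_in); try now apply cvx_lerp.
      * now rewrite pl_0, lerp_1.
      * destruct l2 as [|z l2]; [easy|]. rewrite pl_0, (pl_1 l1 y d). exact E.
Qed.

Definition rs (f : R -> Cpl) (a b s : R) : Cpl := f (a + s * (b - a)).

Lemma rs_cont f a b : a <= b -> contD dR dm (I01 a b) f -> pathC (rs f a b).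
Proof.
  intros Hab Hf. unfold rs. apply (contD_comp dR dR dm In01 (I01 a b) (fun s => a + s * (b - a)) f); auto; [ctac|].
  unfold In01, I01. intros; nra.
Qed.

Lemma rs_in (S : Cpl -> Prop) f a b : a <= b -> (forall t, a <= t <= b -> S (f t)) -> forall s, In01 s -> S (rs f a b s).
Proof. intros Hab H s Hs. unfold rs. apply H. unfold In01 in Hs. nra. Qed.

Lemma rs_split S f a u b : a <= u -> u <= b -> contD dR dm (I01 a b) f -> (forall t, a <= t <= b -> S (f t)) ->
  hp S (rs f a b) (cat (rs f a u) (rs f u b)).
Proof.
  intros H1 H2 Hf HS.
  destruct (Req_dec a b) as [E|E].
  - eapply hp_ext; [apply (hp_refl (fun _ => S) (rs f a b))| |]; auto.
    + apply rs_cont; auto; lra.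
    + apply rs_in; auto; lra.
    + intros s _. assert (u = a) by lra. subst u b. unfold cat, rs. destruct Rle_dec; f_equal; ring.
  - eapply hp_ext; [apply (hp_reparam S (rs f a b) (fun s => (Rmin (2 * s) 1 * (u - a) + Rmax (2 * s - 1) 0 * (b - u)) * / (b - a)))| |].
    + apply rs_cont; auto; lra.
    + apply rs_in; auto; lra.
    + ctac.
    + unfold In01. intros s Hs. assert (0 < / (b - a)) by (apply Rinv_0_lt_compat; lra).
      assert (A1 : 0 <= Rmin (2 * s) 1 <= 1) by rmm. assert (A2 : 0 <= Rmax (2 * s - 1) 0 <= 1) by rmm.
      split. { apply Rmult_le_pos; [nra|lra]. }
      apply Rmult_le_reg_r with (b - a); [lra|]. rewrite Rmult_assoc, Rinv_l; [nra|lra].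
    + rewrite Rmult_0_r. replace (Rmin 0 1) with 0 by rmm. replace (Rmax (0 - 1) 0) with 0 by rmm. ring.
    + replace (Rmin (2 * 1) 1) with 1 by rmm. replace (Rmax (2 * 1 - 1) 0) with 1 by rmm. field. lra.
    + auto.
    + intros s Hs. unfold In01 in Hs. unfold cat, rs. destruct Rle_dec.
      * replace (Rmin (2 * s) 1) with (2 * s) by rmm. replace (Rmax (2 * s - 1) 0) with 0 by rmm. f_equal; field; lra.
      * replace (Rmin (2 * s) 1) with 1 by rmm. replace (Rmax (2 * s - 1) 0) with (2 * s - 1) by rmm. f_equal; field; lra.
Qed.

(** Each short arc lies together with its chord in one convex piece, where linear interpolation
    joins them. *)
Lemma path_chain S f l r d : fine S f l r d -> contD dR dm (I01 l r) f -> forall a b tau, FL d a b tau -> l <= a -> b <= r -> hp S (rs f a b) (pl (map f tau)).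
Proof.
  intros Hf Hc a b tau F.
  assert (HS : forall t, l <= t <= r -> S (f t)). { intros t Ht. destruct Hf as [Hd Hf]. destruct (Hf t Ht) as (K & K1 & K2 & K3). apply K2, K3; auto. rabs. }
  induction F as [x|x u y tau Hu F IH]; intros Ha Hb.
  - eapply hp_ext; [apply (hp_refl (fun _ => S) (fun _ => f x))| |].
    + apply contD_const, dm_refl.
    + intros; apply HS; lra.
    + intros s _. unfold rs. f_equal; ring.
    + reflexivity.
  - pose proof (FL_le _ _ _ _ F). specialize (IH ltac:(lra) Hb).
    destruct (FL_shape _ _ _ _ F) as [t Et]. rewrite Et in *. simpl map in *.
    change (pl (f x :: f u :: map f t)) with (cat (lerp (f x) (f u)) (pl (f u :: map f t))).
    eapply hp_trans; [apply (rs_split S f x u y); try lra|].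
    + eapply contD_sub; [exact Hc|]. unfold I01; intros; lra.
    + intros; apply HS; lra.
    + apply hp_cat; auto.
      * destruct Hf as [Hd Hf]. destruct (Hf x ltac:(lra)) as (K & K1 & K2 & K3).
        assert (KK : forall q, x <= q <= u -> K (f q)) by (intros; apply K3; [lra|rabs]).
        apply hp_lin.
        -- apply rs_cont; [lra|]. eapply contD_sub; [exact Hc|]. unfold I01; intros; lra.
        -- apply lerp_path.
        -- rewrite lerp_0. unfold rs. f_equal; ring.
        -- rewrite lerp_1. unfold rs. f_equal; ring.
        -- intros p q Hp Hq. apply K2, K1; auto. { apply (rs_in K); auto; lra. } apply K1; auto; apply KK; lra.
      * unfold rs. f_equal; ring.
Qed.

(** At the point (s, t) of the square the parameter (s + t) / 2 runs along both concatenations, and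
    [th] interpolates from the lower right boundary, where it is 0, to the upper left one, where it
    is 1. The corners (0, 0) and (1, 1) are blown up to the sides on which the homotopy is
    constant. *)
Lemma square_of_hp S al be t0 t1 : al 1 = t1 0 -> t0 1 = be 0 -> hp S (cat al t1) (cat t0 be) ->
  exists Q, contD dm dm Sq Q /\ (forall z, Sq z -> S (Q z)) /\
    forall s, In01 s -> Q (s, 0) = al s /\ Q (s, 1) = be s /\ Q (0, s) = t0 s /\ Q (1, s) = t1 s.
Proof.
  intros E1 E2 (K & H1 & H2 & H3). rewrite cat_0, cat_1 in H3.
  (* On the square [den] vanishes exactly at the corners (0, 0) and (1, 1). *)
  set (den := fun z : Cpl => snd z * (1 - fst z) + fst z * (1 - snd z)).
  set (th := fun z : Cpl => snd z * (1 - fst z) * / den z).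
  assert (Hden : forall z, Sq z -> 0 <= snd z * (1 - fst z) <= den z /\ 0 <= den z).
  { intros z [Hs Ht]. unfold In01, den in *. split; [split|]; nra. }
  assert (Hth : forall z, Sq z -> In01 (th z)).
  { intros z Hz. destruct (Hden z Hz) as [A B]. unfold th, In01. destruct (Req_dec (den z) 0) as [E|E].
    - replace (snd z * (1 - fst z)) with 0 by lra. rewrite Rmult_0_l. lra.
    - assert (0 < / den z) by (apply Rinv_0_lt_compat; lra). split; [apply Rmult_le_pos; lra|].
      apply Rmult_le_reg_r with (den z); [lra|]. rewrite Rmult_assoc, Rinv_l; lra. }
  set (ph := fun z : Cpl => ((fst z + snd z) / 2, th z)).
  assert (Hph : forall z, Sq z -> Sq (ph z)).
  { intros z Hz. split; [|now apply Hth]. destruct Hz as [Hs Ht]. unfold In01, ph in *; simpl. lra. }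
  (* At these corners only the first coordinate of [ph] converges, which suffices because the
     homotopy does not depend on the second one there. *)
  assert (Corner : forall z e, Sq z -> (z = (0, 0) \/ z = (1, 1)) -> 0 < e -> exists dl, 0 < dl /\ forall y, Sq y -> dm z y < dl -> dm (K (ph z)) (K (ph y)) < e).
  { intros z e Hz Hc He.
    destruct (unif_cont dm dm Sq K dm_tri dm_tri dm_sym seqcpt_Sq H1 e He) as [dl [Hdl HU]]. exists dl. split; auto.
    intros y Hy Hzy. apply dm_lt in Hzy as [Z1 Z2].
    assert (Q : forall k, In01 k -> (forall q, In01 q -> K (k, q) = K (k, 0)) -> Rabs (k - (fst y + snd y) / 2) < dl -> fst (ph z) = k -> dm (K (ph z)) (K (ph y)) < e).
    { intros k Hk HK Hky Hz'. destruct (ph z) as [pz qz] eqn:Ez. simpl in Hz'. subst pz.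
      assert (Sz : In01 qz). { specialize (Hph z Hz). rewrite Ez in Hph. apply Hph. }
      replace (K (k, qz)) with (K (k, th y)). 2:{ rewrite (HK qz Sz), (HK (th y)); auto. }
      apply HU; [split; simpl; auto|now apply Hph|]. apply dm_lt. simpl. rewrite Rminus_diag, Rabs_R0. auto. }
    destruct Hc as [-> | ->]; simpl in Z1, Z2.
    - apply (Q 0); auto using in01_0. { intros q Hq. destruct (H3 q Hq) as (_ & _ & A & _). destruct (H3 0 in01_0) as (_ & _ & B & _). congruence. }
      + apply Rabs_lt_iff in Z1, Z2. apply Rabs_lt_iff. lra.
      + simpl. lra.
    - apply (Q 1); auto using in01_1. { intros q Hq. destruct (H3 q Hq) as (_ & _ & _ & A). destruct (H3 0 in01_0) as (_ & _ & _ & B). congruence. }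
      + apply Rabs_lt_iff in Z1, Z2. apply Rabs_lt_iff. lra.
      + simpl. lra. }
  exists (fun z => K (ph z)). split; [|split].
  - intros z Hz e He. destruct (classic (z = (0, 0) \/ z = (1, 1))) as [Hc|Hc]; [now apply Corner|].
    assert (Hp : 0 < den z).
    { destruct (Hden z Hz) as [_ A]. destruct (Req_dec (den z) 0) as [E|E]; [|lra]. exfalso. apply Hc.
      destruct z as [s t]. unfold den, Sq, In01 in *; simpl in *. 
      assert (t * (1 - s) = 0) by nra. assert (s * (1 - t) = 0) by nra.
      destruct (Req_dec s 0) as [->|]; [left; f_equal; lra|]. right. assert (t = 1) by (apply Rmult_integral in H0; lra). subst t. f_equal; lra. }
    assert (Cden : contD dm dR Sq den) by (unfold den; ctac).
    destruct (Cden z Hz (den z) Hp) as [d1 [Hd1 D1]].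
    assert (Cph : contD dm dm (fun y => Sq y /\ dm z y < d1) ph).
    { assert (contD dm dR (fun y => Sq y /\ dm z y < d1) (fun y => / den y)).
      { apply contD_inv. { eapply contD_sub; [exact Cden|tauto]. } intros y [Hy Hzy]. specialize (D1 y Hy Hzy). unfold dR in D1. apply Rabs_lt_iff in D1. lra. }
      unfold ph, th, Rdiv. ctac. }
    assert (CK := contD_comp dm dm dm _ Sq ph K Cph H1 ltac:(intros y [Hy _]; now apply Hph)).
    destruct (CK z) with (e := e) as [d2 [Hd2 D2]]; auto. { split; auto. now rewrite dm_refl. }
    exists (Rmin d1 d2). split; [now apply Rmin_pos|]. intros y Hy Hzy. apply Rlt_min in Hzy as [Y1 Y2]. apply D2; auto.
  - intros z Hz. now apply H2, Hph.
  - intros s Hs. unfold ph, th, den. simpl.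
    assert (Hs2 : In01 (s / 2)) by (unfold In01 in *; lra). assert (Hs3 : In01 ((1 + s) / 2)) by (unfold In01 in *; lra).
    unfold In01 in Hs. split; [|split; [|split]].
    + rewrite Rmult_0_l, Rmult_0_l, Rplus_0_r. destruct (H3 _ Hs2) as (A & _). rewrite A. unfold cat. destruct Rle_dec; [|lra]. f_equal; lra.
    + destruct (Req_dec s 1) as [->|Es].
      { rewrite Rminus_diag, Rmult_0_r, Rmult_0_l. replace ((1 + 1) / 2) with 1 by lra. destruct (H3 0 in01_0) as (_ & _ & _ & A). destruct (H3 1 in01_1) as (_ & B & _ & C).
        rewrite A. rewrite cat_1 in B. congruence. }
      replace (1 * (1 - s) * / (1 * (1 - s) + s * (1 - 1))) with 1 by (field; lra).
      replace ((s + 1) / 2) with ((1 + s) / 2) by lra. destruct (H3 _ Hs3) as (_ & A & _). rewrite A. unfold cat. destruct Rle_dec.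
      * replace s with 0 by lra. replace (2 * ((1 + 0) / 2)) with 1 by lra. auto.
      * f_equal; lra.
    + destruct (Req_dec s 0) as [->|Es].
      { rewrite Rmult_0_l, Rmult_0_l. replace ((0 + 0) / 2) with 0 by lra. destruct (H3 0 in01_0) as (A & B & C & D). destruct (H3 1 in01_1) as (_ & _ & D' & _). rewrite cat_0 in B.
        rewrite A, cat_0. destruct (H3 1 in01_1) as (_ & B' & _). destruct (H3 0 in01_0) as (_ & B0 & _). rewrite cat_0 in B0. congruence. }
      replace (s * (1 - 0) * / (s * (1 - 0) + 0 * (1 - s))) with 1 by (field; lra). rewrite Rplus_0_l.
      destruct (H3 _ Hs2) as (_ & A & _). rewrite A. unfold cat. destruct Rle_dec; [|lra]. f_equal; lra.
    + rewrite Rminus_diag, Rmult_0_r, Rmult_0_l.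
      destruct (H3 _ Hs3) as (A & _). rewrite A. unfold cat. destruct Rle_dec.
      * replace s with 0 by lra. replace (2 * ((1 + 0) / 2)) with 1 by lra. auto.
      * f_equal; lra.
Qed.

Lemma valid_Forall S z l : S z -> valid S (z :: l) -> Forall S (z :: l).
Proof.
  revert z. induction l as [|w l IH]; intros z Hz V; [fall|]. constructor; auto.
  destruct V as [(K & K1 & K2 & K3) V]. rewrite !Forall_cons_iff in K3. apply IH; auto. apply K2. tauto.
Qed.

Lemma cvx_single (S : Cpl -> Prop) z : S z -> cvx S [z; z].
Proof.
  intros Hz. exists (fun w => w = z). split; [|split].
  - intros x y t -> -> _. apply lerp_same.
  - now intros w ->.
  - fall.
Qed.

(** * Filling a null-homotopic box inside a rectangle *)

Section Box.
Variables (S : Cpl -> Prop) (l r d : R) (x0 x1 y0 y1 : R).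
Let Rc := rect x0 x1 y0 y1.
Let SR (z : Cpl) : Prop := S z /\ Rc z.

Lemma cvx_rect m : cvx S m -> Forall Rc m -> cvx SR m.
Proof.
  intros [K [K1 [K2 K3]]] H. exists (fun z => K z /\ Rc z). split; [|split].
  - intros x y t [X1 X2] [Y1 Y2] Ht. split; auto. now apply convex_rect.
  - intros z [Z1 Z2]. split; auto.
  - rewrite Forall_forall in *. auto.
Qed.

Lemma valid_rect m : valid S m -> Forall Rc m -> valid SR m.
Proof.
  induction m as [|a [|b m] IH]; auto. intros [V1 V2] F. apply Forall_cons_iff in F as [Fa F]. split.
  - apply cvx_rect; auto. apply Forall_cons_iff in F as [Fb F]. fall.
  - now apply IH.
Qed.

Lemma good_rect f a b : good S l r d f -> l <= a -> a <= b -> b <= r -> (forall t, a <= t <= b -> Rc (f t)) -> good SR a b d f.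
Proof.
  intros [[Hd Hf] Hc] Ha Hab Hb HR. split; [split; auto|].
  - intros t Ht. destruct (Hf t ltac:(lra)) as (K & K1 & K2 & K3). exists (fun z => K z /\ Rc z). split; [|split].
    + intros x y s [X1 X2] [Y1 Y2] Hs. split; auto. now apply convex_rect.
    + intros z [Z1 Z2]. split; auto.
    + intros t' Ht' Htt. split; [apply K3; lra|]. auto.
  - eapply contD_sub; [exact Hc|]. unfold I01; intros; lra.
Qed.

Lemma good_in f : good S l r d f -> forall t, l <= t <= r -> S (f t).
Proof. intros [[Hd H] _] t Ht. destruct (H t Ht) as (K & K1 & K2 & K3). apply K2, K3; auto. rabs. Qed.

(** The tracks enter as chains in [Adm] but as prescribed paths [tau] and [tau'] in the filling, so
    that fillings of adjacent boxes can be glued along a common side. *)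
Theorem box_fill f g T a a' T' b b' tau tau' :
  good S l r d f -> good S l r d g -> l <= a -> a <= b -> b <= r -> l <= a' -> a' <= b' -> b' <= r ->
  isTrack S f g T a a' -> isTrack S f g T' b b' -> Adm S d f g T a a' T' b b' ->
  (forall t, a <= t <= b -> Rc (f t)) -> (forall t, a' <= t <= b' -> Rc (g t)) -> Forall Rc T -> Forall Rc T' ->
  hp SR tau (pl T) -> hp SR tau' (pl T') ->
  exists Q, contD dm dm Sq Q /\ (forall z, Sq z -> SR (Q z)) /\
    forall s, In01 s -> Q (s, 0) = rs f a b s /\ Q (s, 1) = rs g a' b' s /\ Q (0, s) = tau s /\ Q (1, s) = tau' s.
Proof.
  intros Gf Gg Ha Hab Hb Ha' Hab' Hb' HT HT' HA Rf Rg RT RT' Ht Ht'.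
  pose proof (proj1 Gf) as Ff. pose proof (proj1 Gg) as Fg. pose proof (proj1 Ff) as Hd.
  pose proof (good_rect f a b Gf Ha Hab Hb Rf) as Gf'. pose proof (good_rect g a' b' Gg Ha' Hab' Hb' Rg) as Gg'.
  destruct HT as (VT & (T0 & ET) & LT), HT' as (VT' & (T0' & ET') & LT').
  assert (Rcf : Forall Rc (ch d f a b)). { apply Forall_forall. intros z Hz. destruct (ch_in S f l r d Ff a b z Hab Hz) as [t [H1 ->]]. auto. }
  assert (Rcg : Forall Rc (ch d g a' b')). { apply Forall_forall. intros z Hz. destruct (ch_in S g l r d Fg a' b' z Hab' Hz) as [t [H1 ->]]. auto. }
  (* Here the homotopy of the boundary, given anywhere in [S], is compressed into the rectangle. *)
  assert (CE : ceq SR (ch d f a b ++ T') (T ++ ch d g a' b')).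
  { apply ceq_rect; auto; apply Forall_app; auto. }
  assert (Sfa : SR (f a)). { split; [apply good_in; auto; lra|apply Rf; lra]. }
  assert (Sfb : SR (f b)). { split; [apply good_in; auto; lra|apply Rf; lra]. }
  assert (Sga : SR (g a')). { split; [apply good_in; auto; lra|apply Rg; lra]. }
  assert (V1 : valid SR (ch d f a b)) by (apply valid_rect; auto; apply (ch_valid S f l r d Ff); auto).
  assert (V2 : valid SR (ch d g a' b')) by (apply valid_rect; auto; apply (ch_valid S g l r d Fg); auto).
  assert (V3 : valid SR T) by now apply valid_rect. assert (V4 : valid SR T') by now apply valid_rect.
  assert (J : forall X Y z, valid SR X -> valid SR (z :: Y) -> SR z -> X <> [] -> last X z = z -> Forall SR X -> vS SR (X ++ z :: Y)).
  { intros X Y z VX VY Sz NX LX FX. split.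
    - destruct (app_cons_last X z NX) as [X0 [y Ey]]. rewrite Ey, last_last in LX. subst y. rewrite Ey in *. rewrite <- app_assoc. simpl.
      apply valid_join; auto. split; auto. now apply cvx_single.
    - apply Forall_app. split; auto. now apply valid_Forall. }
  destruct (ch_shape S f l r d Ff a b Hab) as [cf Ecf]. destruct (ch_shape S g l r d Fg a' b' Hab') as [cg Ecg].
  pose proof (ch_last S f l r d Ff a b (f b) Hab) as Lf. pose proof (ch_last S g l r d Fg a' b' (g b') Hab') as Lg.
  assert (W1 : vS SR (ch d f a b ++ T')).
  { rewrite ET' in *. apply J; auto. { rewrite Ecf; easy. } rewrite Ecf. apply valid_Forall; auto. now rewrite <- Ecf. }
  assert (W2 : vS SR (T ++ ch d g a' b')).
  { rewrite Ecg in *. apply J; auto. { rewrite ET; easy. } { rewrite <- LT, ET. apply last_cons_default. } rewrite ET. apply valid_Forall; auto. now rewrite <- ET. }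
  assert (E1 : rs f a b 1 = f b) by (unfold rs; f_equal; ring).
  assert (E2 : rs g a' b' 0 = g a') by (unfold rs; f_equal; ring).
  assert (Pf : hp SR (rs f a b) (pl (ch d f a b))).
  { apply (path_chain SR f a b d (proj1 Gf') (proj2 Gf') a b); try lra. now apply fl_spec. }
  assert (Pg : hp SR (rs g a' b') (pl (ch d g a' b'))).
  { apply (path_chain SR g a' b' d (proj1 Gg') (proj2 Gg') a' b'); try lra. now apply fl_spec. }
  destruct (hp_ends _ _ _ Ht) as [t0 t1]. destruct (hp_ends _ _ _ Ht') as [t0' t1'].
  assert (T0E : tau' 0 = f b). { rewrite <- t0', ET'. apply pl_0. }
  assert (T1E : tau 1 = g a'). { rewrite <- t1, ET, (pl_1 T0 (f a) (f a)), <- ET. exact LT. }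
  apply square_of_hp; try congruence.
  eapply hp_trans; [apply hp_cat; [exact Pf|exact Ht'|congruence]|].
  eapply hp_trans; [apply hp_sym, (pl_app SR (ch d f a b) T' (f b)); auto|].
  { rewrite Ecf; easy. } { rewrite ET'; easy. } { rewrite Lf, ET'. reflexivity. }
  eapply hp_trans; [apply ceq_hp; [exact CE|exact W1|rewrite Ecf; easy]|].
  eapply hp_trans; [apply (pl_app SR T (ch d g a' b') (f a)); auto|].
  { rewrite ET; easy. } { rewrite Ecg; easy. } { rewrite LT, Ecg. reflexivity. }
  apply hp_sym, hp_cat; auto. congruence.
Qed.
End Box.

(** * Paths in a domain except possibly at the endpoints *)

Lemma cont01_iff g : cont01 g <-> pathC g.
Proof.
  split; intros H s Hs e He.
  - destruct (H s Hs e He) as [d [Hd H']]. exists d. split; auto. intros y Hy Hsy. eapply Rle_lt_trans; [apply dm_cdist|]. now apply H'.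
  - destruct (H s Hs (e / 2)) as [d [Hd H']]; [lra|]. exists d. split; auto. intros y Hy Hsy.
    eapply Rle_lt_trans; [apply cdist_dm|]. specialize (H' y Hy Hsy). lra.
Qed.

Lemma cont2_iff h : cont01x01 h <-> contD dm dm Sq (fun z => h (fst z) (snd z)).
Proof.
  split; intros H.
  - intros [s t] [Hs Ht] e He. destruct (H s t Hs Ht e He) as [d [Hd H']]. exists d. split; auto.
    intros [s' t'] [Hs' Ht'] Hst. apply dm_lt in Hst as [A B]. eapply Rle_lt_trans; [apply dm_cdist|]. now apply H'.
  - intros s t Hs Ht e He. destruct (H (s, t) (conj Hs Ht) (e / 2)) as [d [Hd H']]; [lra|]. exists d. split; auto.
    intros s' t' Hs' Ht' A B. eapply Rle_lt_trans; [apply cdist_dm|]. specialize (H' (s', t') (conj Hs' Ht')). simpl in H'.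
    assert (dm (s, t) (s', t') < d) by (apply dm_lt; auto). specialize (H' H0). lra.
Qed.

Definition inn (Om : Cpl -> Prop) (s : R) (z : Cpl) : Prop := 0 < s < 1 -> Om z.

Notation hequiv Om := (hq (inn Om)).

Definition epe (Om : Cpl -> Prop) (g : R -> Cpl) : Prop := pathC g /\ forall s, 0 < s < 1 -> Om (g s).

Lemma epe_iff Om p q g : path_epe Om p q g <-> epe Om g /\ g 0 = p /\ g 1 = q.
Proof. unfold path_epe, epe. rewrite cont01_iff. tauto. Qed.

Lemma hequiv_epe Om f g : hequiv Om f g -> epe Om f /\ epe Om g.
Proof.
  intros H. destruct (hp_cont _ _ _ H) as [A B]. destruct (hp_in _ _ _ H) as [C D]. unfold inn in *.
  split; split; auto; intros s Hs; [apply C|apply D]; auto; unfold In01; lra.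
Qed.

Lemma hequiv_refl Om f : epe Om f -> hequiv Om f f.
Proof. intros [A B]. apply hp_refl; auto. intros s _ Hs. auto. Qed.

Lemma hequiv_reparam Om f th : epe Om f -> contD dR dR In01 th -> th 0 = 0 -> th 1 = 1 -> (forall s, 0 < s < 1 -> 0 < th s < 1) ->
  hequiv Om f (fun s => f (th s)).
Proof.
  intros [Hf HO] Hr R0 R1 Hin.
  assert (Hin' : forall s, In01 s -> In01 (th s)).
  { unfold In01. intros s Hs. destruct (Req_dec s 0) as [->|]; [lra|]. destruct (Req_dec s 1) as [->|]; [lra|]. specialize (Hin s). lra. }
  assert (Hc : contD dm dR Sq (fun z => (1 - snd z) * fst z + snd z * th (fst z))).
  { assert (contD dm dR Sq (fun z => th (fst z))) by (apply (contD_comp dm dR dR Sq In01 fst th); auto; [ctac|now intros z []]). ctac. }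
  exists (fun z => f ((1 - snd z) * fst z + snd z * th (fst z))). split; [|split].
  - apply (contD_comp dm dR dm Sq In01 _ f); auto. intros z [Hs Ht]. apply in01_mix; auto.
  - intros z [Hs Ht] Hz. apply HO. specialize (Hin _ Hz). unfold In01 in *. destruct (Req_dec (snd z) 0) as [->|]; [lra|].
    destruct (Req_dec (snd z) 1) as [->|]; [lra|]. split; nra.
  - intros s Hs. simpl. rewrite R0, R1. repeat split; f_equal; ring.
Qed.

Definition repl (F : R -> Cpl) (u w : R) (k : R -> Cpl) (s : R) : Cpl :=
  if Rle_dec u s then if Rle_dec s w then k ((s - u) / (w - u)) else F s else F s.

Lemma paste3 (D : Cpl -> Prop) (F k : Cpl -> Cpl) u w : u < w ->
  contD dm dm D F -> contD dm dm (fun z => D z /\ u <= fst z <= w) k ->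
  (forall z, D z -> fst z = u -> k z = F z) -> (forall z, D z -> fst z = w -> k z = F z) ->
  contD dm dm D (fun z => if Rle_dec u (fst z) then if Rle_dec (fst z) w then k z else F z else F z).
Proof.
  intros Huw HF Hk Eu Ew.
  apply (contD_paste dm dm D (fun z => fst z <= u) (fun z => u <= fst z)).
  - apply relclosed_le; ctac.
  - apply relclosed_le; ctac.
  - intros; lra.
  - apply contD_ext with (f := F). { eapply contD_sub; [exact HF|tauto]. }
    intros z [Dz Hz]. destruct Rle_dec; auto. destruct Rle_dec; auto. symmetry. apply Eu; auto. lra.
  - apply (contD_paste dm dm (fun z => D z /\ u <= fst z) (fun z => fst z <= w) (fun z => w <= fst z)).
    + apply relclosed_le; ctac.
    + apply relclosed_le; ctac.
    + intros; lra.
    + apply contD_ext with (f := k). { eapply contD_sub; [exact Hk|tauto]. }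
      intros z [[Dz Hz] Hz']. destruct Rle_dec; [|lra]. destruct Rle_dec; [auto|lra].
    + apply contD_ext with (f := F). { eapply contD_sub; [exact HF|tauto]. }
      intros z [[Dz Hz] Hz']. destruct Rle_dec; auto. destruct Rle_dec; auto. symmetry. apply Ew; auto. lra.
Qed.

Lemma div01 s u w : u < w -> u <= s <= w -> In01 ((s - u) / (w - u)).
Proof.
  intros H Hs. unfold In01, Rdiv. assert (0 < / (w - u)) by (apply Rinv_0_lt_compat; lra).
  split. { apply Rmult_le_pos; lra. } apply Rmult_le_reg_r with (w - u); [lra|]. rewrite Rmult_assoc, Rinv_l; lra.
Qed.

Lemma hequiv_repl Om F u w k : epe Om F -> 0 < u -> u < w -> w < 1 -> hp Om (rs F u w) k -> hequiv Om F (repl F u w k).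
Proof.
  intros [HF HO] Hu Huw Hw (K & K1 & K2 & K3).
  assert (E0 : rs F u w 0 = F u) by (unfold rs; f_equal; ring). assert (E1 : rs F u w 1 = F w) by (unfold rs; f_equal; ring).
  exists (fun z => if Rle_dec u (fst z) then if Rle_dec (fst z) w then K ((fst z - u) / (w - u), snd z) else F (fst z) else F (fst z)).
  assert (Z0 : (u - u) / (w - u) = 0) by (field; lra). assert (Z1 : (w - u) / (w - u) = 1) by (field; lra).
  split; [|split].
  - apply (paste3 Sq (fun z => F (fst z)) (fun z => K ((fst z - u) / (w - u), snd z)) u w); auto.
    + now apply contD_on_fst.
    + apply (contD_comp dm dm dm _ Sq (fun z => ((fst z - u) / (w - u), snd z)) K); auto.
      * unfold Rdiv. ctac.
      * intros z [[Hs Ht] Hz]. split; [|exact Ht]. simpl. now apply div01.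
    + intros z [Hs Ht] ->. rewrite Z0. destruct (K3 _ Ht) as (_ & _ & A & _). congruence.
    + intros z [Hs Ht] ->. rewrite Z1. destruct (K3 _ Ht) as (_ & _ & _ & A). congruence.
  - intros z [Hs Ht] Hz. repeat destruct Rle_dec; auto. apply K2. split; [|exact Ht]. simpl. now apply div01.
  - intros s Hs. simpl. unfold repl. split; [|split; [|split]].
    + repeat destruct Rle_dec; auto. destruct (K3 _ (div01 s u w Huw ltac:(lra))) as (A & _). rewrite A. unfold rs. f_equal. field. lra.
    + repeat destruct Rle_dec; auto. destruct (K3 _ (div01 s u w Huw ltac:(lra))) as (_ & A & _). auto.
    + destruct Rle_dec; [lra|auto].
    + destruct Rle_dec; auto. destruct Rle_dec; [lra|auto].
Qed.

Lemma repl_straighten F u w s : repl F u w (lerp (F u) (F w)) s = straighten F u w s.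
Proof.
  unfold repl, straighten. repeat destruct Rle_dec; auto. unfold lerp, cadd, cscale, csub; simpl. f_equal; ring.
Qed.

(** * Numbers of crossings of strips *)

(** The strip between the levels [k] and [k + 1] of an integral functional. Integer data make the
    family countable, the fixed gap 1 makes alternations finite on every path, and scaling yields
    arbitrarily thin strips in every rational direction. *)
Record strip := Strip { sa : Z; sb : Z; sk : Z }.

Definition sv (j : strip) (z : Cpl) : R := IZR (sa j) * fst z + IZR (sb j) * snd z.
Definition sym (j : strip) (b : bool) (z : Cpl) : Prop := if b then IZR (sk j) + 1 < sv j z else sv j z < IZR (sk j).

Fixpoint alts (lam : R -> Cpl) (j : strip) (b : bool) (s T : R) (ts : list R) : Prop :=
  match ts with
  | [] => True
  | r :: ts' => s <= r <= T /\ sym j b (lam r) /\ alts lam j (negb b) r T ts'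
  end.

(** Crossing numbers occur only through their upper bounds, so no maximum has to be computed. Only
    strings that begin below the strip are counted. *)
Definition Nle (lam : R -> Cpl) (j : strip) (n : nat) : Prop := forall ts, alts lam j false 0 1 ts -> (length ts <= n)%nat.

Definition flip (b : bool) (n : nat) : bool := if Nat.even n then b else negb b.

Lemma flip_S b n : flip (negb b) n = flip b (S n).
Proof. unfold flip. rewrite Nat.even_succ, <- Nat.negb_even. destruct (Nat.even n); simpl; auto. now rewrite negb_involutive. Qed.

Lemma flip_neg b n : negb (flip b n) = flip b (S n).
Proof. unfold flip. rewrite Nat.even_succ, <- Nat.negb_even. destruct (Nat.even n); simpl; auto. now rewrite negb_involutive. Qed.

Lemma sym_excl j b z : sym j b z -> sym j (negb b) z -> False.
Proof. destruct b; simpl; lra. Qed.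

Lemma alts_le lam j b s s' T T' ts : s' <= s -> T <= T' -> alts lam j b s T ts -> alts lam j b s' T' ts.
Proof.
  revert b s s'. induction ts as [|r ts IH]; simpl; auto. intros b s s' H1 H2 (A & B & C).
  split; [lra|]. split; auto. apply (IH _ r); auto; lra.
Qed.

Lemma alts_app lam j ts1 : forall b s u T ts2, s <= u -> u <= T -> alts lam j b s u ts1 -> alts lam j (flip b (length ts1)) u T ts2 ->
  alts lam j b s T (ts1 ++ ts2).
Proof.
  induction ts1 as [|r ts1 IH]; intros b s u T ts2 Hs Hu H1 H2; simpl in *.
  - eapply alts_le; [| |exact H2]; lra.
  - destruct H1 as (A & B & C). split; [lra|]. split; auto. apply (IH _ r u); auto; try lra. now rewrite flip_S.
Qed.

Lemma alts_range lam j ts : forall b s T, alts lam j b s T ts -> Forall (fun r => s <= r <= T) ts.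
Proof.
  induction ts as [|r ts IH]; simpl; auto. intros b s T (A & B & C). constructor; auto.
  eapply Forall_impl; [|apply (IH _ _ _ C)]. simpl; intros; lra.
Qed.

Lemma alts_ext lam mu j ts : forall b s T, Forall (fun r => mu r = lam r) ts -> alts mu j b s T ts -> alts lam j b s T ts.
Proof.
  induction ts as [|r ts IH]; simpl; auto. intros b s T F (A & B & C). apply Forall_cons_iff in F as [F1 F2].
  split; auto. rewrite <- F1. split; auto.
Qed.

Lemma alts_cut lam j u T ts : forall b s, s <= T -> u <= T -> alts lam j b s T ts ->
  exists ts1 ts2, ts = ts1 ++ ts2 /\ alts lam j b s T ts1 /\ Forall (fun r => r < u) ts1 /\
    alts lam j (flip b (length ts1)) (Rmax s u) T ts2.
Proof.
  induction ts as [|r ts IH]; intros b s Hs Hu H; simpl in H.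
  - exists [], []. simpl. auto.
  - destruct H as (A & B & C). destruct (Rlt_dec r u) as [L|L].
    + destruct (IH (negb b) r) as (ts1 & ts2 & -> & H1 & H2 & H3); auto; try lra.
      exists (r :: ts1), ts2. split; auto. split; [simpl; auto|]. split; [constructor; auto|].
      simpl length. rewrite <- flip_S. eapply alts_le; [| |exact H3]; [|lra]. apply Rmax_lub; [eapply Rle_trans; [|apply Rmax_l]; lra|apply Rmax_r].
    + exists [], (r :: ts). split; auto. split; [simpl; auto|]. split; [constructor|]. simpl. split; auto.
      split; [apply Rmax_lub; lra|lra].
Qed.

Lemma alts_upper lam j u T ts : forall b s, alts lam j b s T ts -> Forall (fun r => r <= u) ts -> alts lam j b s u ts.
Proof.
  induction ts as [|r ts IH]; simpl; auto. intros b s (A & B & C) F. apply Forall_cons_iff in F as [F1 F2].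
  split; [lra|]. split; auto.
Qed.

Lemma flip_add2 b n m k : m = (n + 2 * k)%nat -> flip b m = flip b n.
Proof.
  intros ->. unfold flip. rewrite Nat.even_add, Nat.even_mul. simpl. destruct (Nat.even n); reflexivity.
Qed.

Lemma flip_app b n m : flip (flip b n) m = flip b (n + m)%nat.
Proof. unfold flip. rewrite Nat.even_add. destruct (Nat.even n), (Nat.even m); simpl; auto. now rewrite negb_involutive. Qed.

(** A string is cut at [s0] and [s1] and its middle part exchanged. The length changes by an even
    number, so the symbol due at [s1] is the same and the last part still fits. It is used with
    [k = 0] and, for a strict gain, with [k = 1]. *)
Lemma splice lam mu j s0 s1 k : 0 <= s0 -> s0 < s1 -> s1 <= 1 -> (forall r, 0 <= r < s0 -> mu r = lam r) -> (forall r, s1 < r <= 1 -> mu r = lam r) ->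
  (forall b ts, alts mu j b s0 s1 ts -> exists ts', alts lam j b s0 s1 ts' /\ length ts' = (length ts + 2 * k)%nat) ->
  forall ts b, alts mu j b 0 1 ts -> exists ts', alts lam j b 0 1 ts' /\ length ts' = (length ts + 2 * k)%nat.
Proof.
  intros H0 H01 H1 E0 E1 HP ts b H.
  destruct (alts_cut mu j s0 1 ts b 0) as (ts1 & ts' & -> & A1 & A2 & A3); try lra; auto.
  rewrite Rmax_right in A3 by lra.
  assert (C : exists ts2 ts3, ts' = ts2 ++ ts3 /\ alts mu j (flip b (length ts1)) s0 s1 ts2 /\ alts mu j (flip b (length ts1 + length ts2)%nat) s1 1 ts3 /\ Forall (fun r => s1 < r) ts3).
  { clear -A3 H01 H1. revert A3. generalize (length ts1). intros n. revert n. assert (L : s0 <= s0) by lra. revert L. generalize s0 at 2 3 4. intros s.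
    revert s. induction ts' as [|r ts IH]; intros s L n H.
    - exists [], []. simpl. auto.
    - simpl in H. destruct H as (A & B & C). destruct (Rle_dec r s1) as [Q|Q].
      + destruct (IH r ltac:(lra) (S n)) as (ts2 & ts3 & -> & I1 & I2 & I3).
        { now rewrite <- flip_neg. }
        exists (r :: ts2), ts3. split; auto. split.
        * simpl. split; [lra|]. split; auto. now rewrite flip_neg.
        * simpl. split; auto. now rewrite Nat.add_succ_r.
      + exists [], (r :: ts). split; auto. split; [simpl; auto|]. split.
        * simpl length. rewrite Nat.add_0_r. simpl. split; [lra|auto].
        * assert (G : forall qs b r, alts mu j b r 1 qs -> s1 < r -> Forall (fun q => s1 < q) qs).
          { induction qs as [|q qs IH0]; intros b0 r0 HH Hr; constructor; simpl in HH.
            - lra.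
            - destruct HH as (X & Y & Z). apply (IH0 _ q Z). lra. }
          constructor; [lra|]. eapply G; [exact C|lra]. }
  destruct C as (ts2 & ts3 & -> & B1 & B2 & B3).
  destruct (HP _ _ B1) as (ts2' & B1' & L').
  exists (ts1 ++ ts2' ++ ts3). split; [|rewrite !length_app, L'; lia].
  apply (alts_app lam j ts1 b 0 s0); try lra.
  - assert (A1' : alts mu j b 0 s0 ts1). { eapply alts_upper; [exact A1|]. eapply Forall_impl; [|exact A2]. simpl; intros; lra. }
    eapply alts_ext; [|exact A1']. pose proof (alts_range _ _ _ _ _ _ A1) as Q. rewrite Forall_forall in *.
    intros r Hr. apply E0. specialize (A2 r Hr). specialize (Q r Hr). simpl in *. lra.
  - apply (alts_app lam j ts2' _ s0 s1); auto; try lra.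
    rewrite flip_app. rewrite (flip_add2 b (length ts1 + length ts2)%nat _ k) by lia.
    eapply alts_ext; [|exact B2]. pose proof (alts_range _ _ _ _ _ _ B2) as Q. rewrite Forall_forall in *.
    intros r Hr. apply E1. specialize (B3 r Hr). specialize (Q r Hr). simpl in *. lra.
Qed.

Lemma sv_lerp j x y t : sv j (lerp x y t) = (1 - t) * sv j x + t * sv j y.
Proof. unfold sv, lerp; simpl. ring. Qed.

Lemma straighten_in lam s0 s1 s : s0 < s1 -> s0 <= s <= s1 -> straighten lam s0 s1 s = lerp (lam s0) (lam s1) ((s - s0) / (s1 - s0)).
Proof. intros H Hs. rewrite <- repl_straighten. unfold repl. repeat destruct Rle_dec; auto; lra. Qed.

Lemma straighten_out lam s0 s1 s : s < s0 \/ s1 < s -> straighten lam s0 s1 s = lam s.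
Proof. intros H. unfold straighten. repeat destruct Rle_dec; auto; lra. Qed.

Lemma sym_mono j z0 z1 r r' b : 0 <= r <= r' -> r' <= 1 -> sym j b (lerp z0 z1 r) -> sym j (negb b) (lerp z0 z1 r') ->
  sym j b z0 /\ sym j (negb b) z1.
Proof.
  destruct b; simpl; rewrite !sv_lerp; intros H1 H2 A B.
  - assert (sv j z1 < sv j z0) by (apply Rnot_le_lt; intro; nra). split; nra.
  - assert (sv j z0 < sv j z1) by (apply Rnot_le_lt; intro; nra). split; nra.
Qed.

Lemma sym_end j z0 z1 r b : 0 <= r <= 1 -> sym j b (lerp z0 z1 r) -> sym j b z0 \/ sym j b z1.
Proof.
  destruct b; simpl; rewrite sv_lerp; intros H A.
  - destruct (Rlt_dec (IZR (sk j) + 1) (sv j z0)); auto. right. nra.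
  - destruct (Rlt_dec (sv j z0) (IZR (sk j))); auto. right. nra.
Qed.

(** An affine function is monotone along the chord, so it changes sides at most once, and every
    symbol seen on the chord occurs at one of its ends. *)
Lemma chord_strings lam j s0 s1 b ts : s0 < s1 -> alts (straighten lam s0 s1) j b s0 s1 ts ->
  ts = [] \/ (length ts = 1%nat /\ (sym j b (lam s0) \/ sym j b (lam s1))) \/ (length ts = 2%nat /\ sym j b (lam s0) /\ sym j (negb b) (lam s1)).
Proof.
  intros H A. destruct ts as [|r1 [|r2 [|r3 ts]]]; [auto| | |]; right; simpl in A.
  - left. split; auto. destruct A as (A1 & A2 & _). rewrite straighten_in in A2 by lra. eapply sym_end; [|exact A2]. now apply div01.
  - right. split; auto. destruct A as (A1 & A2 & A3 & A4 & _). rewrite straighten_in in A2, A4 by lra.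
    eapply sym_mono; [| |exact A2|exact A4].
    + split; [apply div01; lra|]. unfold Rdiv. apply Rmult_le_compat_r; [|lra]. left; apply Rinv_0_lt_compat; lra.
    + apply div01; lra.
  - exfalso. destruct A as (A1 & A2 & A3 & A4 & A5 & A6 & _). rewrite straighten_in in A2, A4, A6 by lra.
    assert (Q : forall p q, s0 <= p -> p <= q -> (p - s0) / (s1 - s0) <= (q - s0) / (s1 - s0)).
    { intros p q _ Hpq. unfold Rdiv. apply Rmult_le_compat_r; [|lra]. left; apply Rinv_0_lt_compat; lra. }
    assert (Q1 := div01 r1 s0 s1 H ltac:(lra)). assert (Q2 := div01 r2 s0 s1 H ltac:(lra)). assert (Q3 := div01 r3 s0 s1 H ltac:(lra)). unfold In01 in *.
    destruct (sym_mono j (lam s0) (lam s1) ((r1 - s0) / (s1 - s0)) ((r2 - s0) / (s1 - s0)) b) as [B1 B2]; auto; try lra. { split; [lra|apply Q; lra]. }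
    destruct (sym_mono j (lam s0) (lam s1) ((r2 - s0) / (s1 - s0)) ((r3 - s0) / (s1 - s0)) (negb b)) as [B3 B4]; auto; try lra. { split; [lra|apply Q; lra]. }
    eapply sym_excl; [exact B1|exact B3].
Qed.

(** Strings of the chord are realized by [lam] at the times [s0] and [s1] alone. *)
Lemma straighten_Nle lam s0 s1 j n : 0 <= s0 -> s0 < s1 -> s1 <= 1 -> Nle lam j n -> Nle (straighten lam s0 s1) j n.
Proof.
  intros H0 H01 H1 HN ts HA.
  destruct (splice lam (straighten lam s0 s1) j s0 s1 0 H0 H01 H1) with (ts := ts) (b := false) as (ts' & A & L); auto.
  - intros r Hr. apply straighten_out; lra.
  - intros r Hr. apply straighten_out; lra.
  - intros b qs Q. destruct (chord_strings _ _ _ _ _ _ H01 Q) as [->|[[L [S|S]]|[L [S S']]]]; rewrite ?L.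
    + exists []. simpl; auto.
    + exists [s0]. simpl. repeat split; auto; lra.
    + exists [s1]. simpl. repeat split; auto; lra.
    + exists [s0; s1]. simpl. repeat split; auto; lra.
  - apply HN in A. lia.
Qed.

Lemma sv_lip j z w e : 0 < e -> dm z w < e / (Rabs (IZR (sa j)) + Rabs (IZR (sb j)) + 1) -> Rabs (sv j z - sv j w) < e.
Proof.
  intros He H. apply dm_lt in H as [U1 U2]. set (A := Rabs (IZR (sa j))) in *. set (B := Rabs (IZR (sb j))) in *.
  assert (HA : 0 <= A) by apply Rabs_pos. assert (HB : 0 <= B) by apply Rabs_pos.
  set (q := e / (A + B + 1)) in *. assert (Eq : q * (A + B + 1) = e) by (unfold q; field; lra).
  assert (0 < q) by (apply Rdiv_lt_0_compat; lra).
  unfold sv. replace (IZR (sa j) * fst z + IZR (sb j) * snd z - (IZR (sa j) * fst w + IZR (sb j) * snd w))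
    with (IZR (sa j) * (fst z - fst w) + IZR (sb j) * (snd z - snd w)) by ring.
  eapply Rle_lt_trans; [apply Rabs_triang|]. rewrite !Rabs_mult. fold A B.
  assert (A * Rabs (fst z - fst w) <= A * q) by (apply Rmult_le_compat_l; lra).
  assert (B * Rabs (snd z - snd w) <= B * q) by (apply Rmult_le_compat_l; lra). lra.
Qed.

(** Changing sides alters [sv j] by more than 1, which by uniform continuity takes at least time
    [d]. *)
Lemma Nle_finite lam j : pathC lam -> exists n, Nle lam j n.
Proof.
  intros H. set (C := Rabs (IZR (sa j)) + Rabs (IZR (sb j)) + 1).
  assert (HC : 0 < C) by (unfold C; pose proof (Rabs_pos (IZR (sa j))); pose proof (Rabs_pos (IZR (sb j))); lra).
  destruct (unif_path 0 1 lam H (1 / C)) as [d [Hd HU]]. { apply Rdiv_lt_0_compat; lra. }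
  assert (Gap : forall b r r', 0 <= r <= 1 -> 0 <= r' <= 1 -> r <= r' -> sym j b (lam r) -> sym j (negb b) (lam r') -> d <= r' - r).
  { intros b r r' Hr Hr' Hrr S S'. apply Rnot_lt_le. intros Hlt. specialize (HU r r' Hr Hr'). rewrite Rabs_minus_sym, Rabs_right in HU by lra.
    specialize (HU Hlt). apply sv_lip in HU; [|lra]. rename HU into H0.
    apply Rabs_lt_iff in H0. destruct b; simpl in *; lra. }
  assert (L : forall ts b r, 0 <= r <= 1 -> sym j b (lam r) -> alts lam j (negb b) r 1 ts -> INR (length ts) * d <= 1 - r).
  { induction ts as [|r' ts IH]; intros b r Hr S A.
    - simpl. lra.
    - destruct A as (A1 & A2 & A3). specialize (IH (negb b) r' ltac:(lra) A2 A3).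
      specialize (Gap b r r' Hr ltac:(lra) ltac:(lra) S A2). simpl length. rewrite S_INR. lra. }
  destruct (INR_unbounded (/ d)) as [n Hn]. exists (Datatypes.S n). intros ts A. destruct ts as [|r ts]; [simpl; lia|].
  destruct A as (A1 & A2 & A3). specialize (L ts false r A1 A2 A3). simpl. apply le_n_S. apply INR_le.
  apply Rmult_le_reg_r with d; auto. assert (1 < INR n * d); [|lra].
  apply Rmult_lt_reg_r with (/ d). { now apply Rinv_0_lt_compat. } rewrite Rmult_assoc, Rinv_r; lra.
Qed.

Lemma alts_near lam j ts : forall b s T, 0 <= s -> T <= 1 -> alts lam j b s T ts ->
  exists e, 0 < e /\ forall mu, (forall r, 0 <= r <= 1 -> dm (lam r) (mu r) < e) -> alts mu j b s T ts.
Proof.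
  induction ts as [|r ts IH]; intros b s T Hs HT A.
  - exists 1. split; [lra|]. intros; exact I.
  - destruct A as (A1 & A2 & A3). destruct (IH (negb b) r T ltac:(lra) HT A3) as [e [He H]].
    set (C := Rabs (IZR (sa j)) + Rabs (IZR (sb j)) + 1).
    assert (HC : 0 < C) by (unfold C; pose proof (Rabs_pos (IZR (sa j))); pose proof (Rabs_pos (IZR (sb j))); lra).
    assert (exists g, 0 < g /\ forall z, Rabs (sv j (lam r) - sv j z) < g -> sym j b z) as [g [Hg HG]].
    { destruct b; simpl in *.
      - exists (sv j (lam r) - (IZR (sk j) + 1)). split; [lra|]. intros z Hz. apply Rabs_lt_iff in Hz. lra.
      - exists (IZR (sk j) - sv j (lam r)). split; [lra|]. intros z Hz. apply Rabs_lt_iff in Hz. lra. }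
    assert (0 < g / C) by now apply Rdiv_lt_0_compat.
    exists (Rmin e (g / C)). split; [now apply Rmin_pos|]. intros mu Hmu. split; auto. split.
    + apply HG. specialize (Hmu r ltac:(lra)). apply Rlt_min in Hmu as [_ U]. now apply sv_lip.
    + apply H. intros q Hq. specialize (Hmu q Hq). now apply Rlt_min in Hmu.
Qed.

(** The inequalities in [sym] are strict, so a given string survives small perturbations of the
    path. *)
Lemma Nle_lsc lam j n : (forall e, 0 < e -> exists mu, Nle mu j n /\ forall r, 0 <= r <= 1 -> dm (lam r) (mu r) < e) -> Nle lam j n.
Proof.
  intros H ts A. destruct (alts_near lam j ts false 0 1 ltac:(lra) ltac:(lra) A) as [e [He HE]].
  destruct (H e He) as [mu [HN Hmu]]. apply HN. now apply HE.
Qed.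

Lemma alts_reparam lam th j ts : (forall a b, 0 <= a -> a <= b -> b <= 1 -> th a <= th b) ->
  forall b s T, 0 <= s -> s <= T -> T <= 1 -> alts (fun r => lam (th r)) j b s T ts -> alts lam j b (th s) (th T) (map th ts).
Proof.
  intros Hm. induction ts as [|r ts IH]; simpl; auto. intros b s T H1 H2 H3 (A & B & C).
  split; [split; apply Hm; lra|]. split; auto. apply IH; auto; lra.
Qed.

Lemma Nle_reparam lam th j n : th 0 = 0 -> th 1 = 1 -> (forall a b, 0 <= a -> a <= b -> b <= 1 -> th a <= th b) -> Nle lam j n -> Nle (fun r => lam (th r)) j n.
Proof.
  intros T0 T1 Hm HN ts A. apply (alts_reparam lam th j ts Hm) in A; try lra. rewrite T0, T1 in A. apply HN in A. now rewrite length_map in A.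
Qed.

Lemma Nle_ext lam mu j n : (forall r, 0 <= r <= 1 -> lam r = mu r) -> Nle lam j n -> Nle mu j n.
Proof.
  intros E HN ts A. apply HN. eapply alts_ext; [|exact A]. apply alts_range in A. eapply Forall_impl; [|exact A]. simpl. intros r Hr. symmetry. now apply E.
Qed.

Lemma reparam01_surj phi : reparam01 phi -> forall r, 0 <= r <= 1 -> exists s, 0 <= s <= 1 /\ phi s = r.
Proof.
  intros (P0 & P1 & P2 & P3) r Hr. destruct (Req_dec r 0) as [->|]; [exists 0; split; [lra|auto]|].
  destruct (Req_dec r 1) as [->|]; [exists 1; split; [lra|auto]|].
  destruct (ivt 0 1 phi r) as [s [Hs E]]; try lra.
  - intros x Hx e He. destruct (P3 x Hx e He) as [d [Hd H']]. exists d. split; auto.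
  - exists s. split; [lra|auto].
Qed.

(** A weakly increasing [phi] has no inverse; preimages are chosen arbitrarily and still respect the
    order of the times of a string. *)
Lemma Nle_reparam_inv lam phi j n : reparam01 phi -> Nle (fun r => lam (phi r)) j n -> Nle lam j n.
Proof.
  intros HP HN. pose proof (reparam01_surj phi HP) as HS. destruct HP as (P0 & P1 & P2 & P3).
  assert (HS' : forall r, exists s, 0 <= r <= 1 -> 0 <= s <= 1 /\ phi s = r).
  { intros r. destruct (classic (0 <= r <= 1)) as [Hr|Hr]; [|exists 0; tauto]. destruct (HS r Hr) as [s Hs]. exists s; auto. }
  destruct (choice _ HS') as [g Hg].
  assert (Q : forall ts b r, 0 <= r <= 1 -> sym j b (lam r) -> alts lam j (negb b) r 1 ts -> alts (fun q => lam (phi q)) j (negb b) (g r) 1 (map g ts)).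
  { induction ts as [|q ts IH]; simpl; auto. intros b r Hr S (A & B & C).
    destruct (Hg r Hr) as [G1 G2]. destruct (Hg q ltac:(lra)) as [G3 G4]. split.
    (* Disorder would force [q = r], but consecutive times carry opposite symbols. *)
    - split; [|lra]. apply Rnot_lt_le. intros Hl. assert (phi (g q) <= phi (g r)) by (apply P2; unfold In01; lra).
      assert (q = r) by lra. subst q. exact (sym_excl _ _ _ S B).
    - rewrite G4. split; auto. apply IH; auto. lra. }
  intros ts A. destruct ts as [|r ts]; [simpl; lia|]. destruct A as (A1 & A2 & A3).
  assert (X : alts (fun q => lam (phi q)) j false 0 1 (map g (r :: ts))).
  { simpl. destruct (Hg r A1) as [G1 G2]. split; auto. rewrite G2. split; auto. apply (Q ts false r); auto. }
  apply HN in X. now rewrite length_map in X.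
Qed.

Lemma eqrep_Nle lam mu j n : eq_up_to_reparam lam mu -> Nle lam j n -> Nle mu j n.
Proof.
  intros (phi & psi & Hphi & Hpsi & E) HN. apply (Nle_reparam_inv mu psi j n Hpsi).
  apply (Nle_ext (fun r => lam (phi r))). { intros r Hr. now apply E. }
  destruct Hphi as (P0 & P1 & P2 & P3). apply Nle_reparam; auto. intros a b H1 H2 H3. apply P2; unfold In01; lra.
Qed.

(** * Rigidity *)

Lemma int_approx (x : R) : exists k, x < IZR k <= x + 1.
Proof. exists (up x). destruct (archimed x). lra. Qed.

(** A real functional that separates strictly is scaled up until its gap absorbs the rounding of the
    coefficients to integers and still contains a strip of width 1. *)
Lemma separate (a b : R) (x1 x2 y1 y2 : Cpl) :
  (forall x y, (x = x1 \/ x = x2) -> (y = y1 \/ y = y2) -> a * fst x + b * snd x < a * fst y + b * snd y) ->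
  exists j, sym j false x1 /\ sym j false x2 /\ sym j true y1 /\ sym j true y2.
Proof.
  intros H.
  set (g := Rmin (Rmin ((a * fst y1 + b * snd y1) - (a * fst x1 + b * snd x1)) ((a * fst y1 + b * snd y1) - (a * fst x2 + b * snd x2)))
                 (Rmin ((a * fst y2 + b * snd y2) - (a * fst x1 + b * snd x1)) ((a * fst y2 + b * snd y2) - (a * fst x2 + b * snd x2)))).
  assert (Hg : 0 < g). { pose proof (H x1 y1). pose proof (H x1 y2). pose proof (H x2 y1). pose proof (H x2 y2). unfold g. repeat apply Rmin_glb_lt; intuition lra. }
  assert (Hg' : forall x y, (x = x1 \/ x = x2) -> (y = y1 \/ y = y2) -> g <= (a * fst y + b * snd y) - (a * fst x + b * snd x)).
  { intros x y [->| ->] [->| ->]; unfold g, Rmin; repeat destruct Rle_dec; lra. }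
  set (D := dm x1 y1 + dm x1 y2 + dm x2 y1 + dm x2 y2).
  assert (HD : forall x y, (x = x1 \/ x = x2) -> (y = y1 \/ y = y2) -> Rabs (fst x - fst y) <= D /\ Rabs (snd x - snd y) <= D).
  { pose proof (dm_pos x1 y1). pose proof (dm_pos x1 y2). pose proof (dm_pos x2 y1). pose proof (dm_pos x2 y2).
    intros x y [->| ->] [->| ->]; apply dm_le; unfold D; lra. }
  (* Rounding costs at most [D] in each coordinate, so the integral functional keeps a gap above 3,
     room for an integer [k] and [k + 1]. *)
  destruct (INR_unbounded ((2 * D + 3) / g)) as [N HN].
  assert (HNg : 2 * D + 3 < INR N * g).
  { apply Rmult_lt_reg_r with (/ g). { now apply Rinv_0_lt_compat. } rewrite Rmult_assoc, Rinv_r; lra. }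
  destruct (int_approx (INR N * a)) as [A HA]. destruct (int_approx (INR N * b)) as [B HB].
  set (w := fun z : Cpl => IZR A * fst z + IZR B * snd z).
  assert (Hw : forall x y, (x = x1 \/ x = x2) -> (y = y1 \/ y = y2) -> 3 < w y - w x).
  { intros x y Hx Hy. specialize (Hg' x y Hx Hy). destruct (HD x y Hx Hy) as [D1 D2]. apply Rabs_le_iff in D1, D2. unfold w.
    replace (IZR A * fst y + IZR B * snd y - (IZR A * fst x + IZR B * snd x)) with
      (INR N * ((a * fst y + b * snd y) - (a * fst x + b * snd x)) + (IZR A - INR N * a) * (fst y - fst x) + (IZR B - INR N * b) * (snd y - snd x)) by ring.
    pose proof (pos_INR N).
    assert (P1 : - D <= (IZR A - INR N * a) * (fst y - fst x)) by nra.
    assert (P2 : - D <= (IZR B - INR N * b) * (snd y - snd x)) by nra.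
    assert (P3 : INR N * g <= INR N * ((a * fst y + b * snd y) - (a * fst x + b * snd x))) by (apply Rmult_le_compat_l; lra). lra. }
  destruct (int_approx (Rmax (w x1) (w x2))) as [k Hk].
  pose proof (Rmax_l (w x1) (w x2)). pose proof (Rmax_r (w x1) (w x2)).
  exists (Strip A B k). unfold sym, sv; simpl. fold (w x1) (w x2) (w y1) (w y2).
  pose proof (Hw x1 y1 ltac:(auto) ltac:(auto)). pose proof (Hw x1 y2 ltac:(auto) ltac:(auto)).
  pose proof (Hw x2 y1 ltac:(auto) ltac:(auto)). pose proof (Hw x2 y2 ltac:(auto) ltac:(auto)).
  revert Hk H0 H1. unfold Rmax. destruct Rle_dec; intros; repeat split; lra.
Qed.

(** A longest string of the straightened path would extend by two alternations to a string of [lam],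
    which by hypothesis alternates no more often. *)
Lemma extra_not lam s0 s1 j : pathC lam -> 0 <= s0 -> s0 < s1 -> s1 <= 1 ->
  (forall n, Nle (straighten lam s0 s1) j n -> Nle lam j n) ->
  (forall b ts, alts (straighten lam s0 s1) j b s0 s1 ts -> exists ts', alts lam j b s0 s1 ts' /\ length ts' = (length ts + 2 * 1)%nat) -> False.
Proof.
  intros HC H0 H01 H1 HN HS.
  destruct (Nle_finite lam j HC) as [n0 Hn0].
  assert (F : exists m, Nle (straighten lam s0 s1) j m /\ exists ts, alts (straighten lam s0 s1) j false 0 1 ts /\ length ts = m).
  { apply straighten_Nle with (s0 := s0) (s1 := s1) in Hn0; auto. induction n0 as [|n IH].
    - exists O. split; auto. exists []. simpl; auto.
    - destruct (classic (exists ts, alts (straighten lam s0 s1) j false 0 1 ts /\ length ts = S n)) as [E|E]; [eauto|].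
      apply IH. intros ts A. specialize (Hn0 ts A). destruct (Nat.eq_dec (length ts) (S n)); [exfalso; eauto|lia]. }
  destruct F as (m & Hm & ts & A & L). apply HN in Hm.
  destruct (splice lam (straighten lam s0 s1) j s0 s1 1 H0 H01 H1) with (ts := ts) (b := false) as (ts' & A' & L'); auto.
  - intros r Hr. apply straighten_out; lra.
  - intros r Hr. apply straighten_out; lra.
  - apply Hm in A'. lia.
Qed.

(** Testing with the two normals of the chord puts [w] on its line, testing with the two directions
    of the chord puts it between the ends. The repeated disjunct matches [separate] with both upper
    points equal. *)
Lemma on_segment (z0 z1 w : Cpl) : (forall a b, ~ (forall x y, (x = z0 \/ x = z1) -> (y = w \/ y = w) -> a * fst x + b * snd x < a * fst y + b * snd y)) ->
  exists t, In01 t /\ w = lerp z0 z1 t.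
Proof.
  intros H. destruct z0 as [x0 y0], z1 as [x1 y1], w as [x y].
  assert (H' : forall a b, ~ (a * x0 + b * y0 < a * x + b * y /\ a * x1 + b * y1 < a * x + b * y)).
  { intros a b [A B]. apply (H a b). intros p q [->| ->] [->| ->]; simpl; auto. }
  destruct (classic (x0 = x1 /\ y0 = y1)) as [[-> ->]|Hne].
  - exists 0. split; [unfold In01; lra|]. pose proof (H' (x - x1) (y - y1)) as Q.
    assert (E : (x - x1) * (x - x1) + (y - y1) * (y - y1) <= 0). { apply Rnot_lt_le. intros L. apply Q. split; lra. }
    destruct (Rplus_sqr_eq_0 (x - x1) (y - y1)) as [EX EY]. { pose proof (Rle_0_sqr (x - x1)). pose proof (Rle_0_sqr (y - y1)). unfold Rsqr in *. lra. } unfold lerp; simpl. f_equal; lra.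
  - set (dx := x1 - x0). set (dy := y1 - y0).
    assert (Hd : 0 < dx * dx + dy * dy).
    { destruct (Req_dec dx 0) as [Ex|Ex]; [|pose proof (Rsqr_pos_lt dx Ex); unfold Rsqr in *; nra].
      destruct (Req_dec dy 0) as [Ey|Ey]; [|pose proof (Rsqr_pos_lt dy Ey); unfold Rsqr in *; nra].
      exfalso. apply Hne. unfold dx, dy in *. lra. }
    assert (C0 : dx * (y - y0) - dy * (x - x0) = 0).
    { pose proof (H' (- dy) dx). pose proof (H' dy (- dx)). unfold dx, dy in *. nra. }
    set (N := dx * dx + dy * dy) in *. set (P := dx * (x - x0) + dy * (y - y0)).
    assert (P0 : 0 <= P). { apply Rnot_lt_le. intros L. apply (H' (- dx) (- dy)). unfold P, N, dx, dy in *. nra. }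
    assert (P1 : P <= N). { apply Rnot_lt_le. intros L. apply (H' dx dy). unfold P, N, dx, dy in *. nra. }
    exists (P / N). split.
    + split. { apply Rmult_le_pos; [lra|]. left. now apply Rinv_0_lt_compat. }
      apply Rmult_le_reg_r with N; auto. unfold Rdiv. rewrite Rmult_assoc, Rinv_l; lra.
    + unfold lerp; simpl.
      assert (EX : (x - x0) * N = P * dx). { unfold P, N. transitivity (dx * (dx * (x - x0) + dy * (y - y0)) - dy * (dx * (y - y0) - dy * (x - x0))); [ring|]. rewrite C0. ring. }
      assert (EY : (y - y0) * N = P * dy). { unfold P, N. transitivity (dy * (dx * (x - x0) + dy * (y - y0)) + dx * (dx * (y - y0) - dy * (x - x0))); [ring|]. rewrite C0. ring. }
      assert (X2 : x - x0 = P / N * dx). { apply Rmult_eq_reg_r with N; [|lra]. rewrite EX. field. lra. }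
      assert (Y2 : y - y0 = P / N * dy). { apply Rmult_eq_reg_r with N; [|lra]. rewrite EY. field. lra. }
      unfold dx, dy in *. f_equal; lra.
Qed.

(** A point of the arc off the chord is separated from both ends by a strip that the arc visits and
    leaves, while the chord stays on one side: two extra alternations. Hence the arc lies on the
    chord, and by the same count it never turns back. *)
Theorem rigid lam s0 s1 : pathC lam -> 0 <= s0 -> s0 < s1 -> s1 <= 1 ->
  (forall j n, Nle (straighten lam s0 s1) j n -> Nle lam j n) ->
  exists psi, reparam01 psi /\ (forall u, In01 u -> In01 (psi u)) /\ forall u, In01 u -> rs lam s0 s1 u = lerp (lam s0) (lam s1) (psi u).
Proof.
  intros HC H0 H01 H1 HN. set (z0 := lam s0). set (z1 := lam s1).
  assert (Seg : forall s, s0 <= s <= s1 -> exists t, In01 t /\ lam s = lerp z0 z1 t).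
  { intros s Hs. apply on_segment. intros a b Q. destruct (separate a b z0 z1 (lam s) (lam s) Q) as [j (J1 & J2 & J3 & _)].
    apply (extra_not lam s0 s1 j HC H0 H01 H1 (HN j)).
    intros bb ts A. destruct (chord_strings _ _ _ _ _ _ H01 A) as [->|[[L SS]|[L [SS SS']]]]; rewrite ?L; simpl length.
    - destruct bb; [exists [s; s1]|exists [s0; s]]; simpl; repeat split; auto; lra.
    - destruct bb. { exfalso. destruct SS as [SS|SS]; eapply (sym_excl j true); eauto. }
      exists [s0; s; s1]; simpl; repeat split; auto; lra.
    - exfalso. destruct bb; [eapply (sym_excl j true); [exact SS|exact J1]|eapply (sym_excl j true); [exact SS'|exact J2]]. }
  destruct (classic (z0 = z1)) as [E|E].
  { exists (fun u => u). split; [|split; [auto|]].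
    - unfold reparam01. repeat split; auto. intros s Hs e He. exists e. auto.
    - intros u Hu. destruct (Seg (s0 + u * (s1 - s0))) as [t [Ht Et]]. { unfold In01 in Hu. nra. }
      unfold rs. rewrite Et, <- E, !lerp_same. reflexivity. }
  set (dx := fst z1 - fst z0). set (dy := snd z1 - snd z0).
  assert (Hd : 0 < dx * dx + dy * dy).
  { destruct (Req_dec dx 0) as [Ex|Ex]; [|pose proof (Rsqr_pos_lt dx Ex); unfold Rsqr in *; nra].
    destruct (Req_dec dy 0) as [Ey|Ey]; [|pose proof (Rsqr_pos_lt dy Ey); unfold Rsqr in *; nra].
    exfalso. apply E. unfold dx, dy in *. destruct z0, z1; simpl in *. f_equal; lra. }
  set (N := dx * dx + dy * dy) in *.
  set (P := fun z : Cpl => (dx * (fst z - fst z0) + dy * (snd z - snd z0)) * / N).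
  assert (PL : forall t, P (lerp z0 z1 t) = t). { intros t. unfold P, lerp; simpl. unfold N, dx, dy in *. field. lra. }
  assert (Hpsi : forall u, In01 u -> In01 (P (rs lam s0 s1 u)) /\ rs lam s0 s1 u = lerp z0 z1 (P (rs lam s0 s1 u))).
  { intros u Hu. destruct (Seg (s0 + u * (s1 - s0))) as [t [Ht Et]]. { unfold In01 in Hu. nra. }
    unfold rs. rewrite Et, PL. auto. }
  exists (fun u => P (rs lam s0 s1 u)). split; [|split; intros u Hu; apply Hpsi; auto].
  assert (R0 : rs lam s0 s1 0 = z0) by (unfold rs, z0; f_equal; ring). assert (R1 : rs lam s0 s1 1 = z1) by (unfold rs, z1; f_equal; ring).
  split; [|split; [|split]].
  - rewrite R0. rewrite <- (lerp_0 z0 z1) at 1. apply PL.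
  - rewrite R1. rewrite <- (lerp_1 z0 z1) at 1. apply PL.
  (* A step backwards from [s] to [s']: a strip between the two positions is passed before [s],
     recrossed before [s'] and passed again before [s1], twice more than by the chord. *)
  - intros u u' Hu Hu' Huu. apply Rnot_lt_le. intros Hl.
    destruct (Hpsi u Hu) as [A1 A2], (Hpsi u' Hu') as [B1 B2]. set (p := P (rs lam s0 s1 u)) in *. set (q := P (rs lam s0 s1 u')) in *.
    set (s := s0 + u * (s1 - s0)). set (s' := s0 + u' * (s1 - s0)).
    assert (Hs : s0 <= s <= s') by (unfold s, s', In01 in *; nra). assert (Hs' : s' <= s1) by (unfold s', In01 in *; nra).
    change (rs lam s0 s1 u) with (lam s) in A2. change (rs lam s0 s1 u') with (lam s') in B2.
    destruct (separate dx dy z0 (lam s') (lam s) z1) as [j (J1 & J2 & J3 & J4)].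
    { assert (V : forall t, dx * fst (lerp z0 z1 t) + dy * snd (lerp z0 z1 t) = dx * fst z0 + dy * snd z0 + t * N) by (intros; unfold lerp, N, dx, dy; simpl; ring).
      unfold In01 in *. intros x y [->| ->] [->| ->].
      - rewrite A2, V. nra.
      - rewrite <- (lerp_1 z0 z1) at 1 2. rewrite V. nra.
      - rewrite A2, B2, !V. nra.
      - rewrite B2. rewrite <- (lerp_1 z0 z1) at 3 4. rewrite !V. nra. }
    apply (extra_not lam s0 s1 j HC H0 H01 H1 (HN j)).
    intros bb ts A. destruct (chord_strings _ _ _ _ _ _ H01 A) as [->|[[L SS]|[L [SS SS']]]]; rewrite ?L; simpl length.
    + destruct bb; [exists [s; s']|exists [s0; s]]; simpl; repeat split; auto; lra.
    + destruct bb; [exists [s; s'; s1]|exists [s0; s; s']]; simpl; repeat split; auto; lra.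
    + destruct bb; [exfalso; eapply (sym_excl j true); [exact SS|exact J1]|]. exists [s0; s; s'; s1]; simpl; repeat split; auto; lra.
  - assert (Q : contD dR dR In01 (fun u => P (rs lam s0 s1 u))).
    { assert (X : contD dR dm In01 (rs lam s0 s1)). { apply rs_cont; [lra|]. eapply contD_sub; [exact HC|]. unfold I01, In01; intros; lra. }
      unfold P. ctac. }
    intros x Hx e He. destruct (Q x Hx e He) as [d [Hd' H']]. exists d. split; auto.
Qed.

Lemma rigid_eqrep lam s0 s1 : pathC lam -> 0 <= s0 -> s0 < s1 -> s1 <= 1 ->
  (forall j n, Nle (straighten lam s0 s1) j n -> Nle lam j n) -> eq_up_to_reparam lam (straighten lam s0 s1).
Proof.
  intros HC H0 H01 H1 HN. destruct (rigid lam s0 s1 HC H0 H01 H1 HN) as (psi & (P0 & P1 & P2 & P3) & Pin & HP).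
  exists (fun s => s), (fun s => if Rle_dec s0 s then if Rle_dec s s1 then s0 + psi ((s - s0) / (s1 - s0)) * (s1 - s0) else s else s).
  assert (Rid : reparam01 (fun s => s)). { unfold reparam01. repeat split; auto. intros s Hs e He. exists e. auto. }
  assert (Z0 : (s0 - s0) / (s1 - s0) = 0) by (field; lra). assert (Z1 : (s1 - s0) / (s1 - s0) = 1) by (field; lra).
  split; auto. split.
  - split; [|split; [|split]].
    + destruct Rle_dec; auto. destruct Rle_dec; auto. replace s0 with 0 in * by lra. rewrite Z0, P0. ring.
    + destruct Rle_dec; auto. destruct Rle_dec; auto. replace s1 with 1 in * by lra. rewrite Z1, P1. ring.
    + intros a b Ha Hb Hab. repeat destruct Rle_dec; try lra.
      * assert (A := div01 a s0 s1 H01 ltac:(lra)). assert (B := div01 b s0 s1 H01 ltac:(lra)).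
        assert (psi ((a - s0) / (s1 - s0)) <= psi ((b - s0) / (s1 - s0))); [|nra]. apply P2; auto.
        unfold Rdiv. apply Rmult_le_compat_r; [|lra]. left; apply Rinv_0_lt_compat; lra.
      * assert (A := Pin _ (div01 a s0 s1 H01 ltac:(lra))). unfold In01 in A. nra.
      * assert (A := Pin _ (div01 b s0 s1 H01 ltac:(lra))). unfold In01 in A. nra.
    + assert (Q : contD dm dm (fun z => In01 (fst z)) (fun z => if Rle_dec s0 (fst z) then if Rle_dec (fst z) s1 then (s0 + psi ((fst z - s0) / (s1 - s0)) * (s1 - s0), 0) else (fst z, 0) else (fst z, 0))).
      { apply (paste3 _ (fun z => (fst z, 0)) (fun z => (s0 + psi ((fst z - s0) / (s1 - s0)) * (s1 - s0), 0)) s0 s1 H01).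
        - ctac.
        - assert (contD dm dR (fun z => In01 (fst z) /\ s0 <= fst z <= s1) (fun z => psi ((fst z - s0) / (s1 - s0)))).
          { apply (contD_comp dm dR dR _ In01 (fun z => (fst z - s0) / (s1 - s0)) psi).
            - unfold Rdiv. ctac.
            - intros x Hx e He. destruct (P3 x Hx e He) as [d [Hd H']]. exists d. split; auto.
            - intros z [_ Hz]. now apply div01. }
          ctac.
        - intros z _ ->. rewrite Z0, P0. f_equal. ring.
        - intros z _ ->. rewrite Z1, P1. f_equal. ring. }
      intros s Hs e He. destruct (Q (s, 0) Hs e He) as [d [Hd H']]. exists d. split; auto. intros s' Hs' Hss.
      specialize (H' (s', 0) Hs'). simpl in H'. assert (D : dm (s, 0) (s', 0) < d). { apply dm_lt; simpl. rewrite Rminus_diag, Rabs_R0. auto. }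
      specialize (H' D). apply dm_lt in H' as [H' _]. repeat destruct Rle_dec; simpl in *; auto.
  - intros s Hs. destruct (Rle_dec s0 s); [destruct (Rle_dec s s1)|].
    + assert (A := div01 s s0 s1 H01 ltac:(lra)). assert (B := Pin _ A). unfold In01 in B.
      rewrite straighten_in; [|lra|nra]. replace (s0 + psi ((s - s0) / (s1 - s0)) * (s1 - s0) - s0) with (psi ((s - s0) / (s1 - s0)) * (s1 - s0)) by ring.
      replace (psi ((s - s0) / (s1 - s0)) * (s1 - s0) / (s1 - s0)) with (psi ((s - s0) / (s1 - s0))) by (field; lra).
      rewrite <- HP; auto. unfold rs. f_equal. field. lra.
    + rewrite straighten_out; auto; lra.
    + rewrite straighten_out; auto; lra.
Qed.

(** * Compactness up to reparametrization *)

Lemma nat_max (P : nat -> Prop) n : P O -> (forall m, P m -> (m <= n)%nat) -> exists m, P m /\ forall k, P k -> (k <= m)%nat.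
Proof.
  intros H0 Hn. induction n as [|n IH]; [exists O; auto|].
  destruct (classic (P (S n))) as [E|E]; [eauto|].
  apply IH. intros m Hm. specialize (Hn m Hm). destruct (Nat.eq_dec m (S n)) as [->|]; [tauto|lia].
Qed.

(** [c t] is the greatest length of a string on the interval from 0 to [t]. *)
Lemma count_exists lam j n : Nle lam j n -> exists c : R -> R, (forall t, 0 <= t <= 1 -> 0 <= c t <= INR n) /\
  (forall s t, 0 <= s -> s <= t -> t <= 1 -> c s <= c t) /\
  (forall s t b, 0 <= s -> s <= t -> t <= 1 -> sym j b (lam s) -> sym j (negb b) (lam t) -> c s + 1 <= c t).
Proof.
  intros HN.
  assert (H : forall t, exists m : nat, 0 <= t <= 1 -> (exists ts, alts lam j false 0 t ts /\ length ts = m) /\ forall ts, alts lam j false 0 t ts -> (length ts <= m)%nat).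
  { intros t. destruct (classic (0 <= t <= 1)) as [Ht|]; [|exists O; tauto].
    destruct (nat_max (fun m => exists ts, alts lam j false 0 t ts /\ length ts = m) n) as [m [A B]].
    - exists []. simpl; auto.
    - intros m [ts [A <-]]. apply HN. eapply alts_le; [| |exact A]; lra.
    - exists m. intros _. split; auto. intros ts A'. apply B. eauto. }
  destruct (choice _ H) as [c Hc]. exists (fun t => INR (c t)). split; [|split].
  - intros t Ht. split; [apply pos_INR|]. apply le_INR. destruct (Hc t Ht) as [[ts [A <-]] _]. apply HN. eapply alts_le; [| |exact A]; lra.
  - intros s t H1 H2 H3. apply le_INR. destruct (Hc s ltac:(lra)) as [[ts [A <-]] _]. apply Hc; [lra|]. eapply alts_le; [| |exact A]; lra.
  - intros s t b H1 H2 H3 S1 S2. rewrite <- S_INR. apply le_INR. destruct (Hc s ltac:(lra)) as [[ts [A L]] M].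
    (* The symbol due after a longest string up to [s] cannot be [b], or [s] itself would prolong
       the string; so it is [negb b], and [t] prolongs it. *)
    destruct (Bool.bool_dec (flip false (length ts)) b) as [E|E].
    + exfalso. assert (X : alts lam j false 0 s (ts ++ [s])). { apply (alts_app _ _ _ _ _ s); auto; try lra. rewrite E. simpl. repeat split; auto; lra. }
      apply M in X. rewrite length_app in X. simpl in X. lia.
    + assert (X : alts lam j false 0 t (ts ++ [t])).
      { apply (alts_app _ _ _ _ _ s); auto. replace (flip false (length ts)) with (negb b) by (destruct b, (flip false (length ts)); simpl in *; congruence).
        simpl. repeat split; auto; lra. }
      apply Hc in X; [|lra]. rewrite length_app in X. simpl in X. lia.
Qed.

Lemma counts_exist lam (nf : strip -> nat) L : (forall j, Nle lam j (nf j)) -> exists c : R -> R,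
  (forall t, 0 <= t <= 1 -> 0 <= c t <= fold_right (fun j x => INR (nf j) + x) 0 L) /\
  (forall s t, 0 <= s -> s <= t -> t <= 1 -> c s <= c t) /\
  (forall j s t b, In j L -> 0 <= s -> s <= t -> t <= 1 -> sym j b (lam s) -> sym j (negb b) (lam t) -> c s + 1 <= c t).
Proof.
  intros HN. induction L as [|j L (c & C1 & C2 & C3)].
  - exists (fun _ => 0). simpl. repeat split; intros; try lra; tauto.
  - destruct (count_exists lam j (nf j) (HN j)) as (c' & C1' & C2' & C3'). exists (fun t => c' t + c t). simpl. split; [|split].
    + intros t Ht. specialize (C1 t Ht). specialize (C1' t Ht). lra.
    + intros s t H1 H2 H3. specialize (C2 s t H1 H2 H3). specialize (C2' s t H1 H2 H3). lra.
    + intros i s t b [->|Hi] H1 H2 H3 S1 S2.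
      * specialize (C2 s t H1 H2 H3). specialize (C3' s t b H1 H2 H3 S1 S2). lra.
      * specialize (C2' s t H1 H2 H3). specialize (C3 i s t b Hi H1 H2 H3 S1 S2). lra.
Qed.

Definition zrange (K : Z) : list Z := map (fun i => (Z.of_nat i - K)%Z) (seq 0 (Z.to_nat (2 * K + 1))).

Lemma zrange_in K k : (- K <= k <= K)%Z -> In k (zrange K).
Proof.
  intros H. unfold zrange. apply in_map_iff. exists (Z.to_nat (k + K)). split; [lia|]. apply in_seq. lia.
Qed.

(** Points at distance [e] differ by [e] in one coordinate; scaled by [N > 3 / e] the difference
    exceeds 3 and contains a whole strip. Boundedness leaves finitely many levels. *)
Lemma strips_exist e Rad : 0 < e -> 0 < Rad -> exists L : list strip, forall z w, dm z (0, 0) <= Rad -> dm w (0, 0) <= Rad -> e <= dm z w ->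
  exists j b, In j L /\ sym j b z /\ sym j (negb b) w.
Proof.
  intros He HR. destruct (int_approx (3 / e)) as [N [HN _]]. destruct (int_approx (IZR N * Rad + 1)) as [K [HK _]].
  assert (HNe : 3 < IZR N * e). { apply Rmult_lt_reg_r with (/ e). { now apply Rinv_0_lt_compat. } rewrite Rmult_assoc, Rinv_r; lra. }
  assert (HNp : 0 < IZR N). { eapply Rlt_trans; [|exact HN]. apply Rdiv_lt_0_compat; lra. }
  assert (Mid : forall a b, Rabs a <= Rad -> Rabs b <= Rad -> e <= b - a -> exists k, In k (zrange K) /\ IZR N * a < IZR k /\ IZR k + 1 < IZR N * b).
  { intros a b Ha Hb Hab. apply Rabs_le_iff in Ha, Hb. destruct (int_approx (IZR N * a)) as [k Hk]. exists k.
    assert (A1 : - (IZR N * Rad) <= IZR N * a) by nra. assert (A2 : IZR N * a <= IZR N * Rad) by nra. split; [|split; [lra|nra]].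
    apply zrange_in. split; apply le_IZR; [rewrite opp_IZR|]; lra. }
  exists (flat_map (fun k => [Strip N 0 k; Strip 0 N k]) (zrange K)).
  assert (InL : forall k, In k (zrange K) -> In (Strip N 0 k) (flat_map (fun k => [Strip N 0 k; Strip 0 N k]) (zrange K)) /\ In (Strip 0 N k) (flat_map (fun k => [Strip N 0 k; Strip 0 N k]) (zrange K))).
  { intros k Hk. split; apply in_flat_map; exists k; simpl; auto. }
  intros z w Hz Hw Hd. apply dm_le in Hz as [Z1 Z2], Hw as [W1 W2]. simpl in *. rewrite Rminus_0_r in *.
  unfold dm in Hd. apply Rmax_Rle in Hd. unfold sym, sv.
  destruct Hd as [Hd|Hd]; (unfold Rabs in Hd; destruct Rcase_abs).
  - destruct (Mid (fst z) (fst w)) as (k & Hk & K1 & K2); auto; try lra. exists (Strip N 0 k), false. simpl. split; [apply InL; auto|lra].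
  - destruct (Mid (fst w) (fst z)) as (k & Hk & K1 & K2); auto; try lra. exists (Strip N 0 k), true. simpl. split; [apply InL; auto|lra].
  - destruct (Mid (snd z) (snd w)) as (k & Hk & K1 & K2); auto; try lra. exists (Strip 0 N k), false. simpl. split; [apply InL; auto|lra].
  - destruct (Mid (snd w) (snd z)) as (k & Hk & K1 & K2); auto; try lra. exists (Strip 0 N k), true. simpl. split; [apply InL; auto|lra].
Qed.

(* Truncated variation: unlike crossing counts it depends continuously on the endpoint, so it can be used to reparametrize. *)
Fixpoint tv (e : R) (lam : R -> Cpl) (s : R) (ts : list R) : R :=
  match ts with [] => 0 | r :: ts' => Rmax 0 (dm (lam s) (lam r) - e) + tv e lam r ts' end.

Fixpoint inc (s T : R) (ts : list R) : Prop :=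
  match ts with [] => True | r :: ts' => s <= r <= T /\ inc r T ts' end.

Lemma tv_snoc2 e lam ts s t : forall a, tv e lam a ts + Rmax 0 (dm (lam s) (lam t) - e) <= tv e lam a (ts ++ [s; t]).
Proof.
  induction ts as [|r ts IH]; intros a; simpl.
  - pose proof (Rmax_l 0 (dm (lam a) (lam s) - e)). lra.
  - specialize (IH r). lra.
Qed.

Lemma inc_snoc2 ts s t : s <= t -> forall a, a <= s -> inc a s ts -> inc a t (ts ++ [s; t]).
Proof.
  intros Hst. induction ts as [|r ts IH]; simpl; intros a Ha H.
  - repeat split; auto; lra.
  - split; [lra|]. apply IH; [lra|tauto].
Qed.

Lemma tv_small e lam s t : (forall r r', s <= r <= t -> s <= r' <= t -> dm (lam r) (lam r') <= e) ->
  forall ts a, s <= a <= t -> inc a t ts -> tv e lam a ts = 0.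
Proof.
  intros H. induction ts as [|r ts IH]; simpl; auto. intros a Ha [H1 H2]. rewrite IH; [|lra|auto].
  rewrite Rmax_left; [lra|]. specialize (H a r Ha ltac:(lra)). lra.
Qed.

(** After [s] the oscillation is at most [2 * eta <= e], so only the term straddling [s] still
    counts, exceeding its part before [s] by at most [eta]. *)
Lemma tv_cut e lam s t eta : s <= t -> 2 * eta <= e -> (forall r, s <= r <= t -> dm (lam s) (lam r) <= eta) ->
  forall ts a, a <= s -> inc a t ts -> exists ts', inc a s ts' /\ tv e lam a ts <= tv e lam a ts' + eta.
Proof.
  intros Hst He H.
  assert (Heta : 0 <= eta). { eapply Rle_trans; [apply (dm_pos (lam s) (lam s))|apply H; lra]. }
  induction ts as [|r ts IH]; intros a Ha HI.
  - exists []. simpl. split; auto; lra.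
  - destruct HI as [H1 H2]. destruct (Rle_dec r s) as [L|L].
    + destruct (IH r L H2) as [ts' [A B]]. exists (r :: ts'). simpl. split; [split; auto; lra|lra].
    + exists [s]. simpl. split; [split; auto; lra|].
      rewrite (tv_small e lam s t) with (a := r); auto; [|intros r0 r' H0 H3|lra].
      * specialize (H r ltac:(lra)). pose proof (dm_tri (lam a) (lam s) (lam r)). unfold Rmax; repeat destruct Rle_dec; lra.
      * pose proof (H r0 H0). pose proof (H r' H3). pose proof (dm_tri (lam r0) (lam s) (lam r')). rewrite (dm_sym (lam r0) (lam s)) in *. lra.
Qed.

(** [F t] is the supremum of the truncated variations up to [t]. Only moves longer than [e]
    contribute, each at most [D] and each raising the count [c] by one, which bounds [F]; [tv_cut]
    makes it continuous. *)
Lemma tvar lam e D B (c : R -> R) : pathC lam -> 0 < e -> 0 < D -> (forall s t, In01 s -> In01 t -> dm (lam s) (lam t) <= D) ->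
  (forall t, 0 <= t <= 1 -> 0 <= c t <= B) -> (forall s t, 0 <= s -> s <= t -> t <= 1 -> c s <= c t) ->
  (forall s t, 0 <= s -> s <= t -> t <= 1 -> e <= dm (lam s) (lam t) -> c s + 1 <= c t) ->
  exists F, contD dR dR In01 F /\ (forall t, In01 t -> 0 <= F t <= D * B) /\
    (forall s t, 0 <= s -> s <= t -> t <= 1 -> F s <= F t /\ dm (lam s) (lam t) <= e + (F t - F s)).
Proof.
  intros HL He HD Hdm C1 C2 C3.
  assert (Bd : forall ts a, 0 <= a <= 1 -> inc a 1 ts -> tv e lam a ts <= D * (B - c a)).
  { induction ts as [|r ts IH]; intros a Ha HI; simpl.
    - apply Rmult_le_pos; [lra|]. specialize (C1 a Ha). lra.
    - destruct HI as [H1 H2]. specialize (IH r ltac:(lra) H2). assert (Rmax 0 (dm (lam a) (lam r) - e) <= D * (c r - c a)); [|lra].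
      specialize (C2 a r ltac:(lra) ltac:(lra) ltac:(lra)). apply Rmax_lub; [apply Rmult_le_pos; lra|].
      destruct (Rle_dec e (dm (lam a) (lam r))) as [L|L].
      + specialize (C3 a r ltac:(lra) ltac:(lra) ltac:(lra) L). specialize (Hdm a r Ha ltac:(unfold In01; lra)). nra.
      + assert (0 <= D * (c r - c a)) by (apply Rmult_le_pos; lra). lra. }
  assert (Inc1 : forall ts a t, t <= 1 -> inc a t ts -> inc a 1 ts).
  { induction ts as [|r ts IH]; simpl; auto. intros a t Ht [H1 H2]. split; [lra|]. eapply IH; eauto. }
  assert (H : forall t, exists x, In01 t -> is_lub (fun y => exists ts, inc 0 t ts /\ y = tv e lam 0 ts) x).
  { intros t. destruct (classic (In01 t)) as [Ht|]; [|exists 0; tauto].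
    destruct (completeness (fun y => exists ts, inc 0 t ts /\ y = tv e lam 0 ts)) as [x Hx]; [| |exists x; auto].
    - exists (D * (B - c 0)). intros y [ts [A ->]]. apply Bd; [lra|]. eapply Inc1; [|exact A]. unfold In01 in Ht; lra.
    - exists 0, []. simpl. auto. }
  destruct (choice _ H) as [F HF].
  assert (Mono : forall s t, 0 <= s -> s <= t -> t <= 1 -> F s + Rmax 0 (dm (lam s) (lam t) - e) <= F t).
  { intros s t H1 H2 H3. destruct (HF s ltac:(unfold In01; lra)) as [_ S2]. destruct (HF t ltac:(unfold In01; lra)) as [T1 _].
    assert (F s <= F t - Rmax 0 (dm (lam s) (lam t) - e)); [|lra]. apply S2. intros y [ts [A ->]].
    specialize (T1 (tv e lam 0 (ts ++ [s; t]))). pose proof (tv_snoc2 e lam ts s t 0).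
    assert (tv e lam 0 (ts ++ [s; t]) <= F t); [|lra]. apply T1. exists (ts ++ [s; t]). split; auto. now apply inc_snoc2. }
  assert (Cut : forall s t eta, 0 <= s -> s <= t -> t <= 1 -> 2 * eta <= e -> (forall r, s <= r <= t -> dm (lam s) (lam r) <= eta) -> F t <= F s + eta).
  { intros s t eta H1 H2 H3 H4 H5. destruct (HF s ltac:(unfold In01; lra)) as [S1 _]. destruct (HF t ltac:(unfold In01; lra)) as [_ T2].
    apply T2. intros y [ts [A ->]]. destruct (tv_cut e lam s t eta H2 H4 H5 ts 0 H1 A) as [ts' [A' L]].
    assert (tv e lam 0 ts' <= F s); [|lra]. apply S1. eauto. }
  exists F. split; [|split].
  - intros x Hx eps Heps. set (eta := Rmin (eps / 2) (e / 2)).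
    assert (Hp : 0 < eta) by (apply Rmin_pos; lra). assert (eta <= eps / 2) by apply Rmin_l. assert (eta <= e / 2) by apply Rmin_r.
    destruct (unif_path 0 1 lam HL eta Hp) as [d [Hd HU]]. exists d. split; auto. intros y Hy Hxy. unfold dR in *. unfold In01 in *.
    destruct (Rle_dec x y) as [L|L].
    + assert (F y <= F x + eta). { apply Cut; try lra. intros r Hr. left. apply HU; try lra. rabs. }
      specialize (Mono x y ltac:(lra) L ltac:(lra)). pose proof (Rmax_l 0 (dm (lam x) (lam y) - e)). rabs.
    + assert (F x <= F y + eta). { apply Cut; try lra. intros r Hr. left. apply HU; try lra. rabs. }
      specialize (Mono y x ltac:(lra) ltac:(lra) ltac:(lra)). pose proof (Rmax_l 0 (dm (lam y) (lam x) - e)). rabs.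
  - intros t Ht. destruct (HF t Ht) as [T1 T2]. split. { apply T1. exists []. simpl. auto. }
    apply T2. intros y [ts [A ->]]. unfold In01 in Ht. assert (X := Bd ts 0 ltac:(lra) (Inc1 ts 0 t ltac:(lra) A)).
    specialize (C1 0 ltac:(lra)). nra.
  - intros s t H1 H2 H3. specialize (Mono s t H1 H2 H3). pose proof (Rmax_l 0 (dm (lam s) (lam t) - e)). pose proof (Rmax_r 0 (dm (lam s) (lam t) - e)). lra.
Qed.

Definition homeo (th : R -> R) : Prop :=
  contD dR dR In01 th /\ th 0 = 0 /\ th 1 = 1 /\ forall x y, In01 x -> In01 y -> x < y -> th x < th y.

Lemma homeo_le th x y : homeo th -> In01 x -> In01 y -> x <= y -> th x <= th y.
Proof. intros (_ & _ & _ & H) Hx Hy [L| ->]; [left; auto|lra]. Qed.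

Lemma homeo_in th x : homeo th -> In01 x -> In01 (th x).
Proof.
  intros H Hx. pose proof H as (_ & H0 & H1 & _). unfold In01 in *. rewrite <- H0 at 1. rewrite <- H1.
  split; apply homeo_le; auto; unfold In01; lra.
Qed.

Lemma homeo_inn th x : homeo th -> 0 < x < 1 -> 0 < th x < 1.
Proof.
  intros (_ & H0 & H1 & H) Hx. rewrite <- H0 at 1. rewrite <- H1.
  split; apply H; unfold In01; lra.
Qed.

Lemma homeo_inv th : homeo th -> exists th', homeo th' /\ (forall y, In01 y -> th (th' y) = y) /\ (forall x, In01 x -> th' (th x) = x).
Proof.
  intros (Hc & H0 & H1 & Hi). destruct (incr_inverse th Hc H0 H1 Hi) as (g & G1 & G2 & G3 & G4 & G5 & G6).
  exists g. split; [repeat split; auto|]. split; auto. intros y Hy. now apply G1.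
Qed.

Lemma path_reparam lam th : pathC lam -> homeo th -> pathC (fun x => lam (th x)).
Proof. intros H1 H2. eapply contD_comp; [apply H2|exact H1|]. intros x Hx. now apply homeo_in. Qed.

(** * A parametrization that controls finitely many variations at once *)

Section Equalize.
Variables (F : nat -> R -> R) (B : nat -> R).
Hypothesis (Fc : forall i, contD dR dR In01 (F i)) (Bpos : forall i, 0 < B i) (Fb : forall i t, In01 t -> 0 <= F i t <= B i).
Hypothesis Fm : forall i s t, 0 <= s -> s <= t -> t <= 1 -> F i s <= F i t.

(** The summand [t] makes the sum strictly increasing, and the weights keep its total growth below 1
    + 2 = 3. Its normalized inverse slows each [F i] down to the Lipschitz constant
    [3 * (2 ^ i * B i)], which depends on the bounds only. *)
Fixpoint wsum (k : nat) (t : R) : R := match k with O => t | S i => wsum i t + (/ 2) ^ i / B i * F i t end.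

Lemma equalize k : exists th, homeo th /\ forall i u u', (i < k)%nat -> In01 u -> In01 u' -> u <= u' ->
  F i (th u') - F i (th u) <= 3 * (2 ^ i * B i) * (u' - u).
Proof.
  assert (W : forall i, 0 < (/ 2) ^ i / B i). { intros i. apply Rdiv_lt_0_compat; auto. apply pow_lt; lra. }
  assert (Cc : forall k, contD dR dR In01 (wsum k)). { induction k0; simpl; ctac. apply Fc. }
  assert (Up : forall k s t, 0 <= s -> s <= t -> t <= 1 -> t - s <= wsum k t - wsum k s).
  { induction k0; simpl; intros s t H1 H2 H3; [lra|]. specialize (IHk0 s t H1 H2 H3). specialize (Fm k0 s t H1 H2 H3). specialize (W k0). nra. }
  assert (Up2 : forall i k s t, (i < k)%nat -> 0 <= s -> s <= t -> t <= 1 -> (/ 2) ^ i / B i * (F i t - F i s) <= wsum k t - wsum k s).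
  { intros i. induction k0; intros s t Hi H1 H2 H3; [lia|]. simpl. destruct (Nat.eq_dec i k0) as [->|].
    - specialize (Up k0 s t H1 H2 H3). lra.
    - specialize (IHk0 s t ltac:(lia) H1 H2 H3). specialize (Fm k0 s t H1 H2 H3). specialize (W k0). nra. }
  assert (Tot : forall k, wsum k 1 - wsum k 0 <= 1 + 2 * (1 - (/ 2) ^ k)).
  { induction k0; simpl; [lra|]. pose proof (Fb k0 1 in01_1). pose proof (Fb k0 0 in01_0). specialize (W k0).
    assert ((/ 2) ^ k0 / B k0 * (F k0 1 - F k0 0) <= (/ 2) ^ k0 / B k0 * B k0) by (apply Rmult_le_compat_l; lra).
    replace ((/ 2) ^ k0 / B k0 * B k0) with ((/ 2) ^ k0) in H1 by (field; specialize (Bpos k0); lra). lra. }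
  set (n := wsum k 1 - wsum k 0).
  assert (N1 : 1 <= n). { pose proof (Up k 0 1 ltac:(lra) ltac:(lra) ltac:(lra)). unfold n. lra. }
  assert (N3 : n <= 3). { specialize (Tot k). assert (0 < (/ 2) ^ k) by (apply pow_lt; lra). unfold n. lra. }
  assert (Hi : 0 < / n) by (apply Rinv_0_lt_compat; lra).
  destruct (homeo_inv (fun t => (wsum k t - wsum k 0) * / n)) as (th & H1 & H2 & H3).
  { split; [|split; [|split]].
    - pose proof (Cc k). ctac.
    - ring.
    - fold n. field. lra.
    - intros x y Hx Hy L. unfold In01 in *. apply Rmult_lt_compat_r; auto. specialize (Up k x y ltac:(lra) ltac:(lra) ltac:(lra)). lra. }
  exists th. split; auto. intros i u u' Hik Hu Hu' Huu.
  assert (A := homeo_in th u H1 Hu). assert (A' := homeo_in th u' H1 Hu'). assert (Am := homeo_le th u u' H1 Hu Hu' Huu). unfold In01 in A, A'.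
  pose proof (Up2 i k (th u) (th u') Hik ltac:(lra) Am ltac:(lra)) as U.
  pose proof (H2 u Hu) as E. pose proof (H2 u' Hu') as E'. simpl in E, E'.
  assert (D : wsum k (th u') - wsum k (th u) = n * (u' - u)).
  { rewrite <- E at 2. rewrite <- E' at 2. field. lra. }
  rewrite D in U. specialize (W i). assert (P : 0 < 2 ^ i) by (apply pow_lt; lra). specialize (Bpos i).
  assert (V : (2 ^ i * B i) * ((/ 2) ^ i / B i * (F i (th u') - F i (th u))) <= (2 ^ i * B i) * (n * (u' - u))).
  { apply Rmult_le_compat_l; auto. apply Rmult_le_pos; lra. }
  replace ((2 ^ i * B i) * ((/ 2) ^ i / B i * (F i (th u') - F i (th u)))) with (F i (th u') - F i (th u)) in V by (rewrite pow_inv; field; lra).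
  assert ((2 ^ i * B i) * (n * (u' - u)) <= (2 ^ i * B i) * (3 * (u' - u))); [|lra].
  apply Rmult_le_compat_l; [apply Rmult_le_pos; lra|]. apply Rmult_le_compat_r; lra.
Qed.
End Equalize.

Lemma unif_limit lam : (forall e, 0 < e -> exists mu, pathC mu /\ forall r, In01 r -> dm (lam r) (mu r) < e) -> pathC lam.
Proof.
  intros H x Hx e He. destruct (H (e / 3)) as [mu [Hm Hc]]; [lra|]. destruct (Hm x Hx (e / 3)) as [d [Hd HD]]; [lra|].
  exists d. split; auto. intros y Hy Hxy. specialize (HD y Hy Hxy). pose proof (Hc x Hx). pose proof (Hc y Hy).
  pose proof (dm_tri (lam x) (mu x) (lam y)). pose proof (dm_tri (mu x) (mu y) (lam y)). rewrite (dm_sym (mu y)) in H3. lra.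
Qed.

(** At each scale [/ (INR i + 1)] the crossing bounds give truncated variations below a constant
    [B i] common to all paths. Equalizing the first [k] of them on the [k]-th path yields asymptotic
    equicontinuity, and [ascoli] applies to each coordinate. *)
Theorem compact_paths (lam : nat -> R -> Cpl) (nf : strip -> nat) Rad : 0 < Rad -> (forall k, pathC (lam k)) ->
  (forall k t, In01 t -> dm (lam k t) (0, 0) <= Rad) -> (forall k j, Nle (lam k) j (nf j)) ->
  exists (s : nat -> nat) (th : nat -> R -> R) (L : R -> Cpl), (forall k, (k <= s k)%nat) /\ (forall k, homeo (th k)) /\
    forall e, 0 < e -> exists K, forall k, (K <= k)%nat -> forall x, In01 x -> dm (lam (s k) (th k x)) (L x) < e.
Proof.
  intros HR HL HB HN.
  assert (St : forall i : nat, exists B, 0 < B /\ forall k, exists F, contD dR dR In01 F /\ (forall t, In01 t -> 0 <= F t <= B) /\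
    (forall s t, 0 <= s -> s <= t -> t <= 1 -> F s <= F t /\ dm (lam k s) (lam k t) <= / (INR i + 1) + (F t - F s))).
  { intros i. destruct (strips_exist (/ (INR i + 1)) Rad (inv_succ_pos i) HR) as [J HJ].
    set (b := fold_right (fun j x => INR (nf j) + x) 0 J).
    assert (Hb : 0 <= b). { unfold b. clear. induction J as [|j J IH]; simpl; [lra|]. pose proof (pos_INR (nf j)). lra. }
    exists (2 * Rad * b + 1). split; [nra|]. intros k. destruct (counts_exist (lam k) nf J (HN k)) as (c & C1 & C2 & C3). fold b in C1.
    destruct (tvar (lam k) (/ (INR i + 1)) (2 * Rad) b c) as (F & F1 & F2 & F3); auto; try lra.
    - apply inv_succ_pos.
    - intros s t Hs Ht. pose proof (HB k s Hs). pose proof (HB k t Ht). pose proof (dm_tri (lam k s) (0,0) (lam k t)). rewrite (dm_sym (0,0)) in H1. lra.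
    - intros s t H1 H2 H3 He. destruct (HJ (lam k s) (lam k t)) as (j & bb & Hj & S1 & S2); auto; try (apply HB; unfold In01; lra).
      apply (C3 j s t bb); auto.
    - exists F. split; auto. split; auto. intros t Ht. specialize (F2 t Ht). lra. }
  destruct (choice _ St) as [B HB'].
  assert (St2 : forall p : nat * nat, exists F, contD dR dR In01 F /\ (forall t, In01 t -> 0 <= F t <= B (fst p)) /\
    (forall s t, 0 <= s -> s <= t -> t <= 1 -> F s <= F t /\ dm (lam (snd p) s) (lam (snd p) t) <= / (INR (fst p) + 1) + (F t - F s))).
  { intros [i k]. apply HB'. }
  destruct (choice _ St2) as [F HF].
  assert (St3 : forall k, exists th, homeo th /\ forall i u u', (i < k)%nat -> In01 u -> In01 u' -> u <= u' ->
    F (i, k) (th u') - F (i, k) (th u) <= 3 * (2 ^ i * B i) * (u' - u)).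
  { intros k. apply (equalize (fun i => F (i, k)) B).
    - intros i. apply HF.
    - intros i. apply HB'.
    - intros i t Ht. destruct (HF (i, k)) as (_ & A & _). now apply A.
    - intros i s t H1 H2 H3. destruct (HF (i, k)) as (_ & _ & A). now apply A. }
  destruct (choice _ St3) as [th Hth].
  assert (Eq : forall e, 0 < e -> exists d K, 0 < d /\ forall k, (K <= k)%nat -> forall u u', In01 u -> In01 u' -> Rabs (u - u') < d ->
    dm (lam k (th k u)) (lam k (th k u')) < e).
  { intros e He. destruct (archi_inv (e / 2)) as [i Hi]; [lra|]. specialize (Hi i (le_n i)).
    assert (Bp : 0 < 3 * (2 ^ i * B i)). { assert (0 < 2 ^ i) by (apply pow_lt; lra). destruct (HB' i). assert (0 < 2 ^ i * B i) by now apply Rmult_lt_0_compat. lra. }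
    set (d := e / 2 / (3 * (2 ^ i * B i))). assert (Ed : 3 * (2 ^ i * B i) * d = e / 2) by (unfold d; field; split; apply Rgt_not_eq; [destruct (HB' i); lra|apply pow_lt; lra]).
    exists d, (S i). split; [apply Rdiv_lt_0_compat; lra|]. intros k Hk.
    assert (G : forall u u', In01 u -> In01 u' -> u <= u' -> u' - u < d -> dm (lam k (th k u)) (lam k (th k u')) < e).
    { intros u u' Hu Hu' Huu Hd. destruct (Hth k) as [T1 T2]. specialize (T2 i u u' ltac:(lia) Hu Hu' Huu).
      assert (A := homeo_in _ u T1 Hu). assert (A' := homeo_in _ u' T1 Hu'). assert (Am := homeo_le _ u u' T1 Hu Hu' Huu). unfold In01 in A, A'.
      destruct (HF (i, k)) as (_ & _ & Q). simpl in Q. destruct (Q _ _ (proj1 A) Am (proj2 A')) as [_ Q2].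
      assert (3 * (2 ^ i * B i) * (u' - u) < 3 * (2 ^ i * B i) * d) by (apply Rmult_lt_compat_l; lra). lra. }
    intros u u' Hu Hu' Huu. destruct (Rle_dec u u'); [apply G; auto; rabs|]. rewrite dm_sym. apply G; auto; try lra. rabs. }
  destruct (ascoli (fun k x => fst (lam k (th k x))) Rad) as (s1 & X & S1 & CX).
  { intros k x Hx. assert (A := HB k _ (homeo_in _ x (proj1 (Hth k)) Hx)). apply dm_le in A. simpl in A. rewrite Rminus_0_r in A. tauto. }
  { intros e He. destruct (Eq e He) as (d & K & Hd & H). exists d, K. split; auto. intros k Hk s s' Hs Hs' Hss. specialize (H k Hk s s' Hs Hs' Hss). now apply dm_lt in H. }
  destruct (ascoli (fun k x => snd (lam (s1 k) (th (s1 k) x))) Rad) as (s2 & Y & S2 & CY).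
  { intros k x Hx. assert (A := HB (s1 k) _ (homeo_in _ x (proj1 (Hth (s1 k))) Hx)). apply dm_le in A. simpl in A. rewrite !Rminus_0_r in A. tauto. }
  { intros e He. destruct (Eq e He) as (d & K & Hd & H). exists d, K. split; auto. intros k Hk s s' Hs Hs' Hss. specialize (S1 k). specialize (H (s1 k) ltac:(lia) s s' Hs Hs' Hss). now apply dm_lt in H. }
  exists (fun k => s1 (s2 k)), (fun k => th (s1 (s2 k))), (fun x => (X x, Y x)). split; [|split].
  - intros k. specialize (S2 k). specialize (S1 (s2 k)). lia.
  - intros k. apply Hth.
  - intros e He. destruct (CX e He) as [K1 H1]. destruct (CY e He) as [K2 H2]. exists (Nat.max K1 K2). intros k Hk x Hx.
    apply dm_lt. simpl. split; [apply H1; auto; specialize (S2 k); lia|apply H2; auto; lia].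
Qed.

(** * Minimizing all crossing numbers *)

Definition near (e : R) (f g : R -> Cpl) : Prop := forall r, In01 r -> dm (f r) (g r) < e.

(* The closure of the homotopy class of [gam] in the topology of uniform convergence; unlike the class of the theorem
   it is closed under uniform limits. *)
Definition wcl (Om : Cpl -> Prop) (gam lam : R -> Cpl) : Prop :=
  pathC lam /\ forall e, 0 < e -> exists mu, hequiv Om gam mu /\ near e lam mu.

Lemma wcl_limit Om gam lam : (forall e, 0 < e -> exists nu, wcl Om gam nu /\ near e lam nu) -> wcl Om gam lam.
Proof.
  intros H. split.
  - apply unif_limit. intros e He. destruct (H e He) as [nu [[A _] B]]. exists nu. split; auto.
  - intros e He. destruct (H (e / 2)) as [nu [[_ A] B]]; [lra|]. destruct (A (e / 2)) as [mu [A1 A2]]; [lra|].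
    exists mu. split; auto. intros r Hr. specialize (B r Hr). specialize (A2 r Hr). pose proof (dm_tri (lam r) (nu r) (mu r)). lra.
Qed.

Lemma wcl_refl Om gam mu : hequiv Om gam mu -> wcl Om gam mu.
Proof.
  intros H. split. { now apply hp_cont in H. } intros e He. exists mu. split; auto. intros r Hr. now rewrite dm_refl.
Qed.

Lemma wcl_ends Om gam lam : wcl Om gam lam -> lam 0 = gam 0 /\ lam 1 = gam 1.
Proof.
  intros [HC H].
  assert (G : forall r, (r = 0 \/ r = 1) -> lam r = gam r).
  { intros r Hr. apply dm_0. apply Rnot_lt_le. intros Hl.
    destruct (H _ Hl) as [mu [M1 M2]]. apply hp_ends in M1 as [E0 E1].
    assert (In01 r) by (destruct Hr as [->| ->]; [apply in01_0|apply in01_1]). specialize (M2 r H0).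
    destruct Hr as [->| ->]; [rewrite E0 in M2|rewrite E1 in M2]; lra. }
  split; apply G; auto.
Qed.

Lemma wcl_reparam Om gam lam th : homeo th -> wcl Om gam lam -> wcl Om gam (fun s => lam (th s)).
Proof.
  intros Ht [HC H]. split; [now apply path_reparam|]. intros e He. destruct (H e He) as [mu [M1 M2]].
  exists (fun s => mu (th s)). split.
  - eapply hp_trans; [exact M1|]. apply hequiv_epe in M1 as [_ M1]. pose proof Ht as (T1 & T2 & T3 & _).
    apply hequiv_reparam; auto. intros s Hs. now apply homeo_inn.
  - intros r Hr. apply M2. now apply homeo_in.
Qed.

Definition zdec (n : nat) : Z := let (a, b) := of_nat n in (Z.of_nat a - Z.of_nat b)%Z.
Definition sdec (n : nat) : strip := let (x, y) := of_nat n in let (y1, y2) := of_nat y in Strip (zdec x) (zdec y1) (zdec y2).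

Lemma zdec_surj z : exists n, zdec n = z.
Proof. exists (to_nat (Z.to_nat z, Z.to_nat (- z))). unfold zdec. rewrite cancel_of_to. lia. Qed.

Lemma sdec_surj j : exists n, sdec n = j.
Proof.
  destruct j as [a b k]. destruct (zdec_surj a) as [x <-], (zdec_surj b) as [y <-], (zdec_surj k) as [z <-].
  exists (to_nat (x, to_nat (y, z))). unfold sdec. now rewrite !cancel_of_to.
Qed.

Section Minimizer.
Variables (Om : Cpl -> Prop) (gam : R -> Cpl).
Hypothesis Hgam : epe Om gam.

(** Lexicographic minimization over the first [k] strips of an enumeration. The comparison with
    [gam] at the start provides the uniform bounds for [compact_paths]. *)
Fixpoint Lex (k : nat) (nu : R -> Cpl) : Prop :=
  match k with
  | O => wcl Om gam nu /\ forall j n, Nle gam j n -> Nle nu j n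
  | S i => Lex i nu /\ forall mu, Lex i mu -> forall n, Nle mu (sdec i) n -> Nle nu (sdec i) n
  end.

Lemma Lex_wcl k nu : Lex k nu -> wcl Om gam nu /\ forall j n, Nle gam j n -> Nle nu j n.
Proof. revert nu. induction k; intros nu H; auto. apply IHk, H. Qed.

Lemma Lex_nonempty k : exists nu, Lex k nu.
Proof.
  induction k as [|k [nu0 IH]].
  - exists gam. split; auto. apply wcl_refl. now apply hequiv_refl.
  - assert (G : forall n nu, Lex k nu -> Nle nu (sdec k) n -> exists nu', Lex (S k) nu').
    { induction n as [n IHn] using lt_wf_ind. intros nu H1 H2.
      destruct (classic (exists m mu, (m < n)%nat /\ Lex k mu /\ Nle mu (sdec k) m)) as [(m & mu & A & B & C)|N].
      - eapply IHn; eauto.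
      - exists nu. split; auto. intros mu Hmu m Hm. destruct (Nat.lt_ge_cases m n) as [L|L].
        + exfalso. apply N. eauto.
        + intros ts A. apply H2 in A. lia. }
    destruct (Nle_finite nu0 (sdec k)) as [n Hn]. { apply Lex_wcl in IH. apply IH. }
    eapply G; eauto.
Qed.

Lemma bound_path f : pathC f -> exists B, 0 < B /\ forall t, In01 t -> dm (f t) (0, 0) <= B.
Proof.
  intros H. destruct (max_attained dR In01 (fun t => dm (f t) (0, 0)) (seqcpt_I 0 1)) as [x [Hx Hm]].
  - intros x Hx e He. destruct (H x Hx e He) as [d [Hd H']]. exists d. split; auto. intros y Hy Hxy. specialize (H' y Hy Hxy).
    pose proof (dm_tri (f x) (f y) (0, 0)). pose proof (dm_tri (f y) (f x) (0, 0)). rewrite (dm_sym (f y) (f x)) in *. unfold dR. rabs.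
  - exists 0. apply in01_0.
  - exists (dm (f x) (0, 0) + 1). pose proof (dm_pos (f x) (0, 0)). split; [lra|]. intros t Ht. specialize (Hm t Ht). lra.
Qed.

(** Crossing bounds confine the path: [gam] lies below level [K] of the four coordinate functionals,
    so its strings there have length at most 1, while a path leaving the square of radius [K + 1]
    has the string formed by 0 and the exit time. *)
Lemma W_bounded : exists Rad, 0 < Rad /\ forall nu, wcl Om gam nu -> (forall j n, Nle gam j n -> Nle nu j n) -> forall t, In01 t -> dm (nu t) (0, 0) <= Rad.
Proof.
  destruct (bound_path gam (proj1 Hgam)) as [B [HB H]]. destruct (int_approx B) as [K [HK HK']].
  exists (IZR K + 1). split; [lra|]. intros nu Hnu HN t Ht.
  assert (G : forall a b, (a = 1 /\ b = 0 \/ a = -1 /\ b = 0 \/ a = 0 /\ b = 1 \/ a = 0 /\ b = -1)%Z -> IZR a * fst (nu t) + IZR b * snd (nu t) <= IZR K + 1).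
  { intros a b Hab. apply Rnot_lt_le. intros Hl.
    assert (Small : forall s, In01 s -> IZR a * fst (gam s) + IZR b * snd (gam s) < IZR K).
    { intros s Hs. specialize (H s Hs). apply dm_le in H as [X Y]. simpl in *. rewrite Rminus_0_r in *. apply Rabs_le_iff in X, Y.
      destruct Hab as [[-> ->]|[[-> ->]|[[-> ->]|[-> ->]]]]; simpl; lra. }
    assert (N1 : Nle gam (Strip a b K) 1).
    { intros ts A. destruct ts as [|r [|r' ts]]; simpl; auto. exfalso. simpl in A. destruct A as (A0 & _ & A1 & A2 & _).
      unfold sym, sv in A2; simpl in A2. specialize (Small r' ltac:(unfold In01; lra)). lra. }
    apply HN in N1. specialize (N1 [0; t]). simpl in N1. enough (2 <= 1)%nat by lia. apply N1.
    destruct (wcl_ends _ _ _ Hnu) as [E0 _]. rewrite E0. unfold sym, sv; simpl. specialize (Small 0 in01_0). unfold In01 in Ht.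
    repeat split; lra. }
  pose proof (G 1 0 ltac:(lia))%Z. pose proof (G (-1) 0 ltac:(lia))%Z. pose proof (G 0 1 ltac:(lia))%Z. pose proof (G 0 (-1) ltac:(lia))%Z.
  apply dm_le. simpl. rewrite !Rminus_0_r. split; apply Rabs_le_iff; lra.
Qed.

(** By lower semicontinuity a limit of paths taken from [Lex k] lies in every [Lex k]. Minimality is
    asserted only against paths that cross no strip more often, which is the situation of
    straightenings. *)
Theorem minimizer : exists lam, wcl Om gam lam /\
  forall nu, wcl Om gam nu -> (forall j n, Nle lam j n -> Nle nu j n) -> forall j n, Nle nu j n -> Nle lam j n.
Proof.
  destruct (choice _ Lex_nonempty) as [nu Hnu].
  destruct W_bounded as [Rad [HR HB]].
  assert (HF : forall j, exists n, Nle gam j n). { intros j. apply Nle_finite, Hgam. }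
  destruct (choice _ HF) as [nf Hnf].
  assert (HW : forall k, wcl Om gam (nu k) /\ forall j n, Nle gam j n -> Nle (nu k) j n). { intros k. now apply (Lex_wcl k). }
  destruct (compact_paths nu nf Rad HR) as (s & th & L & S1 & S2 & S3).
  { intros k. apply HW. } { intros k. apply HB; apply HW. } { intros k j. apply HW, Hnf. }
  assert (Lim : forall K e, 0 < e -> exists k, (K <= s k)%nat /\ near e L (fun x => nu (s k) (th k x))).
  { intros K e He. destruct (S3 e He) as [K' HK']. exists (Nat.max K K'). split. { specialize (S1 (Nat.max K K')). lia. }
    intros r Hr. rewrite dm_sym. apply HK'; auto. lia. }
  assert (LW : wcl Om gam L).
  { apply wcl_limit. intros e He. destruct (Lim O e He) as (k & _ & Hk). exists (fun x => nu (s k) (th k x)). split; auto. apply wcl_reparam; auto. apply HW. }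
  assert (LN : forall K j n, (forall k, (K <= k)%nat -> Nle (nu k) j n) -> Nle L j n).
  { intros K j n H. apply Nle_lsc. intros e He. destruct (Lim K e He) as (k & K1 & Hk). exists (fun x => nu (s k) (th k x)). split; auto.
    pose proof (S2 k) as T. pose proof T as (_ & T1 & T2 & _). apply Nle_reparam; auto.
    intros a b A1 A2 A3. apply homeo_le; auto; unfold In01; lra. }
  assert (Down : forall k i mu, (i <= k)%nat -> Lex k mu -> Lex i mu).
  { induction k; intros i mu Hi H. { now replace i with O by lia. } destruct (Nat.eq_dec i (S k)) as [->|]; auto. apply IHk; [lia|]. apply H. }
  assert (LL : forall k, Lex k L).
  { induction k.
    - split; auto. intros j n H. apply (LN O). intros k _. now apply HW.
    - split; auto. intros mu Hmu n Hn. apply (LN (S k)). intros i Hi. specialize (Hnu i). apply (Down i (S k)) in Hnu; auto. exact (proj2 Hnu mu Hmu n Hn). }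
  exists L. split; auto. intros mu Hmu HN.
  assert (LM : forall k, Lex k mu).
  { induction k.
    - split; auto. intros j n H. apply HN. apply (LL O). auto.
    - split; auto. intros rho Hr n Hn. apply HN. exact (proj2 (LL (S k)) rho Hr n Hn). }
  intros j n Hn. destruct (sdec_surj j) as [i <-]. exact (proj2 (LL (S i)) mu (LM i) n Hn).
Qed.
End Minimizer.

(** * A generic direction *)

(** Nested intervals: at each stage one outer third is kept, the one that avoids [u n]. *)
Lemma avoid_sequence (u : nat -> R) : exists x, forall n, u n <> x.
Proof.
  set (st := fun n (p : R * R) => let (a, b) := p in if Rle_dec (u n) ((a + b) / 2) then ((a + 2 * b) / 3, b) else (a, (2 * a + b) / 3)).
  set (I := fix I (n : nat) : R * R := match n with O => (0, 1) | S k => st k (I k) end).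
  assert (Ord : forall n, fst (I n) < snd (I n)).
  { induction n; simpl; [lra|]. unfold st. destruct (I n) as [a b]. simpl in *. destruct Rle_dec; simpl; lra. }
  assert (Step : forall n, fst (I n) <= fst (I (S n)) /\ snd (I (S n)) <= snd (I n)).
  { intros n. specialize (Ord n). simpl. unfold st. destruct (I n) as [a b]. simpl in *. destruct Rle_dec; simpl; lra. }
  assert (Nest : forall n k, fst (I n) <= fst (I (n + k)%nat) /\ snd (I (n + k)%nat) <= snd (I n)).
  { intros n. induction k; [rewrite Nat.add_0_r; lra|]. rewrite Nat.add_succ_r. specialize (Step (n + k)%nat). lra. }
  assert (Cr : forall n k, fst (I n) <= snd (I k)).
  { intros n k. pose proof (Nest n k). pose proof (Nest k n). rewrite (Nat.add_comm k n) in *. specialize (Ord (n + k)%nat). lra. }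
  destruct (completeness (fun x => exists n, x = fst (I n))) as [x [H1 H2]].
  { exists 1. intros y [n ->]. apply (Cr n O). } { exists 0, O. reflexivity. }
  exists x. intros n E.
  assert (A : fst (I (S n)) <= x) by (apply H1; eauto).
  assert (B : x <= snd (I (S n))). { apply H2. intros y [k ->]. apply Cr. }
  specialize (Ord n). simpl in A, B. unfold st in A, B. destruct (I n) as [a b]. simpl in *. destruct Rle_dec; simpl in *; lra.
Qed.

Definition qdec (i : nat) : R := INR (fst (of_nat i)) / (INR (snd (of_nat i)) + 1).

Lemma qdec_dense x y : 0 <= x -> x < y -> exists i, x < qdec i < y.
Proof.
  intros Hx Hxy. destruct (archi_inv (y - x)) as [N HN]; [lra|]. specialize (HN N (le_n N)). pose proof (pos_INR N).
  destruct (int_approx (x * (INR N + 1))) as [k [K1 K2]].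
  assert (0 <= x * (INR N + 1)) by (apply Rmult_le_pos; lra). assert (Kp : (0 <= k)%Z) by (apply le_IZR; lra).
  exists (to_nat (Z.to_nat k, N)). unfold qdec. rewrite cancel_of_to. simpl. rewrite INR_IZR_INZ, Z2Nat.id by auto.
  assert (P : 0 < / (INR N + 1)) by (apply Rinv_0_lt_compat; lra).
  assert (E : (INR N + 1) * / (INR N + 1) = 1) by (field; lra). unfold Rdiv. split.
  - apply Rmult_lt_reg_r with (INR N + 1); [lra|]. rewrite Rmult_assoc, Rinv_l by lra. lra.
  - assert (IZR k * / (INR N + 1) <= (x * (INR N + 1) + 1) * / (INR N + 1)) by (apply Rmult_le_compat_r; lra).
    replace ((x * (INR N + 1) + 1) * / (INR N + 1)) with (x + / (INR N + 1)) in H1 by (field; lra). lra.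
Qed.

(** No arc moves inside a line [x + m y = c]. Pauses are allowed, since limits of reparametrized
    paths may be constant for a while. *)
Definition generic (m : R) (lam : R -> Cpl) : Prop :=
  forall s s', 0 <= s -> s <= s' -> s' <= 1 -> (forall t, s <= t <= s' -> lin 1 m (lam t) = lin 1 m (lam s)) -> forall t, s <= t <= s' -> lam t = lam s.

(* A direction in which [lam] moves without being constant is the direction of a chord between two rational times. *)
Lemma not_generic lam m : pathC lam -> ~ generic m lam ->
  exists i k, m = - (fst (lam (qdec i)) - fst (lam (qdec k))) / (snd (lam (qdec i)) - snd (lam (qdec k))).
Proof.
  intros HC HN.
  assert (exists s s' t, 0 <= s /\ s' <= 1 /\ (forall t, s <= t <= s' -> lin 1 m (lam t) = lin 1 m (lam s)) /\ s < t <= s' /\ lam t <> lam s) as (s & s' & t & H0 & H1 & HX & Ht & Hne).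
  { apply NNPP. intros Q. apply HN. intros s s' H0 Hss H1 HX t Ht. apply NNPP. intros Hne. apply Q. exists s, s', t.
    repeat split; auto; try lra. destruct (Req_dec s t) as [->|]; [congruence|lra]. }
  assert (He : 0 < dm (lam t) (lam s)). { apply Rnot_le_lt. intros L. apply dm_0 in L. auto. }
  destruct (HC s ltac:(unfold In01; lra) (dm (lam t) (lam s) / 2)) as [d1 [D1 E1]]; [lra|].
  destruct (HC t ltac:(unfold In01; lra) (dm (lam t) (lam s) / 2)) as [d2 [D2 E2]]; [lra|].
  destruct (qdec_dense s (Rmin t (s + d1))) as [i [I1 I2]]; [lra|apply Rmin_glb_lt; lra|].
  destruct (qdec_dense (Rmax s (t - d2)) t) as [k [K1 K2]]; [eapply Rle_trans; [exact H0|apply Rmax_l]|apply Rmax_lub_lt; lra|].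
  pose proof (Rmin_l t (s + d1)). pose proof (Rmin_r t (s + d1)). pose proof (Rmax_l s (t - d2)). pose proof (Rmax_r s (t - d2)).
  specialize (E1 (qdec i) ltac:(unfold In01; lra) ltac:(unfold dR; rabs)). specialize (E2 (qdec k) ltac:(unfold In01; lra) ltac:(unfold dR; rabs)).
  assert (NE : lam (qdec i) <> lam (qdec k)).
  { intros E. rewrite E in E1. pose proof (dm_tri (lam t) (lam (qdec k)) (lam s)). rewrite (dm_sym (lam s)) in E1. lra. }
  pose proof (HX (qdec i) ltac:(lra)) as X1. pose proof (HX (qdec k) ltac:(lra)) as X2. unfold lin in X1, X2.
  exists i, k. destruct (lam (qdec i)) as [x1 y1], (lam (qdec k)) as [x2 y2]. simpl in *.
  assert (Y : y1 - y2 <> 0). { intros Y. apply NE. assert (y1 = y2) by lra. subst y2. f_equal. lra. }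
  assert (EE : x1 - x2 = - m * (y1 - y2)) by lra. rewrite EE. field. auto.
Qed.

Lemma generic_exists lam1 lam2 : pathC lam1 -> pathC lam2 -> exists m, generic m lam1 /\ generic m lam2.
Proof.
  intros H1 H2.
  set (b := fun (lam : R -> Cpl) i k => - (fst (lam (qdec i)) - fst (lam (qdec k))) / (snd (lam (qdec i)) - snd (lam (qdec k)))).
  (* The sequence lists the directions of all chords of both paths between rational times. *)
  destruct (avoid_sequence (fun n => let (x, y) := of_nat n in let (i, k) := of_nat y in b (match x with O => lam1 | _ => lam2 end) i k)) as [m Hm].
  exists m. split; apply NNPP; intros N; apply not_generic in N as (i & k & E); auto.
  - apply (Hm (to_nat (0%nat, to_nat (i, k)))). rewrite !cancel_of_to. symmetry. exact E.
  - apply (Hm (to_nat (1%nat, to_nat (i, k)))). rewrite !cancel_of_to. symmetry. exact E.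
Qed.

Lemma lin_lip al be z w : Rabs (lin al be z - lin al be w) <= (Rabs al + Rabs be) * dm z w.
Proof.
  unfold lin. replace (al * fst z + be * snd z - (al * fst w + be * snd w)) with (al * (fst z - fst w) + be * (snd z - snd w)) by ring.
  eapply Rle_trans; [apply Rabs_triang|]. rewrite !Rabs_mult. pose proof (proj1 (dm_le z w (dm z w)) (Rle_refl _)) as [A B].
  pose proof (Rabs_pos al). pose proof (Rabs_pos be). nra.
Qed.

Lemma lin_path al be (D : R -> Prop) f : contD dR dm D f -> contD dR dR D (fun t => lin al be (f t)).
Proof. intros H. unfold lin. ctac. Qed.

(** Arcs with vanishing variation of [lin 1 m] but points at distance [e] would subconverge to an
    arc on which [lin 1 m] is constant and whose ends differ. *)
Lemma generic_modulus m lam : pathC lam -> generic m lam -> forall e, 0 < e -> exists w, 0 < w /\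
  forall s s', 0 <= s -> s' <= 1 -> (forall t t', s <= t <= s' -> s <= t' <= s' -> Rabs (lin 1 m (lam t) - lin 1 m (lam t')) <= w) ->
  forall t t', s <= t <= s' -> s <= t' <= s' -> dm (lam t) (lam t') < e.
Proof.
  intros HC HG e He. apply NNPP. intros N.
  assert (Q : forall n : nat, exists z : (R * R) * (R * R), let '((s, s'), (t, t')) := z in 0 <= s /\ s' <= 1 /\
    (forall t t', s <= t <= s' -> s <= t' <= s' -> Rabs (lin 1 m (lam t) - lin 1 m (lam t')) <= / (INR n + 1)) /\
    s <= t /\ t <= t' /\ t' <= s' /\ e <= dm (lam t) (lam t')).
  { intros n. apply NNPP. intros N'. apply N. exists (/ (INR n + 1)). split; [apply inv_succ_pos|].
    intros s s' H0 H1 HX t t' Ht Ht'. apply Rnot_le_lt. intros L. apply N'.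
    destruct (Rle_dec t t').
    - exists ((s, s'), (t, t')). repeat split; auto; lra.
    - exists ((s, s'), (t', t)). rewrite dm_sym in L. repeat split; auto; lra. }
  destruct (choice _ Q) as [z Hz]. clear Q.
  destruct (seqcpt_Sq (fun n => snd (z n))) as [[t t'] [sg [[L1 L2] L3]]].
  { intros n. specialize (Hz n). destruct (z n) as [[s s'] [t t']]. unfold Sq, In01; simpl. lra. }
  simpl in *. unfold In01 in L1, L2.
  assert (Lim : forall d, 0 < d -> exists n : nat, / (INR n + 1) < d /\ dm (t, t') (snd (z n)) < d).
  { intros d Hd. destruct (archi_inv d Hd) as [k Hk]. exists (sg k). destruct (L3 k) as [A B]. split; [apply Hk; auto|]. specialize (Hk k (le_n k)). lra. }
  assert (Htt : t <= t').
  { apply Rnot_lt_le. intros Hl. destruct (Lim ((t - t') / 2)) as (n & _ & D); [lra|]. specialize (Hz n). destruct (z n) as [[s s'] [x x']]. simpl in *.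
    apply dm_lt in D as [D1 D2]. simpl in *. apply Rabs_lt_iff in D1, D2. lra. }
  assert (Hc : forall r, t <= r <= t' -> lin 1 m (lam r) = lin 1 m (lam t)).
  { assert (G : forall r r', t < r < t' -> t < r' < t' -> lin 1 m (lam r) = lin 1 m (lam r')).
    { intros r r' Hr Hr'. apply Rminus_diag_uniq. apply NNPP. intros Ne.
      set (d := Rmin (Rabs (lin 1 m (lam r) - lin 1 m (lam r'))) (Rmin (Rmin (r - t) (t' - r)) (Rmin (r' - t) (t' - r')))).
      assert (Hd : 0 < d). { unfold d. repeat apply Rmin_pos; try lra. now apply Rabs_pos_lt. }
      destruct (Lim d Hd) as (n & Hn & D). specialize (Hz n). destruct (z n) as [[s s'] [x x']]. simpl in *.
      destruct Hz as (Z1 & Z2 & Z3 & Z4 & Z5 & Z6 & Z7). apply dm_lt in D as [D1 D2]. simpl in *.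
      repeat match goal with H : _ < d |- _ => unfold d in H; repeat (apply Rlt_min in H as [? H] || idtac) end.
      assert (V1 : Rabs (t - x) < Rmin (r - t) (r' - t)) by (apply Rmin_glb_lt; unfold d in *; unfold Rmin in *; repeat destruct Rle_dec; lra).
      assert (V2 : Rabs (t' - x') < Rmin (t' - r) (t' - r')) by (apply Rmin_glb_lt; unfold d in *; unfold Rmin in *; repeat destruct Rle_dec; lra).
      apply Rlt_min in V1 as [V1 V1'], V2 as [V2 V2']. apply Rabs_lt_iff in V1, V1', V2, V2'.
      specialize (Z3 r r' ltac:(lra) ltac:(lra)). lra. }
    destruct (Req_dec t t') as [->|Hne]. { intros r Hr. replace r with t' by lra. auto. }
    set (mid := (t + t') / 2).
    assert (G2 : forall r, t <= r <= t' -> lin 1 m (lam r) = lin 1 m (lam mid)).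
    { intros r Hr. apply Rminus_diag_uniq. apply NNPP. intros Ne. assert (Hp := Rabs_pos_lt _ Ne).
      destruct (lin_path 1 m _ _ HC r ltac:(unfold In01; lra) _ Hp) as [d [Hd HD]].
      assert (exists r', t < r' < t' /\ Rabs (r - r') < d) as (r' & R1 & R2).
      { destruct (Rle_dec r mid).
        - exists (Rmin mid (r + d / 2)). assert (r < Rmin mid (r + d/2) \/ r = mid) by (destruct (Req_dec r mid); auto; left; apply Rmin_glb_lt; lra).
          pose proof (Rmin_l mid (r + d/2)). pose proof (Rmin_r mid (r+d/2)). unfold mid in *. destruct H as [H|H].
          + split; [lra|rabs].
          + rewrite <- H. rewrite Rmin_left by lra. split; [lra|rabs].
        - exists (Rmax mid (r - d / 2)). assert (Rmax mid (r - d/2) < r) by (apply Rmax_lub_lt; lra).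
          pose proof (Rmax_l mid (r - d/2)). pose proof (Rmax_r mid (r-d/2)). unfold mid in *. split; [lra|rabs]. }
      specialize (HD r' ltac:(unfold In01; lra) R2). rewrite (G r' mid R1) in HD by (unfold mid; lra). unfold dR in HD. lra. }
    intros r Hr. rewrite (G2 r Hr), (G2 t); auto. lra. }
  assert (E : lam t' = lam t). { apply (HG t t'); auto; lra. }
  destruct (HC t L1 (e / 2)) as [d1 [D1 E1]]; [lra|]. destruct (HC t' L2 (e / 2)) as [d2 [D2 E2]]; [lra|].
  destruct (Lim (Rmin d1 d2)) as (n & _ & D); [now apply Rmin_pos|]. apply Rlt_min in D as [Da Db].
  specialize (Hz n). destruct (z n) as [[s s'] [x x']]. destruct Hz as (Z1 & Z2 & Z3 & Z4 & Z5 & Z6 & Z7). simpl in *.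
  apply dm_lt in Da as [Da _], Db as [_ Db]. simpl in *.
  specialize (E1 x ltac:(unfold In01; lra) Da). specialize (E2 x' ltac:(unfold In01; lra) Db). rewrite E in E2.
  pose proof (dm_tri (lam x) (lam t) (lam x')). rewrite (dm_sym (lam x) (lam t)) in H. lra.
Qed.

(** * Ladders between homotopic paths without shortcuts *)

(* [NS]: no shortcuts of depth [e]. *)
Definition NS (Om : Cpl -> Prop) (e : R) (f : R -> Cpl) : Prop :=
  forall s s', 0 < s -> s <= s' -> s' < 1 -> hp Om (rs f s s') (lerp (f s) (f s')) ->
  forall t, s <= t <= s' -> exists u, In01 u /\ dm (f t) (lerp (f s) (f s') u) < e.

(** * Paths without deep shortcuts are flat over a line *)

Section Pair.
Variables (Om : Cpl -> Prop) (l r d : R) (f g : R -> Cpl).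
Hypothesis (Hl : 0 < l) (Hr : r < 1).
Hypothesis (Gf : good Om l r d f) (Gg : good Om l r d g).

Lemma short_flat (h : R -> Cpl) e al be c s t s' : good Om l r d h -> NS Om e h -> l <= s -> s <= t -> t <= s' -> s' <= r -> Short Om d h s s' ->
  lin al be (h s) = c -> lin al be (h s') = c -> lin al be (h t) <= c + (Rabs al + Rabs be) * e.
Proof.
  intros Gh HN H1 H2 H3 H4 [C1 C2] E1 E2. pose proof (proj1 Gh) as Fh. pose proof (proj1 Fh) as Hd.
  destruct (HN s s' ltac:(lra) ltac:(lra) ltac:(lra)) with (t := t) as (u & Hu & Hd'); [|lra|].
  - assert (V : vS Om (ch d h s s')).
    { split. { apply (ch_valid Om h l r d Fh); lra. } apply Forall_forall. intros z Hz.
      destruct (ch_in Om h l r d Fh s s' z ltac:(lra) Hz) as [q [Q ->]]. apply (good_in Om l r d h Gh). lra. }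
    eapply hp_trans; [apply (path_chain Om h l r d Fh (proj2 Gh) s s' (fl d s s')); try lra; apply fl_spec; auto; lra|].
    eapply hp_trans; [apply ceq_hp; [exact C2|exact V|]|].
    { change (ch d h s s' <> []). destruct (ch_shape Om h l r d Fh s s') as [x ->]; [lra|easy]. }
    apply hp_sym. apply (hp_unit_r Om (lerp (h s) (h s')) (h s')); [apply lerp_path|now apply cvx_lerp|apply lerp_1].
  - pose proof (lin_lip al be (h t) (lerp (h s) (h s') u)) as L. rewrite lin_lerp, E1, E2 in L.
    pose proof (Rabs_pos al). pose proof (Rabs_pos be).
    assert ((Rabs al + Rabs be) * dm (h t) (lerp (h s) (h s') u) <= (Rabs al + Rabs be) * e) by (apply Rmult_le_compat_l; lra).
    apply Rabs_le_iff in L. nra.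
Qed.

(** A crossing of [f] cannot be joined to [g], which stays below the level, so [cross_or_short]
    gives a shortcut, and over a shortcut [f] is within [e] of a chord in the line. *)
Lemma no_peak e al be c T a a' T' b b' t : al <> 0 \/ be <> 0 -> NS Om e f ->
  l <= a -> a <= t -> t <= b -> b <= r -> l <= a' -> a' <= b' -> b' <= r ->
  isTrack Om f g T a a' -> isTrack Om f g T' b b' -> Adm Om d f g T a a' T' b b' ->
  Forall (fun z => lin al be z <= c) T -> Forall (fun z => lin al be z <= c) T' -> (forall q, a' <= q <= b' -> lin al be (g q) < c) ->
  lin al be (f t) <= c + (Rabs al + Rabs be) * e.
Proof.
  intros Hnz HN H1 H2 H3 H4 H5 H6 H7 K K' HA F F' Hq. apply Rnot_lt_le. intros Hlt.
  destruct (Rlt_dec c (lin al be (f t))) as [L|L].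
  - destruct (cross_or_short Om l r d f g Gf Gg al be c T a a' T' b b' t false) as (s & S1 & S2 & [(s' & S3 & S4 & S5)|(q & Q1 & Q2 & _)]); auto.
    + eapply Forall_impl; [|exact F']. intros z. apply sd_false.
    + pose proof (short_flat f e al be c s t s' Gf HN ltac:(lra) ltac:(lra) ltac:(lra) ltac:(lra) S5 S2 S4). lra.
    + specialize (Hq q Q1). lra.
  (* Not above the level, only [0 <= e] is needed; the trivial shortcut from [t] to [t] provides
     it. *)
  - assert (0 <= (Rabs al + Rabs be) * e); [|lra]. pose proof (Rabs_pos al). pose proof (Rabs_pos be). apply Rmult_le_pos; [lra|].
    destruct (HN t t ltac:(lra) ltac:(lra) ltac:(lra)) with (t := t) as (u & _ & Hu); [|lra|].
    + apply hp_lin.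
      * apply rs_cont; [lra|]. eapply contD_sub; [exact (proj2 Gf)|]. unfold I01; intros; lra.
      * apply lerp_path.
      * unfold rs. rewrite lerp_same. f_equal. ring.
      * unfold rs. rewrite lerp_same. f_equal. ring.
      * intros x y Hx Hy. unfold rs. rewrite lerp_same. replace (t + x * (t - t)) with t by ring. rewrite lerp_same. apply (good_in Om l r d f Gf). lra.
    + pose proof (dm_pos (f t) (lerp (f t) (f t) u)). lra.
Qed.
End Pair.

Lemma no_peak' Om l r d f g : 0 < l -> r < 1 -> good Om l r d f -> good Om l r d g -> forall e al be c T a a' T' b b' t, al <> 0 \/ be <> 0 -> NS Om e g ->
  l <= a -> a <= b -> b <= r -> l <= a' -> a' <= t -> t <= b' -> b' <= r ->
  isTrack Om f g T a a' -> isTrack Om f g T' b b' -> Adm Om d f g T a a' T' b b' ->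
  Forall (fun z => lin al be z <= c) T -> Forall (fun z => lin al be z <= c) T' -> (forall q, a <= q <= b -> lin al be (f q) < c) ->
  lin al be (g t) <= c + (Rabs al + Rabs be) * e.
Proof.
  intros Hl Hr Gf Gg e al be c T a a' T' b b' t Hnz HN H1 H2 H3 H4 H5 H6 H7 K K' HA F F' Hq.
  apply (no_peak Om l r d g f Hl Hr Gg Gf e al be c (rev T) a' a (rev T') b' b t); auto; try lra.
  - now apply track_rev.
  - now apply track_rev.
  - apply (Adm_sym Om l r d f g); auto; lra.
  - now apply Forall_rev.
  - now apply Forall_rev.
Qed.

Lemma Rabs_pm1 s : s = 1 \/ s = -1 -> Rabs s = 1.
Proof. intros [->| ->]; rabs. Qed.

(** * Construction of a ladder *)

Section Ladder.
Variables (Om : Cpl -> Prop) (m w : R) (l r d : R) (f g : R -> Cpl) (Te : list Cpl).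
Hypothesis (Hl : 0 < l) (Hlr : l < r) (Hr : r < 1) (Hw : 0 < w).
Hypothesis (Gf : good Om l r d f) (Gg : good Om l r d g).
Notation X := (lin 1 m).

(** The constant 16 comes from the last box in [ladder_exists]: [15 * w] encloses the end track as
    well, and [box_range] adds one [w] for [g]. *)
Definition Box (T : list Cpl) (a a' : R) (T2 : list Cpl) (b b' : R) : Prop :=
  l <= a /\ a < b /\ b <= r /\ l <= a' /\ a' < b' /\ b' <= r /\ isTrack Om f g T a a' /\ isTrack Om f g T2 b b' /\ Adm Om d f g T a a' T2 b b' /\
  exists c, (forall t, a <= t <= b -> Rabs (X (f t) - c) <= 16 * w) /\ (forall t, a' <= t <= b' -> Rabs (X (g t) - c) <= 16 * w).

Inductive lad : list Cpl -> R -> R -> list (R * R) -> Prop :=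
| lad_last T a a' : Box T a a' Te r r -> lad T a a' [(a, a')]
| lad_cons T a a' b b' L : Box T a a' [f b; g b'] b b' -> lad [f b; g b'] b b' L -> lad T a a' ((a, a') :: L).

Variable e : R.
Hypothesis (He : (1 + Rabs m) * e <= w) (Nf : NS Om e f) (Ng : NS Om e g).
Variable xq : R.
Hypothesis (HTe : isTrack Om f g Te r r) (Xe : Forall (fun z => Rabs (X z - xq) < w) Te).

Lemma lin_sg s z : lin s (s * m) z = s * X z.
Proof. unfold lin. ring. Qed.

(** [no_peak'] is used for the functional and its negative; each costs [(1 + Rabs m) * e <= w]. *)
Lemma box_range T a a' T2 b b' c B : l <= a -> a <= b -> b <= r -> l <= a' -> a' <= b' -> b' <= r -> isTrack Om f g T a a' -> isTrack Om f g T2 b b' -> Adm Om d f g T a a' T2 b b' ->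
  Forall (fun z => Rabs (X z - c) <= B) T -> Forall (fun z => Rabs (X z - c) <= B) T2 -> (forall t, a <= t <= b -> Rabs (X (f t) - c) < B) ->
  forall t, a' <= t <= b' -> Rabs (X (g t) - c) <= B + w.
Proof.
  intros H1 H2 H3 H4 H5 H6 K K2 HA F F2 Hf t Ht.
  assert (G : forall s, s = 1 \/ s = -1 -> s * X (g t) <= s * c + B + w).
  { intros s Hs. assert (Q := no_peak' Om l r d f g Hl Hr Gf Gg e s (s * m) (s * c + B) T a a' T2 b b' t).
    rewrite lin_sg, Rabs_mult, (Rabs_pm1 s Hs), Rmult_1_l in Q.
    assert (P : forall z, Rabs (X z - c) <= B -> s * X z <= s * c + B). { intros z Hz. apply Rabs_le_iff in Hz. destruct Hs as [->| ->]; lra. }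
    assert (s * X (g t) <= s * c + B + (1 + Rabs m) * e); [|lra]. apply Q; auto; try lra.
    - eapply Forall_impl; [|exact F]. intros z Hz. simpl in Hz. rewrite lin_sg. auto.
    - eapply Forall_impl; [|exact F2]. intros z Hz. simpl in Hz. rewrite lin_sg. auto.
    - intros q Hq. rewrite lin_sg. specialize (Hf q Hq). apply Rabs_lt_iff in Hf. destruct Hs as [->| ->]; lra. }
  pose proof (G 1 ltac:(auto)). pose proof (G (-1) ltac:(auto)). apply Rabs_le_iff. lra.
Qed.

Lemma track_ends T a a' P : isTrack Om f g T a a' -> Forall P T -> P (f a) /\ P (g a').
Proof.
  intros (_ & (T0 & E) & La) F. rewrite E in *. split; [now apply Forall_inv in F|].
  rewrite <- La. rewrite Forall_forall in F. apply F.
  destruct (app_cons_last (f a :: T0) (f a)) as [A [y Ey]]; [easy|]. rewrite Ey, last_last. apply in_or_app. right. now left.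
Qed.

(** [f] is followed until its functional leaves the window of radius [12 * w] about the current
    rung. The next rung lies on a line at distance [4 * w] or [8 * w] inside the window, and the
    part of [f] up to that rung is split off as a box. *)
Lemma ladder_exists : forall n T a a' c dl, 0 < dl -> (forall x y, l <= x <= r -> l <= y <= r -> Rabs (x - y) < dl -> Rabs (X (f x) - X (f y)) < 2 * w) ->
  l <= a -> a < r -> l <= a' -> a' < r -> isTrack Om f g T a a' -> Adm Om d f g T a a' Te r r -> Forall (fun z => Rabs (X z - c) <= w) T ->
  r - a <= INR n * dl -> exists L, lad T a a' L.
Proof.
  induction n as [|n IH]; intros T a a' c dl Hdl HU Ha Har Ha' Har' HT HA FT Hn; [simpl in Hn; lra|].
  destruct (track_ends T a a' _ HT FT) as [Xa Xa']. destruct (track_ends Te r r _ HTe Xe) as [Xr Xr'].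
  destruct (first_hit a r (fun t => Rabs (X (f t) - c)) (12 * w)) as [Hlt|(t & Ht & Et & Hb)]; try lra.
  { assert (Q : contD dR dR (I01 a r) (fun t => X (f t))). { apply lin_path. eapply contD_sub; [exact (proj2 Gf)|]. unfold I01; intros; lra. }
    intros x Hx ee Hee. destruct (Q x Hx ee Hee) as [dd [Hdd H']]. exists dd. split; auto. intros y Hy Hxy. specialize (H' y Hy Hxy). unfold dR in *. rabs. }
  - exists [(a, a')]. apply lad_last. repeat split; auto; try lra; try apply HT; try apply HTe. exists c. split.
    + intros t Ht. specialize (Hlt t Ht). lra.
    + intros t Ht. assert (Rabs (X (g t) - c) <= 15 * w + w); [|lra].
      apply (box_range T a a' Te r r c (15 * w)); auto; try lra.
      * eapply Forall_impl; [|exact FT]. simpl. intros; lra.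
      * eapply Forall_impl; [|exact Xe]. simpl. intros z Hz. specialize (Hlt r ltac:(lra)). apply Rabs_le_iff. apply Rabs_lt_iff in Hz, Hlt, Xr. lra.
      * intros q Hq. specialize (Hlt q Hq). lra.
  - assert (exists s, (s = 1 \/ s = -1) /\ s * X (f t) = s * c + 12 * w) as (s & Hs & Es).
    { unfold Rabs in Et. destruct Rcase_abs; [exists (-1)|exists 1]; (split; [auto|lra]). }
    assert (Hss : s * s = 1) by (destruct Hs as [->| ->]; lra).
    (* The two candidate lines are [4 * w] apart, so one of them keeps distance [2 * w] from the
       level [xq] of the end track, which then does not meet it. *)
    assert (exists k, (k = 4 \/ k = 8) /\ 2 * w <= Rabs (s * xq - (s * c + k * w))) as (k & Hk & Ek).
    { destruct (Rle_dec (2 * w) (Rabs (s * xq - (s * c + 4 * w)))); [exists 4; auto|]. exists 8. split; auto. rabs. }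
    assert (Av : forall z, Rabs (X z - xq) < w -> s * X z <> s * c + k * w).
    { intros z Hz E. rewrite <- E in Ek. replace (s * xq - s * X z) with (s * (xq - X z)) in Ek by ring. rewrite Rabs_mult, (Rabs_pm1 s Hs), Rabs_minus_sym in Ek. lra. }
    assert (T1 : Forall (fun z => lin s (s * m) z <= s * c + k * w) T).
    { eapply Forall_impl; [|exact FT]. simpl. intros z Hz. rewrite lin_sg. apply Rabs_le_iff in Hz. destruct Hs as [->| ->]; destruct Hk as [->| ->]; lra. }
    assert (exists beta, Forall (fun z => sd s (s * m) (s * c + k * w) z = beta) Te) as [beta Hbeta].
    { destruct (Rle_dec (s * xq) (s * c + k * w)) as [Q|Q].
      - exists false. eapply Forall_impl; [|exact Xe]. simpl. intros z Hz. apply sd_false. rewrite lin_sg. apply Rabs_lt_iff in Hz. unfold Rabs in Ek. destruct Rcase_abs in Ek; destruct Hs as [->| ->]; lra.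
      - exists true. eapply Forall_impl; [|exact Xe]. simpl. intros z Hz. apply sd_true. rewrite lin_sg. apply Rabs_lt_iff in Hz. unfold Rabs in Ek. destruct Rcase_abs in Ek; destruct Hs as [->| ->]; lra. }
    destruct (cross_or_short Om l r d f g Gf Gg s (s * m) (s * c + k * w) T a a' Te r r t beta) as (x & X1 & X2 & [(x' & X3 & X4 & X5)|(q & Q1 & Q2 & Q3 & Q4)]); auto; try lra.
    { rewrite lin_sg, Es. destruct Hk as [->| ->]; lra. }
    (* Over a shortcut [f] would rise at most to [k * w + w <= 9 * w], but it reaches [12 * w] at
       [t]. *)
    + exfalso. pose proof (short_flat Om l r d Hl Hr f e s (s * m) (s * c + k * w) x t x' Gf Nf ltac:(lra) ltac:(lra) ltac:(lra) ltac:(lra) X5 X2 X4) as Q.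
      rewrite lin_sg, Es, Rabs_mult, (Rabs_pm1 s Hs), Rmult_1_l in Q. destruct Hk as [->| ->]; lra.
    + rewrite lin_sg in X2, Q2.
      assert (Eq : forall z, s * X z = s * c + k * w -> X z = c + s * (k * w)). { intros z E. replace (X z) with (s * (s * X z)) by (rewrite <- Rmult_assoc, Hss; ring). rewrite E. replace (s * (s * c + k * w)) with (s * s * c + s * (k * w)) by ring. rewrite Hss. ring. }
      pose proof (Eq _ X2) as Xx. pose proof (Eq _ Q2) as Xq.
      assert (Dk : 4 * w <= Rabs (s * (k * w))). { rewrite Rabs_mult, (Rabs_pm1 s Hs), Rabs_right; destruct Hk as [->| ->]; lra. }
      assert (a < x). { destruct (Req_dec a x) as [->|]; [|lra]. rewrite Xx in Xa. replace (c + s * (k * w) - c) with (s * (k * w)) in Xa by ring. lra. }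
      assert (a' < q). { destruct (Req_dec a' q) as [->|]; [|lra]. rewrite Xq in Xa'. replace (c + s * (k * w) - c) with (s * (k * w)) in Xa' by ring. lra. }
      assert (x < r). { destruct (Req_dec x r) as [->|]; [|lra]. exfalso. exact (Av _ Xr X2). }
      assert (q < r). { destruct (Req_dec q r) as [->|]; [|lra]. exfalso. exact (Av _ Xr' Q2). }
      assert (K2 : isTrack Om f g [f x; g q] x q). { split; [|split; [eauto|reflexivity]]. simpl. auto. }
      assert (F2 : Forall (fun z => Rabs (X z - (c + s * (k * w))) <= w) [f x; g q]).
      { repeat constructor; [rewrite Xx|rewrite Xq]; rewrite Rminus_diag, Rabs_R0; lra. }
      destruct (IH [f x; g q] x q (c + s * (k * w)) dl) as [L HL]; auto; try lra.
      { apply (Adm_cancel Om l r d f g Gf Gg T a a' [f x; g q] x q Te r r); auto; lra. }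
      (* Progress: between consecutive rungs the functional changes by at least [3 * w], which takes
         at least time [dl]. *)
      { rewrite S_INR in Hn. assert (dl <= x - a); [|lra]. apply Rnot_lt_le. intros Hlt. specialize (HU x a ltac:(lra) ltac:(lra)).
        rewrite Rabs_right in HU by lra. specialize (HU Hlt). rewrite Xx in HU.
        apply Rabs_le_iff in Xa. apply Rabs_lt_iff in HU. unfold Rabs in Dk. destruct Rcase_abs in Dk; lra. }
      exists ((a, a') :: L). apply lad_cons with x q; auto.
      assert (Hf : forall t0, a <= t0 <= x -> Rabs (X (f t0) - c) < 13 * w).
      { intros t0 Ht0. destruct (Req_dec t0 t) as [->|]; [lra|]. specialize (Hb t0 ltac:(lra)). lra. }
      repeat split; auto; try lra; try apply HT; try apply K2. exists c. split.
      * intros t0 Ht0. specialize (Hf t0 Ht0). lra.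
      * intros t0 Ht0. assert (Rabs (X (g t0) - c) <= 13 * w + w); [|lra].
        apply (box_range T a a' [f x; g q] x q c (13 * w)); auto; try lra.
        -- eapply Forall_impl; [|exact FT]. simpl. intros; lra.
        -- assert (Rabs (s * (k * w)) < 13 * w). { rewrite Rabs_mult, (Rabs_pm1 s Hs), Rabs_right; destruct Hk as [->| ->]; lra. }
           repeat constructor; [rewrite Xx|rewrite Xq]; replace (c + s * (k * w) - c) with (s * (k * w)) by ring; auto.
Qed.
End Ladder.

(** * The limit of ladders *)

Lemma Adm_refl Om l r d f g T a a' : good Om l r d f -> good Om l r d g -> l <= a <= r -> l <= a' <= r -> isTrack Om f g T a a' -> Adm Om d f g T a a' T a a'.
Proof.
  intros [Ff Cf] [Fg Cg] Ha Ha' (V & (T0 & E) & La). unfold Adm.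
  rewrite <- (ch_fl Om f l r d Ff a a [a]), <- (ch_fl Om g l r d Fg a' a' [a']); try lra; try apply FL_one. simpl.
  destruct (app_cons_last T (f a)) as [A [y Ey]]; [rewrite E; easy|]. rewrite Ey, last_last in La. subst y.
  transitivity T.
  - rewrite E. apply ceq_dup0.
  - rewrite Ey, <- app_assoc. simpl. symmetry. rewrite ceq_dup0. reflexivity.
Qed.

(** The ladder is parametrized by the sum [x] of the two times, [phi x] on [f] and [x - phi x] on
    [g]. Inside a box first [f] and then [g] advances, so both times are monotone, hence 1-Lipschitz
    in [x], and every rung is met. *)
Lemma lad_sync Om m w l r d f g Te : good Om l r d f -> good Om l r d g -> forall T a a' L, lad Om m w l r d f g Te T a a' L ->
  l <= a /\ a < r /\ l <= a' /\ a' < r /\ isTrack Om f g T a a' /\ In (a, a') L /\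
  exists phi : R -> R, (forall x, a + a' <= x <= 2 * r -> a <= phi x <= r /\ a' <= x - phi x <= r) /\
    (forall x y, a + a' <= x -> x <= y -> y <= 2 * r -> phi x <= phi y /\ x - phi x <= y - phi y) /\
    (forall u u', In (u, u') L -> a + a' <= u + u' <= 2 * r /\ phi (u + u') = u) /\
    (forall x, a + a' <= x <= 2 * r -> exists T1 u u' T2 v v', Box Om m w l r d f g T1 u u' T2 v v' /\ (a <= u /\ a' <= u') /\ u <= phi x <= v /\ u' <= x - phi x <= v' /\
       Adm Om d f g T a a' T1 u u' /\ Adm Om d f g T a a' T2 v v' /\
       (T1 = [f u; g u'] \/ T1 = T) /\ (T2 = [f v; g v'] \/ T2 = Te)).
Proof.
  intros Gf Gg T a a' L H. induction H as [T a a' B|T a a' b b' L B HL (I1 & I2 & I3 & I4 & I5 & I6 & phi & P1 & P2 & P3 & P4)].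
  - pose proof B as (B1 & B2 & B3 & B4 & B5 & B6 & B7 & B8 & B9 & B10). repeat (split; [first [lra|assumption|now left]|]).
    exists (fun x => Rmin (x - a') r). split; [|split; [|split]].
    + intros x Hx. unfold Rmin. destruct Rle_dec; lra.
    + intros x y H1 H2 H3. unfold Rmin. repeat destruct Rle_dec; lra.
    + intros u u' [E|[]]. inversion E; subst. unfold Rmin. destruct Rle_dec; lra.
    + intros x Hx. exists T, a, a', Te, r, r. split; auto. split; [lra|]. split; [unfold Rmin; destruct Rle_dec; lra|]. split; [unfold Rmin; destruct Rle_dec; lra|].
      split; [|split; auto]. apply (Adm_refl Om l r d); auto; lra.
  - pose proof B as (B1 & B2 & B3 & B4 & B5 & B6 & B7 & B8 & B9 & B10). destruct (P3 b b' I6) as [_ Pb].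
    split; [lra|]. split; [lra|]. split; [lra|]. split; [lra|]. split; auto. split; [now left|].
    assert (Vert : forall T1 u u' , isTrack Om f g T1 u u' -> T1 = [f u; g u'] \/ T1 = [f b; g b'] -> T1 = [f u; g u'] \/ T1 = T).
    { intros T1 u u' (_ & (X & E) & La) [->|E2]; auto. left. rewrite E2 in *. inversion E. simpl in La. congruence. }
    exists (fun x => if Rle_dec x (b + b') then Rmin (x - a') b else phi x).
    assert (Q : forall x, b + b' <= x <= 2 * r -> b <= phi x /\ b' <= x - phi x).
    { intros x Hx. destruct (P1 x Hx). lra. }
    split; [|split; [|split]].
    + intros x Hx. destruct Rle_dec; [unfold Rmin; destruct Rle_dec; lra|]. destruct (P1 x ltac:(lra)). lra.
    + intros x y H1 H2 H3. destruct (Rle_dec x (b + b')), (Rle_dec y (b + b')); try lra.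
      * unfold Rmin; repeat destruct Rle_dec; lra.
      * destruct (Q y ltac:(lra)). unfold Rmin; destruct Rle_dec; lra.
      * apply P2; lra.
    + intros u u' [E|Hu].
      * inversion E; subst. split; [lra|]. destruct Rle_dec; [|lra]. unfold Rmin; destruct Rle_dec; lra.
      * destruct (P3 u u' Hu) as [U1 U2]. split; [lra|]. destruct Rle_dec; auto. assert (E : u + u' = b + b') by lra. rewrite E in U2. rewrite E, Rmin_right by lra. lra.
    + intros x Hx. destruct Rle_dec as [L1|L1].
      * exists T, a, a', [f b; g b'], b, b'. split; auto. split; [lra|]. split; [unfold Rmin; destruct Rle_dec; lra|]. split; [unfold Rmin; destruct Rle_dec; lra|].
        split; [apply (Adm_refl Om l r d); auto; lra|]. auto.
      * destruct (P4 x ltac:(lra)) as (T1 & u & u' & T2 & v & v' & C1 & (U1 & U2) & C2 & C3 & C4 & C5 & C6 & C7).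
        pose proof C1 as (D1 & D2 & D3 & D4 & D5 & D6 & D7 & D8 & D9 & D10).
        exists T1, u, u', T2, v, v'. split; auto. split; [lra|]. split; auto. split; auto.
        split; [|split; [|split; auto]].
        -- apply (Adm_trans Om l r d f g Gf Gg T a a' [f b; g b'] b b'); auto; lra.
        -- apply (Adm_trans Om l r d f g Gf Gg T a a' [f b; g b'] b b'); auto; lra.
Qed.

(** The end points may lie on the boundary, so the ladder lives on the times from [l] to [1 - l],
    with the columns of the homotopy [K] at these times as first and last tracks. Beyond them [K] is
    already within [kap] of the end points. *)
Record Ldr (Om : Cpl -> Prop) (m w kap : R) (f g : R -> Cpl) (L : list (R * R)) (l d : R) (K : Cpl -> Cpl) : Prop := {
  ldr_l : 0 < l < kap /\ l < 1 - l;
  ldr_f : good Om l (1 - l) d f;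
  ldr_g : good Om l (1 - l) d g;
  ldr_K : contD dm dm Sq K /\ (forall z, Sq z -> inn Om (fst z) (K z)) /\
    forall s, In01 s -> K (s, 0) = f s /\ K (s, 1) = g s /\ K (0, s) = f 0 /\ K (1, s) = f 1;
  ldr_0 : forall s t, 0 <= s <= l -> In01 t -> dm (K (s, t)) (f 0) < kap;
  ldr_1 : forall s t, 1 - l <= s <= 1 -> In01 t -> dm (K (s, t)) (f 1) < kap;
  ldr_K0 : good Om 0 1 d (fun t => K (l, t));
  ldr_K1 : good Om 0 1 d (fun t => K (1 - l, t));
  ldr_lad : lad Om m w l (1 - l) d f g (ch d (fun t => K (1 - l, t)) 0 1) (ch d (fun t => K (l, t)) 0 1) l l L
}.

Lemma Ldr_exists Om m w kap e f g : c_open Om -> hequiv Om f g -> 0 < w -> 0 < kap -> (1 + Rabs m) * kap <= w -> (1 + Rabs m) * e <= w ->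
  NS Om e f -> NS Om e g -> exists L l d K, Ldr Om m w kap f g L l d K.
Proof.
  intros HO HE Hw Hk Hkw Hew Nf Ng. destruct (hequiv_epe _ _ _ HE) as [[Cf Of] [Cg Og]]. destruct HE as (K & K1 & K2 & K3).
  destruct (unif_cont dm dm Sq K dm_tri dm_tri dm_sym seqcpt_Sq K1 kap Hk) as [dl [Hdl HU]].
  set (l := Rmin (1/3) (Rmin (kap / 2) (dl / 2))).
  assert (Hl : 0 < l). { unfold l. repeat apply Rmin_pos; lra. }
  assert (L1 : l <= 1/3) by apply Rmin_l. assert (L2 : l <= Rmin (kap / 2) (dl / 2)) by apply Rmin_r.
  assert (L3 : l <= kap / 2) by (eapply Rle_trans; [exact L2|apply Rmin_l]). assert (L4 : l <= dl / 2) by (eapply Rle_trans; [exact L2|apply Rmin_r]).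
  assert (Sub : forall h : R -> Cpl, pathC h -> contD dR dm (I01 l (1 - l)) h).
  { intros h Hh. eapply contD_sub; [exact Hh|]. unfold I01, In01; intros; lra. }
  assert (C0 : pathC (fun t => K (l, t))) by (apply (sq_col K l); [unfold In01; lra|auto]).
  assert (C1 : pathC (fun t => K (1 - l, t))) by (apply (sq_col K (1 - l)); [unfold In01; lra|auto]).
  assert (OK : forall s t, l <= s <= 1 - l -> 0 <= t <= 1 -> Om (K (s, t))).
  { intros s t Hs Ht. apply (K2 (s, t)); simpl; [|lra]. unfold Sq, In01; simpl; lra. }
  destruct (fine_exists Om f l (1 - l) HO (Sub f Cf)) as (d1 & D1 & F1). { intros t Ht. apply Of; lra. }
  destruct (fine_exists Om g l (1 - l) HO (Sub g Cg)) as (d2 & D2 & F2). { intros t Ht. apply Og; lra. }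
  destruct (fine_exists Om (fun t => K (l, t)) 0 1 HO C0) as (d3 & D3 & F3). { intros t Ht. apply OK; lra. }
  destruct (fine_exists Om (fun t => K (1 - l, t)) 0 1 HO C1) as (d4 & D4 & F4). { intros t Ht. apply OK; lra. }
  destruct (homotopy_chains Om K l (1 - l) HO ltac:(lra)) as (d5 & D5 & F5).
  { eapply contD_sub; [exact K1|]. unfold Sq, In01; intros; lra. } { intros [s t] [Hs Ht]. simpl in *. apply OK; auto. }
  assert (exists d, 0 < d /\ d <= d1 /\ d <= d2 /\ d <= d3 /\ d <= d4 /\ d <= d5) as (d & Hd & E1 & E2 & E3 & E4 & E5).
  { exists (Rmin d1 (Rmin d2 (Rmin d3 (Rmin d4 d5)))). split; [repeat apply Rmin_pos; auto|]. unfold Rmin; repeat destruct Rle_dec; lra. }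
  set (T0 := ch d (fun t => K (l, t)) 0 1). set (Te := ch d (fun t => K (1 - l, t)) 0 1).
  assert (Gf : good Om l (1 - l) d f) by (split; [apply F1; lra|now apply Sub]).
  assert (Gg : good Om l (1 - l) d g) by (split; [apply F2; lra|now apply Sub]).
  assert (G0 : good Om 0 1 d (fun t => K (l, t))) by (split; [apply F3; lra|auto]).
  assert (G1 : good Om 0 1 d (fun t => K (1 - l, t))) by (split; [apply F4; lra|auto]).
  assert (N0 : forall s t, 0 <= s <= l -> In01 t -> dm (K (s, t)) (f 0) < kap).
  { intros s t Hs Ht. destruct (K3 t Ht) as (_ & _ & <- & _). apply HU; [unfold Sq, In01 in *; simpl; lra..|].
    apply dm_lt; simpl. rewrite Rminus_diag, Rabs_R0. split; [rabs|lra]. }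
  assert (N1 : forall s t, 1 - l <= s <= 1 -> In01 t -> dm (K (s, t)) (f 1) < kap).
  { intros s t Hs Ht. destruct (K3 t Ht) as (_ & _ & _ & <-). apply HU; [unfold Sq, In01 in *; simpl; lra..|].
    apply dm_lt; simpl. rewrite Rminus_diag, Rabs_R0. split; [rabs|lra]. }
  assert (Tr : forall s, l <= s <= 1 - l -> good Om 0 1 d (fun t => K (s, t)) -> isTrack Om f g (ch d (fun t => K (s, t)) 0 1) s s).
  { intros s Hs [Gs _]. destruct (K3 s ltac:(unfold In01; lra)) as (K30 & K31 & _). split; [|split].
    - apply (ch_valid Om _ 0 1 d Gs); lra.
    - destruct (ch_shape Om _ 0 1 d Gs 0 1 ltac:(lra)) as [x E]. exists x. rewrite E. now rewrite K30.
    - rewrite (ch_last Om _ 0 1 d Gs 0 1 (f s) ltac:(lra)). auto. }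
  assert (Pos : 0 <= Rabs m) by apply Rabs_pos.
  assert (XK : forall z p, dm z p < kap -> Rabs (lin 1 m z - lin 1 m p) < w).
  { intros z p Hz. eapply Rle_lt_trans; [apply lin_lip|]. rewrite Rabs_R1. assert ((1 + Rabs m) * dm z p < (1 + Rabs m) * kap) by (apply Rmult_lt_compat_l; lra). lra. }
  assert (A : Adm Om d f g T0 l l Te (1 - l) (1 - l)).
  { unfold Adm. specialize (F5 d ltac:(lra)). fold T0 Te in F5.
    assert (Ext : forall (h h' : R -> Cpl), (forall t, l <= t <= 1 - l -> h t = h' t) -> ch d h l (1 - l) = ch d h' l (1 - l)).
    { intros h h' E. unfold ch. apply map_ext_in. intros t Ht. apply E. assert (R := FL_range _ _ _ _ (fl_spec d l (1 - l) ltac:(lra) ltac:(lra))). rewrite Forall_forall in R. now apply R. }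
    rewrite (Ext (fun s => K (s, 0)) f), (Ext (fun s => K (s, 1)) g) in F5; auto; intros t Ht; apply K3; unfold In01; lra. }
  assert (InT : forall s z, l <= s <= 1 - l -> good Om 0 1 d (fun t => K (s, t)) -> In z (ch d (fun t => K (s, t)) 0 1) -> exists t, In01 t /\ z = K (s, t)).
  { intros s z Hs [Gs _] Hz. destruct (ch_in Om _ 0 1 d Gs 0 1 z ltac:(lra) Hz) as [t [Ht ->]]. exists t. auto. }
  destruct (unif_cont dR dR _ _ dR_tri dR_tri dR_sym (seqcpt_I l (1 - l)) (lin_path 1 m _ _ (Sub f Cf)) (2 * w) ltac:(lra)) as [del [Hdel HUd]].
  destruct (INR_unbounded ((1 - l - l) / del)) as [n Hn].
  destruct (ladder_exists Om m w l (1 - l) d f g Te Hl ltac:(lra) ltac:(lra) Hw Gf Gg e Hew Nf Ng (lin 1 m (f 1))) with (n := n) (T := T0) (a := l) (a' := l) (c := lin 1 m (f 0)) (dl := del) as [L HL]; auto; try lra.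
  - apply Tr; auto; lra.
  - apply Forall_forall. intros z Hz. destruct (InT (1 - l) z ltac:(lra) G1 Hz) as (t & Ht & ->). apply XK. apply N1; auto; lra.
  - apply Tr; auto; lra.
  - apply Forall_forall. intros z Hz. destruct (InT l z ltac:(lra) G0 Hz) as (t & Ht & ->). left. apply XK. apply N0; auto; lra.
  - apply Rmult_le_reg_r with (/ del). { now apply Rinv_0_lt_compat. } rewrite Rmult_assoc, Rinv_r; lra.
  - exists L, l, d, K. split; auto; lra.
Qed.

(** What a stretch of the limit curves inherits from the ladders: up to [ze], an admissible box
    between paths without deep shortcuts that follow [A] and [B], with end tracks near [A e0] and
    [A e1]. *)
Definition Span Om (A B : R -> Cpl) (e0 e1 ze : R) : Prop :=
  exists l r d f g e T u u' T' v v', 0 < l /\ r < 1 /\ good Om l r d f /\ good Om l r d g /\ NS Om e f /\ NS Om e g /\ e < ze /\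
    (l <= u /\ u <= v /\ v <= r) /\ (l <= u' /\ u' <= v' /\ v' <= r) /\ isTrack Om f g T u u' /\ isTrack Om f g T' v v' /\ Adm Om d f g T u u' T' v v' /\
    Forall (fun z => dm z (A e0) < ze) T /\ Forall (fun z => dm z (A e1) < ze) T' /\
    (forall t, u <= t <= v -> exists s, e0 <= s <= e1 /\ dm (f t) (A s) < ze) /\ (forall t, u' <= t <= v' -> exists s, e0 <= s <= e1 /\ dm (g t) (B s) < ze) /\
    (forall s, e0 <= s <= e1 -> exists t, u <= t <= v /\ dm (f t) (A s) < ze) /\ (forall s, e0 <= s <= e1 -> exists t, u' <= t <= v' /\ dm (g t) (B s) < ze).

Lemma Span_sym Om A B e0 e1 ze : A e0 = B e0 -> A e1 = B e1 -> Span Om A B e0 e1 ze -> Span Om B A e0 e1 ze.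
Proof.
  intros E0 E1 (l & r & d & f & g & e & T & u & u' & T' & v & v' & H1 & H2 & H3 & H4 & H5 & H6 & H7 & H8 & H9 & H10 & H11 & H12 & H13 & H14 & H15 & H16 & H17 & H18).
  exists l, r, d, g, f, e, (rev T), u', u, (rev T'), v', v. rewrite <- E0, <- E1.
  repeat match goal with |- _ /\ _ => split; [solve [auto; lra]|] end.
  split; [now apply track_rev|]. split; [now apply track_rev|]. split. { apply (Adm_sym Om l r d f g); auto; lra. }
  split; [now apply Forall_rev|]. split; [now apply Forall_rev|]. auto.
Qed.

Lemma max_on (h : R -> R) e0 e1 : e0 <= e1 -> contD dR dR (I01 e0 e1) h -> exists s, e0 <= s <= e1 /\ forall t, e0 <= t <= e1 -> h t <= h s.
Proof.
  intros He Hc. destruct (max_attained dR (I01 e0 e1) h (seqcpt_I e0 e1) Hc) as [s [Hs Hm]]; [exists e0; unfold I01; lra|]. exists s. auto.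
Qed.

(* The arc of [A] above the chord can be cut off along a line that [B] does not reach. *)
Lemma bigon_peak Om A B e0 e1 al be sg : al <> 0 \/ be <> 0 -> contD dR dm (I01 e0 e1) A -> contD dR dm (I01 e0 e1) B ->
  A e0 = B e0 -> A e1 = B e1 -> (forall s, e0 < s < e1 -> lin al be (B s) < lin al be (A s)) ->
  e0 <= sg <= e1 -> lin al be (A e0) < lin al be (A sg) -> lin al be (A e1) < lin al be (A sg) ->
  (forall ze, 0 < ze -> Span Om A B e0 e1 ze) -> False.
Proof.
  intros Hnz CA CB E0 E1 Lt Hsg L0 L1 HS.
  destruct (max_on (fun t => lin al be (A t)) e0 e1 ltac:(lra) (lin_path _ _ _ _ CA)) as (x & Hx & Mx).
  destruct (max_on (fun t => lin al be (B t)) e0 e1 ltac:(lra) (lin_path _ _ _ _ CB)) as (y & Hy & My). simpl in *.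
  pose proof (Mx sg Hsg) as Msg.
  assert (Mxy : lin al be (B y) < lin al be (A x)).
  { destruct (Req_dec y e0) as [->|]; [rewrite <- E0; lra|]. destruct (Req_dec y e1) as [->|]; [rewrite <- E1; lra|].
    specialize (Lt y ltac:(lra)). specialize (Mx y Hy). lra. }
  set (M1 := lin al be (A x)) in *.
  (* A level exceeded neither by [B] nor by the two ends, but by the peak of [A]. *)
  set (c0 := Rmax (lin al be (B y)) (Rmax (lin al be (A e0)) (lin al be (A e1)))).
  assert (C0 : c0 < M1) by (unfold c0; repeat apply Rmax_lub_lt; lra).
  assert (C1 : lin al be (B y) <= c0) by apply Rmax_l.
  assert (C2 : lin al be (A e0) <= c0) by (eapply Rle_trans; [apply Rmax_l|apply Rmax_r]).
  assert (C3 : lin al be (A e1) <= c0) by (eapply Rle_trans; [apply Rmax_r|apply Rmax_r]).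
  set (N := Rabs al + Rabs be + 1). assert (HN : 1 <= N) by (unfold N; pose proof (Rabs_pos al); pose proof (Rabs_pos be); lra).
  (* Three errors of a quarter of the gap occur: at the peak, for the tracks and [g], and in
     [no_peak]. *)
  set (ze := (M1 - c0) / 4 / N). assert (Hze : 0 < ze) by (unfold ze; repeat apply Rdiv_lt_0_compat; lra).
  assert (Eze : N * ze = (M1 - c0) / 4) by (unfold ze; field; lra).
  assert (Lip : forall z z', dm z z' < ze -> Rabs (lin al be z - lin al be z') < (M1 - c0) / 4).
  { intros z z' Hz. eapply Rle_lt_trans; [apply lin_lip|]. rewrite <- Eze. pose proof (dm_pos z z'). unfold N in *. pose proof (Rabs_pos al). pose proof (Rabs_pos be). nra. }
  destruct (HS ze Hze) as (l & r & d & f & g & e & T & u & u' & T' & v & v' & H1 & H2 & H3 & H4 & H5 & H6 & H7 & H8 & H9 & H10 & H11 & H12 & H13 & H14 & H15 & H16 & H17 & H18).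
  destruct (H17 x Hx) as (t & Ht & Dt). apply Lip, Rabs_lt_iff in Dt. fold M1 in Dt.
  assert (Q := no_peak Om l r d f g H1 H2 H3 H4 e al be (c0 + (M1 - c0) / 4) T u u' T' v v' t Hnz H5).
  assert (lin al be (f t) <= c0 + (M1 - c0) / 4 + (Rabs al + Rabs be) * e).
  { apply Q; auto; try lra.
    - eapply Forall_impl; [|exact H13]. simpl. intros z Hz. apply Lip, Rabs_lt_iff in Hz. lra.
    - eapply Forall_impl; [|exact H14]. simpl. intros z Hz. apply Lip, Rabs_lt_iff in Hz. lra.
    - intros q Hq. destruct (H16 q Hq) as (s & Hs & Ds). apply Lip, Rabs_lt_iff in Ds. specialize (My s Hs). lra. }
  assert ((Rabs al + Rabs be) * e <= (Rabs al + Rabs be) * ze) by (apply Rmult_le_compat_l; [pose proof (Rabs_pos al); pose proof (Rabs_pos be)|]; lra).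
  unfold N in Eze. lra.
Qed.

Lemma last_before (P : R -> Prop) a b : a <= b -> P a -> (forall t, a <= t <= b -> ~ P t -> exists d, 0 < d /\ forall t', a <= t' <= b -> Rabs (t - t') < d -> ~ P t') ->
  exists e, a <= e <= b /\ P e /\ forall t, e < t <= b -> ~ P t.
Proof.
  intros Hab Ha Hcl. destruct (sup_prefix P a b Hab Ha) as (e & He & H1 & H2). exists e. split; auto. split; auto.
  apply NNPP. intros N. destruct (Hcl e He N) as (d & Hd & HD).
  destruct (Req_dec a e) as [->|Hne]; [auto|].
  destruct (H1 (Rmax a (e - d / 2))) as (t' & Ht' & Pt'). { split; [apply Rmax_l|apply Rmax_lub_lt; lra]. }
  pose proof (Rmax_l a (e - d / 2)). pose proof (Rmax_r a (e - d / 2)). apply (HD t'); auto; [lra|rabs].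
Qed.

(** Around a time where the curves differ, a maximal interval gives a bigon with one side strictly
    on top throughout. By [bigon_peak] the upper side cannot bulge upwards nor the lower side
    downwards, in any direction transversal to the lines of the ladder, which leaves no room for the
    bigon. *)
Lemma sync_curves Om m A B : pathC A -> pathC B -> A 0 = B 0 -> A 1 = B 1 -> (forall s, In01 s -> lin 1 m (A s) = lin 1 m (B s)) ->
  (forall s s', 0 <= s -> s <= s' -> s' <= 1 -> (forall t, s <= t <= s' -> lin 1 m (A t) = lin 1 m (A s)) -> forall t, s <= t <= s' -> A t = A s /\ B t = B s) ->
  (forall e0 e1 ze, 0 <= e0 -> e0 <= e1 -> e1 <= 1 -> A e0 = B e0 -> A e1 = B e1 -> 0 < ze -> Span Om A B e0 e1 ze) ->
  forall s, In01 s -> A s = B s.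
Proof.
  intros CA CB A0 A1 HX HG HS s Hs. apply NNPP. intros Ne.
  assert (CD : contD dR dR In01 (fun t => snd (A t) - snd (B t))) by ctac.
  assert (Eq : forall t, In01 t -> snd (A t) - snd (B t) = 0 -> A t = B t).
  { intros t Ht E. specialize (HX t Ht). unfold lin in HX. destruct (A t), (B t); simpl in *. f_equal; nra. }
  assert (Cl : forall t, In01 t -> A t <> B t -> exists d, 0 < d /\ forall t', In01 t' -> Rabs (t - t') < d -> A t' <> B t').
  { intros t Ht N. assert (N' : snd (A t) - snd (B t) <> 0) by (intros E; apply N; auto). assert (P := Rabs_pos_lt _ N').
    destruct (CD t Ht _ P) as (d & Hd & HD). exists d. split; auto. intros t' Ht' Htt E. specialize (HD t' Ht' Htt). rewrite E in HD. unfold dR in HD. rewrite Rminus_diag, Rminus_0_r in HD. lra. }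
  unfold In01 in Hs.
  destruct (last_before (fun t => A t = B t) 0 s) as (e0 & H0 & E0 & N0); auto; try lra.
  { intros t Ht N. destruct (Cl t ltac:(unfold In01; lra) N) as (d & Hd & HD). exists d. split; auto. intros t' Ht'. apply HD. unfold In01; lra. }
  destruct (last_before (fun t => A (1 - t) = B (1 - t)) 0 (1 - s)) as (e1' & H1 & E1 & N1); auto; try lra.
  { now rewrite Rminus_0_r. }
  { intros t Ht N. destruct (Cl (1 - t) ltac:(unfold In01; lra) N) as (d & Hd & HD). exists d. split; auto. intros t' Ht' Htt. apply HD; [unfold In01; lra|].
    replace (1 - t - (1 - t')) with (- (t - t')) by ring. now rewrite Rabs_Ropp. }
  set (e1 := 1 - e1') in *.
  assert (Hes : e0 < s < e1).
  { assert (e0 <> s) by (intros ->; auto). assert (e1' <> 1 - s). { intros ->. apply Ne. unfold e1 in E1. replace (1 - (1 - s)) with s in E1 by ring. auto. } unfold e1. lra. }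
  assert (NE : forall t, e0 < t < e1 -> A t <> B t).
  { intros t Ht. destruct (Rle_dec t s); [apply N0; lra|]. specialize (N1 (1 - t)). replace (1 - (1 - t)) with t in N1 by ring. apply N1. unfold e1 in *. lra. }
  assert (He1 : e1 <= 1) by (unfold e1; lra).
  assert (ND : forall t, e0 < t < e1 -> snd (A t) - snd (B t) <> 0).
  { intros t Ht E. apply (NE t Ht). apply Eq; auto. unfold In01; lra. }
  assert (exists tau, tau * tau = 1 /\ forall t, e0 < t < e1 -> tau * snd (B t) < tau * snd (A t)) as (tau & Ht2 & Hpos).
  { assert (IV : forall x y, e0 < x < e1 -> e0 < y < e1 -> snd (A x) - snd (B x) < 0 < snd (A y) - snd (B y) -> False).
    { intros x y Hx Hy Hxy. destruct (Rle_dec x y) as [L|L].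
      - destruct (ivt x y (fun t => snd (A t) - snd (B t)) 0 L) as (z & Hz & Ez); auto. { eapply contD_sub; [exact CD|]. unfold I01, In01; intros; lra. } apply (ND z); auto; lra.
      - destruct (ivt y x (fun t => snd (B t) - snd (A t)) 0) as (z & Hz & Ez); try lra. { eapply contD_sub; [|unfold I01, In01; intros; instantiate (1 := In01); unfold In01; lra]. ctac. } apply (ND z); lra. }
    destruct (Rlt_dec 0 (snd (A s) - snd (B s))) as [P|P].
    - exists 1. split; [lra|]. intros t Ht. pose proof (ND t Ht). destruct (Rlt_dec (snd (A t) - snd (B t)) 0); [exfalso; apply (IV t s); auto|lra].
    - exists (-1). split; [lra|]. pose proof (ND s ltac:(lra)). intros t Ht. pose proof (ND t Ht). destruct (Rlt_dec 0 (snd (A t) - snd (B t))); [exfalso; apply (IV s t); auto; lra|lra]. }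
  assert (HSp : forall ze, 0 < ze -> Span Om A B e0 e1 ze) by (intros; apply HS; auto; lra).
  assert (HSp' : forall ze, 0 < ze -> Span Om B A e0 e1 ze) by (intros; apply Span_sym; auto).
  assert (CA' : contD dR dm (I01 e0 e1) A) by (eapply contD_sub; [exact CA|]; unfold I01, In01; intros; lra).
  assert (CB' : contD dR dm (I01 e0 e1) B) by (eapply contD_sub; [exact CB|]; unfold I01, In01; intros; lra).
  assert (V : forall beta z, lin (- beta) (tau - beta * m) z = tau * snd z - beta * lin 1 m z) by (intros; unfold lin; ring).
  assert (NZ : forall beta, - beta <> 0 \/ tau - beta * m <> 0).
  { intros beta. destruct (Req_dec beta 0) as [->|]; [right|left; lra]. intros E. assert (tau = 0) by lra. subst tau. lra. }
  assert (NZ' : forall beta, beta <> 0 \/ - (tau - beta * m) <> 0). { intros beta. destruct (NZ beta); [left|right]; lra. }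
  assert (VN : forall beta z, lin beta (- (tau - beta * m)) z = - (tau * snd z - beta * lin 1 m z)) by (intros; unfold lin; ring).
  (* For every slope [beta] the upper side nowhere exceeds both ends under [tau * y - beta * X];
     [Dn] is the mirror statement for the lower side. *)
  assert (Up : forall beta sg, e0 <= sg <= e1 -> lin (- beta) (tau - beta * m) (A e0) < lin (- beta) (tau - beta * m) (A sg) -> lin (- beta) (tau - beta * m) (A e1) < lin (- beta) (tau - beta * m) (A sg) -> False).
  { intros beta sg Hsg L0 L1. apply (bigon_peak Om A B e0 e1 (- beta) (tau - beta * m) sg); auto.
    intros t Ht. rewrite !V, (HX t) by (unfold In01; lra). specialize (Hpos t Ht). lra. }
  assert (Dn : forall beta sg, e0 <= sg <= e1 -> lin (- beta) (tau - beta * m) (B sg) < lin (- beta) (tau - beta * m) (A e0) -> lin (- beta) (tau - beta * m) (B sg) < lin (- beta) (tau - beta * m) (A e1) -> False).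
  { intros beta sg Hsg L0 L1. rewrite !V in L0, L1. apply (bigon_peak Om B A e0 e1 beta (- (tau - beta * m)) sg); auto.
    - intros t Ht. rewrite !VN, (HX t) by (unfold In01; lra). specialize (Hpos t Ht). lra.
    - rewrite !VN, <- E0. lra.
    - rewrite !VN, <- E1. lra. }
  destruct (Req_dec (lin 1 m (A e0)) (lin 1 m (A e1))) as [EX|EX].
  - destruct (classic (forall t, e0 <= t <= e1 -> lin 1 m (A t) = lin 1 m (A e0))) as [C|C].
    + apply Ne. destruct (HG e0 e1 ltac:(lra) ltac:(lra) He1 C s ltac:(lra)) as [-> ->]. auto.
    + apply not_all_ex_not in C as [sg C]. apply imply_to_and in C as [Hsg C].
      set (D := lin 1 m (A sg) - lin 1 m (A e0)) in *. assert (HD : D <> 0) by (unfold D; lra).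
      (* A slope so steep that the point [sg], being displaced in the functional, beats both
         ends. *)
      set (b := - (tau * snd (A e0) - tau * snd (A sg) + Rabs (tau * snd (A e1) - tau * snd (A e0)) + 1) / D).
      apply (Up b sg Hsg); rewrite !V; [|rewrite <- EX];
        assert (Eb : b * lin 1 m (A sg) = b * lin 1 m (A e0) - (tau * snd (A e0) - tau * snd (A sg) + Rabs (tau * snd (A e1) - tau * snd (A e0)) + 1))
          by (replace (lin 1 m (A sg)) with (lin 1 m (A e0) + D) by (unfold D; ring); unfold b; field; auto);
        rewrite Eb; unfold Rabs; destruct Rcase_abs; lra.
  (* With the slope of the chord both ends are level: the upper side cannot be above the chord, nor
     the lower side below it, against their order at [s]. *)
  - set (b := tau * (snd (A e1) - snd (A e0)) / (lin 1 m (A e1) - lin 1 m (A e0))).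
    assert (Ev : lin (- b) (tau - b * m) (A e0) = lin (- b) (tau - b * m) (A e1)).
    { rewrite !V. assert (b * (lin 1 m (A e1) - lin 1 m (A e0)) = tau * (snd (A e1) - snd (A e0))) by (unfold b; field; lra). lra. }
    specialize (Hpos s Hes). assert (Es : lin 1 m (A s) = lin 1 m (B s)) by (apply HX; unfold In01; lra).
    destruct (Rlt_dec (lin (- b) (tau - b * m) (A e0)) (lin (- b) (tau - b * m) (A s))) as [L|L].
    + apply (Up b s); lra.
    + apply Rnot_lt_le in L. rewrite !V in Ev, L. apply (Dn b s); [lra|rewrite !V, <- Es; lra..].
Qed.

(** [generic_modulus] is transferred to paths near [lam]; [w / (4 * M)] keeps the change of the
    functional below [w / 4]. *)
Lemma narrow_small m lam : pathC lam -> generic m lam -> forall e, 0 < e -> exists rho, 0 < rho /\ forall f c u v,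
  near rho lam f -> 0 <= u -> v <= 1 -> (forall t, u <= t <= v -> Rabs (lin 1 m (f t) - c) <= rho) -> forall t t', u <= t <= v -> u <= t' <= v -> dm (f t) (f t') < e.
Proof.
  intros HC HG e He. destruct (generic_modulus m lam HC HG (e / 3)) as (w & Hw & HW); [lra|].
  set (M := 1 + Rabs m). assert (HM : 1 <= M) by (unfold M; pose proof (Rabs_pos m); lra).
  assert (Hq : 0 < w / (4 * M)) by (apply Rdiv_lt_0_compat; lra). assert (Eq : M * (w / (4 * M)) = w / 4) by (field; lra).
  exists (Rmin (e / 3) (Rmin (w / 4) (w / (4 * M)))). split; [repeat apply Rmin_pos; lra|].
  intros f c u v Hn Hu Hv Hx t t' Ht Ht'.
  set (rho := Rmin (e / 3) (Rmin (w / 4) (w / (4 * M)))) in *.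
  assert (R1 : rho <= e / 3) by apply Rmin_l. assert (R2 : rho <= w / 4) by (eapply Rle_trans; [apply Rmin_r|apply Rmin_l]).
  assert (R3 : rho <= w / (4 * M)) by (eapply Rle_trans; [apply Rmin_r|apply Rmin_r]).
  assert (Lp : forall x, u <= x <= v -> Rabs (lin 1 m (lam x) - lin 1 m (f x)) <= w / 4).
  { intros x H. eapply Rle_trans; [apply lin_lip|]. rewrite Rabs_R1. fold M. specialize (Hn x ltac:(unfold In01; lra)). rewrite <- Eq. apply Rmult_le_compat_l; lra. }
  assert (D : dm (lam t) (lam t') < e / 3).
  { apply (HW u v); auto. intros x y H1 H2. pose proof (Lp x H1) as A1. pose proof (Lp y H2) as A2. pose proof (Hx x H1) as A3. pose proof (Hx y H2) as A4.
    apply Rabs_le_iff in A1, A2, A3, A4. apply Rabs_le_iff. lra. }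
  pose proof (Hn t ltac:(unfold In01; lra)). pose proof (Hn t' ltac:(unfold In01; lra)).
  pose proof (dm_tri (f t) (lam t) (f t')). pose proof (dm_tri (lam t) (lam t') (f t')). rewrite (dm_sym (f t) (lam t)) in *. lra.
Qed.

Lemma lip_cont (D : R -> Prop) (h : R -> R) : (forall x y, D x -> D y -> Rabs (h x - h y) <= 2 * Rabs (x - y)) -> contD dR dR D h.
Proof.
  intros H x Hx e He. exists (e / 2). split; [lra|]. intros y Hy Hxy. unfold dR in *. specialize (H x y Hx Hy). lra.
Qed.

(** * Limits of the parametrizations given by ladders *)

Section SyncLimit.
Variables (Om : Cpl -> Prop) (m : R) (f g : nat -> R -> Cpl) (lam1 lam2 : R -> Cpl) (w kap e l d : nat -> R) (L : nat -> list (R * R)) (K : nat -> Cpl -> Cpl).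
Hypothesis (C1 : pathC lam1) (C2 : pathC lam2) (G1 : generic m lam1) (G2 : generic m lam2).
Hypothesis (N1 : forall n, near (/ (INR n + 1)) lam1 (f n)) (N2 : forall n, near (/ (INR n + 1)) lam2 (g n)).
Hypothesis HL : forall n, Ldr Om m (w n) (kap n) (f n) (g n) (L n) (l n) (d n) (K n).
Hypothesis (Sw : forall n, w n <= / (INR n + 1)) (Sk : forall n, kap n <= / (INR n + 1)) (Se : forall n, e n <= / (INR n + 1)).
Hypothesis (Nf : forall n, NS Om (e n) (f n)) (Ng : forall n, NS Om (e n) (g n)).

Lemma box_small ep : 0 < ep -> exists N, forall n, (N <= n)%nat -> forall T1 u u' T2 v v', Box Om m (w n) (l n) (1 - l n) (d n) (f n) (g n) T1 u u' T2 v v' ->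
  (forall t t', u <= t <= v -> u <= t' <= v -> dm (f n t) (f n t') < ep) /\ (forall t t', u' <= t <= v' -> u' <= t' <= v' -> dm (g n t) (g n t') < ep).
Proof.
  intros Hep. destruct (narrow_small m lam1 C1 G1 ep Hep) as (r1 & R1 & H1). destruct (narrow_small m lam2 C2 G2 ep Hep) as (r2 & R2 & H2).
  destruct (archi_inv (Rmin r1 r2 / 16)) as [N HN]. { pose proof (Rmin_pos r1 r2 R1 R2). lra. }
  exists N. intros n Hn T1 u u' T2 v v' (B1 & B2 & B3 & B4 & B5 & B6 & _ & _ & _ & c & B7 & B8). specialize (HN n Hn). pose proof (Rmin_l r1 r2). pose proof (Rmin_r r1 r2).
  destruct (ldr_l _ _ _ _ _ _ _ _ _ _ (HL n)) as [Hl _]. specialize (Sw n). pose proof (inv_succ_pos n). split.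
  - apply (H1 (f n) c u v); try lra. { intros x Hx. specialize (N1 n x Hx). lra. } intros t Ht. specialize (B7 t Ht). lra.
  - apply (H2 (g n) c u' v'); try lra. { intros x Hx. specialize (N2 n x Hx). lra. } intros t Ht. specialize (B8 t Ht). lra.
Qed.

Lemma ends_eq x : x = 0 \/ x = 1 -> lam1 x = lam2 x.
Proof.
  intros Hx. apply dm_0. apply Rnot_lt_le. intros Hp. destruct (archi_inv (dm (lam1 x) (lam2 x) / 2)) as [n Hn]; [lra|]. specialize (Hn n (le_n n)).
  destruct (ldr_K _ _ _ _ _ _ _ _ _ _ (HL n)) as (_ & _ & HK). assert (Ix : In01 x) by (destruct Hx as [->| ->]; unfold In01; lra).
  assert (E : f n x = g n x).
  { destruct (HK x Ix) as (A1 & A2 & A3 & A4). destruct Hx as [->| ->].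
    - destruct (HK 1 in01_1) as (_ & _ & A5 & _). rewrite <- A5. destruct (HK 0 in01_0) as (_ & A6 & _). auto.
    - congruence. }
  pose proof (N1 n x Ix). pose proof (N2 n x Ix). pose proof (dm_tri (lam1 x) (f n x) (lam2 x)). rewrite E in *. rewrite (dm_sym (g n x)) in *. lra.
Qed.

(** The sum of the two times runs from [2 * l n] to [2 * (1 - l n)]. Clamping [2 * x] to this range
    gives all ladders the same parameter interval. *)
Let cl n x := Rmax (2 * l n) (Rmin (2 * x) (2 * (1 - l n))).

Lemma cl_facts n : (forall x, In01 x -> 2 * l n <= cl n x <= 2 * (1 - l n) /\ Rabs (cl n x - 2 * x) <= 2 * l n) /\
  (forall x y, x <= y -> 0 <= cl n y - cl n x <= 2 * (y - x)) /\ (forall x, 2 * l n <= 2 * x <= 2 * (1 - l n) -> cl n x = 2 * x).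
Proof.
  destruct (ldr_l _ _ _ _ _ _ _ _ _ _ (HL n)) as [H1 H2]. split; [|split].
  - intros x Hx. unfold In01, cl, Rmax, Rmin in *. repeat destruct Rle_dec; (split; [lra|rabs]).
  - intros x y Hxy. unfold cl, Rmax, Rmin in *. repeat destruct Rle_dec; lra.
  - intros x Hx. unfold cl, Rmax, Rmin in *. repeat destruct Rle_dec; lra.
Qed.

Let Te n := ch (d n) (fun t => K n (1 - l n, t)) 0 1.
Let T0 n := ch (d n) (fun t => K n (l n, t)) 0 1.

Lemma phi_exists : exists Phi : nat -> R -> R, forall n,
  (forall x, In01 x -> l n <= Phi n x <= 1 - l n /\ l n <= cl n x - Phi n x <= 1 - l n) /\
  (forall x y, In01 x -> In01 y -> x <= y -> Phi n x <= Phi n y /\ cl n x - Phi n x <= cl n y - Phi n y) /\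
  (forall u u', In (u, u') (L n) -> exists x, In01 x /\ Phi n x = u /\ cl n x - Phi n x = u') /\
  (forall x, In01 x -> exists T1 u u' T2 v v', Box Om m (w n) (l n) (1 - l n) (d n) (f n) (g n) T1 u u' T2 v v' /\ u <= Phi n x <= v /\ u' <= cl n x - Phi n x <= v' /\
     Adm Om (d n) (f n) (g n) (T0 n) (l n) (l n) T1 u u' /\ Adm Om (d n) (f n) (g n) (T0 n) (l n) (l n) T2 v v' /\
     (T1 = [f n u; g n u'] \/ T1 = T0 n) /\ (T2 = [f n v; g n v'] \/ T2 = Te n)).
Proof.
  assert (H : forall n, exists phi : R -> R, 
    (forall x, l n + l n <= x <= 2 * (1 - l n) -> l n <= phi x <= 1 - l n /\ l n <= x - phi x <= 1 - l n) /\
    (forall x y, l n + l n <= x -> x <= y -> y <= 2 * (1 - l n) -> phi x <= phi y /\ x - phi x <= y - phi y) /\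
    (forall u u', In (u, u') (L n) -> l n + l n <= u + u' <= 2 * (1 - l n) /\ phi (u + u') = u) /\
    (forall x, l n + l n <= x <= 2 * (1 - l n) -> exists T1 u u' T2 v v', Box Om m (w n) (l n) (1 - l n) (d n) (f n) (g n) T1 u u' T2 v v' /\ (l n <= u /\ l n <= u') /\ u <= phi x <= v /\ u' <= x - phi x <= v' /\
       Adm Om (d n) (f n) (g n) (T0 n) (l n) (l n) T1 u u' /\ Adm Om (d n) (f n) (g n) (T0 n) (l n) (l n) T2 v v' /\
       (T1 = [f n u; g n u'] \/ T1 = T0 n) /\ (T2 = [f n v; g n v'] \/ T2 = Te n))).
  { intros n. destruct (HL n) as [_ Gf Gg _ _ _ _ _ Hlad]. apply (lad_sync _ _ _ _ _ _ _ _ _ Gf Gg) in Hlad. exact (proj2 (proj2 (proj2 (proj2 (proj2 (proj2 Hlad)))))). }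
  destruct (choice _ H) as [phi Hp]. exists (fun n x => phi n (cl n x)). intros n. destruct (Hp n) as (P1 & P2 & P3 & P4). destruct (cl_facts n) as (Q1 & Q2 & Q3).
  split; [|split; [|split]].
  - intros x Hx. apply P1. destruct (Q1 x Hx). lra.
  - intros x y Hx Hy Hxy. destruct (Q1 x Hx), (Q1 y Hy). specialize (Q2 x y Hxy). apply P2; lra.
  - intros u u' Hu. destruct (P3 u u' Hu) as [U1 U2]. exists ((u + u') / 2).
    assert (E : cl n ((u + u') / 2) = u + u') by (rewrite Q3; lra). rewrite E, U2.
    destruct (ldr_l _ _ _ _ _ _ _ _ _ _ (HL n)). unfold In01. repeat split; lra.
  - intros x Hx. destruct (P4 (cl n x)) as (T1 & u & u' & T2 & v & v' & B1 & _ & B2). { destruct (Q1 x Hx). lra. }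
    exists T1, u, u', T2, v, v'. split; auto.
Qed.

(** The times on [f n] and [g n] are 2-Lipschitz in the common parameter, so [ascoli] gives limits
    [phi] and [psi] with sum [2 * x]. The reparametrized limit paths have the same functional
    [lin 1 m], and [sync_curves] makes them equal. *)
Theorem sync_limit : exists (s : nat -> nat) phi psi, (forall k, (k <= s k)%nat) /\ reparam01 phi /\ reparam01 psi /\ (forall x, In01 x -> lam1 (phi x) = lam2 (psi x)) /\
  forall ep, 0 < ep -> exists N, forall k, (N <= k)%nat -> forall u u', In (u, u') (L (s k)) -> dm (f (s k) u) (g (s k) u') < ep.
Proof.
  destruct phi_exists as [Phi HP]. set (Psi := fun n x => cl n x - Phi n x).
  assert (Ll : forall n, 0 < l n < / (INR n + 1)). { intros n. destruct (ldr_l _ _ _ _ _ _ _ _ _ _ (HL n)). specialize (Sk n). lra. }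
  assert (Lip : forall n x y, In01 x -> In01 y -> Rabs (Phi n x - Phi n y) <= 2 * Rabs (x - y) /\ Rabs (Psi n x - Psi n y) <= 2 * Rabs (x - y)).
  { intros n x y Hx Hy. destruct (HP n) as (_ & P2 & _). destruct (cl_facts n) as (_ & Q2 & _). unfold Psi.
    destruct (Rle_dec x y) as [H|H].
    - specialize (P2 x y Hx Hy H). specialize (Q2 x y H). split; rabs.
    - specialize (P2 y x Hy Hx ltac:(lra)). specialize (Q2 y x ltac:(lra)). split; rabs. }
  assert (In_ : forall n x, In01 x -> In01 (Phi n x) /\ In01 (Psi n x)).
  { intros n x Hx. destruct (HP n) as (P1 & _). specialize (P1 x Hx). specialize (Ll n). unfold Psi, In01. lra. }
  destruct (ascoli Phi 1) as (s & phi & Hs & Cv).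
  { intros k x Hx. destruct (In_ k x Hx) as [[A B] _]. rabs. }
  { intros ep Hep. exists (ep / 2), O. split; [lra|]. intros k _ x y Hx Hy Hxy. destruct (Lip k x y Hx Hy). lra. }
  set (psi := fun x => 2 * x - phi x).
  assert (Cv2 : forall ep, 0 < ep -> exists N, forall k, (N <= k)%nat -> forall x, In01 x -> Rabs (Phi (s k) x - phi x) < ep /\ Rabs (Psi (s k) x - psi x) < ep).
  { intros ep Hep. destruct (Cv (ep / 2)) as [A HA]; [lra|]. destruct (archi_inv (ep / 4)) as [B HB]; [lra|]. exists (Nat.max A B). intros k Hk x Hx.
    specialize (HA k ltac:(lia) x Hx). specialize (Hs k). specialize (HB (s k) ltac:(lia)). destruct (cl_facts (s k)) as (Q1 & _). destruct (Q1 x Hx) as [_ Q]. specialize (Ll (s k)).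
    unfold Psi, psi. split; [lra|]. apply Rabs_lt_iff in HA. apply Rabs_le_iff in Q. apply Rabs_lt_iff. lra. }
  assert (Le : forall a b : R, (forall ep, 0 < ep -> a <= b + ep) -> a <= b). { intros a b H. apply Rnot_lt_le. intros Hlt. specialize (H ((a - b) / 2) ltac:(lra)). lra. }
  assert (Pt : forall ep, 0 < ep -> exists k, / (INR (s k) + 1) < ep /\ forall x, In01 x -> Rabs (Phi (s k) x - phi x) < ep /\ Rabs (Psi (s k) x - psi x) < ep).
  { intros ep Hep. destruct (Cv2 ep Hep) as [N HN]. destruct (archi_inv ep Hep) as [M HM]. exists (Nat.max N M). split; [apply HM; specialize (Hs (Nat.max N M)); lia|]. apply HN. lia. }
  assert (Rng : forall x, In01 x -> In01 (phi x) /\ In01 (psi x)).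
  { intros x Hx. assert (A : forall ep, 0 < ep -> - ep <= phi x <= 1 + ep /\ - ep <= psi x <= 1 + ep).
    { intros ep Hep. destruct (Pt ep Hep) as (k & _ & Hk). destruct (Hk x Hx) as [K1 K2]. apply Rabs_lt_iff in K1, K2. destruct (In_ (s k) x Hx) as [[A B] [C D]]. lra. }
    unfold In01. repeat split; apply Le; intros ep Hep; specialize (A ep Hep); lra. }
  assert (Mono : forall x y, In01 x -> In01 y -> x <= y -> phi x <= phi y /\ psi x <= psi y).
  { intros x y Hx Hy Hxy. split; apply Le; intros ep Hep; destruct (Pt (ep / 2)) as (k & _ & Hk); try lra; destruct (Hk x Hx) as [X1 X2]; destruct (Hk y Hy) as [Y1 Y2];
      apply Rabs_lt_iff in X1, X2, Y1, Y2; destruct (HP (s k)) as (_ & P2 & _); specialize (P2 x y Hx Hy Hxy); unfold Psi in *; lra. }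
  (* [phi 0] and [psi 0 = - phi 0] are both nonnegative; similarly at 1 both are at most 1 and add
     up to 2. *)
  assert (P0 : phi 0 = 0).
  { destruct (Rng 0 in01_0) as [[A B] [C D]]. unfold psi in *. lra. }
  assert (P1 : phi 1 = 1).
  { destruct (Rng 1 in01_1) as [[A B] [C D]]. unfold psi in *. lra. }
  assert (LipL : forall x y, In01 x -> In01 y -> Rabs (phi x - phi y) <= 2 * Rabs (x - y) /\ Rabs (psi x - psi y) <= 2 * Rabs (x - y)).
  { intros x y Hx Hy. unfold psi. destruct (Rle_dec x y) as [H|H].
    - destruct (Mono x y Hx Hy H) as [A B]. unfold psi in *. split; rabs.
    - destruct (Mono y x Hy Hx ltac:(lra)) as [A B]. unfold psi in *. split; rabs. }
  assert (Cphi : contD dR dR In01 phi) by (apply lip_cont; intros; now apply LipL).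
  assert (Cpsi : contD dR dR In01 psi) by (apply lip_cont; intros; now apply LipL).
  assert (Rphi : reparam01 phi). { split; [auto|split; [auto|split]]. { intros; now apply Mono. } exact Cphi. }
  assert (Rpsi : reparam01 psi). { split; [unfold psi; lra|split; [unfold psi; lra|split]]. { intros; now apply Mono. } exact Cpsi. }
  set (A := fun x => lam1 (phi x)). set (B := fun x => lam2 (psi x)).
  assert (CA : pathC A). { apply (contD_comp dR dR dm In01 In01 phi lam1); auto. intros; now apply Rng. }
  assert (CB : pathC B). { apply (contD_comp dR dR dm In01 In01 psi lam2); auto. intros; now apply Rng. }
  assert (Cv3 : forall ep, 0 < ep -> exists N, forall k, (N <= k)%nat -> forall x, In01 x -> dm (f (s k) (Phi (s k) x)) (A x) < ep /\ dm (g (s k) (Psi (s k) x)) (B x) < ep).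
  { intros ep Hep. destruct (unif_path 0 1 lam1 C1 (ep / 2)) as (d1 & D1 & U1); [lra|]. destruct (unif_path 0 1 lam2 C2 (ep / 2)) as (d2 & D2 & U2); [lra|].
    destruct (Cv2 (Rmin d1 d2)) as [N HN]; [now apply Rmin_pos|]. destruct (archi_inv (ep / 2)) as [M HM]; [lra|].
    exists (Nat.max N M). intros k Hk x Hx. destruct (HN k ltac:(lia) x Hx) as [E1 E2]. apply Rlt_min in E1 as [E1 _]. apply Rlt_min in E2 as [_ E2].
    specialize (Hs k). specialize (HM (s k) ltac:(lia)). destruct (In_ (s k) x Hx) as [I1 I2]. destruct (Rng x Hx) as [J1 J2].
    specialize (U1 _ _ I1 J1 E1). specialize (U2 _ _ I2 J2 E2). pose proof (N1 (s k) _ I1) as V1. pose proof (N2 (s k) _ I2) as V2.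
    pose proof (dm_tri (f (s k) (Phi (s k) x)) (lam1 (Phi (s k) x)) (A x)) as W1. pose proof (dm_tri (g (s k) (Psi (s k) x)) (lam2 (Psi (s k) x)) (B x)) as W2.
    rewrite dm_sym in V1, V2. unfold A, B in *. lra. }
  (* Corresponding points lie in one box, so their functionals differ by at most [32 * w n], which
     tends to zero. *)
  assert (HXX : forall x, In01 x -> lin 1 m (A x) = lin 1 m (B x)).
  { intros x Hx. apply Rminus_diag_uniq. apply NNPP. intros Ne. assert (Hp := Rabs_pos_lt _ Ne). set (D := Rabs (lin 1 m (A x) - lin 1 m (B x))) in *.
      set (M := 1 + Rabs m). assert (HM : 1 <= M) by (unfold M; pose proof (Rabs_pos m); lra).
      destruct (Cv3 (D / (8 * M))) as [N HN]; [apply Rdiv_lt_0_compat; lra|]. destruct (archi_inv (D / 64)) as [N' HN']; [lra|].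
      set (k := Nat.max N N'). destruct (HN k ltac:(lia) x Hx) as [E1 E2]. specialize (HN' (s k) ltac:(specialize (Hs k); lia)).
      destruct (HP (s k)) as (_ & _ & _ & P4). destruct (P4 x Hx) as (T1 & u & u' & T2 & v & v' & (_ & _ & _ & _ & _ & _ & _ & _ & _ & c & X1 & X2) & Y1 & Y2 & _).
      specialize (X1 _ Y1). specialize (X2 _ Y2). specialize (Sw (s k)).
      assert (Lx : forall z z', dm z z' < D / (8 * M) -> Rabs (lin 1 m z - lin 1 m z') <= D / 8).
      { intros z z' Hz. eapply Rle_trans; [apply lin_lip|]. rewrite Rabs_R1. fold M. replace (D / 8) with (M * (D / (8 * M))) by (field; lra). apply Rmult_le_compat_l; lra. }
      apply Lx in E1, E2. apply Rabs_le_iff in E1, E2, X1, X2. unfold Psi in *. assert (D <= 3 * D / 4); [|lra]. unfold D at 1. apply Rabs_le_iff. lra. }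
  assert (HAB : forall x, In01 x -> A x = B x).
  { apply (sync_curves Om m A B CA CB).
    - unfold A, B. rewrite P0. unfold psi. rewrite P0, Rmult_0_r, Rminus_0_r. apply ends_eq; auto.
    - unfold A, B. rewrite P1. unfold psi. rewrite P1. replace (2 * 1 - 1) with 1 by ring. apply ends_eq; auto.
    - exact HXX.
    - intros x y H0 Hxy H1 HX t Ht.
      assert (Surj : forall h, reparam01 h -> forall q, h x <= q <= h y -> exists t, x <= t <= y /\ h t = q).
      { intros h (_ & _ & _ & Hc) q Hq. destruct (Req_dec q (h x)) as [->|]; [exists x; split; [lra|auto]|]. destruct (Req_dec q (h y)) as [->|]; [exists y; split; [lra|auto]|].
        destruct (ivt x y h q Hxy) as (z & Hz & Ez); [|lra|exists z; split; [lra|auto]].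
        intros z Hz ee Hee. destruct (Hc z ltac:(unfold In01, I01 in *; lra) ee Hee) as (dd & Hdd & HD). exists dd. split; auto. intros z' Hz'. apply HD. unfold In01, I01 in *; lra. }
      assert (Ix : In01 x) by (unfold In01; lra). assert (Iy : In01 y) by (unfold In01; lra). assert (It : In01 t) by (unfold In01; lra).
      destruct (Rng x Ix) as [X1 X2], (Rng y Iy) as [Y1 Y2]. destruct (Mono x y Ix Iy Hxy) as [M1 M2].
      destruct (Mono x t Ix It ltac:(lra)) as [M3 M4]. destruct (Mono t y It Iy ltac:(lra)) as [M5 M6]. unfold In01 in X1, X2, Y1, Y2. split.
      + apply (G1 (phi x) (phi y)); try lra. intros q Hq. destruct (Surj phi Rphi q Hq) as (z & Hz & <-). apply (HX z Hz).
      + apply (G2 (psi x) (psi y)); try lra. intros q Hq. destruct (Surj psi Rpsi q Hq) as (z & Hz & <-). specialize (HX z Hz). fold (B z) (B x). rewrite <- !HXX; auto. unfold In01; lra.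
    (* The span runs from the start of the box met at [e0] to the end of the box met at [e1];
       [Adm_cancel] removes the part of the ladder before it. *)
    - intros e0 e1 ze H0 H01 H1 E0 E1 Hze.
      assert (I0 : In01 e0) by (unfold In01; lra). assert (I1 : In01 e1) by (unfold In01; lra).
      destruct (Cv3 (ze / 3)) as [K1 HK1]; [lra|]. destruct (box_small (ze / 3)) as [K2 HK2]; [lra|]. destruct (archi_inv (ze / 6)) as [K3 HK3]; [lra|].
      set (k := Nat.max K1 (Nat.max K2 K3)). specialize (HK1 k ltac:(lia)). assert (Hsk := Hs k). specialize (HK2 (s k) ltac:(lia)). specialize (HK3 (s k) ltac:(lia)).
      set (n := s k) in *. destruct (HP n) as (Q1 & Q2 & _ & Q4).
      destruct (Q4 e0 I0) as (T1 & u & u' & T2 & v & v' & B1 & B2 & B3 & B4 & _ & B5 & _).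
      destruct (Q4 e1 I1) as (T3 & x & x' & T4 & y & y' & D1 & D2 & D3 & _ & D4 & _ & D5).
      destruct (HK2 _ _ _ _ _ _ B1) as [Sf Sg]. destruct (HK2 _ _ _ _ _ _ D1) as [Sf' Sg'].
      destruct B1 as (B6 & B7 & B8 & B9 & B10 & B11 & B12 & _). destruct D1 as (D6 & D7 & D8 & D9 & D10 & D11 & _ & D12 & _).
      destruct (Q2 e0 e1 I0 I1 H01) as [M1 M2]. specialize (Sk n). specialize (Se n).
      destruct (HL n) as [L1 Gf Gg LK L0' L1' LK0 LK1 _].
      destruct (HK1 e0 I0) as [Fa Ga]. destruct (HK1 e1 I1) as [Fb Gb]. rewrite <- E0 in Ga. rewrite <- E1 in Gb. unfold Psi in *.
      assert (InT : forall t z, l n <= t <= 1 - l n -> good Om 0 1 (d n) (fun q => K n (t, q)) -> In z (ch (d n) (fun q => K n (t, q)) 0 1) -> exists q, In01 q /\ z = K n (t, q)).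
      { intros t z _ [Gs _] Hz. destruct (ch_in Om _ 0 1 _ Gs 0 1 z ltac:(lra) Hz) as [q [Hq ->]]. exists q. auto. }
      exists (l n), (1 - l n), (d n), (f n), (g n), (e n), T1, u, u', T4, y, y'.
      assert (Surj : forall (h : R -> R) a b, (forall a b, In01 a -> In01 b -> Rabs (h a - h b) <= 2 * Rabs (a - b)) -> In01 a -> In01 b -> a <= b -> forall q, h a <= q <= h b -> exists t, a <= t <= b /\ h t = q).
      { intros h a b Hh Ha Hb Hab q Hq. destruct (Req_dec q (h a)) as [->|]; [exists a; split; [lra|auto]|]. destruct (Req_dec q (h b)) as [->|]; [exists b; split; [lra|auto]|].
        destruct (ivt a b h q Hab) as (z & Hz & Ez); [|lra|exists z; split; [lra|auto]]. apply lip_cont. intros r r' Hr Hr'. apply Hh; unfold In01, I01 in *; lra. }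
      split; [lra|]. split; [lra|]. split; auto. split; auto. split; auto. split; auto. split; [lra|]. split; [lra|]. split; [lra|]. split; auto. split; auto. split.
      { apply (Adm_cancel Om (l n) (1 - l n) (d n) (f n) (g n) Gf Gg (T0 n) (l n) (l n) T1 u u' T4 y y'); auto; lra. }
      split; [|split; [|split; [|split; [|split]]]].
      + assert (Fu : dm (f n u) (A e0) < 2 * ze / 3). { specialize (Sf u (Phi n e0) ltac:(lra) ltac:(lra)). pose proof (dm_tri (f n u) (f n (Phi n e0)) (A e0)). lra. }
        assert (Gu : dm (g n u') (A e0) < 2 * ze / 3). { specialize (Sg u' (cl n e0 - Phi n e0) ltac:(lra) ltac:(lra)). pose proof (dm_tri (g n u') (g n (cl n e0 - Phi n e0)) (A e0)). lra. }
        destruct B5 as [->|E]. { repeat constructor; lra. }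
        apply Forall_forall. intros z Hz. rewrite E in Hz. destruct (InT (l n) z ltac:(lra) LK0 Hz) as (q & Hq & ->).
        destruct (track_ends Om (f n) (g n) T1 u u' (fun z => In z T1) B12) as [Z _]. { now apply Forall_forall. }
        rewrite E in Z. destruct (InT (l n) _ ltac:(lra) LK0 Z) as (q' & Hq' & Eq').
        pose proof (L0' (l n) q ltac:(lra) Hq) as A1. pose proof (L0' (l n) q' ltac:(lra) Hq') as A2. rewrite <- Eq' in A2.
        pose proof (dm_tri (K n (l n, q)) (f n 0) (A e0)). pose proof (dm_tri (f n 0) (f n u) (A e0)). rewrite (dm_sym (f n 0) (f n u)) in *. lra.
      + assert (Fu : dm (f n y) (A e1) < 2 * ze / 3). { specialize (Sf' y (Phi n e1) ltac:(lra) ltac:(lra)). pose proof (dm_tri (f n y) (f n (Phi n e1)) (A e1)). lra. }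
        assert (Gu : dm (g n y') (A e1) < 2 * ze / 3). { specialize (Sg' y' (cl n e1 - Phi n e1) ltac:(lra) ltac:(lra)). pose proof (dm_tri (g n y') (g n (cl n e1 - Phi n e1)) (A e1)). lra. }
        destruct D5 as [->|E]. { repeat constructor; lra. }
        apply Forall_forall. intros z Hz. rewrite E in Hz. destruct (InT (1 - l n) z ltac:(lra) LK1 Hz) as (q & Hq & ->).
        destruct (track_ends Om (f n) (g n) T4 y y' (fun z => In z T4) D12) as [Z _]. { now apply Forall_forall. }
        rewrite E in Z. destruct (InT (1 - l n) _ ltac:(lra) LK1 Z) as (q' & Hq' & Eq').
        pose proof (L1' (1 - l n) q ltac:(lra) Hq) as A1. pose proof (L1' (1 - l n) q' ltac:(lra) Hq') as A2. rewrite <- Eq' in A2.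
        pose proof (dm_tri (K n (1 - l n, q)) (f n 1) (A e1)). pose proof (dm_tri (f n 1) (f n y) (A e1)). rewrite (dm_sym (f n 1) (f n y)) in *. lra.
      + intros t Ht. destruct (Rle_dec t (Phi n e0)) as [Q|Q].
        { exists e0. split; [lra|]. specialize (Sf t (Phi n e0) ltac:(lra) ltac:(lra)). pose proof (dm_tri (f n t) (f n (Phi n e0)) (A e0)). lra. }
        destruct (Rle_dec (Phi n e1) t) as [Q'|Q'].
        { exists e1. split; [lra|]. specialize (Sf' t (Phi n e1) ltac:(lra) ltac:(lra)). pose proof (dm_tri (f n t) (f n (Phi n e1)) (A e1)). lra. }
        destruct (Surj (Phi n) e0 e1) with (q := t) as (z & Hz & <-); auto; try lra. { intros; now apply Lip. }
        exists z. split; auto. destruct (HK1 z ltac:(unfold In01; lra)). lra.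
      + intros t Ht. destruct (Rle_dec t (cl n e0 - Phi n e0)) as [Q|Q].
        { exists e0. split; [lra|]. rewrite <- E0. specialize (Sg t (cl n e0 - Phi n e0) ltac:(lra) ltac:(lra)). pose proof (dm_tri (g n t) (g n (cl n e0 - Phi n e0)) (A e0)). lra. }
        destruct (Rle_dec (cl n e1 - Phi n e1) t) as [Q'|Q'].
        { exists e1. split; [lra|]. rewrite <- E1. specialize (Sg' t (cl n e1 - Phi n e1) ltac:(lra) ltac:(lra)). pose proof (dm_tri (g n t) (g n (cl n e1 - Phi n e1)) (A e1)). lra. }
        destruct (Surj (fun x => cl n x - Phi n x) e0 e1) with (q := t) as (z & Hz & <-); auto; try lra. { intros; now apply Lip. }
        exists z. split; auto. destruct (HK1 z ltac:(unfold In01; lra)). lra.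
      + intros z Hz. assert (Iz : In01 z) by (unfold In01; lra). exists (Phi n z). destruct (Q2 e0 z I0 Iz ltac:(lra)). destruct (Q2 z e1 Iz I1 ltac:(lra)). split; [lra|]. destruct (HK1 z Iz). lra.
      + intros z Hz. assert (Iz : In01 z) by (unfold In01; lra). exists (cl n z - Phi n z). destruct (Q2 e0 z I0 Iz ltac:(lra)). destruct (Q2 z e1 Iz I1 ltac:(lra)). split; [lra|]. destruct (HK1 z Iz). lra. }
  exists s, phi, psi. split; auto. split; auto. split; auto. split; auto.
  intros ep Hep. destruct (Cv3 (ep / 2)) as [N HN]; [lra|]. exists N. intros k Hk u u' Hu.
  destruct (HP (s k)) as (_ & _ & P3 & _). destruct (P3 u u' Hu) as (x & Hx & E1 & E2). destruct (HN k Hk x Hx) as [D1 D2]. unfold Psi in D2. rewrite E2 in D2. rewrite E1 in D1.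
  pose proof (dm_tri (f (s k) u) (A x) (g (s k) u')) as W. rewrite <- (HAB x Hx), dm_sym in D2. lra.
Qed.
End SyncLimit.

(** * Small homotopies *)

(** Smallness refers to the tracks of the homotopy, and [g] is reached only up to reparametrization
    because the rungs join different times. [th] is a homeomorphism, so interior times stay interior
    when such homotopies are chained. *)
Definition Close (Om : Cpl -> Prop) (ep : R) (f g : R -> Cpl) : Prop :=
  exists th K, homeo th /\ contD dm dm Sq K /\ (forall z, Sq z -> inn Om (fst z) (K z) /\ dm (K z) (f (fst z)) <= ep) /\
    forall s, In01 s -> K (s, 0) = f s /\ K (s, 1) = g (th s) /\ K (0, s) = f 0 /\ K (1, s) = f 1.

Lemma paste_at {A B} (dA : A -> A -> R) (dB : B -> B -> R) (D : A -> Prop) (h : A -> R) b F1 F2 : contD dA dR D h ->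
  contD dA dB (fun z => D z /\ h z <= b) F1 -> contD dA dB (fun z => D z /\ b <= h z) F2 -> (forall z, D z -> h z = b -> F1 z = F2 z) ->
  contD dA dB D (fun z => if Rle_dec (h z) b then F1 z else F2 z).
Proof.
  intros Hh H1 H2 E. apply (contD_paste dA dB D (fun z => h z <= b) (fun z => b <= h z)).
  - apply relclosed_le; auto. apply contD_cR.
  - apply relclosed_le; auto. apply contD_cR.
  - intros; lra.
  - apply contD_ext with (f := F1); auto. intros z [Dz Hz]. destruct Rle_dec; auto; lra.
  - apply contD_ext with (f := F2); auto. intros z [Dz Hz]. destruct Rle_dec; auto. symmetry. apply E; auto. lra.
Qed.

Notation ball c rho := (rect (fst c - rho) (fst c + rho) (snd c - rho) (snd c + rho)).

Lemma ball_dm c rho z : ball c rho z <-> dm z c <= rho.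
Proof. rewrite dm_le. unfold rect. rewrite !Rabs_le_iff. lra. Qed.

(* Restriction to balls makes [box_fill] produce a small square. *)
Definition along (Om : Cpl -> Prop) (T : list Cpl) (tau : R -> Cpl) : Prop :=
  forall c rho, Forall (ball c rho) T -> (forall t, In01 t -> ball c rho (tau t)) -> hp (fun z => Om z /\ ball c rho z) tau (pl T).

Lemma along_seg (Om : Cpl -> Prop) x y : cvx Om [x; y] -> along Om [x; y] (pl [x; y]).
Proof.
  intros C c rho F Ht. apply hp_refl; [apply pl_cont|]. intros s Hs. split; auto.
  apply (pl_in Om [x; y]); auto; [|easy]. destruct C as (Kc & K1 & K2 & K3). apply Forall_cons_iff in K3 as [X K3]. apply Forall_cons_iff in K3 as [Y _].
  split; [simpl; split; auto; exists Kc; repeat split; auto; repeat constructor; auto|]. repeat constructor; auto.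
Qed.

Lemma along_path Om d k : good Om 0 1 d k -> along Om (ch d k 0 1) k.
Proof.
  intros G c rho F Ht. apply hp_ext with (f := rs k 0 1) (g := pl (ch d k 0 1)); auto.
  - assert (G' := good_rect Om 0 1 d (fst c - rho) (fst c + rho) (snd c - rho) (snd c + rho) k 0 1 G ltac:(lra) ltac:(lra) ltac:(lra)).
    destruct G' as [G1 G2]; [intros t Ht'; apply Ht; auto|]. apply (path_chain _ k 0 1 d G1 G2 0 1 (fl d 0 1)); try lra. apply fl_spec; [apply (proj1 G1)|lra].
  - intros s Hs. unfold rs. f_equal. ring.
Qed.

(** * Filling the boxes of a ladder *)

Section Fill.
Variables (Om : Cpl -> Prop) (m w : R) (l r d : R) (f g : R -> Cpl) (Te : list Cpl) (taue : R -> Cpl) (ep : R).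
Hypothesis (Gf : good Om l r d f) (Gg : good Om l r d g) (Hep : 0 < ep).
Hypothesis Sm : forall T1 u u' T2 v v', Box Om m w l r d f g T1 u u' T2 v v' ->
  (forall t t', u <= t <= v -> u <= t' <= v -> dm (f t) (f t') < ep) /\ (forall t t', u' <= t <= v' -> u' <= t' <= v' -> dm (g t) (g t') < ep).

(** The ball of radius [3 * ep] about [f a] contains both tracks and both arcs, so [box_fill] stays
    in it; since [f] moves by less than [ep] inside the box, the square is within [4 * ep] of
    [f s]. *)
Lemma box_square T a a' T2 b b' tau tau2 : Box Om m w l r d f g T a a' T2 b b' -> dm (f a) (g a') < ep ->
  along Om T tau -> along Om T2 tau2 -> Forall (fun z => dm z (f a) <= 3 * ep) T -> Forall (fun z => dm z (f a) <= 3 * ep) T2 ->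
  (forall t, In01 t -> dm (tau t) (f a) <= 3 * ep) -> (forall t, In01 t -> dm (tau2 t) (f a) <= 3 * ep) ->
  exists K, contD dm dm (fun z => a <= fst z <= b /\ In01 (snd z)) K /\ (forall z, a <= fst z <= b -> In01 (snd z) -> Om (K z) /\ dm (K z) (f (fst z)) <= 4 * ep) /\
    (forall s, a <= s <= b -> K (s, 0) = f s /\ K (s, 1) = g (a' + (s - a) / (b - a) * (b' - a'))) /\ (forall t, In01 t -> K (a, t) = tau t /\ K (b, t) = tau2 t).
Proof.
  intros HB Ha At At2 FT FT2 Ft Ft2. destruct (Sm _ _ _ _ _ _ HB) as [Sf Sg].
  destruct HB as (B1 & B2 & B3 & B4 & B5 & B6 & B7 & B8 & B9 & _).
  assert (Bl : forall (X : list Cpl), Forall (fun z => dm z (f a) <= 3 * ep) X -> Forall (ball (f a) (3 * ep)) X).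
  { intros X HX. eapply Forall_impl; [|exact HX]. intros z Hz. now apply ball_dm. }
  destruct (box_fill Om l r d (fst (f a) - 3 * ep) (fst (f a) + 3 * ep) (snd (f a) - 3 * ep) (snd (f a) + 3 * ep) f g T a a' T2 b b' tau tau2) as (Q & Q1 & Q2 & Q3); auto; try lra.
  - intros t Ht. apply ball_dm. specialize (Sf t a Ht ltac:(lra)). lra.
  - intros t Ht. apply ball_dm. specialize (Sg t a' Ht ltac:(lra)). pose proof (dm_tri (g t) (g a') (f a)). rewrite (dm_sym (g a')) in *. lra.
  - apply At; auto. intros t Ht. apply ball_dm; auto.
  - apply At2; auto. intros t Ht. apply ball_dm; auto.
  - assert (Hab : 0 < / (b - a)) by (apply Rinv_0_lt_compat; lra).
    exists (fun z => Q ((fst z - a) / (b - a), snd z)). split; [|split; [|split]].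
    + apply (contD_comp dm dm dm _ Sq (fun z => ((fst z - a) / (b - a), snd z)) Q); auto.
      * unfold Rdiv. ctac.
      * intros z [Z1 Z2]. split; simpl; auto. apply div01; lra.
    + intros z Z1 Z2. assert (Zs : Sq ((fst z - a) / (b - a), snd z)) by (split; simpl; auto; apply div01; lra).
      destruct (Q2 _ Zs) as [O1 O2]. split; auto. apply ball_dm in O2. specialize (Sf a (fst z) ltac:(lra) ltac:(lra)).
      pose proof (dm_tri (Q ((fst z - a) / (b - a), snd z)) (f a) (f (fst z))). lra.
    + intros s Hs. simpl. assert (Hq := div01 s a b B2 Hs). destruct (Q3 _ Hq) as (E1 & E2 & _). rewrite E1, E2. unfold rs. split; f_equal. field. lra.
    + intros t Ht. simpl. destruct (Q3 t Ht) as (_ & _ & E3 & E4). rewrite <- E3, <- E4.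
      split; f_equal; f_equal; field; lra.
Qed.

Hypothesis (Ae : along Om Te taue) (Me : Forall (fun z => dm z (f r) <= 2 * ep) Te) (Me' : forall t, In01 t -> dm (taue t) (f r) <= 2 * ep).

(** Neighbouring squares share the segment of their rung and fit together. [th] is affine on each
    box, and strictly increasing because boxes have positive duration on both paths. *)
Lemma lad_fill T a a' L : lad Om m w l r d f g Te T a a' L -> (forall u u', In (u, u') L -> dm (f u) (g u') < ep) -> forall tau,
  along Om T tau -> Forall (fun z => dm z (f a) <= 3 * ep) T -> (forall t, In01 t -> dm (tau t) (f a) <= 3 * ep) ->
  exists K th, contD dm dm (fun z => a <= fst z <= r /\ In01 (snd z)) K /\ (forall z, a <= fst z <= r -> In01 (snd z) -> Om (K z) /\ dm (K z) (f (fst z)) <= 4 * ep) /\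
    (forall s, a <= s <= r -> K (s, 0) = f s /\ K (s, 1) = g (th s)) /\ (forall t, In01 t -> K (a, t) = tau t /\ K (r, t) = taue t) /\
    contD dR dR (I01 a r) th /\ th a = a' /\ th r = r /\ (forall x y, a <= x -> x < y -> y <= r -> th x < th y).
Proof.
  assert (Line : forall a b a' b', a < b -> a' < b' -> let th := fun s => a' + (s - a) / (b - a) * (b' - a') in
    (forall D, contD dR dR D th) /\ th a = a' /\ th b = b' /\ (forall x y, x < y -> th x < th y)).
  { intros x y x' y' H1 H2 th. split; [|split; [|split]].
    - intros D. unfold th, Rdiv. ctac.
    - unfold th. field. lra.
    - unfold th. field. lra.
    - intros s t Hst. unfold th, Rdiv. assert (0 < / (y - x)) by (apply Rinv_0_lt_compat; lra). assert ((s - x) * / (y - x) < (t - x) * / (y - x)) by (apply Rmult_lt_compat_r; lra). nra. }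
  intros H. induction H as [T a a' HB|T a a' b b' L HB HL IH]; intros HV tau At FT Ft.
  - destruct (Sm _ _ _ _ _ _ HB) as [Sf Sg]. pose proof HB as (B1 & B2 & B3 & B4 & B5 & B6 & _).
    assert (Fr : forall z, dm z (f r) <= 2 * ep -> dm z (f a) <= 3 * ep). { intros z Hz. specialize (Sf r a ltac:(lra) ltac:(lra)). pose proof (dm_tri z (f r) (f a)). lra. }
    destruct (box_square T a a' Te r r tau taue HB) as (K & K1 & K2 & K3 & K4); auto.
    { apply HV. now left. } { eapply Forall_impl; [|exact Me]. auto. }
    destruct (Line a r a' r) as (L1 & L2 & L3 & L4); try lra.
    exists K, (fun s => a' + (s - a) / (r - a) * (r - a')). repeat (split; [solve [auto]|]). intros x y _ Hxy _. now apply L4.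
  - destruct (Sm _ _ _ _ _ _ HB) as [Sf Sg]. pose proof HB as (B1 & B2 & B3 & B4 & B5 & B6 & B7 & B8 & _).
    assert (HV' : dm (f b) (g b') < ep). { apply HV. right. inversion HL; now left. }
    assert (Cv : cvx Om [f b; g b']). { destruct B8 as (V & _). simpl in V. apply V. }
    assert (Sgm : forall c rho, ball c rho (f b) -> ball c rho (g b') -> forall t, In01 t -> ball c rho (pl [f b; g b'] t)).
    { intros c rho X1 X2 t Ht. simpl. apply cat_in; auto. intros s Hs. apply convex_rect; auto. }
    assert (Fb : dm (f b) (f a) <= 3 * ep). { specialize (Sf b a ltac:(lra) ltac:(lra)). lra. }
    assert (Gb : dm (g b') (f a) <= 3 * ep). { specialize (Sf b a ltac:(lra) ltac:(lra)). pose proof (dm_tri (g b') (f b) (f a)). rewrite (dm_sym (g b') (f b)) in *. lra. }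
    assert (Gb' : dm (g b') (f b) <= 3 * ep). { rewrite dm_sym. lra. }
    assert (Fb' : dm (f b) (f b) <= 3 * ep). { rewrite dm_refl. lra. }
    destruct (box_square T a a' [f b; g b'] b b' tau (pl [f b; g b']) HB) as (K & K1 & K2 & K3 & K4); auto.
    { apply HV. now left. } { now apply along_seg. } { intros t Ht. apply ball_dm. apply Sgm; auto; now apply ball_dm. }
    destruct (IH (fun u u' Hu => HV u u' (or_intror Hu)) (pl [f b; g b'])) as (K' & th & M1 & M2 & M3 & M4 & M5 & M6 & M7 & M8); auto.
    { now apply along_seg. } { intros t Ht. apply ball_dm. apply Sgm; auto; now apply ball_dm. }
    destruct (Line a b a' b') as (L1 & L2 & L3 & L4); try lra. set (th0 := fun s => a' + (s - a) / (b - a) * (b' - a')) in *.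
    assert (Hbr : b < r). { inversion HL; subst; match goal with X : Box _ _ _ _ _ _ _ _ _ _ _ _ _ _ |- _ => destruct X as (Y1 & Y2 & Y3 & _) end; lra. }
    exists (fun z => if Rle_dec (fst z) b then K z else K' z), (fun s => if Rle_dec s b then th0 s else th s).
    split; [|split; [|split; [|split; [|split; [|split; [|split]]]]]].
    + apply (paste_at dm dm _ fst b).
      * ctac.
      * eapply contD_sub; [exact K1|]. simpl. intros z Hz; split; [lra|tauto].
      * eapply contD_sub; [exact M1|]. simpl. intros z Hz; split; [lra|tauto].
      * intros [z1 z2] [_ Hz] E. simpl in *. subst z1. destruct (K4 z2 Hz) as [_ ->]. destruct (M4 z2 Hz) as [-> _]. auto.
    + intros z Z1 Z2. destruct Rle_dec; [apply K2; auto; lra|apply M2; auto; lra].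
    + intros s Hs. simpl. destruct Rle_dec; [apply K3; lra|apply M3; lra].
    + intros t Ht. simpl. split; (destruct Rle_dec; [|]); try lra; [now apply K4|now apply M4].
    + apply (paste_at dR dR _ (fun s => s) b).
      * apply contD_id.
      * apply L1.
      * eapply contD_sub; [exact M5|]. unfold I01. intros; lra.
      * intros z _ ->. rewrite M6. exact L3.
    + destruct Rle_dec; [auto|lra].
    + destruct Rle_dec; [lra|auto].
    + intros x y H1 H2 H3. destruct (Rle_dec x b), (Rle_dec y b); try lra.
      * now apply L4.
      * apply Rle_lt_trans with (th0 b). { destruct (Req_dec x b) as [->|]; [lra|]. left. apply L4. lra. } unfold th0. rewrite L3, <- M6. apply M8; lra.
      * apply M8; lra.
Qed.
End Fill.

Lemma ladder_Close Om m w kap ep f g L l d K : Ldr Om m w kap f g L l d K -> 0 < ep -> kap <= ep ->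
  (forall T1 u u' T2 v v', Box Om m w l (1 - l) d f g T1 u u' T2 v v' ->
    (forall t t', u <= t <= v -> u <= t' <= v -> dm (f t) (f t') < ep) /\ (forall t t', u' <= t <= v' -> u' <= t' <= v' -> dm (g t) (g t') < ep)) ->
  (forall u u', In (u, u') L -> dm (f u) (g u') < ep) -> Close Om (4 * ep) f g.
Proof.
  intros [[H1 H2] Gf Gg (K1 & K2 & K3) N0 N1 G0 G1 HL] Hep Hk Sm HV.
  assert (D0 : forall s t, 0 <= s <= l -> In01 t -> dm (K (s, t)) (f s) <= 2 * ep).
  { intros s t Hs Ht. pose proof (N0 s t Hs Ht) as A. pose proof (N0 s 0 Hs in01_0) as B. destruct (K3 s ltac:(unfold In01; lra)) as (E & _). rewrite E in B.
    pose proof (dm_tri (K (s, t)) (f 0) (f s)). rewrite (dm_sym (f 0) (f s)) in *. lra. }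
  assert (D1 : forall s t, 1 - l <= s <= 1 -> In01 t -> dm (K (s, t)) (f s) <= 2 * ep).
  { intros s t Hs Ht. pose proof (N1 s t Hs Ht) as A. pose proof (N1 s 0 Hs in01_0) as B. destruct (K3 s ltac:(unfold In01; lra)) as (E & _). rewrite E in B.
    pose proof (dm_tri (K (s, t)) (f 1) (f s)). rewrite (dm_sym (f 1) (f s)) in *. lra. }
  assert (InT : forall (P : Cpl -> Prop) t, good Om 0 1 d (fun q => K (t, q)) -> (forall q, In01 q -> P (K (t, q))) -> Forall P (ch d (fun q => K (t, q)) 0 1)).
  { intros P t [Gs _] HP. apply Forall_forall. intros z Hz. destruct (ch_in Om _ 0 1 _ Gs 0 1 z ltac:(lra) Hz) as [q [Hq ->]]. auto. }
  destruct (lad_fill Om m w l (1 - l) d f g _ (fun t => K (1 - l, t)) ep Gf Gg Hep Sm (along_path Om d _ G1)) with (T := ch d (fun t => K (l, t)) 0 1) (a := l) (a' := l) (L := L) (tau := fun t => K (l, t)) as (K' & th & M1 & M2 & M3 & M4 & M5 & M6 & M7 & M8); auto.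
  - apply InT; auto. intros q Hq. apply D1; auto; lra.
  - intros t Ht. apply D1; auto; lra.
  - now apply along_path.
  - apply InT; auto. intros q Hq. specialize (D0 l q ltac:(lra) Hq). lra.
  - intros t Ht. specialize (D0 l t ltac:(lra) Ht). lra.
  (* Near the ends the given homotopy is kept: it is small there already, and [th] is the
     identity. *)
  - exists (fun s => if Rle_dec s l then s else if Rle_dec s (1 - l) then th s else s), (fun z => if Rle_dec (fst z) l then K z else if Rle_dec (fst z) (1 - l) then K' z else K z).
    split; [|split; [|split]].
    + split; [|split; [|split]].
      * apply (paste_at dR dR _ (fun s => s) l); [apply contD_id|apply contD_id| |].
        -- apply (paste_at dR dR _ (fun s => s) (1 - l)); [apply contD_id| |apply contD_id|].
           ++ eapply contD_sub; [exact M5|]. unfold I01. intros; lra.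
           ++ intros z _ ->. auto.
        -- intros z _ ->. destruct Rle_dec; [auto|lra].
      * destruct Rle_dec; lra.
      * repeat destruct Rle_dec; lra.
      * assert (R1 : forall x, l <= x <= 1 - l -> l <= th x <= 1 - l).
        { intros x Hx. split; [|].
          - destruct (Req_dec x l) as [->|]; [lra|]. rewrite <- M6 at 1. left. apply M8; lra.
          - destruct (Req_dec x (1 - l)) as [->|]; [lra|]. rewrite <- M7. left. apply M8; lra. }
        assert (R2 : forall x, l < x <= 1 - l -> l < th x). { intros x Hx. rewrite <- M6 at 1. apply M8; lra. }
        intros x y Hx Hy Hxy. destruct (Rle_dec x l), (Rle_dec y l); try lra; destruct (Rle_dec y (1 - l)); try lra.
        -- specialize (R2 y ltac:(lra)). lra.
        -- destruct (Rle_dec x (1 - l)); [|lra]. apply M8; lra.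
        -- destruct (Rle_dec x (1 - l)); [|lra]. specialize (R1 x ltac:(lra)). lra.
    + apply (paste_at dm dm _ fst l).
      * ctac.
      * eapply contD_sub; [exact K1|]. tauto.
      * apply (paste_at dm dm _ fst (1 - l)).
        -- ctac.
        -- eapply contD_sub; [exact M1|]. unfold Sq. intros z Hz; split; [lra|tauto].
        -- eapply contD_sub; [exact K1|]. tauto.
        -- intros [z1 z2] [[_ Hz] _] E. simpl in *. subst z1. destruct (M4 z2 Hz) as [_ ->]. auto.
      * intros [z1 z2] [_ Hz] E. simpl in *. subst z1. destruct Rle_dec; [|lra]. destruct (M4 z2 Hz) as [-> _]. auto.
    + intros [z1 z2] [Z1 Z2]. simpl in *. unfold In01 in Z1. destruct (Rle_dec z1 l); [|destruct (Rle_dec z1 (1 - l))].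
      * split. { apply (K2 (z1, z2)). split; auto. } specialize (D0 z1 z2 ltac:(lra) Z2). lra.
      * destruct (M2 (z1, z2)) as [Q1 Q2]; auto; simpl; try lra. split; [intros _; auto|auto].
      * split. { apply (K2 (z1, z2)). split; auto. } specialize (D1 z1 z2 ltac:(lra) Z2). lra.
    + intros s Hs. simpl. destruct (K3 s Hs) as (E0 & E1 & E2 & E3). destruct (Rle_dec 0 l); [|lra]. destruct (Rle_dec 1 l); [lra|]. destruct (Rle_dec 1 (1 - l)); [lra|].
      destruct (Rle_dec s l); [|destruct (Rle_dec s (1 - l))]; auto. destruct (M3 s) as [-> ->]; [lra|]. auto.
Qed.

(** One direction generic for both limits serves all ladders. A subsequence is chosen along which
    the width [w n] and the shortcut depth [e n] tend to zero together, with
    [(1 + Rabs m) * e n = w n] as the construction of ladders demands. *)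
Theorem sync Om (f g : nat -> R -> Cpl) lam1 lam2 : c_open Om -> (forall i, hequiv Om (f i) (g i)) ->
  (forall e, 0 < e -> exists N, forall i, (N <= i)%nat -> near e lam1 (f i) /\ near e lam2 (g i)) ->
  (forall e, 0 < e -> exists N, forall i, (N <= i)%nat -> NS Om e (f i) /\ NS Om e (g i)) ->
  eq_up_to_reparam lam1 lam2 /\ forall ep, 0 < ep -> exists i, Close Om ep (f i) (g i).
Proof.
  intros HO HE HN HS.
  assert (C1 : pathC lam1). { apply unif_limit. intros e He. destruct (HN e He) as [N HN']. exists (f N). split; [apply (hp_cont _ _ _ (HE N))|apply (HN' N (le_n N))]. }
  assert (C2 : pathC lam2). { apply unif_limit. intros e He. destruct (HN e He) as [N HN']. exists (g N). split; [apply (hp_cont _ _ _ (HE N))|apply (HN' N (le_n N))]. }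
  destruct (generic_exists lam1 lam2 C1 C2) as (m & G1 & G2).
  set (M := 1 + Rabs m). assert (HM : 1 <= M) by (unfold M; pose proof (Rabs_pos m); lra).
  set (w := fun n : nat => / (INR n + 1)). set (e := fun n => w n / M).
  assert (Hw : forall n, 0 < w n) by (intros; apply inv_succ_pos).
  assert (He : forall n, 0 < e n) by (intros n; unfold e; apply Rdiv_lt_0_compat; [apply Hw|lra]).
  assert (Ee : forall n, M * e n = w n) by (intros n; unfold e; field; lra).
  assert (Le : forall n, e n <= w n). { intros n. rewrite <- Ee. specialize (He n). nra. }
  assert (Ix : forall n, exists z : nat * (list (R * R) * (R * R * (Cpl -> Cpl))), let '(i, (L, (l, d, K))) := z in
    near (/ (INR n + 1)) lam1 (f i) /\ near (/ (INR n + 1)) lam2 (g i) /\ NS Om (e n) (f i) /\ NS Om (e n) (g i) /\ Ldr Om m (w n) (e n) (f i) (g i) L l d K).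
  { intros n. destruct (HN _ (inv_succ_pos n)) as [A HA]. destruct (HS _ (He n)) as [B HB]. set (i := Nat.max A B).
    destruct (HA i ltac:(lia)) as [A1 A2]. destruct (HB i ltac:(lia)) as [B1 B2].
    destruct (Ldr_exists Om m (w n) (e n) (e n) (f i) (g i) HO (HE i) (Hw n) (He n)) as (L & l & d & K & HL); auto; try (fold M; rewrite Ee; lra).
    exists (i, (L, (l, d, K))). auto. }
  destruct (choice _ Ix) as [z Hz]. clear Ix.
  set (i := fun n => fst (z n)). set (L := fun n => fst (snd (z n))). set (l := fun n => fst (fst (snd (snd (z n))))). set (d := fun n => snd (fst (snd (snd (z n))))). set (K := fun n => snd (snd (snd (z n)))).
  assert (HZ : forall n, near (/ (INR n + 1)) lam1 (f (i n)) /\ near (/ (INR n + 1)) lam2 (g (i n)) /\ NS Om (e n) (f (i n)) /\ NS Om (e n) (g (i n)) /\ Ldr Om m (w n) (e n) (f (i n)) (g (i n)) (L n) (l n) (d n) (K n)).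
  { intros n. specialize (Hz n). unfold i, L, l, d, K. destruct (z n) as [? [? [[? ?] ?]]]. exact Hz. }
  assert (HLd : forall n, Ldr Om m (w n) (e n) (f (i n)) (g (i n)) (L n) (l n) (d n) (K n)) by (intros n; apply HZ).
  assert (Na : forall n, near (/ (INR n + 1)) lam1 (f (i n))) by (intros n; apply HZ).
  assert (Nb : forall n, near (/ (INR n + 1)) lam2 (g (i n))) by (intros n; apply HZ).
  destruct (sync_limit Om m (fun n => f (i n)) (fun n => g (i n)) lam1 lam2 w e e l d L K C1 C2 G1 G2 Na Nb HLd) as (s & phi & psi & S1 & R1 & R2 & E & V); auto.
  { intros n. unfold w. lra. } { intros n. apply HZ. } { intros n. apply HZ. }
  split. { exists phi, psi. auto. }
  intros ep Hep. destruct (V (ep / 4)) as [N1 HN1]; [lra|].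
  destruct (box_small Om m (fun n => f (i n)) (fun n => g (i n)) lam1 lam2 w e l d L K C1 C2 G1 G2 Na Nb HLd) with (ep := ep / 4) as [N2 HN2]; [intros n; unfold w; lra|lra|].
  destruct (archi_inv (ep / 4)) as [N3 HN3]; [lra|]. set (k := Nat.max N1 (Nat.max N2 N3)). specialize (S1 k).
  exists (i (s k)). replace ep with (4 * (ep / 4)) by field. specialize (HN3 (s k) ltac:(lia)). specialize (Le (s k)).
  apply (ladder_Close Om m (w (s k)) (e (s k)) (ep / 4) _ _ (L (s k)) (l (s k)) (d (s k)) (K (s k))); auto; try lra.
  - unfold w in *. lra.
  - apply HN2. lia.
  - apply HN1. lia.
Qed.

(** * Limits of shortcuts *)

Lemma lerp_dm x y x' y' u e : In01 u -> dm x x' < e -> dm y y' < e -> dm (lerp x y u) (lerp x' y' u) < e.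
Proof.
  intros Hu Hx Hy. apply dm_lt in Hx as [X1 X2], Hy as [Y1 Y2]. apply Rabs_lt_iff in X1, X2, Y1, Y2. unfold In01 in Hu.
  apply dm_lt. unfold lerp; simpl. split; apply Rabs_lt_iff; destruct (Req_dec u 0) as [->|]; try lra; split; nra.
Qed.

Lemma lerp_move x y u v B : dm x y <= B -> dm (lerp x y u) (lerp x y v) <= Rabs (u - v) * B.
Proof.
  intros H. apply dm_le in H as [H1 H2]. apply dm_le. unfold lerp; simpl. pose proof (Rabs_pos (u - v)). split.
  - replace ((1 - u) * fst x + u * fst y - ((1 - v) * fst x + v * fst y)) with ((u - v) * - (fst x - fst y)) by ring.
    rewrite Rabs_mult, Rabs_Ropp. now apply Rmult_le_compat_l.
  - replace ((1 - u) * snd x + u * snd y - ((1 - v) * snd x + v * snd y)) with ((u - v) * - (snd x - snd y)) by ring.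
    rewrite Rabs_mult, Rabs_Ropp. now apply Rmult_le_compat_l.
Qed.

(** Deep shortcuts in infinitely many [mu n] subconverge: their times tend to [s0] and [s1], and the
    points at depth [e] tend to a point of [lam] off the limit chord. *)
Lemma shortcut_limit Om (mu : nat -> R -> Cpl) lam e : pathC lam -> (forall n, pathC (mu n)) ->
  (forall ep, 0 < ep -> exists N, forall n, (N <= n)%nat -> near ep lam (mu n)) -> 0 < e ->
  ~ (exists N, forall n, (N <= n)%nat -> NS Om e (mu n)) ->
  exists s0 s1 t, 0 <= s0 /\ s0 < s1 /\ s1 <= 1 /\ s0 <= t <= s1 /\ (forall u, In01 u -> lam t <> lerp (lam s0) (lam s1) u) /\
    forall ep N, 0 < ep -> exists n s s', (N <= n)%nat /\ 0 < s /\ s < s' /\ s' < 1 /\ Rabs (s - s0) < ep /\ Rabs (s' - s1) < ep /\ hp Om (rs (mu n) s s') (lerp (mu n s) (mu n s')).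
Proof.
  intros HC HM Hcv He HN.
  assert (H : forall k : nat, exists z : nat * (R * R * R), let '(n, (s, s', t)) := z in (k <= n)%nat /\ 0 < s /\ s <= t /\ t <= s' /\ s' < 1 /\ hp Om (rs (mu n) s s') (lerp (mu n s) (mu n s')) /\
    forall u, In01 u -> e <= dm (mu n t) (lerp (mu n s) (mu n s') u)).
  { intros k. apply NNPP. intros Q. apply HN. exists k. intros n Hn s s' H1 H2 H3 H4 t Ht. apply NNPP. intros Q'. apply Q. exists (n, (s, s', t)).
    repeat (split; [solve [auto; lra]|]). intros u Hu. apply Rnot_lt_le. intros L. apply Q'. eauto. }
  destruct (choice _ H) as [z Hz]. clear H.
  set (nn := fun k => fst (z k)). set (s := fun k => fst (fst (snd (z k)))). set (s' := fun k => snd (fst (snd (z k)))). set (t := fun k => snd (snd (z k))).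
  assert (HZ : forall k, (k <= nn k)%nat /\ 0 < s k /\ s k <= t k /\ t k <= s' k /\ s' k < 1 /\ hp Om (rs (mu (nn k)) (s k) (s' k)) (lerp (mu (nn k) (s k)) (mu (nn k) (s' k))) /\
    forall u, In01 u -> e <= dm (mu (nn k) (t k)) (lerp (mu (nn k) (s k)) (mu (nn k) (s' k)) u)).
  { intros k. specialize (Hz k). unfold nn, s, s', t. destruct (z k) as [? [[? ?] ?]]. exact Hz. }
  destruct (seqcpt_Sq (fun k => (s k, s' k))) as ([s0 s1] & sg & [L1 L2] & L3). { intros k. destruct (HZ k) as (_ & ? & ? & ? & ? & _). unfold Sq, In01; simpl. lra. }
  destruct (seqcpt_I 0 1 (fun k => t (sg k))) as (t0 & rh & L4 & L5). { intros k. destruct (HZ (sg k)) as (_ & ? & ? & ? & ? & _). unfold I01. lra. }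
  simpl in *. unfold In01 in L1, L2. unfold I01 in L4.
  assert (Lim : forall ep (N : nat), 0 < ep -> exists k, (N <= nn k)%nat /\ Rabs (s k - s0) < ep /\ Rabs (s' k - s1) < ep /\ Rabs (t k - t0) < ep).
  { intros ep N Hep. destruct (archi_inv ep Hep) as [A HA]. set (j := Nat.max N A). exists (sg (rh j)). destruct (L5 j) as [R1 R2]. destruct (L3 (rh j)) as [S1 S2].
    destruct (HZ (sg (rh j))) as (Q & _). split; [lia|]. apply dm_lt in S2 as [S2 S3]. simpl in *. pose proof (HA (rh j) ltac:(lia)). pose proof (HA j ltac:(lia)). unfold dR in R2.
    rewrite (Rabs_minus_sym (s _)), (Rabs_minus_sym (s' _)), (Rabs_minus_sym (t _)). repeat split; lra. }
  assert (Ord : s0 <= t0 /\ t0 <= s1).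
  { split; apply Rnot_lt_le; intros Hl; [destruct (Lim ((s0 - t0) / 2) O) as (k & _ & A & B & C)|destruct (Lim ((t0 - s1) / 2) O) as (k & _ & A & B & C)]; try lra;
      destruct (HZ k) as (_ & ? & ? & ? & ? & _); apply Rabs_lt_iff in A, B, C; lra. }
  assert (Off : forall u, In01 u -> lam t0 <> lerp (lam s0) (lam s1) u).
  { intros u Hu E. destruct (Hcv (e / 4)) as [N HN']; [lra|]. destruct (unif_path 0 1 lam HC (e / 4)) as (dl & Hdl & HU); [lra|].
    destruct (Lim dl N Hdl) as (k & K1 & K2 & K3 & K4). destruct (HZ k) as (_ & ? & ? & ? & ? & _ & Q). specialize (Q u Hu).
    specialize (HN' _ K1). pose proof (HN' (s k) ltac:(unfold In01; lra)) as A1. pose proof (HN' (s' k) ltac:(unfold In01; lra)) as A2. pose proof (HN' (t k) ltac:(unfold In01; lra)) as A3.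
    pose proof (HU (s k) s0 ltac:(lra) ltac:(lra) K2) as B1. pose proof (HU (s' k) s1 ltac:(lra) ltac:(lra) K3) as B2. pose proof (HU (t k) t0 ltac:(lra) ltac:(lra) K4) as B3.
    set (m := mu (nn k)) in *. assert (D1 : dm (lam s0) (m (s k)) < e / 2). { pose proof (dm_tri (lam s0) (lam (s k)) (m (s k))). rewrite (dm_sym (lam s0) (lam (s k))) in *. lra. }
    assert (D2 : dm (lam s1) (m (s' k)) < e / 2). { pose proof (dm_tri (lam s1) (lam (s' k)) (m (s' k))). rewrite (dm_sym (lam s1) (lam (s' k))) in *. lra. }
    pose proof (lerp_dm _ _ _ _ u _ Hu D1 D2) as D3. rewrite <- E in D3.
    pose proof (dm_tri (m (t k)) (lam (t k)) (lerp (m (s k)) (m (s' k)) u)). pose proof (dm_tri (lam (t k)) (lam t0) (lerp (m (s k)) (m (s' k)) u)). rewrite (dm_sym (m (t k)) (lam (t k))) in *. lra. }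
  (* If the limit times agreed, the point at [t0] would be the degenerate chord itself. *)
  assert (Hlt : s0 < s1). { destruct (Req_dec s0 s1) as [E|]; [|lra]. exfalso. apply (Off 0 in01_0). rewrite lerp_0. f_equal. lra. }
  exists s0, s1, t0. split; [lra|]. split; auto. split; [lra|]. split; auto. split; auto.
  intros ep N Hep. destruct (Lim (Rmin ep ((s1 - s0) / 2)) N) as (k & K1 & K2 & K3 & _). { apply Rmin_pos; lra. }
  apply Rlt_min in K2 as [K2 K2'], K3 as [K3 K3']. destruct (HZ k) as (_ & ? & ? & ? & ? & Q & _). exists (nn k), (s k), (s' k). apply Rabs_lt_iff in K2', K3'.
  repeat (split; [solve [auto; lra]|]). auto.
Qed.

Definition clamp x := Rmax 0 (Rmin 1 x).

Lemma clamp_in x : In01 (clamp x).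
Proof. unfold clamp, In01, Rmax, Rmin. repeat destruct Rle_dec; lra. Qed.

Lemma clamp_lip x y : Rabs (clamp x - clamp y) <= Rabs (x - y).
Proof. unfold clamp, Rmax, Rmin. repeat destruct Rle_dec; rabs. Qed.

(** One formula for all positions of [x], in which the dependence on the cut times is visibly
    continuous. *)
Lemma straighten_formula lam s s' x : s < s' -> straighten lam s s' x = lerp (lam (Rmin x s)) (lam (Rmax x s')) (clamp ((x - s) / (s' - s))).
Proof.
  intros H. assert (P : 0 < / (s' - s)) by (apply Rinv_0_lt_compat; lra).
  destruct (Rlt_dec x s) as [L|L]; [|destruct (Rlt_dec s' x) as [L'|L']].
  - rewrite straighten_out by auto. rewrite Rmin_left by lra. replace (clamp _) with 0; [now rewrite lerp_0|].
    assert ((x - s) / (s' - s) <= 0) by (unfold Rdiv; nra). unfold clamp, Rmax, Rmin. repeat destruct Rle_dec; lra.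
  - rewrite straighten_out by auto. rewrite (Rmax_left x) by lra. replace (clamp _) with 1; [now rewrite lerp_1|].
    assert (1 <= (x - s) / (s' - s)). { replace 1 with ((s' - s) * / (s' - s)) by (field; lra). unfold Rdiv. apply Rmult_le_compat_r; lra. } unfold clamp, Rmax, Rmin. repeat destruct Rle_dec; lra.
  - rewrite straighten_in by lra. rewrite Rmin_right, (Rmax_right x) by lra. f_equal.
    pose proof (div01 x s s' H ltac:(lra)) as [A B]. unfold clamp, Rmax, Rmin. repeat destruct Rle_dec; lra.
Qed.

Lemma straighten_near lam mu s s' e : 0 <= s -> s < s' -> s' <= 1 -> near e lam mu -> near e (straighten lam s s') (straighten mu s s').
Proof.
  intros H0 H H1 Hn x Hx. rewrite !straighten_formula by auto. unfold In01 in Hx. apply lerp_dm; [apply clamp_in|apply Hn|apply Hn]; unfold In01, Rmin, Rmax; destruct Rle_dec; lra.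
Qed.

Lemma straighten_move lam s0 s1 : pathC lam -> 0 <= s0 -> s0 < s1 -> s1 <= 1 -> forall ep, 0 < ep -> exists eta, 0 < eta /\
  forall s s', In01 s -> In01 s' -> s < s' -> Rabs (s - s0) < eta -> Rabs (s' - s1) < eta -> near ep (straighten lam s0 s1) (straighten lam s s').
Proof.
  intros HC H0 H01 H1 ep Hep. destruct (bound_path lam HC) as (B & HB & Hb). destruct (unif_path 0 1 lam HC (ep / 2)) as (dl & Hdl & HU); [lra|].
  set (v := s1 - s0). assert (Hv : 0 < v <= 1) by (unfold v; lra).
  (* Bounds the dependence of the clamped parameter on the cut times: a numerator of at most [4 * m]
     over a denominator of at least [v * v / 2], with a factor 2 to spare. *)
  set (C := 16 / (v * v)). assert (Vv : 0 < v * v) by nra. assert (HCp : 0 < C) by (unfold C; apply Rdiv_lt_0_compat; lra).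
  set (eta := Rmin dl (Rmin (v / 4) (ep / (4 * B * C)))).
  assert (Q : 0 < ep / (4 * B * C)). { apply Rdiv_lt_0_compat; auto. assert (0 < B * C) by now apply Rmult_lt_0_compat. lra. }
  exists eta. split. { unfold eta. repeat apply Rmin_pos; lra. }
  intros s s' Hs Hs' Hss Ds Ds' x Hx. unfold eta in Ds, Ds'. apply Rlt_min in Ds as [Ds1 Ds], Ds' as [Ds1' Ds']. apply Rlt_min in Ds as [Ds2 Ds3], Ds' as [Ds2' Ds3'].
  rewrite !straighten_formula by auto. unfold In01 in Hx, Hs, Hs'.
  set (c0 := clamp ((x - s0) / (s1 - s0))). set (c := clamp ((x - s) / (s' - s))).
  assert (Mn : forall y, In01 y -> In01 (Rmin x y) /\ In01 (Rmax x y)) by (intros y Hy; unfold In01, Rmin, Rmax in Hy |- *; destruct Rle_dec; lra).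
  destruct (Mn s0 ltac:(unfold In01; lra)) as [M1 _]. destruct (Mn s1 ltac:(unfold In01; lra)) as [_ M2]. destruct (Mn s Hs) as [M3 _]. destruct (Mn s' Hs') as [_ M4].
  assert (A : dm (lerp (lam (Rmin x s0)) (lam (Rmax x s1)) c) (lerp (lam (Rmin x s)) (lam (Rmax x s')) c) < ep / 2).
  { apply lerp_dm; [apply clamp_in|apply HU; auto|apply HU; auto]; [clear - Ds1|clear - Ds1']; unfold Rmin, Rmax; repeat destruct Rle_dec; rabs. }
  assert (D : Rabs (c0 - c) <= C * Rmax (Rabs (s - s0)) (Rabs (s' - s1))).
  { eapply Rle_trans; [apply clamp_lip|]. fold v. set (m := Rmax (Rabs (s - s0)) (Rabs (s' - s1))).
    assert (m1 : Rabs (s - s0) <= m) by apply Rmax_l. assert (m2 : Rabs (s' - s1) <= m) by apply Rmax_r. apply Rabs_le_iff in m1, m2.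
    apply Rabs_lt_iff in Ds2, Ds2'. assert (Hv' : v / 2 <= s' - s) by (unfold v in *; lra).
    assert (Hm : 0 <= m) by lra.
    replace ((x - s0) / v - (x - s) / (s' - s)) with (((x - s0) * (s' - s) - (x - s) * v) * / (v * (s' - s))) by (field; lra).
    rewrite Rabs_mult. assert (P : 0 < / (v * (s' - s))). { apply Rinv_0_lt_compat. apply Rmult_lt_0_compat; lra. } rewrite (Rabs_right (/ _)) by lra.
    assert (N : Rabs ((x - s0) * (s' - s) - (x - s) * v) <= 4 * m).
    { replace ((x - s0) * (s' - s) - (x - s) * v) with ((s - s0) * (s' - s) + (x - s) * ((s' - s1) - (s - s0))) by (unfold v; ring).
      eapply Rle_trans; [apply Rabs_triang|]. rewrite !Rabs_mult.
      assert (Rabs (s - s0) <= m) by (apply Rabs_le_iff; lra). assert (Rabs (s' - s) <= 1) by (apply Rabs_le_iff; lra). assert (Rabs (x - s) <= 1) by (apply Rabs_le_iff; lra).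
      assert (Rabs (s' - s1 - (s - s0)) <= 2 * m) by (apply Rabs_le_iff; lra).
      pose proof (Rabs_pos (s - s0)). pose proof (Rabs_pos (s' - s)). pose proof (Rabs_pos (x - s)). pose proof (Rabs_pos (s' - s1 - (s - s0))). nra. }
    assert (I : / (v * (s' - s)) <= 2 / (v * v)).
    { replace (2 / (v * v)) with (/ (v * (v / 2))) by (field; lra). apply Rinv_le_contravar; [nra|nra]. }
    pose proof (Rabs_pos ((x - s0) * (s' - s) - (x - s) * v)).
    eapply Rle_trans. { apply Rmult_le_compat; [lra|lra|exact N|exact I]. } unfold C. assert (0 < / (v * v)) by now apply Rinv_0_lt_compat. unfold Rdiv. nra. }
  assert (E : dm (lerp (lam (Rmin x s0)) (lam (Rmax x s1)) c0) (lerp (lam (Rmin x s0)) (lam (Rmax x s1)) c) <= Rabs (c0 - c) * (2 * B)).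
  { apply lerp_move. pose proof (Hb _ M1). pose proof (Hb _ M2). pose proof (dm_tri (lam (Rmin x s0)) (0,0) (lam (Rmax x s1))). rewrite (dm_sym (0,0)) in *. lra. }
  assert (F : Rabs (c0 - c) * (2 * B) < ep / 2).
  { assert (Rmax (Rabs (s - s0)) (Rabs (s' - s1)) < ep / (4 * B * C)) by (apply Rmax_lub_lt; auto).
    assert (C * Rmax (Rabs (s - s0)) (Rabs (s' - s1)) < C * (ep / (4 * B * C))) by (apply Rmult_lt_compat_l; lra).
    replace (C * (ep / (4 * B * C))) with (ep / (4 * B)) in H2 by (field; lra).
    replace (ep / 2) with (ep / (4 * B) * (2 * B)) by (field; lra). apply Rmult_lt_compat_r; lra. }
  pose proof (dm_tri (lerp (lam (Rmin x s0)) (lam (Rmax x s1)) c0) (lerp (lam (Rmin x s0)) (lam (Rmax x s1)) c) (lerp (lam (Rmin x s)) (lam (Rmax x s')) c)). lra.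
Qed.

Definition minimal (Om : Cpl -> Prop) (gam lam : R -> Cpl) : Prop :=
  wcl Om gam lam /\ forall nu, wcl Om gam nu -> (forall j n, Nle lam j n -> Nle nu j n) -> forall j n, Nle nu j n -> Nle lam j n.

Lemma minimal_rigid Om gam lam s0 s1 : minimal Om gam lam -> 0 <= s0 -> s0 < s1 -> s1 <= 1 -> wcl Om gam (straighten lam s0 s1) ->
  forall j n, Nle (straighten lam s0 s1) j n -> Nle lam j n.
Proof. intros [_ HM] H0 H H1 HW. apply HM; auto. intros j n HN. now apply straighten_Nle. Qed.

(** If deep shortcuts persisted, the straightened approximants would put the straightening of [lam]
    into [wcl]. Minimality and [rigid] then place the arc on its chord, against the point off it. *)
Lemma minimal_NS Om gam lam (mu : nat -> R -> Cpl) : minimal Om gam lam -> (forall n, hequiv Om gam (mu n)) ->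
  (forall ep, 0 < ep -> exists N, forall n, (N <= n)%nat -> near ep lam (mu n)) -> forall e, 0 < e -> exists N, forall n, (N <= n)%nat -> NS Om e (mu n).
Proof.
  intros HM HE Hcv e He. apply NNPP. intros HN. pose proof HM as [[HC _] _].
  assert (HCm : forall n, pathC (mu n)) by (intros n; apply (hp_cont _ _ _ (HE n))).
  destruct (shortcut_limit Om mu lam e HC HCm Hcv He HN) as (s0 & s1 & t & H0 & H01 & H1 & Ht & Off & Sh).
  assert (HW : wcl Om gam (straighten lam s0 s1)).
  { apply wcl_limit. intros ep Hep. destruct (straighten_move lam s0 s1 HC H0 H01 H1 (ep / 2)) as (eta & Heta & Hmv); [lra|].
    destruct (Hcv (ep / 2)) as [N HN']; [lra|]. destruct (Sh eta N Heta) as (n & s & s' & K1 & K2 & K3 & K4 & K5 & K6 & K7).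
    exists (straighten (mu n) s s'). split.
    - apply wcl_refl. eapply hp_trans; [apply (HE n)|]. destruct (hequiv_epe _ _ _ (HE n)) as [_ Ep].
      eapply hp_ext; [apply (hequiv_repl Om (mu n) s s' (lerp (mu n s) (mu n s')) Ep K2 K3 K4 K7)| |]; auto. intros x _. apply repl_straighten.
    - intros x Hx. pose proof (Hmv s s' ltac:(unfold In01; lra) ltac:(unfold In01; lra) K3 K5 K6 x Hx).
      pose proof (straighten_near lam (mu n) s s' (ep / 2) ltac:(lra) K3 ltac:(lra) (HN' n K1) x Hx).
      pose proof (dm_tri (straighten lam s0 s1 x) (straighten lam s s' x) (straighten (mu n) s s' x)). lra. }
  destruct (rigid lam s0 s1 HC H0 H01 H1 (minimal_rigid Om gam lam s0 s1 HM H0 H01 H1 HW)) as (psi & _ & Pin & HP).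
  assert (Hu := div01 t s0 s1 H01 Ht). apply (Off (psi ((t - s0) / (s1 - s0)))); auto. rewrite <- HP; auto. unfold rs. f_equal. field. lra.
Qed.

(** * Infinite concatenation of homotopies *)

Lemma floor_exists : exists fl : R -> nat, forall x, 0 <= x -> INR (fl x) <= x < INR (fl x) + 1.
Proof.
  apply (choice (fun x n => 0 <= x -> INR n <= x < INR n + 1)). intros x. destruct (classic (0 <= x)) as [Hx|]; [|exists O; tauto].
  destruct (archimed x) as [A B]. assert (0 < up x)%Z by (apply lt_IZR; lra). exists (Z.to_nat (up x - 1)). intros _.
  rewrite INR_IZR_INZ, Z2Nat.id, minus_IZR by lia. lra.
Qed.

(** The height [t] is stretched to [t / (1 - t)], and the unit interval number [k] carries [P k].
    Continuity at the top is uniform convergence of the stages. *)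
Lemma tower (P : nat -> Cpl -> Cpl) (lim : R -> Cpl) : (forall k, contD dm dm Sq (P k)) -> (forall k s, In01 s -> P k (s, 1) = P (S k) (s, 0)) ->
  (forall e, 0 < e -> exists N, forall k, (N <= k)%nat -> forall z, Sq z -> dm (P k z) (lim (fst z)) < e) ->
  exists h, contD dm dm Sq h /\ (forall s, In01 s -> h (s, 0) = P O (s, 0) /\ h (s, 1) = lim s) /\
    forall s t, In01 s -> 0 <= t < 1 -> exists k u, In01 u /\ h (s, t) = P k (s, u).
Proof.
  intros HP HJ HL. destruct floor_exists as [fl Hfl].
  set (C := fun z : Cpl => P (fl (snd z)) (fst z, snd z - INR (fl (snd z)))).
  assert (Uq : forall x n, 0 <= x -> INR n <= x < INR n + 1 -> fl x = n).
  { intros x n Hx Hn. specialize (Hfl x Hx). assert (fl x < S n)%nat by (apply INR_lt; rewrite S_INR; lra). assert (n < S (fl x))%nat by (apply INR_lt; rewrite S_INR; lra). lia. }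
  assert (Cn : forall n s x, In01 s -> INR n <= x <= INR n + 1 -> C (s, x) = P n (s, x - INR n)).
  { intros n s x Hs Hx. pose proof (pos_INR n). unfold C; simpl. destruct (Req_dec x (INR n + 1)) as [->|].
    - rewrite (Uq (INR n + 1) (S n)); [|lra|rewrite S_INR; lra]. rewrite S_INR. replace (INR n + 1 - (INR n + 1)) with 0 by ring. replace (INR n + 1 - INR n) with 1 by ring. symmetry. now apply HJ.
    - now rewrite (Uq x n) by lra. }
  assert (CC : forall n, contD dm dm (fun z => In01 (fst z) /\ 0 <= snd z <= INR n) C).
  { assert (Pc : forall n, contD dm dm (fun z => In01 (fst z) /\ INR n <= snd z <= INR n + 1) C).
    { intros n. apply contD_ext with (f := fun z => P n (fst z, snd z - INR n)).
      - apply (contD_comp dm dm dm _ Sq (fun z => (fst z, snd z - INR n)) (P n)); auto; [ctac|]. intros z [Z1 Z2]. split; simpl; auto. unfold In01; lra.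
      - intros [s x] [Z1 Z2]. simpl in *. symmetry. now apply Cn. }
    induction n.
    - eapply contD_sub; [apply (Pc O)|]. simpl. intros z Hz. split; [tauto|lra].
    - apply (contD_paste dm dm _ (fun z => snd z <= INR n) (fun z => INR n <= snd z)).
      + apply relclosed_le; ctac.
      + apply relclosed_le; ctac.
      + intros; lra.
      + eapply contD_sub; [exact IHn|]. simpl. intros z Hz. split; [tauto|lra].
      + eapply contD_sub; [apply (Pc n)|]. rewrite S_INR. simpl. intros z Hz. split; [tauto|lra]. }
  set (h := fun z : Cpl => if Rlt_dec (snd z) 1 then C (fst z, snd z * / (1 - snd z)) else lim (fst z)).
  assert (Lc : pathC lim).
  { apply unif_limit. intros e He. destruct (HL e He) as [N HN]. exists (fun s => P N (s, 0)). split. { apply (sq_row (P N) 0); auto. apply in01_0. }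
    intros r Hr. rewrite dm_sym. apply (HN N (le_n N) (r, 0)). split; auto. apply in01_0. }
  exists h. split; [|split].
  - intros [s0 t0] Hz0 e He. pose proof Hz0 as [Hs0 Ht0]. simpl in *. unfold In01 in Ht0. destruct (Rlt_dec t0 1) as [Hlt|Hlt].
    + set (t1 := (1 + t0) / 2). assert (Ht1 : t0 < t1 < 1) by (unfold t1; lra).
      assert (Q : contD dm dm (fun z => Sq z /\ snd z <= t1) h).
      { destruct (INR_unbounded (/ (1 - t1))) as [n Hn].
        apply contD_ext with (f := fun z => C (fst z, snd z * / (1 - snd z))).
        - apply (contD_comp dm dm dm _ (fun z => In01 (fst z) /\ 0 <= snd z <= INR n) (fun z => (fst z, snd z * / (1 - snd z))) C); auto.
          + assert (contD dm dR (fun z => Sq z /\ snd z <= t1) (fun z => / (1 - snd z))). { apply contD_inv; [ctac|]. intros z [_ Hz]. lra. }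
            ctac.
          + intros [s t] [[Z1 Z2] Z3]. unfold In01 in Z2. simpl in *. split; auto.
            assert (0 < / (1 - t)) by (apply Rinv_0_lt_compat; lra). assert (/ (1 - t) <= / (1 - t1)) by (apply Rinv_le_contravar; lra). split; nra.
        - intros z [_ Hz]. unfold h. destruct Rlt_dec; [auto|lra]. }
      destruct (Q (s0, t0)) with (e := e) as (d & Hd & HD); [split; auto; simpl; lra|auto|].
      exists (Rmin d (t1 - t0)). split; [apply Rmin_pos; lra|]. intros [s t] Hz Hd'. apply Rlt_min in Hd' as [D1 D2]. apply HD; auto. split; auto. simpl.
      apply dm_lt in D2 as [_ D2]. simpl in D2. apply Rabs_lt_iff in D2. lra.
    + assert (t0 = 1) by lra. subst t0. destruct (HL (e / 2)) as [N HN]; [lra|]. destruct (Lc s0 Hs0 (e / 2)) as (d & Hd & HD); [lra|].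
      pose proof (pos_INR N) as PN. assert (P2 : 0 < / (INR N + 1)) by (apply Rinv_0_lt_compat; lra).
      exists (Rmin d (/ (INR N + 1))). split; [apply Rmin_pos; lra|]. intros [s t] [Hs Ht] Hd'. simpl in *. apply Rlt_min in Hd' as [D1 D2]. apply dm_lt in D1 as [D1 _], D2 as [_ D2]. simpl in *.
      specialize (HD s Hs D1). unfold h at 1; simpl. destruct (Rlt_dec 1 1); [lra|]. unfold h; simpl. unfold In01 in Ht. destruct (Rlt_dec t 1) as [Hl|]; [|lra].
      assert (Hx : INR N <= t * / (1 - t)).
      { assert (INR N + 1 <= / (1 - t)). { rewrite <- (Rinv_inv (INR N + 1)). apply Rinv_le_contravar; [lra|]. apply Rabs_lt_iff in D2. lra. }
        replace (t * / (1 - t)) with (/ (1 - t) - 1) by (field; lra). lra. }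
      set (x := t * / (1 - t)) in *. assert (Hx0 : 0 <= x) by lra. specialize (Hfl x Hx0).
      assert (Hk : (N <= fl x)%nat). { assert (N < S (fl x))%nat by (apply INR_lt; rewrite S_INR; lra). lia. }
      unfold C; simpl. specialize (HN (fl x) Hk (s, x - INR (fl x))). simpl in HN.
      assert (dm (P (fl x) (s, x - INR (fl x))) (lim s) < e / 2). { apply HN. split; simpl; auto. unfold In01; lra. }
      pose proof (dm_tri (lim s0) (lim s) (P (fl x) (s, x - INR (fl x)))). rewrite (dm_sym (lim s) (P _ _)) in *. lra.
  - intros s Hs. unfold h; simpl. destruct (Rlt_dec 0 1); [|lra]. destruct (Rlt_dec 1 1); [lra|]. split; auto.
    rewrite Rmult_0_l. rewrite (Cn O s 0 Hs) by (simpl; lra). simpl. now rewrite Rminus_0_r.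
  - intros s t Hs Ht. unfold h; simpl. destruct (Rlt_dec t 1); [|lra]. unfold C; simpl. exists (fl (t * / (1 - t))), (t * / (1 - t) - INR (fl (t * / (1 - t)))). split; auto.
    assert (0 <= t * / (1 - t)). { apply Rmult_le_pos; [lra|]. left. apply Rinv_0_lt_compat. lra. } specialize (Hfl _ H). unfold In01. lra.
Qed.

Lemma dyadic_limit (x : nat -> R) : (forall k, Rabs (x k - x (S k)) <= (/ 2) ^ k) -> exists y, forall k, Rabs (x k - y) <= 2 * (/ 2) ^ k.
Proof.
  intros H. assert (Pp : forall k, 0 < (/ 2) ^ k) by (intros; apply pow_lt; lra).
  assert (M : forall k i, x k - 2 * (/ 2) ^ k <= x (k + i)%nat - 2 * (/ 2) ^ (k + i) /\ x (k + i)%nat + 2 * (/ 2) ^ (k + i) <= x k + 2 * (/ 2) ^ k).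
  { intros k. induction i; [rewrite Nat.add_0_r; lra|]. rewrite Nat.add_succ_r. specialize (H (k + i)%nat). apply Rabs_le_iff in H. simpl pow. lra. }
  assert (Cr : forall i k, x i - 2 * (/ 2) ^ i <= x k + 2 * (/ 2) ^ k).
  { intros i k. pose proof (M i k) as [A _]. pose proof (M k i) as [_ B]. rewrite (Nat.add_comm k i) in B. specialize (Pp (i + k)%nat). lra. }
  destruct (completeness (fun y => exists k, y = x k - 2 * (/ 2) ^ k)) as [y [Y1 Y2]].
  - exists (x O + 2 * (/ 2) ^ O). intros y [k ->]. apply Cr.
  - exists (x O - 2 * (/ 2) ^ O), O. auto.
  - exists y. intros k. apply Rabs_le_iff. assert (x k - 2 * (/ 2) ^ k <= y) by (apply Y1; eauto). assert (y <= x k + 2 * (/ 2) ^ k). { apply Y2. intros z [i ->]. apply Cr. } lra.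
Qed.

Lemma dyadic_small e : 0 < e -> exists N, forall k, (N <= k)%nat -> (/ 2) ^ k < e.
Proof.
  intros He. destruct (pow_lt_1_zero (/ 2) ltac:(rewrite Rabs_right; lra) e He) as [N HN]. exists N. intros k Hk. specialize (HN k Hk).
  rewrite Rabs_right in HN; auto. left. apply pow_lt. lra.
Qed.

(** The class of the theorem with a homotopy on pairs. The ends are fixed at [t = 1] too, where this
    follows by continuity ([clcls_iff]). *)
Definition clcls (Om : Cpl -> Prop) (gam lam : R -> Cpl) : Prop :=
  exists h, contD dm dm Sq h /\ (forall s, In01 s -> h (s, 0) = gam s /\ h (s, 1) = lam s) /\
    (forall s t, 0 < s < 1 -> 0 <= t < 1 -> Om (h (s, t))) /\ (forall t, In01 t -> h (0, t) = gam 0 /\ h (1, t) = gam 1).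

Lemma clcls_iff Om p q gam lam : path_epe Om p q gam -> (in_closure_class Om p q gam lam <-> clcls Om gam lam).
Proof.
  intros (_ & Gp & Gq & _). split.
  - intros (Cl & h & Ch & H0 & H1 & Ht). apply cont2_iff in Ch.
    assert (E : forall t, In01 t -> h 0 t = gam 0 /\ h 1 t = gam 1).
    { assert (E0 : forall t, 0 <= t < 1 -> h 0 t = p /\ h 1 t = q). { intros t Htt. destruct (Ht t Htt) as (_ & A & B & _). auto. }
      rewrite Gp, Gq. intros t Htt. unfold In01 in Htt. destruct (Req_dec t 1) as [->|]; [|apply E0; lra].
      assert (G : forall x y, In01 x -> (forall t, 0 <= t < 1 -> h x t = y) -> h x 1 = y).
      { intros x y Hx Hy. apply dm_0. apply Rnot_lt_le. intros Hl. destruct (Ch (x, 1)) with (e := dm (h x 1) y) as (d & Hd & HD); [split; simpl; auto; apply in01_1|auto|].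
        set (t := Rmax 0 (1 - d / 2)). assert (0 <= t < 1) by (unfold t; split; [apply Rmax_l|apply Rmax_lub_lt; lra]). assert (1 - d / 2 <= t) by apply Rmax_r.
        specialize (HD (x, t)). simpl in HD. rewrite (Hy t H) in HD. apply (Rlt_irrefl (dm (h x 1) y)). apply HD; [split; simpl; auto; unfold In01; lra|]. apply dm_lt; simpl. split; rabs. }
      split; apply G; auto; try apply in01_0; try apply in01_1; intros t Ht'; now apply E0. }
    exists (fun z => h (fst z) (snd z)). split; auto. split; [intros s Hs; simpl; auto|]. split.
    + intros s t Hs Htt. simpl. destruct (Ht t Htt) as (_ & _ & _ & A). now apply A.
    + intros t Htt. simpl. now apply E.
  - intros (h & Ch & H01 & HO & HE). split.
    + apply cont01_iff. eapply contD_ext; [apply (sq_row h 1 in01_1 Ch)|]. intros s Hs. now apply H01.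
    + exists (fun s t => h (s, t)). split.
      { apply cont2_iff. eapply contD_ext; [exact Ch|]. intros [s t] _. reflexivity. }
      split; [intros s Hs; now apply H01|]. split; [intros s Hs; now apply H01|]. intros t Ht. split.
      { apply cont01_iff. apply (sq_row h t); auto. unfold In01; lra. }
      destruct (HE t ltac:(unfold In01; lra)) as [-> ->]. split; [auto|split; [auto|]]. intros s Hs. now apply HO.
Qed.

Lemma clcls_row Om gam lam h : contD dm dm Sq h -> (forall s, In01 s -> h (s, 0) = gam s /\ h (s, 1) = lam s) ->
  (forall s t, 0 < s < 1 -> 0 <= t < 1 -> Om (h (s, t))) -> (forall t, In01 t -> h (0, t) = gam 0 /\ h (1, t) = gam 1) ->
  forall t, 0 <= t < 1 -> hequiv Om gam (fun s => h (s, t)).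
Proof.
  intros Ch H01 HO HE t Ht. exists (fun z => h (fst z, t * snd z)). split; [|split].
  - apply (contD_comp dm dm dm _ Sq (fun z => (fst z, t * snd z)) h); auto; [ctac|]. intros z [Z1 Z2]. split; simpl; auto. unfold In01 in *. nra.
  - intros [s u] [Z1 Z2]. simpl in *. intros Hs. apply HO; auto. unfold In01 in *. nra.
  - intros s Hs. simpl. rewrite Rmult_0_r, Rmult_1_r. split; [now apply H01|]. split; auto. unfold In01 in Hs. destruct (HE (t * s)) as [-> ->]; [unfold In01; nra|]. auto.
Qed.

Lemma rows_near lam h : contD dm dm Sq h -> (forall s, In01 s -> h (s, 1) = lam s) -> forall e, 0 < e -> exists d, 0 < d /\ forall t, 1 - d < t <= 1 -> 0 <= t -> near e lam (fun s => h (s, t)).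
Proof.
  intros Ch H1 e He. destruct (unif_cont dm dm Sq h dm_tri dm_tri dm_sym seqcpt_Sq Ch e He) as (d & Hd & HU). exists d. split; auto. intros t Ht Ht0 s Hs.
  rewrite <- H1 by auto. apply HU; [split; simpl; auto; unfold In01; lra..|]. apply dm_lt; simpl. split; rabs.
Qed.

Lemma clcls_wcl Om gam lam : clcls Om gam lam -> wcl Om gam lam.
Proof.
  intros (h & Ch & H01 & HO & HE). split.
  - eapply contD_ext; [apply (sq_row h 1 in01_1 Ch)|]. intros s Hs. now apply H01.
  - intros e He. destruct (rows_near lam h Ch) with (e := e) as (d & Hd & HD); auto. { intros; now apply H01. }
    set (t := Rmax 0 (1 - d / 2)). assert (0 <= t < 1) by (unfold t; split; [apply Rmax_l|apply Rmax_lub_lt; lra]). assert (1 - d / 2 <= t) by apply Rmax_r.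
    exists (fun s => h (s, t)). split; [now apply (clcls_row Om gam lam)|apply HD; lra].
Qed.

Lemma homeo_comp th th' : homeo th -> homeo th' -> homeo (fun s => th' (th s)).
Proof.
  intros H H'. pose proof H as (A1 & A2 & A3 & A4). pose proof H' as (B1 & B2 & B3 & B4). split; [|split; [|split]].
  - apply (contD_comp dR dR dR In01 In01 th th'); auto. intros; now apply homeo_in.
  - now rewrite A2.
  - now rewrite A3.
  - intros x y Hx Hy Hxy. apply B4; auto; now apply homeo_in.
Qed.

Lemma homeo_id : homeo (fun s => s).
Proof. split; [apply contD_id|]. repeat split; auto. Qed.

(** Approximants of a minimal path have no deep shortcuts, so [sync] makes them a Cauchy sequence
    for [Close]. Stages of size [(/ 2) ^ k] are stacked by [tower]; their limit is again minimal,
    though it need not be the path that was started from. *)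
Theorem minimal_in_class Om gam : c_open Om -> epe Om gam -> exists lam, minimal Om gam lam /\ clcls Om gam lam.
Proof.
  intros HO HG. destruct (minimizer Om gam HG) as (lam & HW & HM). pose proof HW as [HC Happ].
  assert (HA : forall n : nat, exists mu, hequiv Om gam mu /\ near (/ (INR n + 1)) lam mu). { intros n. apply Happ. apply inv_succ_pos. }
  destruct (choice _ HA) as [mu Hmu].
  assert (Hcv : forall ep, 0 < ep -> exists N, forall n, (N <= n)%nat -> near ep lam (mu n)).
  { intros ep Hep. destruct (archi_inv ep Hep) as [N HN]. exists N. intros n Hn r Hr. eapply Rlt_trans; [apply (proj2 (Hmu n) r Hr)|]. now apply HN. }
  assert (HNS := minimal_NS Om gam lam mu (conj HW HM) (fun n => proj1 (Hmu n)) Hcv).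
  (* Otherwise there are two subsequences that are never close, both converging to [lam]; [sync]
     with [lam] as both limits joins some pair of them. *)
  assert (Cl : forall ep, 0 < ep -> exists N, forall n k, (N <= n)%nat -> (N <= k)%nat -> Close Om ep (mu n) (mu k)).
  { intros ep Hep. apply NNPP. intros Q.
    assert (Q' : forall N : nat, exists z : nat * nat, (N <= fst z)%nat /\ (N <= snd z)%nat /\ ~ Close Om ep (mu (fst z)) (mu (snd z))).
    { intros N. apply NNPP. intros Q'. apply Q. exists N. intros n k Hn Hk. apply NNPP. intros Q''. apply Q'. exists (n, k). auto. }
    destruct (choice _ Q') as [z Hz].
    destruct (sync Om (fun i => mu (fst (z i))) (fun i => mu (snd (z i))) lam lam HO) as [_ S]; auto.
    - intros i. eapply hp_trans; [apply hp_sym, Hmu|apply Hmu].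
    - intros e He. destruct (Hcv e He) as [N HN]. exists N. intros i Hi. destruct (Hz i) as (A & B & _). split; apply HN; lia.
    - intros e He. destruct (HNS e He) as [N HN]. exists N. intros i Hi. destruct (Hz i) as (A & B & _). split; apply HN; lia.
    - destruct (S ep Hep) as [i Hi]. now apply (Hz i). }
  assert (Cl' : forall k, exists N, forall n i, (N <= n)%nat -> (N <= i)%nat -> Close Om ((/ 2) ^ k) (mu n) (mu i)). { intros k. apply Cl. apply pow_lt. lra. }
  destruct (choice _ Cl') as [m Hm].
  set (ix := fix ix (k : nat) : nat := match k with O => m O | S j => Nat.max (Nat.max (ix j) (S j)) (m (S j)) end).
  assert (Ixm : forall k, (m k <= ix k)%nat) by (intros [|k]; simpl; lia). assert (Ixk : forall k, (k <= ix k)%nat) by (intros [|k]; simpl; lia).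
  assert (Ixs : forall k, (ix k <= ix (S k))%nat) by (intros k; simpl; lia).
  assert (St : forall k, exists z : (R -> R) * (Cpl -> Cpl), homeo (fst z) /\ contD dm dm Sq (snd z) /\ (forall x, Sq x -> inn Om (fst x) (snd z x) /\ dm (snd z x) (mu (ix k) (fst x)) <= (/ 2) ^ k) /\
    forall s, In01 s -> snd z (s, 0) = mu (ix k) s /\ snd z (s, 1) = mu (ix (S k)) (fst z s) /\ snd z (0, s) = mu (ix k) 0 /\ snd z (1, s) = mu (ix k) 1).
  { intros k. destruct (Hm k (ix k) (ix (S k))) as (th & K & A & B & C & D); auto. { specialize (Ixm k). specialize (Ixs k). lia. } exists (th, K). auto. }
  destruct (choice _ St) as [z Hz].
  (* The accumulated reparametrizations make the end of each stage the start of the next. *)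
  set (Th := fix Th (k : nat) : R -> R := match k with O => fun s => s | S j => fun s => fst (z j) (Th j s) end).
  assert (HTh : forall k, homeo (Th k)). { induction k; simpl; [apply homeo_id|]. apply homeo_comp; auto. apply Hz. }
  set (nu := fun k s => mu (ix k) (Th k s)).
  assert (Hends : forall k, nu k 0 = gam 0 /\ nu k 1 = gam 1).
  { intros k. destruct (HTh k) as (_ & T0 & T1 & _). unfold nu. rewrite T0, T1. apply (hp_ends _ _ _ (proj1 (Hmu (ix k)))). }
  set (H := fun k (x : Cpl) => snd (z k) (Th k (fst x), snd x)).
  assert (SqT : forall k x, Sq x -> Sq (Th k (fst x), snd x)). { intros k x [X1 X2]. split; simpl; auto. now apply homeo_in. }
  assert (HH : forall k x, Sq x -> inn Om (fst x) (H k x) /\ dm (H k x) (nu k (fst x)) <= (/ 2) ^ k).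
  { intros k x Hx. destruct (Hz k) as (_ & _ & A & _). destruct (A _ (SqT k x Hx)) as [A1 A2]. split; auto. intros Hi. apply A1. simpl. now apply homeo_inn. }
  assert (HB : forall k s, In01 s -> H k (s, 0) = nu k s /\ H k (s, 1) = nu (S k) s /\ H k (0, s) = gam 0 /\ H k (1, s) = gam 1).
  { intros k s Hs. destruct (Hz k) as (_ & _ & _ & A). unfold H, nu; simpl. destruct (A _ (homeo_in _ s (HTh k) Hs)) as (A1 & A2 & _). destruct (A s Hs) as (_ & _ & A3 & A4).
    destruct (HTh k) as (_ & T0 & T1 & _). rewrite T0, T1, A1, A2, A3, A4. destruct (hp_ends _ _ _ (proj1 (Hmu (ix k)))). auto. }
  assert (Step : forall k s, In01 s -> dm (nu k s) (nu (S k) s) <= (/ 2) ^ k).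
  { intros k s Hs. destruct (HB k s Hs) as (_ & <- & _). rewrite dm_sym. apply (HH k (s, 1)). split; auto. apply in01_1. }
  assert (Lm : forall s, exists y : Cpl, In01 s -> forall k, dm (nu k s) y <= 2 * (/ 2) ^ k).
  { intros s. destruct (classic (In01 s)) as [Hs|]; [|exists (0, 0); tauto].
    destruct (dyadic_limit (fun k => fst (nu k s))) as [a Ha]. { intros k. specialize (Step k s Hs). now apply dm_le in Step. }
    destruct (dyadic_limit (fun k => snd (nu k s))) as [b Hb]. { intros k. specialize (Step k s Hs). now apply dm_le in Step. }
    exists (a, b). intros _ k. apply dm_le; auto. }
  destruct (choice _ Lm) as [ls Hls].
  destruct (Hmu (ix O)) as [(G & GC & GO & GE) _].
  set (P := fun k => match k with O => G | S j => H j end).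
  destruct (tower P ls) as (h & Ch & H01 & Hin).
  - intros [|k]; simpl; auto. apply (contD_comp dm dm dm _ Sq (fun x => (Th k (fst x), snd x)) (snd (z k))); auto; [|apply Hz].
    assert (contD dm dR Sq (fun x => Th k (fst x))). { apply (contD_comp dm dR dR _ In01 fst (Th k)); [ctac|apply HTh|intros x Hx; apply Hx]. } ctac.
  - intros [|k] s Hs; simpl.
    + destruct (HB O s Hs) as (-> & _). destruct (GE s Hs) as (_ & -> & _). reflexivity.
    + destruct (HB k s Hs) as (_ & -> & _). destruct (HB (S k) s Hs) as (-> & _). reflexivity.
  - intros e He. destruct (dyadic_small (e / 3)) as [N HN]; [lra|]. exists (S N). intros [|k] Hk x Hx; [lia|]. simpl. destruct (HH k x Hx) as [_ A].
    specialize (HN k ltac:(lia)). pose proof (Hls (fst x) (proj1 Hx) k). pose proof (dm_tri (H k x) (nu k (fst x)) (ls (fst x))). lra.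
  - assert (CL : clcls Om gam ls).
    { exists h. split; auto. split; [|split].
      - intros s Hs. destruct (H01 s Hs) as [-> ->]. split; auto. simpl. now apply GE.
      - intros s t Hs Ht. destruct (Hin s t ltac:(unfold In01; lra) Ht) as ([|k] & u & Hu & ->); simpl.
        + apply (GO (s, u)); simpl; auto. split; simpl; auto. unfold In01; lra.
        + apply (HH k (s, u)); simpl; auto. split; simpl; auto. unfold In01; lra.
      - assert (E : forall t, 0 <= t < 1 -> h (0, t) = gam 0 /\ h (1, t) = gam 1).
        { intros t Ht. split.
          - destruct (Hin 0 t in01_0 Ht) as ([|k] & u & Hu & ->); simpl; [now apply GE|now apply HB].
          - destruct (Hin 1 t in01_1 Ht) as ([|k] & u & Hu & ->); simpl; [now apply GE|now apply HB]. }
        intros t Ht. unfold In01 in Ht. destruct (Req_dec t 1) as [->|]; [|apply E; lra].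
        assert (forall x, In01 x -> (forall k, nu k x = gam x) -> ls x = gam x).
        { intros x Hx Hk. apply dm_0. apply Rnot_lt_le. intros Hl. destruct (dyadic_small (dm (ls x) (gam x) / 2)) as [N HN]; [lra|].
          specialize (HN N (le_n N)). pose proof (Hls x Hx N) as Q. rewrite Hk, dm_sym in Q. lra. }
        destruct (H01 0 in01_0) as [_ ->]. destruct (H01 1 in01_1) as [_ ->]. split; apply H0; try apply in01_0; try apply in01_1; intros k; apply Hends. }
    exists ls. split; auto. split; [now apply clcls_wcl|].
    (* [ls] is a uniform limit of reparametrizations of [lam], so lower semicontinuity passes the
       crossing bounds on and minimality with them. *)
    assert (Nl : forall j n, Nle lam j n -> Nle ls j n).
    { intros j n HN. apply Nle_lsc. intros e He. destruct (dyadic_small (e / 4)) as [N HN']; [lra|]. destruct (Hcv (e / 2)) as [N2 HN2]; [lra|]. set (k := Nat.max N N2).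
      exists (fun s => lam (Th k s)). split.
      - pose proof (HTh k) as T. pose proof T as (_ & T0 & T1 & _). apply Nle_reparam; auto. intros a b A1 A2 A3. apply homeo_le; auto; unfold In01; lra.
      - intros r Hr. specialize (HN' k ltac:(lia)). pose proof (Hls r Hr k). specialize (HN2 (ix k) ltac:(specialize (Ixk k); lia) (Th k r) (homeo_in _ r (HTh k) Hr)).
        pose proof (dm_tri (ls r) (nu k r) (lam (Th k r))). rewrite (dm_sym (ls r) (nu k r)), (dm_sym (nu k r) (lam _)) in *. unfold nu in *. lra. }
    intros nu' Hnu' HN j n Hn. apply Nl. apply (HM nu'); auto.
Qed.

Theorem efficient_exists Om p q gam : c_open Om -> path_epe Om p q gam -> exists lam, efficient Om p q gam lam.
Proof.
  intros HO Hg. pose proof (proj1 (epe_iff Om p q gam) Hg) as (Ep & _ & _).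
  destruct (minimal_in_class Om gam HO Ep) as (lam & HM & HC). exists lam. split; [now apply clcls_iff|].
  intros s1 s2 H1 H2 H12 Hcl. apply clcls_iff in Hcl; auto. apply clcls_wcl in Hcl. unfold In01 in *.
  apply rigid_eqrep; try lra. { apply HM. } apply (minimal_rigid Om gam); auto; lra.
Qed.

(** * Uniqueness *)

(** At height [t] the weakly increasing [psi] is replaced by its mixture with the identity of weight
    [1 - t], which is invertible for [t < 1]. The homotopy is precomposed with the inverse [sg], and
    in the limit the factor [psi] disappears. *)
Lemma clcls_unreparam Om gam kap psi : reparam01 psi -> pathC kap -> clcls Om gam (fun s => kap (psi s)) -> clcls Om gam kap.
Proof.
  intros (P0 & P1 & Pm & Pc) HK (h & Ch & H01 & HO & HE).
  assert (Pin : forall y, In01 y -> In01 (psi y)).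
  { intros y Hy. unfold In01 in *. rewrite <- P0 at 1. rewrite <- P1. split; apply Pm; unfold In01; lra. }
  set (ps := fun e y => (1 - e) * psi y + e * y).
  assert (Sg : forall z : Cpl, exists y, Sq z -> In01 y /\ ps (1 - snd z) y = fst z).
  { intros z. destruct (classic (Sq z)) as [[Z1 Z2]|]; [|exists 0; tauto].
    destruct (reparam01_surj (ps (1 - snd z))) with (r := fst z) as (y & Hy & E); [|exact Z1|exists y; auto].
    set (e := 1 - snd z). assert (He : 0 <= e <= 1) by (unfold e, In01 in *; lra). unfold ps. split; [rewrite P0; ring|]. split; [rewrite P1; ring|]. split.
    - intros a b Ha Hb Hab. specialize (Pm a b Ha Hb Hab). nra.
    - assert (Pc' : contD dR dR In01 psi) by exact Pc. assert (X : contD dR dR In01 (fun y => (1 - e) * psi y + e * y)) by ctac. exact X. }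
  destruct (choice _ Sg) as [sg Hsg].
  assert (Grow : forall e y y', 0 <= e <= 1 -> In01 y -> In01 y' -> e * Rabs (y - y') <= Rabs (ps e y - ps e y')).
  { intros e y y' He Hy Hy'. unfold ps. destruct (Rle_dec y y') as [L|L].
    - specialize (Pm y y' Hy Hy' L). rewrite (Rabs_minus_sym y), (Rabs_right (y' - y)) by lra. rewrite Rabs_minus_sym, Rabs_right by nra. nra.
    - specialize (Pm y' y Hy' Hy ltac:(lra)). rewrite (Rabs_right (y - y')) by lra. rewrite Rabs_right by nra. nra. }
  assert (Var : forall e e' y, In01 y -> Rabs (ps e y - ps e' y) <= Rabs (e - e')).
  { intros e e' y Hy. unfold ps. replace ((1 - e) * psi y + e * y - ((1 - e') * psi y + e' * y)) with ((e - e') * (y - psi y)) by ring. rewrite Rabs_mult.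
    specialize (Pin y Hy). unfold In01 in *. assert (Rabs (y - psi y) <= 1) by (apply Rabs_le_iff; lra). pose proof (Rabs_pos (e - e')). nra. }
  assert (SqS : forall z, Sq z -> Sq (sg z, snd z)). { intros z Hz. split; simpl; [now apply Hsg|apply Hz]. }
  assert (End : forall z, Sq z -> snd z < 1 -> (fst z = 0 -> sg z = 0) /\ (fst z = 1 -> sg z = 1) /\ (0 < fst z < 1 -> 0 < sg z < 1)).
  { intros z Hz Ht. destruct (Hsg z Hz) as [Y1 Y2]. assert (Hz2 := proj2 Hz). specialize (Pin _ Y1). unfold ps in Y2. unfold In01 in *.
    split; [|split].
    - intros E. rewrite E in Y2. nra.
    - intros E. rewrite E in Y2. nra.
    - intros Hi. split; apply Rnot_le_lt; intros L.
      + assert (E : sg z = 0) by lra. rewrite E, P0 in Y2. lra.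
      + assert (E : sg z = 1) by lra. rewrite E, P1 in Y2. lra. }
  exists (fun z => h (sg z, snd z)). split; [|split; [|split]].
  - intros z0 Hz0 e He. destruct (unif_cont dm dm Sq h dm_tri dm_tri dm_sym seqcpt_Sq Ch (e / 2)) as (d & Hd & HU); [lra|].
    destruct (Hsg z0 Hz0) as [Y1 Y2]. pose proof (proj2 Hz0) as T0. unfold In01 in T0. destruct (Rlt_dec (snd z0) 1) as [Hl|Hl].
    + set (e0 := 1 - snd z0) in *. assert (E0 : 0 < e0 <= 1) by (unfold e0; lra).
      exists (Rmin d (d * e0 / 4)). split. { apply Rmin_pos; auto. assert (0 < d * e0) by (apply Rmult_lt_0_compat; lra). lra. }
      intros z Hz Hzz. apply Rlt_min in Hzz as [D1 D2]. destruct (Hsg z Hz) as [X1 X2].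
      assert (dm (h (sg z0, snd z0)) (h (sg z, snd z)) < e / 2); [|lra]. apply HU; auto.
      apply dm_lt in D1 as [_ D1], D2 as [D2 D3]. apply dm_lt; simpl. split; auto.
      pose proof (Grow e0 (sg z0) (sg z) ltac:(lra) Y1 X1) as G. rewrite Y2 in G. pose proof (Var e0 (1 - snd z) (sg z) X1) as V. rewrite X2 in V.
      assert (A : Rabs (fst z0 - ps e0 (sg z)) <= Rabs (fst z0 - fst z) + Rabs (e0 - (1 - snd z))).
      { replace (fst z0 - ps e0 (sg z)) with ((fst z0 - fst z) + - (ps e0 (sg z) - fst z)) by ring. eapply Rle_trans; [apply Rabs_triang|]. rewrite Rabs_Ropp. lra. }
      replace (e0 - (1 - snd z)) with (- (snd z0 - snd z)) in A by (unfold e0; ring). rewrite Rabs_Ropp in A.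
      apply Rmult_lt_reg_l with e0; [lra|]. assert (0 < d * e0) by (apply Rmult_lt_0_compat; lra). lra.
    (* At the top [sg] may jump, but there [h] depends only on [psi (sg z)], which is continuous. *)
    + assert (E1 : snd z0 = 1) by lra. rewrite E1 in Y2. destruct (HK (fst z0) (proj1 Hz0) (e / 2)) as (d' & Hd' & HD); [lra|].
      exists (Rmin d (d' / 2)). split; [apply Rmin_pos; lra|]. intros z Hz Hzz. apply Rlt_min in Hzz as [D1 D2]. destruct (Hsg z Hz) as [X1 X2].
      apply dm_lt in D1 as [_ D1], D2 as [D2 D3]. rewrite E1 in *. destruct (H01 _ Y1) as [_ ->].
      assert (Ek : psi (sg z0) = fst z0). { rewrite <- Y2. unfold ps. ring. } rewrite Ek.
      assert (A1 : dm (h (sg z, 1)) (h (sg z, snd z)) < e / 2). { apply HU; [split; simpl; auto; apply in01_1|now apply SqS|]. apply dm_lt; simpl. rewrite Rminus_diag, Rabs_R0. auto. }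
      destruct (H01 _ X1) as [_ B]. rewrite B in A1.
      assert (A2 : dm (kap (fst z0)) (kap (psi (sg z))) < e / 2).
      { apply HD; auto. unfold dR. pose proof (Var (1 - snd z) 0 (sg z) X1) as V. rewrite X2 in V. unfold ps in V. rewrite Rminus_0_r in V.
        replace (1 * psi (sg z) + 0 * sg z) with (psi (sg z)) in V by ring. rewrite Rminus_0_r in V.
        apply Rle_lt_trans with (Rabs (fst z0 - fst z) + Rabs (fst z - psi (sg z))); [|lra].
        replace (fst z0 - psi (sg z)) with ((fst z0 - fst z) + (fst z - psi (sg z))) by ring. apply Rabs_triang. }
      pose proof (dm_tri (kap (fst z0)) (kap (psi (sg z))) (h (sg z, snd z))). lra.
  - intros s Hs. simpl. assert (S0 : Sq (s, 0)) by (split; simpl; auto; apply in01_0). assert (S1 : Sq (s, 1)) by (split; simpl; auto; apply in01_1).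
    destruct (Hsg _ S0) as [A1 A2]. destruct (Hsg _ S1) as [B1 B2]. simpl in *. unfold ps in A2, B2. split.
    + replace (sg (s, 0)) with s by lra. now apply H01.
    + destruct (H01 _ B1) as [_ ->]. f_equal. lra.
  - intros s t Hs Ht. simpl. apply HO; auto. apply (End (s, t)); simpl; auto; [|lra]. split; unfold In01; simpl; lra.
  - intros t Ht. simpl. unfold In01 in Ht. destruct (Req_dec t 1) as [->|].
    + assert (forall x, (x = 0 \/ x = 1) -> h (sg (x, 1), 1) = gam x).
      { intros x Hx. assert (Ix : In01 x) by (destruct Hx as [->| ->]; unfold In01; lra). destruct (Hsg (x, 1)) as [B1 B2]; [split; simpl; auto; apply in01_1|]. simpl in *.
        destruct (H01 _ B1) as [_ ->]. unfold ps in B2. replace (psi (sg (x, 1))) with x by lra. destruct (HE 1 in01_1) as [Q0 Q1]. destruct (H01 0 in01_0) as [_ W0]. destruct (H01 1 in01_1) as [_ W1].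
        rewrite P0 in W0. rewrite P1 in W1. destruct Hx as [->| ->]; congruence. }
      split; apply H; auto.
    + destruct (End (0, t)) as (-> & _); simpl; try lra. { split; unfold In01; simpl; lra. } destruct (End (1, t)) as (_ & -> & _); simpl; try lra. { split; unfold In01; simpl; lra. } apply HE. unfold In01; lra.
Qed.

Lemma clamp_cont {A} (dA : A -> A -> R) D h : contD dA dR D h -> contD dA dR D (fun x => clamp (h x)).
Proof. intros H. unfold clamp. ctac. Qed.

Lemma clamp_lo x : x <= 0 -> clamp x = 0.
Proof. intros H. unfold clamp, Rmax, Rmin. repeat destruct Rle_dec; lra. Qed.

Lemma clamp_hi x : 1 <= x -> clamp x = 1.
Proof. intros H. unfold clamp, Rmax, Rmin. repeat destruct Rle_dec; lra. Qed.

Lemma clamp_mid x : 0 <= x <= 1 -> clamp x = x.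
Proof. intros H. unfold clamp, Rmax, Rmin. repeat destruct Rle_dec; lra. Qed.

(** Curves in the parameter square are homotopic by interpolation, and [h] maps the square into [Om]
    away from the top and the vertical sides. *)
Lemma hequiv_in_square Om h (c c' : R -> Cpl) : contD dm dm Sq h -> (forall s t, 0 < s < 1 -> 0 <= t < 1 -> Om (h (s, t))) ->
  pathC c -> pathC c' -> c 0 = c' 0 -> c 1 = c' 1 -> (forall x, In01 x -> Sq (c x) /\ Sq (c' x)) ->
  (forall x, 0 < x < 1 -> (0 < fst (c x) < 1 /\ snd (c x) < 1) /\ (0 < fst (c' x) < 1 /\ snd (c' x) < 1)) ->
  hequiv Om (fun x => h (c x)) (fun x => h (c' x)).
Proof.
  intros Ch HO Cc Cc' E0 E1 HS HI.
  assert (SqL : forall z, Sq z -> Sq (lerp (c (fst z)) (c' (fst z)) (snd z))).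
  { intros z [Z1 Z2]. destruct (HS _ Z1) as [[A1 A2] [B1 B2]]. unfold In01 in *. unfold Sq, lerp, In01; simpl. split; split; nra. }
  exists (fun z => h (lerp (c (fst z)) (c' (fst z)) (snd z))). split; [|split].
  - apply (contD_comp dm dm dm _ Sq (fun z => lerp (c (fst z)) (c' (fst z)) (snd z)) h); auto.
    apply contD_lerp; [now apply contD_on_fst|now apply contD_on_fst|ctac].
  - intros z Hz Hi. destruct (HI _ Hi) as [[A1 A2] [B1 B2]]. pose proof (SqL z Hz) as [Q1 Q2]. pose proof (proj2 Hz) as Z2. unfold In01 in Z2.
    rewrite (surjective_pairing (lerp _ _ _)). apply HO.
    + unfold lerp; simpl. destruct (Req_dec (snd z) 0) as [->|]; [lra|]. split; nra.
    + split; [apply Q2|]. unfold lerp; simpl. destruct (Req_dec (snd z) 0) as [->|]; [lra|]. nra.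
  - intros s Hs. simpl. rewrite lerp_0, lerp_1, <- E0, <- E1, !lerp_same. auto.
Qed.

(** * Modifying a homotopy inside a lens below its final path *)

Section Lens.
Variables (Om : Cpl -> Prop) (gam lam : R -> Cpl) (h : Cpl -> Cpl) (s0 s1 : R).
Hypothesis (Ch : contD dm dm Sq h) (H01 : forall s, In01 s -> h (s, 0) = gam s /\ h (s, 1) = lam s).
Hypothesis (HO : forall s t, 0 < s < 1 -> 0 <= t < 1 -> Om (h (s, t))) (HE : forall t, In01 t -> h (0, t) = gam 0 /\ h (1, t) = gam 1).
Hypothesis (Hs0 : 0 <= s0) (Hs01 : s0 < s1) (Hs1 : s1 <= 1).

(** A parabola in the parameter square that touches the top only at [s0] and [s1]. Its image [g01]
    therefore stays in [Om] at interior times and joins [lam s0] to [lam s1]; the lens lies between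
    the parabola and the top. *)
Let c (u : R) : Cpl := ((1 - u) * s0 + u * s1, 1 - u * (1 - u)).
Let g01 (u : R) : Cpl := h (c u).

Lemma c_sq u : In01 u -> Sq (c u).
Proof. intros Hu. unfold In01 in Hu. unfold c, Sq, In01; simpl. split; split; nra. Qed.

Lemma c_in u : 0 < u < 1 -> 0 < fst (c u) < 1 /\ snd (c u) < 1.
Proof. intros Hu. unfold c; simpl. split; [split; nra|nra]. Qed.

Lemma c_path : pathC c.
Proof. unfold c. ctac. Qed.

Lemma g01_epe : epe Om g01.
Proof.
  split. { apply (contD_comp dR dm dm _ Sq c h); auto; [apply c_path|apply c_sq]. }
  intros u Hu. unfold g01. rewrite (surjective_pairing (c u)). destruct (c_in u Hu) as [A B]. apply HO; auto. split; auto. apply (c_sq u). unfold In01; lra.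
Qed.

Lemma g01_ends : g01 0 = lam s0 /\ g01 1 = lam s1.
Proof.
  unfold g01, c. replace ((1 - 0) * s0 + 0 * s1) with s0 by ring. replace ((1 - 1) * s0 + 1 * s1) with s1 by ring.
  replace (1 - 0 * (1 - 0)) with 1 by ring. replace (1 - 1 * (1 - 1)) with 1 by ring. split; apply H01; unfold In01; lra.
Qed.

(** [g01] is deformed to the image of a curve [c'] that descends from [(s0, 1)] to [(s, t)], follows
    the row [t] to [(s', t)] and climbs to [(s1, 1)]. The shortcut replaces the middle leg, and the
    outer legs are short. *)
Lemma chord_wcl : (forall e, 0 < e -> exists t s s', 1 - e < t < 1 /\ 0 <= t /\ 0 < s /\ s < s' /\ s' < 1 /\ Rabs (s - s0) < e /\ Rabs (s' - s1) < e /\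
    hp Om (rs (fun x => h (x, t)) s s') (lerp (h (s, t)) (h (s', t)))) -> wcl Om g01 (lerp (lam s0) (lam s1)).
Proof.
  intros HS. split; [apply lerp_path|]. intros e He.
  destruct (unif_cont dm dm Sq h dm_tri dm_tri dm_sym seqcpt_Sq Ch (e / 2)) as (d & Hd & HU); [lra|].
  destruct (HS d Hd) as (t & s & s' & K1 & K2 & K3 & K4 & K5 & K6 & K7 & K8).
  set (B := dm (lam s0) (lam s1) + 1). assert (HB : 1 <= B) by (unfold B; pose proof (dm_pos (lam s0) (lam s1)); lra).
  (* Giving time [dl] to each outer leg shifts the parameter of the chord by at most [2 * dl], hence
     moves its points by at most [e / 4]. *)
  set (dl := Rmin (1 / 4) (e / (8 * B))). assert (Hdl : 0 < dl). { apply Rmin_pos; [lra|]. apply Rdiv_lt_0_compat; lra. }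
  assert (D4 : dl <= 1 / 4) by apply Rmin_l. assert (DB : dl * B <= e / 8). { assert (dl <= e / (8 * B)) by apply Rmin_r. apply Rmult_le_compat_r with (r := B) in H; [|lra]. replace (e / (8 * B) * B) with (e / 8) in H by (field; lra). auto. }
  (* Progress along the first, middle and last leg of [c']. *)
  set (A := fun x => clamp (x * / dl)). set (V := fun x => clamp ((x - dl) * / (1 - 2 * dl))). set (C := fun x => clamp ((x - (1 - dl)) * / dl)).
  assert (Pd : 0 < / dl) by now apply Rinv_0_lt_compat. assert (Pv : 0 < / (1 - 2 * dl)) by (apply Rinv_0_lt_compat; lra).
  assert (Ed : dl * / dl = 1) by (field; lra). assert (Ev : (1 - 2 * dl) * / (1 - 2 * dl) = 1) by (field; lra).
  set (c' := fun x => (s0 + A x * (s - s0) + V x * (s' - s) + C x * (s1 - s'), 1 - A x * (1 - t) + C x * (1 - t))).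
  assert (Reg : forall x, In01 x -> (0 <= x <= dl /\ A x = x * / dl /\ V x = 0 /\ C x = 0) \/ (dl <= x <= 1 - dl /\ A x = 1 /\ V x = (x - dl) * / (1 - 2 * dl) /\ C x = 0) \/ (1 - dl <= x <= 1 /\ A x = 1 /\ V x = 1 /\ C x = (x - (1 - dl)) * / dl)).
  { intros x Hx. unfold In01 in Hx. destruct (Rle_dec x dl) as [L|L]; [left|destruct (Rle_dec x (1 - dl)) as [L'|L']; [right; left|right; right]].
    - split; [lra|]. split; [apply clamp_mid; split; nra|]. split; apply clamp_lo; nra.
    - split; [lra|]. split; [apply clamp_hi; nra|]. split; [apply clamp_mid; split; nra|apply clamp_lo; nra].
    - split; [lra|]. split; [apply clamp_hi; nra|]. split; [apply clamp_hi; nra|apply clamp_mid; split; nra]. }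
  assert (C0 : c' 0 = (s0, 1)). { unfold c'. destruct (Reg 0 in01_0) as [(_ & -> & -> & ->)|[R|R]]; [f_equal; ring|lra|lra]. }
  assert (C1 : c' 1 = (s1, 1)). { unfold c'. destruct (Reg 1 in01_1) as [R|[R|(_ & -> & -> & ->)]]; [lra|lra|]. replace ((1 - (1 - dl)) * / dl) with 1 by (field; lra). f_equal; ring. }
  assert (CM : forall x, dl <= x <= 1 - dl -> c' x = (s + (x - dl) * / (1 - 2 * dl) * (s' - s), t)).
  { intros x Hx. unfold c'. destruct (Reg x ltac:(unfold In01; lra)) as [(R & -> & -> & ->)|[(R & -> & -> & ->)|(R & -> & -> & ->)]].
    - replace x with dl by lra. rewrite Ed. f_equal; ring.
    - f_equal; ring.
    - replace x with (1 - dl) by lra. replace (1 - dl - dl) with (1 - 2 * dl) by ring. rewrite Ev. replace (1 - dl - (1 - dl)) with 0 by ring. f_equal; ring. }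
  assert (Cp : pathC c').
  { assert (contD dR dR In01 A) by (apply clamp_cont; ctac). assert (contD dR dR In01 V) by (apply clamp_cont; ctac). assert (contD dR dR In01 C) by (apply clamp_cont; ctac). unfold c'. ctac. }
  assert (CR : forall x, In01 x -> Sq (c' x)).
  { intros x Hx. assert (U1 := clamp_in (x * / dl)). assert (U2 := clamp_in ((x - dl) * / (1 - 2 * dl))). assert (U3 := clamp_in ((x - (1 - dl)) * / dl)). fold (A x) in U1. fold (V x) in U2. fold (C x) in U3.
    unfold In01 in U1, U2, U3. unfold c', Sq, In01; simpl. destruct (Reg x Hx) as [(R & _ & -> & ->)|[(R & -> & _ & ->)|(R & -> & -> & _)]]; split; split; nra. }
  assert (CI : forall x, 0 < x < 1 -> 0 < fst (c' x) < 1 /\ snd (c' x) < 1).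
  { intros x Hx. unfold c'; simpl. assert (U2 := clamp_in ((x - dl) * / (1 - 2 * dl))). fold (V x) in U2. unfold In01 in U2.
    destruct (Reg x ltac:(unfold In01; lra)) as [(R & -> & -> & ->)|[(R & -> & _ & ->)|(R & -> & -> & ->)]].
    - assert (0 < x * / dl <= 1) by (split; nra). set (y := x * / dl) in *. split; [split; nra|nra].
    - split; [split; nra|nra].
    - assert (0 <= (x - (1 - dl)) * / dl < 1). { split; [nra|]. apply Rmult_lt_reg_r with dl; auto. rewrite Rmult_assoc, Rinv_l; lra. } set (y := (x - (1 - dl)) * / dl) in *. split; [split; nra|nra]. }
  set (F := fun x => h (c' x)).
  assert (HF : hequiv Om g01 F).
  { apply hequiv_in_square; auto; [apply c_path| | | |].
    - rewrite C0. unfold c. f_equal; ring.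
    - rewrite C1. unfold c. f_equal; ring.
    - intros x Hx. split; [now apply c_sq|now apply CR].
    - intros x Hx. split; [now apply c_in|now apply CI]. }
  exists (repl F dl (1 - dl) (lerp (h (s, t)) (h (s', t)))). split.
  - eapply hp_trans; [exact HF|]. apply hequiv_epe in HF as [_ HF]. apply hequiv_repl; auto; try lra.
    eapply hp_ext; [exact K8| |auto]. intros x Hx. unfold rs, F. unfold In01 in Hx. rewrite CM by nra. f_equal. f_equal. field. lra.
  - intros x Hx. unfold In01 in Hx. unfold repl.
    assert (I0 : In01 s0) by (unfold In01; lra). assert (I1 : In01 s1) by (unfold In01; lra).
    assert (Near0 : forall z, Sq z -> Rabs (fst z - s0) < d -> Rabs (snd z - 1) < d -> dm (lam s0) (h z) < e / 2).
    { intros z Hz D1 D2. destruct (H01 s0 I0) as [_ <-]. apply HU; auto. { split; simpl; auto. apply in01_1. } apply dm_lt; simpl. rewrite (Rabs_minus_sym s0), (Rabs_minus_sym 1). auto. }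
    assert (Near1 : forall z, Sq z -> Rabs (fst z - s1) < d -> Rabs (snd z - 1) < d -> dm (lam s1) (h z) < e / 2).
    { intros z Hz D1 D2. destruct (H01 s1 I1) as [_ <-]. apply HU; auto. { split; simpl; auto. apply in01_1. } apply dm_lt; simpl. rewrite (Rabs_minus_sym s1), (Rabs_minus_sym 1). auto. }
    apply Rabs_lt_iff in K6, K7.
    assert (Mv : forall u v, Rabs (u - v) <= 2 * dl -> dm (lerp (lam s0) (lam s1) u) (lerp (lam s0) (lam s1) v) <= e / 4).
    { intros u v Huv. eapply Rle_trans; [apply (lerp_move _ _ u v B); unfold B; lra|]. apply Rmult_le_compat_r with (r := B) in Huv; lra. }
    destruct (Rle_dec dl x) as [L|L]; [destruct (Rle_dec x (1 - dl)) as [L'|L']|].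
    + set (v := (x - dl) / (1 - dl - dl)). assert (Hv : In01 v) by (apply div01; lra).
      assert (A1 : dm (lerp (lam s0) (lam s1) v) (lerp (h (s, t)) (h (s', t)) v) < e / 2).
      { apply lerp_dm; auto; [apply Near0|apply Near1]; simpl; try (split; unfold In01; simpl; lra); apply Rabs_lt_iff; lra. }
      assert (A2 : Rabs (x - v) <= 2 * dl).
      { assert (Evv : v * (1 - 2 * dl) = x - dl) by (unfold v; field; lra). unfold In01 in Hv. apply Rabs_le_iff. split; nra. }
      specialize (Mv x v A2). pose proof (dm_tri (lerp (lam s0) (lam s1) x) (lerp (lam s0) (lam s1) v) (lerp (h (s, t)) (h (s', t)) v)). lra.
    + assert (A1 : dm (lam s1) (F x) < e / 2).
      { destruct (Reg x Hx) as [R|[R|(R & R1 & R2 & R3)]]; try lra. assert (U := clamp_in ((x - (1 - dl)) * / dl)). fold (C x) in U. unfold In01 in U.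
        apply Near1; [now apply CR|unfold c'; simpl..]; rewrite R1, ?R2; apply Rabs_lt_iff; split; nra. }
      assert (A2 : Rabs (x - 1) <= 2 * dl) by (apply Rabs_le_iff; lra). specialize (Mv x 1 A2). rewrite lerp_1 in Mv. pose proof (dm_tri (lerp (lam s0) (lam s1) x) (lam s1) (F x)). lra.
    + assert (A1 : dm (lam s0) (F x) < e / 2).
      { destruct (Reg x Hx) as [(R & R1 & R2 & R3)|[R|R]]; try lra. assert (U := clamp_in (x * / dl)). fold (A x) in U. unfold In01 in U.
        apply Near0; [now apply CR|unfold c'; simpl..]; rewrite ?R2, R3; apply Rabs_lt_iff; split; nra. }
      assert (A2 : Rabs (x - 0) <= 2 * dl) by (apply Rabs_le_iff; lra). specialize (Mv x 0 A2). rewrite lerp_0 in Mv. pose proof (dm_tri (lerp (lam s0) (lam s1) x) (lam s0) (F x)). lra.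
Qed.

(* [k] is constant on the vertical sides, so the second coordinate only needs to be continuous away from them. *)
Lemma collapse {A} (dA : A -> A -> R) D (k : Cpl -> Cpl) (u v : A -> R) : contD dm dm Sq k -> (forall t t', In01 t -> In01 t' -> k (0, t) = k (0, t') /\ k (1, t) = k (1, t')) ->
  contD dA dR D u -> (forall x, D x -> In01 (u x) /\ In01 (v x)) -> contD dA dR (fun x => D x /\ 0 < u x < 1) v -> contD dA dm D (fun x => k (u x, v x)).
Proof.
  intros Ck Hk Cu Hr Cv x Hx e He. destruct (unif_cont dm dm Sq k dm_tri dm_tri dm_sym seqcpt_Sq Ck e He) as (d & Hd & HU).
  destruct (Cu x Hx d Hd) as (d1 & Hd1 & HD1). destruct (Hr x Hx) as [U1 V1].
  destruct (classic (0 < u x < 1)) as [Hi|Hi].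
  - destruct (Cv x (conj Hx Hi) d Hd) as (d2 & Hd2 & HD2). destruct (Cu x Hx (Rmin (u x) (1 - u x))) as (d3 & Hd3 & HD3); [apply Rmin_pos; lra|].
    exists (Rmin d1 (Rmin d2 d3)). split; [repeat apply Rmin_pos; auto|]. intros y Hy Hxy. apply Rlt_min in Hxy as [D1 Hxy]. apply Rlt_min in Hxy as [D2 D3].
    destruct (Hr y Hy) as [U2 V2]. specialize (HD3 y Hy D3). apply Rlt_min in HD3 as [W1 W2]. unfold dR in W1, W2. apply Rabs_lt_iff in W1, W2.
    apply HU; [split; auto..|]. apply dm_lt; simpl. split; [apply HD1; auto|]. apply HD2; auto. split; auto. lra.
  - exists d1. split; auto. intros y Hy Hxy. destruct (Hr y Hy) as [U2 V2].
    assert (E : k (u x, v x) = k (u x, v y)). { unfold In01 in U1. destruct (Req_dec (u x) 0) as [->|]; [now apply Hk|]. replace (u x) with 1 by lra. now apply Hk. }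
    rewrite E. apply HU; [split; auto..|]. apply dm_lt; simpl. rewrite Rminus_diag, Rabs_R0. split; auto. apply HD1; auto.
Qed.

(** Below the parabola [h] is kept; above it the homotopy [k] is inserted, with its height [v]
    rescaled by the thickness [b] of the lens. At the tips the thickness vanishes, but [k] is
    constant on its vertical sides, so [collapse] applies. *)
Lemma lens_glue L : clcls Om g01 L -> L 0 = lam s0 -> L 1 = lam s1 -> clcls Om gam (repl lam s0 s1 L).
Proof.
  intros (k & Ck & K01 & KO & KE) L0 L1.
  set (u := fun z : Cpl => (fst z - s0) / (s1 - s0)). set (b := fun z => u z * (1 - u z)).
  set (v := fun z => (snd z - 1 + b z) * / b z).
  set (D := fun z : Cpl => Sq z /\ s0 <= fst z <= s1).
  set (kk := fun z => if Rle_dec (snd z - 1 + b z) 0 then h z else k (u z, v z)).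
  assert (Hi : 0 < / (s1 - s0)) by (apply Rinv_0_lt_compat; lra).
  assert (Uin : forall z, s0 <= fst z <= s1 -> In01 (u z)) by (intros z Hz; unfold u; now apply div01).
  assert (Uc : forall D', contD dm dR D' u) by (intros; unfold u, Rdiv; ctac).
  assert (Bc : forall D', contD dm dR D' b) by (intros D'; pose proof (Uc D'); unfold b; ctac).
  assert (Cu : forall z, c (u z) = (fst z, 1 - b z)). { intros z. unfold c, b. f_equal. unfold u. field. lra. }
  assert (Vin : forall z, D z -> 0 <= snd z - 1 + b z -> In01 (v z)).
  { intros z [[_ Z2] Z3] Hz. specialize (Uin z Z3). unfold In01 in *. unfold v. destruct (Req_dec (b z) 0) as [E|E].
    - rewrite E in *. replace (snd z - 1 + 0) with 0 by lra. lra.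
    - assert (0 < b z) by (unfold b in *; nra). assert (Hb : 0 < / b z) by now apply Rinv_0_lt_compat. assert (b z * / b z = 1) by (field; auto). split; nra. }
  assert (Kc : forall t, In01 t -> k (0, t) = lam s0 /\ k (1, t) = lam s1). { intros t Ht. destruct (KE t Ht) as [-> ->]. apply g01_ends. }
  assert (Ckk : contD dm dm D kk).
  { apply (paste_at dm dm D (fun z => snd z - 1 + b z) 0).
    - pose proof (Bc D). ctac.
    - eapply contD_sub; [exact Ch|]. unfold D; tauto.
    - apply (collapse dm _ k u v Ck).
      + intros t t' Ht Ht'. destruct (Kc t Ht) as [-> ->]. destruct (Kc t' Ht') as [-> ->]. auto.
      + apply Uc.
      + intros z [Z1 Z2]. split; [apply Uin, Z1|apply Vin; auto].
      + unfold v. assert (contD dm dR (fun x => (D x /\ 0 <= snd x - 1 + b x) /\ 0 < u x < 1) (fun z => / b z)). { apply contD_inv; [apply Bc|]. intros z [_ Hz]. unfold b. nra. }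
        pose proof (Bc (fun x => (D x /\ 0 <= snd x - 1 + b x) /\ 0 < u x < 1)). ctac.
    - intros z [Z1 Z3] E. unfold v. rewrite E, Rmult_0_l. destruct (K01 (u z) (Uin z Z3)) as [-> _]. unfold g01. rewrite Cu. destruct z; simpl in *. f_equal. f_equal. lra. }
  assert (B0 : forall z, fst z = s0 -> b z = 0 /\ u z = 0). { intros z E. unfold b, u. rewrite E. replace ((s0 - s0) / (s1 - s0)) with 0 by (field; lra). split; ring. }
  assert (B1 : forall z, fst z = s1 -> b z = 0 /\ u z = 1). { intros z E. unfold b, u. rewrite E. replace ((s1 - s0) / (s1 - s0)) with 1 by (field; lra). split; ring. }
  assert (Side : forall z, Sq z -> fst z = s0 \/ fst z = s1 -> kk z = h z).
  { intros z [_ Z2] E. assert (b z = 0) by (destruct E as [E|E]; [apply (B0 z E)|apply (B1 z E)]). unfold kk. destruct Rle_dec as [|N]; auto. unfold In01 in Z2. lra. }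
  exists (fun z => if Rle_dec s0 (fst z) then if Rle_dec (fst z) s1 then kk z else h z else h z). split; [|split; [|split]].
  - apply (paste3 Sq h kk s0 s1); auto.
  - intros s Hs. simpl. unfold repl. destruct (H01 s Hs) as [E0 E1].
    destruct (Rle_dec s0 s) as [A1|A1]; [destruct (Rle_dec s s1) as [A2|A2]|]; auto.
    assert (Us := Uin (s, 0) (conj A1 A2)). assert (Ub : u (s, 1) = u (s, 0)) by reflexivity. unfold In01 in Us. split.
    + unfold kk; simpl. destruct Rle_dec as [|N]; auto. exfalso. apply N. unfold b. nra.
    + destruct (Req_dec s s0) as [->|]; [rewrite Side; [|split; auto; apply in01_1|auto]; replace ((s0 - s0) / (s1 - s0)) with 0 by (field; lra); rewrite L0; auto|].
      destruct (Req_dec s s1) as [->|]; [rewrite Side; [|split; auto; apply in01_1|auto]; replace ((s1 - s0) / (s1 - s0)) with 1 by (field; lra); rewrite L1; auto|].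
      assert (Ui : 0 < u (s, 1) < 1). { unfold u; simpl. unfold Rdiv. split; [apply Rmult_lt_0_compat; lra|]. apply Rmult_lt_reg_r with (s1 - s0); [lra|]. rewrite Rmult_assoc, Rinv_l; lra. }
      assert (Bp : 0 < b (s, 1)) by (unfold b; nra). unfold kk; simpl. destruct Rle_dec as [N|_]; [lra|].
      assert (Ev : v (s, 1) = 1) by (unfold v; simpl; field; lra). rewrite Ev. destruct (K01 (u (s, 1))) as [_ ->]; auto.
  - intros s t Hs Ht. simpl. destruct (Rle_dec s0 s) as [A1|]; [destruct (Rle_dec s s1) as [A2|]|]; auto.
    unfold kk; simpl. destruct Rle_dec as [N|N]; auto. apply Rnot_le_lt in N. assert (Us := Uin (s, t) (conj A1 A2)). unfold In01 in Us.
    assert (Bp : 0 < b (s, t)) by lra. assert (Ui : 0 < u (s, t) < 1). { unfold b in Bp. split; apply Rnot_le_lt; intros Hc; nra. }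
    apply KO; auto. assert (Dz : D (s, t)) by (split; [split; unfold In01; simpl; lra|simpl; lra]). destruct (Vin _ Dz ltac:(simpl; lra)) as [V1 _]. split; auto.
    unfold v; simpl. apply Rmult_lt_reg_r with (b (s, t)); auto. rewrite Rmult_assoc, Rinv_l; lra.
  - intros t Ht. simpl. assert (S0 : Sq (0, t)) by (split; simpl; auto; apply in01_0). assert (S1 : Sq (1, t)) by (split; simpl; auto; apply in01_1). destruct (HE t Ht) as [E0 E1]. split.
    + destruct (Rle_dec s0 0); [destruct (Rle_dec 0 s1)|]; auto. rewrite Side; auto. simpl. left. lra.
    + destruct (Rle_dec s0 1); [destruct (Rle_dec 1 s1)|]; auto. rewrite Side; auto. simpl. right. lra.
Qed.
End Lens.

Lemma wcl_ext Om gam lam lam' : (forall s, In01 s -> lam s = lam' s) -> wcl Om gam lam -> wcl Om gam lam'.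
Proof.
  intros E [C H]. split. { now apply (contD_ext dR dm In01 lam). } intros e He. destruct (H e He) as (mu & M1 & M2). exists mu. split; auto. intros r Hr. rewrite <- E; auto.
Qed.

Lemma clcls_ext Om gam lam lam' : (forall s, In01 s -> lam s = lam' s) -> clcls Om gam lam -> clcls Om gam lam'.
Proof.
  intros E (h & H1 & H2 & H3). exists h. split; auto. split; auto. intros s Hs. rewrite <- E; auto.
Qed.

Lemma eqrep_sym lam mu : eq_up_to_reparam lam mu -> eq_up_to_reparam mu lam.
Proof. intros (phi & psi & A & B & C). exists psi, phi. split; auto. split; auto. intros s Hs. symmetry. auto. Qed.

(* If a shortcut can be taken arbitrarily late in the homotopy, then it can be taken at the limit: the homotopy that
   straightens it is the minimal one of the arc under the lens. *)
Lemma straighten_in_class Om gam lam h s0 s1 : c_open Om -> contD dm dm Sq h -> (forall s, In01 s -> h (s, 0) = gam s /\ h (s, 1) = lam s) ->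
  (forall s t, 0 < s < 1 -> 0 <= t < 1 -> Om (h (s, t))) -> (forall t, In01 t -> h (0, t) = gam 0 /\ h (1, t) = gam 1) ->
  0 <= s0 -> s0 < s1 -> s1 <= 1 ->
  (forall e, 0 < e -> exists t s s', 1 - e < t < 1 /\ 0 <= t /\ 0 < s /\ s < s' /\ s' < 1 /\ Rabs (s - s0) < e /\ Rabs (s' - s1) < e /\
    hp Om (rs (fun x => h (x, t)) s s') (lerp (h (s, t)) (h (s', t)))) ->
  clcls Om gam (straighten lam s0 s1).
Proof.
  intros HO Ch H01 HI HE H0 H H1 HS.
  pose proof (chord_wcl Om gam lam h s0 s1 Ch H01 HI H0 H H1 HS) as HW.
  pose proof (g01_epe Om h s0 s1 Ch HI H0 H H1) as Ep. destruct (g01_ends gam lam h s0 s1 H01 H0 H H1) as [G0 G1].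
  set (g01 := fun u => h ((1 - u) * s0 + u * s1, 1 - u * (1 - u))) in *.
  destruct (minimal_in_class Om g01 HO Ep) as (ls & HM & HC). destruct (wcl_ends _ _ _ (proj1 HM)) as [L0 L1].
  change (g01 0 = lam s0) in G0. change (g01 1 = lam s1) in G1. rewrite G0 in L0. rewrite G1 in L1.
  (* The chord is [ls] straightened over the whole interval. Minimality makes [ls] a monotone
     parametrization of the chord, and [clcls_unreparam] removes the parametrization. *)
  assert (ES : forall s, In01 s -> lerp (lam s0) (lam s1) s = straighten ls 0 1 s).
  { intros s Hs. rewrite straighten_in by (unfold In01 in Hs; lra). rewrite L0, L1. f_equal. field. }
  assert (HW' := wcl_ext _ _ _ _ ES HW).
  destruct (rigid ls 0 1 (proj1 (proj1 HM)) ltac:(lra) ltac:(lra) ltac:(lra) (minimal_rigid Om g01 ls 0 1 HM ltac:(lra) ltac:(lra) ltac:(lra) HW')) as (psi & P1 & P2 & P3).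
  assert (CL : clcls Om g01 (lerp (lam s0) (lam s1))).
  { apply (clcls_unreparam Om g01 _ psi P1 (lerp_path _ _)). apply (clcls_ext Om g01 ls); auto. intros s Hs. rewrite <- L0, <- L1, <- P3 by auto. unfold rs. f_equal. ring. }
  apply (clcls_ext Om gam (repl lam s0 s1 (lerp (lam s0) (lam s1)))). { intros s _. apply repl_straighten. }
  apply (lens_glue Om gam lam h s0 s1); auto; [apply lerp_0|apply lerp_1].
Qed.

(** The rows of the homotopy at heights tending to 1. Persistent deep shortcuts would put a
    straightening into the class; efficiency makes it a reparametrization of [lam], so crossing
    numbers agree and [rigid] forces the arc onto its chord. *)
Lemma efficient_rows Om p q gam lam : c_open Om -> path_epe Om p q gam -> efficient Om p q gam lam -> exists mu : nat -> R -> Cpl,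
  (forall n, hequiv Om gam (mu n)) /\ (forall e, 0 < e -> exists N, forall n, (N <= n)%nat -> near e lam (mu n)) /\
  (forall e, 0 < e -> exists N, forall n, (N <= n)%nat -> NS Om e (mu n)).
Proof.
  intros HO Hg [HC HE]. apply (clcls_iff Om p q gam lam Hg) in HC. destruct HC as (h & Ch & H01 & HI & Hends).
  set (t := fun n : nat => 1 - / (INR n + 1)).
  assert (Ht : forall n, 0 <= t n < 1). { intros n. unfold t. pose proof (inv_succ_pos n). assert (/ (INR n + 1) <= 1). { rewrite <- Rinv_1. apply Rinv_le_contravar; pose proof (pos_INR n); lra. } lra. }
  assert (HQ : forall n, hequiv Om gam (fun s => h (s, t n))) by (intros n; now apply (clcls_row Om gam lam)).
  assert (Hcv : forall e, 0 < e -> exists N, forall n, (N <= n)%nat -> near e lam (fun s => h (s, t n))).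
  { intros e He. destruct (rows_near lam h Ch) with (e := e) as (d & Hd & HD); auto. { intros; now apply H01. }
    destruct (archi_inv d Hd) as [N HN]. exists N. intros n Hn. apply HD; [|apply Ht]. specialize (HN n Hn). specialize (Ht n). unfold t in *. lra. }
  exists (fun n s => h (s, t n)). split; auto. split; auto. intros e He. apply NNPP. intros HN.
  assert (Cl : pathC lam). { eapply contD_ext; [apply (sq_row h 1 in01_1 Ch)|]. intros s Hs. now apply H01. }
  destruct (shortcut_limit Om (fun n s => h (s, t n)) lam e Cl (fun n => proj2 (hp_cont _ _ _ (HQ n))) Hcv He HN) as (s0 & s1 & x & H0 & H & H1 & Hx & Off & Sh).
  assert (Scl : clcls Om gam (straighten lam s0 s1)).
  { apply (straighten_in_class Om gam lam h s0 s1); auto. intros ep Hep. destruct (archi_inv ep Hep) as [N HNN]. destruct (Sh ep N Hep) as (n & s & s' & K1 & K2).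
    exists (t n), s, s'. specialize (HNN n K1). split; [|split; [apply Ht|exact K2]]. specialize (Ht n). unfold t in *. lra. }
  apply (clcls_iff Om p q gam _ Hg) in Scl. apply HE in Scl; auto; try (unfold In01; lra).
  destruct (rigid lam s0 s1 Cl H0 H H1) as (psi & _ & Pin & HP). { intros j n. apply eqrep_Nle. now apply eqrep_sym. }
  assert (Hu := div01 x s0 s1 H Hx). apply (Off (psi ((x - s0) / (s1 - s0)))); auto. rewrite <- HP; auto. unfold rs. f_equal. field. lra.
Qed.

Theorem theorem1p1 (Om : Cpl -> Prop) (p q : Cpl) (gam : R -> Cpl) :
  c_open Om -> c_connected Om ->
  c_closure Om p -> c_closure Om q ->
  path_epe Om p q gam ->
  (exists lam, efficient Om p q gam lam) /\
  (forall lam1 lam2, efficient Om p q gam lam1 -> efficient Om p q gam lam2 ->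
     eq_up_to_reparam lam1 lam2).
Proof.
  intros HO _ _ _ Hg. split; [now apply efficient_exists|]. intros lam1 lam2 E1 E2.
  destruct (efficient_rows Om p q gam lam1 HO Hg E1) as (f & F1 & F2 & F3). destruct (efficient_rows Om p q gam lam2 HO Hg E2) as (g & G1 & G2 & G3).
  (* The rows of the two homotopies are homotopic to each other through [gam]. *)
  apply (sync Om f g lam1 lam2 HO).
  - intros i. eapply hp_trans; [apply hp_sym, F1|apply G1].
  - intros e He. destruct (F2 e He) as [A HA]. destruct (G2 e He) as [B HB]. exists (Nat.max A B). intros i Hi. split; [apply HA|apply HB]; lia.
  - intros e He. destruct (F3 e He) as [A HA]. destruct (G3 e He) as [B HB]. exists (Nat.max A B). intros i Hi. split; [apply HA|apply HB]; lia.
Qed.
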